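(* Let $\mathcal Y$ be a regular Euclidean polygon with at least four sides and let $(\mathcal G,\mathcal Y)$ be a developable complex of groups over $\mathcal Y$ such that: (1) $(\mathcal G,\mathcal Y)$ is a complex of hyperbolic groups. (2) The universal cover of $(\mathcal G,\mathcal Y)$ is CAT(0). (3) The action of $\pi_1(\mathcal G,\mathcal Y)$ on the universal cover is acylindrical. If $\mathcal Y_1$ is an edge of $\mathcal Y$ and $(\mathcal G,\mathcal Y_1)$ is the restriction of $(\mathcal G,\mathcal Y)$ to $\mathcal Y_1$, then $\pi_1(\mathcal G,\mathcal Y)$ is hyperbolic and the natural homomorphism $\pi_1(\mathcal G,\mathcal Y_1)\to\pi_1(\mathcal G,\mathcal Y)$ is an injective quasiisometric embedding.
   Context: View $\mathcal Y$ as a cell complex with one 2-dimensional face (the polygon), its edges and its vertices as faces. Directed edges are pairs $e=(\sigma,\tau)$ of faces with $\tau\subsetneq\sigma$; $o(e)=\sigma$, $t(e)=\tau$. If $o(e)=t(e')$, put $e*e'=(o(e'),t(e))$. A complex of groups $(\mathcal G,\mathcal Y)$ consists of a local group $G_\sigma$ for each face, an injective homomorphism (local map) $\psi_e:G_{o(e)}\to G_{t(e)}$ for each $e$, and elements $g_{e,e'}\in G_{t(e)}$ for composable $e,e'$ with $\mathrm{Ad}(g_{e,e'})\psi_{e*e'}=\psi_e\psi_{e'}$ (the further cocycle condition is empty in dimension 2). The fundamental group $G=\pi_1(\mathcal G,\mathcal Y)$ is generated by the groups $G_\sigma$ and symbols $k_e$, subject to the relations of the $G_\sigma$, $k_egk_e^{-1}=\psi_e(g)$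 for $g\in G_{o(e)}$, $k_ek_{e'}=g_{e,e'}k_{e*e'}$, and $k_e=1$ for $e$ in a fixed maximal tree of the graph with vertices the faces and edges the $e$'s. It is developable if all natural maps $G_\sigma\to G$ are injective. The universal cover (development) is $B=(G\times\bigsqcup_\sigma\sigma)/\sim$ with $(gg',x)\sim(g,x)$ for $g'\in G_\sigma$, $x\in\sigma$, and, for $e=(\sigma,\sigma')$ and $x\in\sigma'\subset\sigma$, the pair $(g,x)$ with $x$ viewed in $\sigma$ is identified with $(gk_e^{-1},x)$ with $x$ viewed in $\sigma'$. It carries the quotient metric obtained by gluing copies of the regular Euclidean polygon, and $G$ acts on it by isometries. A complex of hyperbolic groups is a developable complex of groups $(\mathcal G,\mathcal Y)$ over the polygon $\mathcal Y$, with local groups $G_\sigma$, local maps $\psi_e$ and elements $g_{e,e'}$, whose local groups $G_\sigma$ are hyperbolic, whose local maps $\psi_e$ are quasiisometric embeddings, and whose universal cover $B$ is a hyperbolic space. Acylindrical (in the sense of Martin's combination theorem): there is a constant $A>0$ such that every subset of $B$ of diameter at least $A$ has finite pointwise stabilizer in $G$. For an edge $\mathcal Y_1$ with endpoints $v,w$, $\pi_1(\mathcal G,\mathcal Y_1)$ is the amalgamated product $G_v*_{G_{\mathcal Y_1}}G_w$. *)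

(* Defs.v *)
From HB Require Import structures.
From Stdlib Require Import Relations.
From mathcomp Require Import all_boot all_order all_algebra.
From mathcomp Require Import monoid generic_quotient.
From mathcomp Require Import all_classical all_reals all_analysis.

Set Implicit Arguments.
Unset Strict Implicit.
Unset Printing Implicit Defensive.

Import Order.TTheory GRing.Theory Num.Theory.

Local Open Scope quotient_scope.
Local Open Scope group_scope.
Local Open Scope ring_scope.
Local Open Scope classical_set_scope.

(* A distance is a bare function [d : X -> X -> R], because the spaces below
   (a group with a word metric, the development) carry a distance that is not
   known to be a metric at the time it is defined. *)
Section MetricNotions.
Context (R : realType) (X : Type).
Implicit Types d : X -> X -> R.

Definition is_metric d : Prop :=
  [/\ forall x y, d x y = 0 <-> x = y,
      forall x y, d x y = d y x &
      forall x y z, d x z <= d x y + d y z].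

(* Gromov's definition of hyperbolicity, which makes sense in any metric
   space, geodesic or not. *)
Definition gromov_product d (w x y : X) : R := (d x w + d y w - d x y) / 2.

Definition hyperbolic_space d : Prop :=
  exists delta : R, forall w x y z : X,
    Num.min (gromov_product d w x y) (gromov_product d w y z) - delta
      <= gromov_product d w x z.

Definition geodesic d (c : R -> X) (x y : X) : Prop :=
  [/\ c 0 = x, c (d x y) = y &
      forall s t, 0 <= s <= d x y -> 0 <= t <= d x y ->
        d (c s) (c t) = `|s - t|].

Definition geodesic_space d : Prop :=
  forall x y, exists c, geodesic d c x y.

Definition diam_ge d (U : set X) (A : R) : Prop :=
  (A%:E <= ereal_sup [set (d p.1 p.2)%:E | p in U `*` U])%E.

End MetricNotions.

(* The norm of ['rV_2] in the library is the sup norm. *)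
Definition eucl_dist (R : realType) (x y : 'rV[R]_2) : R :=
  Num.sqrt (\sum_(i < 2) (x 0 i - y 0 i) ^+ 2).

(* [x', y', z'] is a comparison triangle for [x, y, z], and [p', q'] are the
   comparison points of the points [c s, c' t] of two of its sides. Two
   distinct sides share a vertex, here called [x]; the third side enters only
   through its length. *)
Definition CAT0 (R : realType) (X : Type) (d : X -> X -> R) : Prop :=
  [/\ is_metric d, geodesic_space d &
      forall (x y z : X) (c c' : R -> X) (s t : R)
             (x' y' z' p' q' : 'rV[R]_2),
        geodesic d c x y -> geodesic d c' x z ->
        0 <= s <= d x y -> 0 <= t <= d x z ->
        eucl_dist x' y' = d x y -> eucl_dist x' z' = d x z -> eucl_dist y' z' = d y z ->
        eucl_dist x' p' = s -> eucl_dist p' y' = d x y - s ->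
        eucl_dist x' q' = t -> eucl_dist q' z' = d x z - t ->
        d (c s) (c' t) <= eucl_dist p' q'].

Definition qi_embedding_for (R : realType) (X Y : Type)
    (dX : X -> X -> R) (dY : Y -> Y -> R) (f : X -> Y) : Prop :=
  exists lambda c : R, [/\ 1 <= lambda, 0 <= c &
    forall x y, lambda^-1 * dX x y - c <= dY (f x) (f y)
                /\ dY (f x) (f y) <= lambda * dX x y + c].

Section WordMetric.
Context (R : realType) (G : groupType).

(* The letter [(b, s)] stands for [s^-1] if [b] and for [s] otherwise. *)
Definition word_eval (w : seq (bool * G)) : G :=
  (\prod_(p <- w) (if p.1 then p.2^-1 else p.2))%g.

Definition word_over (S : seq G) (g : G) : set (seq (bool * G)) :=
  [set w | all (fun p => p.2 \in S) w /\ word_eval w = g].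

Definition generates (S : seq G) : Prop := forall g, word_over S g !=set0.

Definition word_length (S : seq G) (g : G) : R :=
  inf [set (size w)%:R | w in word_over S g].

Definition word_dist (S : seq G) (g h : G) : R :=
  word_length S (g^-1 * h)%g.

Definition hyperbolic_group : Prop :=
  exists2 S : seq G, generates S & hyperbolic_space (word_dist S).

End WordMetric.

Definition qi_embedding (R : realType) (G H : groupType) (f : G -> H) : Prop :=
  exists (S : seq G) (S' : seq H), [/\ generates S, generates S' &
    qi_embedding_for (word_dist R S) (word_dist R S') f].

Section GeneratedQuotient.
Context (X : choiceType) (r : X -> X -> Prop).

Definition gen_eqv : rel X := fun x y => `[< clos_refl_sym_trans X r x y >].

Lemma gen_eqv_refl : reflexive gen_eqv.
Proof. by move=> x; apply/asboolP/rst_refl. Qed.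

Lemma gen_eqv_sym : symmetric gen_eqv.
Proof. by move=> x y; apply/asboolP/asboolP; apply: rst_sym. Qed.

Lemma gen_eqv_trans : transitive gen_eqv.
Proof.
by move=> y x z /asboolP xy /asboolP yz; apply/asboolP/(rst_trans _ _ _ y).
Qed.

Canonical gen_eqv_equiv :=
  EquivRel gen_eqv gen_eqv_refl gen_eqv_sym gen_eqv_trans.

Definition gen_quot := {eq_quot gen_eqv}.

HB.instance Definition _ := Choice.on gen_quot.
HB.instance Definition _ := EqQuotient.on gen_quot.

End GeneratedQuotient.

Section Presentation.
Context (X : choiceType).

(* As above, [(true, x)] is the formal inverse of the generator [x]. *)
Definition fword := seq (bool * X).
HB.instance Definition _ := Choice.on fword.

(* [rel_ u v] is the relation [u = v]. *)
Context (rel_ : fword -> fword -> Prop).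

Inductive word_step : fword -> fword -> Prop :=
| step_cancel (a b : fword) (e : bool) (x : X) :
    word_step (a ++ (e, x) :: (~~ e, x) :: b) (a ++ b)
| step_rel (a b u v : fword) :
    rel_ u v -> word_step (a ++ u ++ b) (a ++ v ++ b).

Definition presented := gen_quot word_step.

HB.instance Definition _ := EqQuotient.on presented.
HB.instance Definition _ := Choice.on presented.

Definition finv_word (u : fword) : fword := rev [seq (~~ p.1, p.2) | p <- u].

Definition pres_one : presented := \pi_presented [::].
Definition pres_mul (g h : presented) : presented :=
  \pi_presented (repr g ++ repr h).
Definition pres_inv (g : presented) : presented :=
  \pi_presented (finv_word (repr g)).
Definition pres_gen (x : X) : presented := \pi_presented [:: (false, x)].

Let eqv := clos_refl_sym_trans fword word_step.

Lemma pres_piP (u v : fword) :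
  \pi_presented u = \pi_presented v <-> eqv u v.
Proof. by split=> [/eqmodP/asboolP|uv]; last apply/eqmodP/asboolP. Qed.

Lemma eqv_ctx (a b u v : fword) : eqv u v -> eqv (a ++ u ++ b) (a ++ v ++ b).
Proof.
elim=> [u1 v1 uv|u1|u1 v1 _|u1 v1 w1 _ uv _ vw].
- apply: rst_step; case: uv => [a' b' e x|a' b' u2 v2 r].
    by have := step_cancel (a ++ a') (b' ++ b) e x; rewrite -!catA.
  by have := step_rel (a ++ a') (b' ++ b) r; rewrite -!catA.
- exact: rst_refl.
- exact: rst_sym.
- exact: rst_trans uv vw.
Qed.

Lemma pres_mulE (u v : fword) :
  pres_mul (\pi_presented u) (\pi_presented v) = \pi_presented (u ++ v).
Proof.
apply/pres_piP; apply: (rst_trans _ _ _ (u ++ repr (\pi_presented v))).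
  apply: (@eqv_ctx [::]); apply/pres_piP; exact: reprK.
rewrite -[_ ++ repr _]cats0 -[u ++ v]cats0 -!catA.
apply: eqv_ctx; apply/pres_piP; exact: reprK.
Qed.

Lemma eqv_invl (u : fword) : eqv (finv_word u ++ u) [::].
Proof.
elim: u => [|[e x] u IH] /=; first exact: rst_refl.
rewrite /finv_word /= rev_cons -cats1 -catA /=.
apply: rst_trans IH; apply: rst_step.
by have := step_cancel (finv_word u) u (~~ e) x; rewrite negbK.
Qed.

Lemma finv_wordK : involutive finv_word.
Proof.
move=> u; rewrite /finv_word map_rev revK -map_comp.
by rewrite -[RHS]map_id; apply: eq_map => -[e x] /=; rewrite negbK.
Qed.

Lemma pres_mulA : associative pres_mul.
Proof.
move=> f g h; rewrite -[f]reprK -[g]reprK -[h]reprK.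
by rewrite !pres_mulE !reprK catA.
Qed.

Lemma pres_mul1g : left_id pres_one pres_mul.
Proof. by move=> g; rewrite -[g]reprK pres_mulE. Qed.

Lemma pres_mulg1 : right_id pres_one pres_mul.
Proof. by move=> g; rewrite -[g]reprK pres_mulE cats0. Qed.

Lemma pres_mulVg : left_inverse pres_one pres_inv pres_mul.
Proof.
move=> g; rewrite -{2}[g]reprK pres_mulE; apply/pres_piP; exact: eqv_invl.
Qed.

Lemma pres_mulgV : right_inverse pres_one pres_inv pres_mul.
Proof.
move=> g; rewrite -{1}[g]reprK pres_mulE; apply/pres_piP.
by rewrite -{1}[repr g]finv_wordK; apply: eqv_invl.
Qed.

HB.instance Definition _ := isGroup.Build presented
  pres_mulA pres_mul1g pres_mulg1 pres_mulVg pres_mulgV.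

End Presentation.

(* A finite cell complex whose cells are determined by their vertices is
   given by the family [F] of the vertex sets of its cells; "[t] is a proper
   face of [s]" is then [val t \proper val s]. *)
Definition face (V : finType) (F : {set {set V}}) := {A : {set V} | A \in F}.

Section Complexes.
Context (V : finType) (F : {set {set V}}).

(* A directed edge [e = (s, t)] is presented as the two faces together with
   the proof that [t] is a proper face of [s]. For composable edges
   [e = (s, t)] and [e' = (r, s)], the element [g_{e,e'}] is
   [cg_twist rs st : cg_group t]. The last field is the cocycle condition,
   void when there is no chain of four faces. *)
Record complex_of_groups := ComplexOfGroups {
  cg_group : face F -> groupType;
  cg_map : forall s t : face F, val t \proper val s ->
    {multiplicative cg_group s -> cg_group t};
  cg_twist : forall r s t : face F,
    val s \proper val r -> val t \proper val s -> cg_group t;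
  cg_map_inj : forall (s t : face F) (st : val t \proper val s),
    injective (cg_map st);
  cg_mapM : forall (r s t : face F) (rs : val s \proper val r)
      (st : val t \proper val s) (rt : val t \proper val r) (x : cg_group r),
    (cg_twist rs st * cg_map rt x * (cg_twist rs st)^-1
       = cg_map st (cg_map rs x))%g;
  cg_cocycle : forall (q r s t : face F) (qr : val r \proper val q)
      (rs : val s \proper val r) (st : val t \proper val s)
      (qs : val s \proper val q) (rt : val t \proper val r),
    (cg_map st (cg_twist qr rs) * cg_twist qs st
       = cg_twist rs st * cg_twist qr rt)%g
}.

Definition tree_adj (T : {set face F * face F}) : rel (face F) :=
  fun s t => ((s, t) \in T) || ((t, s) \in T).

(* Maximal tree = spanning tree: connected on all the faces, and without
   simple cycle of length at least 3 (the graph has no loop and no multiple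
   edge, and a cycle of length 2 runs back and forth along one edge). *)
Definition maximal_tree (T : {set face F * face F}) : Prop :=
  [/\ forall s t, (s, t) \in T -> val t \proper val s,
      forall s t, connect (tree_adj T) s t &
      forall c : seq (face F), ucycle (tree_adj T) c -> (size c <= 2)%N].

End Complexes.

Section FundamentalGroup.
Context (V : finType) (F : {set {set V}}).
Context (G : complex_of_groups F) (T : {set face F * face F}).

Inductive pi1_letter : Type :=
| Lgroup (s : face F) (g : cg_group G s)
| Ledge (s t : face F) (st : val t \proper val s).

HB.instance Definition _ := gen_eqMixin pi1_letter.
HB.instance Definition _ := gen_choiceMixin pi1_letter.

Local Notation L g := (false, Lgroup g).
Local Notation k st := (false, Ledge st).
Local Notation kV st := (true, Ledge st).

Inductive pi1_rel : fword pi1_letter -> fword pi1_letter -> Prop :=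
| rel_group (s : face F) (g h : cg_group G s) :
    pi1_rel [:: L g; L h] [:: L (g * h)%g]
| rel_conj (s t : face F) (st : val t \proper val s) (g : cg_group G s) :
    pi1_rel [:: k st; L g; kV st] [:: L (cg_map G st g)]
| rel_comp (r s t : face F) (rs : val s \proper val r)
      (st : val t \proper val s) (rt : val t \proper val r) :
    pi1_rel [:: k st; k rs] [:: L (cg_twist G rs st); k rt]
| rel_tree (s t : face F) (st : val t \proper val s) :
    (s, t) \in T -> pi1_rel [:: k st] [::].

Definition pi1 : groupType := presented pi1_rel.

Definition pi1_group (s : face F) (g : cg_group G s) : pi1 :=
  pres_gen pi1_rel (Lgroup g).

Definition pi1_edge (s t : face F) (st : val t \proper val s) : pi1 :=
  pres_gen pi1_rel (Ledge st).

Definition developable : Prop :=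
  forall s : face F, injective (@pi1_group s).

End FundamentalGroup.

Definition closed_face (V : finType) (F : {set {set V}}) (Y : {set V}) :
    {set {set V}} :=
  finset (fun A => (A \in F) && (A \subset Y)).

Section Restriction.
Context (V : finType) (F : {set {set V}}) (Y : {set V}).

Lemma closed_face_sub (A : {set V}) : A \in closed_face F Y -> A \in F.
Proof. by rewrite inE => /andP[]. Qed.

Definition face_incl (s : face (closed_face F Y)) : face F :=
  exist _ (val s) (closed_face_sub (valP s)).

Definition restriction (G : complex_of_groups F) :
    complex_of_groups (closed_face F Y) :=
  @ComplexOfGroups V (closed_face F Y)
    (fun s => cg_group G (face_incl s))
    (fun s t st => @cg_map V F G (face_incl s) (face_incl t) st)
    (fun r s t rs st =>
       @cg_twist V F G (face_incl r) (face_incl s) (face_incl t) rs st)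
    (fun s t st => @cg_map_inj V F G (face_incl s) (face_incl t) st)
    (fun r s t rs st rt =>
       @cg_mapM V F G (face_incl r) (face_incl s) (face_incl t) rs st rt)
    (fun q r s t qr rs st qs rt =>
       @cg_cocycle V F G (face_incl q) (face_incl r) (face_incl s)
         (face_incl t) qr rs st qs rt).

(* For an edge [Y = y], with maximal tree [T1] (necessarily made of the two
   directed edges [(y, s)], so that the fundamental group of the restriction
   is the amalgamated product over [cg_group y]), the natural homomorphism
   sends [g] in the local group of [y] to [g], and [g] in the local group of
   an endpoint [s] to [k_(y,s)^-1 g k_(y,s)]. This is [g |-> g] if [(y, s)]
   belongs to the maximal tree [T] of [G]; otherwise the conjugation is
   forced by [k_(y,s) = 1] holding in the source but not in the target. *)
Definition natural_hom (G : complex_of_groups F)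
    (T1 : {set face (closed_face F Y) * face (closed_face F Y)})
    (T : {set face F * face F})
    (f : pi1 (restriction G) T1 -> pi1 G T) : Prop :=
  forall y : face (closed_face F Y), val y = Y ->
    (forall g : cg_group (restriction G) y,
       f (pi1_group T1 g) = pi1_group T (g : cg_group G (face_incl y)))
    /\
    (forall (s : face (closed_face F Y)) (ys : val s \proper val y)
            (g : cg_group (restriction G) s),
       let k := @pi1_edge V F G T (face_incl y) (face_incl s) ys in
       f (pi1_group T1 g)
         = (k^-1 * pi1_group T (g : cg_group G (face_incl s)) * k)%g).

End Restriction.

(* Cells of the [n]-gon: the polygon, the edges [{i, i+1}] (indices modulo
   [n]), and the vertices. *)
Definition polygon (n : nat) : {set {set 'I_n}} :=
  ([set: 'I_n]%SET
     |: ([set [set i; ordS i]%SET | i : 'I_n] :|: [set [set i]%SET | i : 'I_n]))%SET.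

Section Development.
Context (R : realType) (n : nat) (rad : R).

Definition polygon_vertex (i : 'I_n) : 'rV[R]_2 :=
  \row_(j < 2) (rad * (if j == 0 then cos (2 * pi * i%:R / n%:R)
                       else sin (2 * pi * i%:R / n%:R))).

(* The geometric cell with vertex set [A], in the regular [n]-gon of
   circumradius [rad]. *)
Definition cell (A : {set 'I_n}) : set 'rV[R]_2 :=
  [set x | exists a : 'I_n -> R,
     [/\ forall i, 0 <= a i, forall i, i \notin A -> a i = 0,
         \sum_i a i = 1 & x = \sum_i a i *: polygon_vertex i]].

Context (G : complex_of_groups (polygon n)).
Context (T : {set face (polygon n) * face (polygon n)}).

Record dev_point := DevPoint {
  dp_elt : pi1 G T;
  dp_face : face (polygon n);
  dp_pos : 'rV[R]_2;
  dp_in : cell (val dp_face) dp_pos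
}.

HB.instance Definition _ := gen_eqMixin dev_point.
HB.instance Definition _ := gen_choiceMixin dev_point.

Inductive dev_glue : dev_point -> dev_point -> Prop :=
| glue_group (g : pi1 G T) (s : face (polygon n)) (h : cg_group G s)
      (x : 'rV[R]_2) (xs : cell (val s) x) :
    dev_glue (DevPoint (g * pi1_group T h)%g xs) (DevPoint g xs)
| glue_face (g : pi1 G T) (s t : face (polygon n))
      (st : val t \proper val s) (x : 'rV[R]_2)
      (xs : cell (val s) x) (xt : cell (val t) x) :
    dev_glue (DevPoint g xs) (DevPoint (g * (pi1_edge G T st)^-1)%g xt).

Definition development := gen_quot dev_glue.

HB.instance Definition _ := EqQuotient.on development.
HB.instance Definition _ := Choice.on development.

(* The quotient metric: the infimum of the lengths of the chains
   [x_1, y_1], [x_2, y_2], ... where [x_i] and [y_i] lie in the same copy of a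
   cell and [y_i] is glued to [x_(i+1)]. Chains exist between any two points
   because the development is connected, so that [inf] below is never taken
   over the empty set. *)
Fixpoint dev_chain (a b : development) (c : seq (dev_point * dev_point)) :
    Prop :=
  if c is (x, y) :: c' then
    [/\ a = \pi_development x, dp_elt x = dp_elt y, dp_face x = dp_face y &
        dev_chain (\pi_development y) b c']
  else a = b.

Definition dev_dist (a b : development) : R :=
  inf [set \sum_(p <- c) eucl_dist (dp_pos p.1) (dp_pos p.2)
         | c in [set c | dev_chain a b c]].

Definition dev_act (g : pi1 G T) (a : development) : development :=
  let x := repr a in \pi_development (DevPoint (g * dp_elt x)%g (dp_in x)).

Definition complex_of_hyperbolic_groups : Prop :=
  [/\ developable G T,
      forall s : face (polygon n), hyperbolic_group R (cg_group G s),
      forall (s t : face (polygon n)) (st : val t \proper val s),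
        qi_embedding R (cg_map G st) &
      hyperbolic_space dev_dist].

Definition acylindrical : Prop :=
  exists2 A : R, 0 < A &
    forall U : set development, diam_ge dev_dist U A ->
      finite_set [set g : pi1 G T | forall a, U a -> dev_act g a = a].

End Development.

(* Main.v *)
(** Conjugation along the directed edges from the polygon to its faces turns the
    local groups into subgroups V_k (vertices), E_k (edges) and P of the
    fundamental group G, which is the colimit of the V_k along the E_k. Distinct
    edge groups meet in P: the midpoints of two edges are joined by a unique
    geodesic of the CAT(0) development, and it runs inside one tile.

    As n >= 4, the vertices can be grouped into four consecutive arcs. This
    presents G as the colimit of a square of groups, hence as an amalgam in two
    ways, by cutting two opposite sides of the square. Suitable cuts show that
    the subgroup of an arc is obtained by adding its vertex groups one at a time,
    each time as an amalgam over an edge group, and that G is the amalgam of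
    L = <V_i, V_(i+1)> and of the subgroup of the complementary arc over
    C = <E_(i-1), E_(i+1)>. A combination theorem for acylindrical amalgams of
    hyperbolic groups over undistorted subgroups applies to each of these.

    It remains to bound the elements fixing a long segment of the tree of a
    splitting. The length in the tree is at most the word length over the union
    of the V_k, and this word metric is quasi-isometric to the development, the
    lower bound coming from 1-Lipschitz bump functions. For a cut over an edge
    group the bound is therefore the acylindricity of the action on the
    development. For the last cut, hyperbolicity of the development bounds the
    projection to C of a translate of C far away in the tree, so that the common
    stabilizer has bounded orbits in the tree of C = E_(i-1) *_P E_(i+1) and is
    conjugate into an edge group at both ends. *)

From HB Require Import structures.
Require Import Defs.
From mathcomp Require Import all_boot all_order all_algebra.
From mathcomp Require Import monoid generic_quotient.
From mathcomp Require Import all_classical all_reals all_analysis.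
From mathcomp Require Import zify lra ring.
From Stdlib Require Import Relations.

Set Implicit Arguments.
Unset Strict Implicit.
Unset Printing Implicit Defensive.

(** * Discrete hyperbolic geometry *)

(** All coarse geometry is done with distances in [nat], on a predicate [W] of a fixed type: one
    notion then serves subgroups, their cosets and, after rounding up, the development. No
    Bass-Serre tree is built either: an amalgam is encoded by a length function that counts the
    letters of reduced words. In the combination theorem the obstacle is that edge groups are
    infinite, so that paths may stay close to many consecutive edge cosets. Guessed geodesics are
    built from nearest point projections done one edge at a time. Two projections either come close
    at some step or have fellow-travelled through all the edges so far, and acylindricity bounds the
    second case. What it needs is a uniform bound on common stabilizers, whereas the action only
    gives finiteness; the bounded order of finite subgroups of a hyperbolic group fills the gap. The
    last amalgam also needs [C] undistorted in both factors. This comes from a second statement on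
    amalgams: a sub-amalgam with undistorted factors is undistorted, again by acylindricity. *)

Record graph_metric (X : Type) (W : X -> Prop) (d : X -> X -> nat) : Prop :=
  GraphMetric {
  gm0 : forall x, W x -> d x x = 0;
  gm_eq : forall x y, W x -> W y -> d x y = 0 -> x = y;
  gmC : forall x y, W x -> W y -> d x y = d y x;
  gmT : forall x y z, W x -> W y -> W z -> d x z <= d x y + d y z;
  gmG : forall x y n, W x -> W y -> n <= d x y ->
    exists z, [/\ W z, d x z = n & d z y = d x y - n] }.

(** The four-point form of Gromov's inequality, doubled to stay in [nat]: [delta] is twice the
    constant of [hyperbolic_space]. *)
Definition hyp (X : Type) (W : X -> Prop) (d : X -> X -> nat) (delta : nat) :=
  forall x y z w, W x -> W y -> W z -> W w ->
    d x y + d z w <= maxn (d x z + d y w) (d x w + d y z) + delta.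

(** For [k = 0] this is the union of all geodesics from [x] to [y]. With intervals instead of chosen
    geodesics, thinness of triangles is a direct consequence of the four-point inequality
    ([btw_thin]). *)
Definition btw (X : Type) (d : X -> X -> nat) k x y p :=
  d x p + d p y <= d x y + k.

Definition geo (X : Type) (W : X -> Prop) (d : X -> X -> nat) n (f : nat -> X) :=
  (forall i, i <= n -> W (f i)) /\
  (forall i j, i <= j -> j <= n -> d (f i) (f j) = j - i).

(** The hypotheses of the criterion for guessed geodesics. [tf_conn] is coarse connectedness of
    [eta x y], stated as a jump of size at most [h] across any predicate that separates the ends, so
    that no path has to be exhibited. *)
Record thin_family (X : Type) (W : X -> Prop) (d : X -> X -> nat) h
    (eta : X -> X -> X -> Prop) : Prop := ThinFamily {
  tf_sub : forall x y w, W x -> W y -> eta x y w -> W w;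
  tf_loc : forall x y w, W x -> W y -> d x y <= 1 -> eta x y w -> d w x <= h;
  tf_thin : forall x y z w, W x -> W y -> W z -> eta x y w ->
    exists2 w', eta x z w' \/ eta z y w' & d w w' <= h;
  tf_left : forall x y, W x -> W y -> eta x y x;
  tf_right : forall x y, W x -> W y -> eta x y y;
  tf_conn : forall x y (Q : X -> Prop), W x -> W y -> Q x -> ~ Q y ->
    exists w w', [/\ eta x y w, eta x y w', Q w, ~ Q w' & d w w' <= h] }.

(** Closes the two bootstrapping arguments below, for quasi-geodesics and for guessed geodesics: a
    distance [t] is there at most linear in the logarithm [k] of a length that is itself at most
    linear in [t]. *)
Lemma expn_beats_linear a b : exists R, forall t k, 2 ^ k <= b * t.+1 ->
  t <= a + a * k -> t <= R.
Proof.
have [k0 Hk0] : exists k0, forall k, k0 <= k -> b * (a + a * k).+1 < 2 ^ k.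
  pose c := b * (a + 1) + b * a + 1.
  exists (4 * c + 4) => k hk.
  have e1 : forall m, m < 2 ^ m by move=> m; apply: ltn_expl.
  have e2 : b * (a + a * k).+1 <= c * k.+1 by rewrite /c; nia.
  have e3 : c * k.+1 < 2 ^ k; last by lia.
  have -> : 2 ^ k = 2 ^ (k./2) * 2 ^ (k - k./2) by rewrite -expnD; congr expn; lia.
  have := e1 (k./2); have := e1 (k - k./2).
  have h3 : 2 * c <= k./2 by lia.
  have h4 : k.+1 <= 2 * (k - k./2) + 1 by lia.
  set u := 2 ^ _; set v := 2 ^ _; set p := k - _ in h4 * => h1 h2.
  have h5 : c * k.+1 <= c * (2 * p + 1) by rewrite leq_mul2l h4 orbT.
  have h6 : p.+1 * k./2.+1 <= v * u by rewrite mulnC leq_mul.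
  nia.
exists (a + a * k0) => t k h1 h2.
case: (leqP k0 k) => hk; last first.
  by apply: (leq_trans h2); rewrite leq_add2l leq_mul2l (ltnW hk) orbT.
have h3 : b * t.+1 <= b * (a + a * k).+1 by rewrite leq_mul2l ltnS h2 orbT.
by have := Hk0 _ hk; rewrite ltnNge (leq_trans h1 h3).
Qed.

Section Graph.
Context (X : Type) (W : X -> Prop) (d : X -> X -> nat).
Hypothesis gm : graph_metric W d.

Lemma geo_cat n m f g : geo W d n f -> geo W d m g -> f n = g 0 ->
  d (f 0) (g m) = n + m ->
  geo W d (n + m) (fun i => if i <= n then f i else g (i - n)).
Proof.
move=> [fW fd] [gW gd] fg dd; split=> [i hi|i j ij hj].
  by case: leqP => h; [apply: fW|apply: gW; lia].
case: (leqP j n) => hjn; first by rewrite (_ : i <= n); [apply: fd|lia].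
case: leqP => hin; last by rewrite gd; lia.
have Wi := fW _ hin; have Wj : W (g (j - n)) by apply: gW; lia.
have Wn := fW n (leqnn _); have W0 := fW 0 (leq0n _); have Wm := gW m (leqnn _).
have t1 := gmT gm Wi Wn Wj; have t2 := gmT gm W0 Wi Wm; have t3 := gmT gm Wi Wj Wm.
have f1 := fd i n hin (leqnn _); have f2 := fd 0 i (leq0n _) hin.
have g1 := gd 0 (j - n) (leq0n _) (ltac:(lia)).
have g2 := gd (j - n) m (ltac:(lia)) (leqnn _).
rewrite fg in t1 f1; lia.
Qed.

Lemma geo_exists x y : W x -> W y ->
  exists f, [/\ geo W d (d x y) f, f 0 = x & f (d x y) = y].
Proof.
move=> Wx Wy; move e : (d x y) => n; elim: n x Wx e => [|n IH] x Wx e.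
  exists (fun=> x); split=> //; last by apply: (gm_eq gm).
  split=> // i j ij j0; rewrite (gm0 gm) //; lia.
have [//|z [Wz z1 z2]] := gmG gm (n := 1) Wx Wy; first by rewrite e.
have [|f [fg f0 fn]] := IH z Wz; first by lia.
have g1 : geo W d 1 (fun i => if i == 0 then x else z).
  split=> [i|[|i] [|j]] //=; first by case: (i == 0).
    - by rewrite (gm0 gm).
    - case: j => //; lia.
    by case: i => //; case: j => // _ _; rewrite (gm0 gm).
have := geo_cat g1 fg; rewrite /= f0 fn => /(_ erefl (ltac:(lia))) h.
exists (fun i => if i <= 1 then if i == 0 then x else z else f (i - 1)); split=> //.
case: n f fg f0 fn {e IH z2 h} => [|n] f fg f0 fn /=; first by rewrite -f0.
by rewrite subn1.
Qed.

Lemma geo_through x y p : W x -> W y -> W p -> d x p + d p y = d x y ->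
  exists f, [/\ geo W d (d x y) f, f 0 = x, f (d x y) = y & f (d x p) = p].
Proof.
move=> Wx Wy Wp e.
have [f [fg f0 fn]] := geo_exists Wx Wp; have [g [gg g0 gn]] := geo_exists Wp Wy.
have := geo_cat fg gg; rewrite fn g0 f0 gn -e => /(_ erefl erefl) h.
exists (fun i => if i <= d x p then f i else g (i - d x p)); split=> //.
  case: leqP => h1; last by rewrite addKn.
  have p0 : d p y = 0 by lia.
  by rewrite p0 addn0 fn; apply: (gm_eq gm).
by rewrite leqnn.
Qed.

Lemma geo_sub n f i m : geo W d n f -> i + m <= n -> geo W d m (fun k => f (i + k)).
Proof.
move=> [fW fd] h; split=> [k hk|k l kl hl]; first by apply: fW; lia.
by rewrite fd; lia.
Qed.

Lemma btw_sym k x y p : W x -> W y -> W p -> btw d k x y p -> btw d k y x p.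
Proof.
move=> Wx Wy Wp; rewrite /btw (gmC gm Wx Wp) (gmC gm Wp Wy) (gmC gm Wx Wy); lia.
Qed.

Lemma switch (Y : Type) (Q : Y -> Prop) (f : nat -> Y) n : Q (f 0) -> ~ Q (f n) ->
  exists i, [/\ i < n, Q (f i) & ~ Q (f i.+1)].
Proof.
elim: n => [//|n IH] q0 qn.
case: (EM (Q (f n))) => qn'; first by exists n.
by have [i [h1 h2 h3]] := IH q0 qn'; exists i; split=> //; lia.
Qed.

Lemma thin_hyp h :
  (forall x y z p, W x -> W y -> W z -> W p -> btw d 0 x y p ->
     exists q, [/\ W q, btw d 0 x z q \/ btw d 0 z y q & d p q <= h]) ->
  hyp W d (8 * h + 4).
Proof.
move=> thin.
(* Follow [[x, y]] from [x]: the point where closeness to [[x, w]] changes into closeness to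
   [[w, y]] is at distance from [w] the Gromov product of [x] and [y], up to a constant. *)
have key w x y : W w -> W x -> W y -> exists p, [/\ W p, btw d 0 x y p &
    2 * d w p + d x y <= d w x + d w y + 4 * h + 2].
  move=> Ww Wx Wy; have [f [[fW fd] f0 fn]] := geo_exists Wx Wy.
  pose Q p := exists q, [/\ W q, btw d 0 x w q & d p q <= h].
  have bf i : i <= d x y -> btw d 0 x y (f i).
    move=> hi; have h1 := fd 0 i (leq0n _) hi; have h2 := fd i _ hi (leqnn _).
    by rewrite f0 in h1; rewrite fn in h2; rewrite /btw; lia.
  have est i : i <= d x y -> Q (f i) -> d w (f i) + i <= d w x + 2 * h.
    move=> hi [q [Wq bq dq]]; have Wi := fW _ hi; move: bq; rewrite /btw => bq.
    have := gmT gm Ww Wq Wi; have := gmT gm Wx Wq Wi.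
    rewrite (gmC gm Wq Wi) (gmC gm Ww Wq) (gmC gm Ww Wx).
    have := fd 0 i (leq0n _) hi; rewrite f0; lia.
  have est' i : i <= d x y -> ~ Q (f i) -> d w (f i) + (d x y - i) <= d w y + 2 * h.
    move=> hi nq; have Wi := fW _ hi.
    have [q [Wq [bq|bq] dq]] := thin x y w (f i) Wx Wy Ww Wi (bf _ hi).
      by case: nq; exists q.
    move: bq; rewrite /btw => bq.
    have := gmT gm Ww Wq Wi; have := gmT gm Wi Wq Wy.
    rewrite (gmC gm Wq Wi).
    have := fd i (d x y) hi (leqnn _); rewrite fn; lia.
  case: (EM (Q (f (d x y)))) => qn.
    exists y; split=> //; first by rewrite /btw (gm0 gm) //; lia.
    have := est _ (leqnn _) qn; rewrite fn; lia.
  case: (EM (Q (f 0))) => q0.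
    have [i [hi qi qi']] := switch q0 qn.
    exists (f i); split; [apply: fW; lia|apply: bf; lia|].
    have := est i (ltac:(lia)) qi; have := est' i.+1 (ltac:(lia)) qi'.
    have Wi := fW i (ltac:(lia)); have Wi' := fW i.+1 (ltac:(lia)).
    have := gmT gm Ww Wi' Wi; rewrite (gmC gm Wi' Wi) fd; lia.
  exists x; split=> //; first by rewrite /btw (gm0 gm) //; lia.
  have := est' 0 (leq0n _) q0; rewrite f0; lia.
move=> x y z w Wx Wy Wz Ww.
have [p [Wp bp hp]] := key w x y Ww Wx Wy.
have [q [Wq [bq|bq] dq]] := thin x y z p Wx Wy Wz Wp bp; move: bp bq; rewrite /btw => bp bq.
  have := gmT gm Ww Wp Wq.
  have t1 := gmT gm Wx Wq Ww; have t2 := gmT gm Ww Wq Wz.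
  move: t1 t2; rewrite (gmC gm Wq Ww) (gmC gm Wx Ww) (gmC gm Wy Ww) (gmC gm Wz Ww).
  have t3 := gmT gm Wx Wq Ww; move: t3; rewrite (gmC gm Wq Ww) (gmC gm Wx Ww).
  lia.
have := gmT gm Ww Wp Wq.
have t1 := gmT gm Wy Wq Ww; have t2 := gmT gm Ww Wq Wz.
move: t1 t2; rewrite (gmC gm Wy Wq) (gmC gm Wq Ww) (gmC gm Wx Ww) (gmC gm Wy Ww) (gmC gm Wz Ww).
rewrite (gmC gm Wy Wz) (gmC gm Wz Wq) in bq *; lia.
Qed.

End Graph.

Section Hyperbolic.
Context (X : Type) (W : X -> Prop) (d : X -> X -> nat) (delta : nat).
Hypotheses (gm : graph_metric W d) (hd : hyp W d delta).

Lemma btw_near k x y p : W x -> W y -> W p -> btw d k x y p ->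
  exists q, [/\ W q, btw d 0 x y q & d p q <= k + delta].
Proof.
rewrite /btw => Wx Wy Wp b.
have [q [Wq q1 q2]] := gmG gm (n := minn (d x p) (d x y)) Wx Wy (geq_minr _ _).
exists q; split=> //; first by lia.
have := hd Wp Wq Wx Wy; have := gmT gm Wx Wp Wy.
rewrite (gmC gm Wp Wx) (gmC gm Wq Wx); lia.
Qed.

Lemma btw_thin k x y z p : W x -> W y -> W z -> W p -> btw d k x y p ->
  btw d (k + delta) x z p \/ btw d (k + delta) z y p.
Proof.
rewrite /btw => Wx Wy Wz Wp b; have := hd Wp Wz Wx Wy.
rewrite (gmC gm Wp Wx) (gmC gm Wz Wx) (gmC gm Wz Wp).
by case: (leqP (d x p + d z y) (d p y + d x z)) => h h'; [left|right]; move: h'; lia.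
Qed.

Lemma btw_weak k k' x y p : k <= k' -> btw d k x y p -> btw d k' x y p.
Proof. rewrite /btw; lia. Qed.

(** Bisection: each halving of the chain costs one [delta], so a point between the ends of a chain
    with [n] links is near a single link up to an error logarithmic in [n]. *)
Lemma btw_chain k m n (f : nat -> X) p : 0 < n -> n <= 2 ^ k ->
  (forall i, i <= n -> W (f i)) -> W p -> btw d m (f 0) (f n) p ->
  exists2 i, i < n & btw d (m + k * delta) (f i) (f i.+1) p.
Proof.
elim: k m n f => [|k IH] m n f n0 nk fW Wp b.
  have -> : n = 1 by lia.
  exists 0 => //; have e : n = 1 by lia.
  by move: b; rewrite e; apply: btw_weak; lia.
case: (leqP n 1) => n1.
  have e : n = 1 by lia.
  by exists 0 => //; move: b; rewrite e; apply: btw_weak; lia.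
rewrite expnS in nk.
have W0 := fW 0 (leq0n _); have Wn := fW n (leqnn _).
have Wh : W (f n./2) by apply: fW; lia.
have [b'|b'] := btw_thin W0 Wn Wh Wp b.
  have [|||||i hi bi] := IH (m + delta) n./2 f; rewrite ?half_gt0 //; first by lia.
    by move=> i hi; apply: fW; lia.
  by exists i; [lia|apply: btw_weak bi; lia].
have [|||||i hi bi] := IH (m + delta) (n - n./2) (fun i => f (n./2 + i)) => //.
- by lia.
- by lia.
- by move=> i hi; apply: fW; lia.
- by rewrite addn0 subnKC //; lia.
exists (n./2 + i); first by lia.
by rewrite -addnS; apply: btw_weak bi; lia.
Qed.

End Hyperbolic.

Lemma up_pow2 t : exists k, t <= 2 ^ k /\ 2 ^ k <= 2 * t.+1.
Proof.
elim: t => [|t [k [h1 h2]]]; first by exists 0.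
case: (leqP t.+1 (2 ^ k)) => h; first by exists k; split=> //; lia.
by exists k.+1; rewrite expnS; lia.
Qed.

(* The stability of quasi-geodesics, for sets instead of paths. *)
Lemma morse delta lam s : exists R, forall (X : Type) (W C : X -> Prop) d,
  graph_metric W d -> hyp W d delta -> (forall c, C c -> W c) ->
  (forall c c', C c -> C c' -> exists n f, [/\ n <= lam * (d c c').+1,
     f 0 = c, f n = c', forall i, i <= n -> C (f i) &
     forall i, i < n -> d (f i) (f i.+1) <= s]) ->
  forall c c' p, C c -> C c' -> W p -> btw d 0 c c' p ->
    exists2 c'', C c'' & d p c'' <= R.
Proof.
pose a := s + 5 * delta + 1.
have [R0 HR] := expn_beats_linear a (12 * lam + 14).
exists R0 => X W C d gm hd CW chain x y p Cx Cy Wp b.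
have Wx := CW _ Cx; have Wy := CW _ Cy.
have pe : d x p + d p y = d x y by have := gmT gm Wx Wp Wy; move: b; rewrite /btw; lia.
have [f [[fW fd] f0 fn fp]] := geo_through gm Wx Wy Wp pe.
pose far i t := exists2 c, C c & d (f i) c <= t.
have xfar i : i <= d x y -> far i (d x y).
  move=> hi; exists x => //; rewrite (gmC gm (fW _ hi) Wx).
  have := fd 0 i (leq0n _) hi; rewrite f0; lia.
(* [t] is the largest distance from the geodesic to [C], attained at [f j] *)
have [t [ht [j [hj tj]]]] : exists t, (forall i, i <= d x y -> far i t) /\
    exists j, j <= d x y /\ forall c, C c -> t <= d (f j) c.
  have ex : exists t, `[< forall i, i <= d x y -> far i t >].
    by exists (d x y); apply/asboolP.
  have := ex_minnP ex; case=> t /asboolP ht tmin; exists t; split=> //.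
  case: t ht tmin => [|t] ht tmin; first by exists 0.
  have : ~ forall i, i <= d x y -> far i t.
    by move=> h; have /tmin := asboolT h; rewrite ltnn.
  move=> /existsNP [j] /not_implyP [hj nf]; exists j; split=> // c Cc.
  by rewrite ltnNge; apply/negP => h; apply: nf; exists c.
have Rt : t <= R0; last first.
  have [|c Cc hc] := ht (d x p); first by lia.
  by exists c => //; rewrite fp in hc; apply: (leq_trans hc).
have Wq := fW j hj.
set q := f j in tj Wq.
(* Leave the geodesic at distance [2 t] on either side of [q], or at its end if that comes first,
   and go on to [C]. The chain in [C] from [z1] to [z2] has length linear in [t] and keeps at
   distance at least [t] from [q], whereas bisection brings it logarithmically close to [q]. *)
have [z1 [C1 d1 h1]] : exists z1, [/\ C z1, d (f (j - 2 * t)) z1 <= t &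
    z1 = f (j - 2 * t) \/ d (f (j - 2 * t)) q = 2 * t].
  case: (leqP (2 * t) j) => h.
    have [z Cz hz] := ht (j - 2 * t) (ltac:(lia)).
    by exists z; split=> //; right; rewrite fd //; lia.
  exists x; rewrite (_ : j - 2 * t = 0) ?f0; last by lia.
  by split=> //; [rewrite (gm0 gm)|left].
pose i2 := minn (j + 2 * t) (d x y).
have [z2 [C2 d2 h2]] : exists z2, [/\ C z2, d (f i2) z2 <= t &
    z2 = f i2 \/ d q (f i2) = 2 * t].
  case: (leqP (j + 2 * t) (d x y)) => h.
    have [z Cz hz] := ht i2 (geq_minr _ _).
    by exists z; split=> //; right; rewrite /i2 fd //; lia.
  exists y; rewrite (_ : i2 = d x y) ?fn; last by rewrite /i2; lia.
  by split=> //; [rewrite (gm0 gm)|left].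
have W1 := CW _ C1; have W2 := CW _ C2.
have Wf1 : W (f (j - 2 * t)) by apply: fW; lia.
have Wf2 : W (f i2) by apply: fW; rewrite /i2; lia.
have t1 := tj _ C1; have t2 := tj _ C2; rewrite -/q in t1 t2.
have bq : btw d 0 (f (j - 2 * t)) (f i2) q by rewrite /btw /q /i2 !fd //; lia.
have R1 : 2 * delta <= R0 -> t <= 2 * delta -> t <= R0 by lia.
have R2 : 2 * delta <= R0.
  apply: (HR _ 0) => //; first by rewrite expn0; lia.
  by rewrite /a; lia.
have [b1|b1] := btw_thin gm hd Wf1 Wf2 W1 Wq bq.
  apply: R1 => //; move: b1 h1; rewrite /btw => b1 [h1|h1]; last by lia.
  by move: b1; rewrite -h1 (gm0 gm) //; lia.
have [b2|b2] := btw_thin gm hd W1 Wf2 W2 Wq b1; last first.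
  apply: R1 => //; move: b2 h2; rewrite /btw (gmC gm W2 Wq) (gmC gm W2 Wf2).
  move=> b2 [h2|h2]; last by lia.
  by move: b2; rewrite -h2 (gm0 gm) //; lia.
have [n [g [gn g0 gN gC gs]]] := chain _ _ C1 C2.
have dz : d z1 z2 <= 6 * t.
  have := gmT gm W1 Wf1 W2; have := gmT gm Wf1 Wf2 W2.
  have : d (f (j - 2 * t)) (f i2) <= 4 * t by rewrite fd /i2; lia.
  by rewrite (gmC gm W1 Wf1); lia.
case: n gn gN gC gs => [|n] gn gN gC gs.
  apply: R1 => //; move: b2; rewrite /btw -gN g0 (gm0 gm) // (gmC gm Wq W1).
  by rewrite (gmC gm Wq W1) in t1; lia.
have [k [k1 k2]] := up_pow2 n.+1.
rewrite -{1}g0 -gN in b2.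
have gW i : i <= n.+1 -> W (g i) by move=> hi; apply/CW/gC.
have [i hi bi] := btw_chain gm hd (ltn0Sn n) k1 gW Wq b2.
have Wgi : W (g i) by apply: gW; lia.
apply: (HR t k).
  have e : lam * (d z1 z2).+1 <= lam * (6 * t).+1 by rewrite leq_mul2l ltnS dz orbT.
  by move: (leq_trans gn e) k2; nia.
have := tj _ (gC i (ltnW hi)); rewrite -/q (gmC gm Wq Wgi).
have := gs i hi; move: bi; rewrite /btw /a; nia.
Qed.

Section Guess.
Context (X : Type) (W : X -> Prop) (d : X -> X -> nat) (h : nat).
Context (eta : X -> X -> X -> Prop).
Hypotheses (gm : graph_metric W d) (te : thin_family W d h eta).

Lemma thin_family_chain k n (f : nat -> X) w : n <= 2 ^ k ->
  (forall i, i <= n -> W (f i)) -> (forall i, i < n -> d (f i) (f i.+1) <= 1) ->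
  eta (f 0) (f n) w -> exists2 i, i <= n & d w (f i) <= h * k.+1.
Proof.
elim: k n f w => [|k IH] n f w nk fW fd ew.
  have W0 := fW 0 (leq0n _); have Wn := fW n (leqnn _).
  exists 0 => //; rewrite muln1; apply: (tf_loc te W0 Wn) => //.
  case: n nk fW fd ew Wn => [|[|n]] // _ _ fd _ _; last exact: fd.
  by rewrite (gm0 gm).
rewrite expnS in nk.
have W0 := fW 0 (leq0n _); have Wn := fW n (leqnn _).
have Wh : W (f n./2) by apply: fW; lia.
have Ww := tf_sub te W0 Wn ew.
have [w' [e|e] dw] := tf_thin te W0 Wn Wh ew.
  have [||||i hi di] := IH n./2 f w' => //; first by lia.
  - by move=> i hi; apply: fW; lia.
  - by move=> i hi; apply: fd; lia.
  have Wi : W (f i) by apply: fW; lia.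
  exists i; first by lia.
  by have := gmT gm Ww (tf_sub te W0 Wh e) Wi; lia.
have [||||i hi di] := IH (n - n./2) (fun i => f (n./2 + i)) w'; first by lia.
- by move=> i hi; apply: fW; lia.
- by move=> i hi; rewrite addnS; apply: fd; lia.
- by rewrite addn0 subnKC //; lia.
have Wi : W (f (n./2 + i)) by apply: fW; lia.
exists (n./2 + i); first by lia.
by have := gmT gm Ww (tf_sub te Wh Wn e) Wi; lia.
Qed.

(** By [thin_family_chain], [eta] is close to a geodesic up to the logarithm of its length. To
    remove the length, take the least [t] that works for all geodesics of length at most [N] and a
    point realizing it, and cut the geodesic at [3 t] on both sides of the foot of this point. The
    logarithmic bound on the middle piece, of length at most [6 t], bounds [t] independently of
    [N]. *)
Lemma thin_family_geo R : (forall t k, 2 ^ k <= 14 * t.+1 ->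
    t <= 3 * h + 3 * h * k -> t <= R) ->
  forall n f w, geo W d n f -> eta (f 0) (f n) w ->
    exists2 i, i <= n & d w (f i) <= R.
Proof.
move=> HR N f0 w0 gf0 ew0.
pose B t := forall n f w, n <= N -> geo W d n f -> eta (f 0) (f n) w ->
  exists2 i, i <= n & d w (f i) <= t.
have ex : exists t, `[< B t >].
  have [k [k1 _]] := up_pow2 N; exists (h * k.+1); apply/asboolP => n f w nN [fW fd] ew.
  apply: thin_family_chain ew => //; first by lia.
  by move=> i hi; rewrite fd //; lia.
have := ex_minnP ex; case=> t /asboolP ht tmin.
suff tR : t <= R.
  have [i hi di] := ht N f0 w0 (leqnn _) gf0 ew0.
  by exists i => //; apply: leq_trans tR.
case: t ht tmin => [//|t'] ht tmin.
have : ~ B t' by move=> hB; have /tmin := asboolT hB; rewrite ltnn.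
move=> /existsNP [n] /existsNP [f] /existsNP [w] /not_implyP [nN].
move=> /not_implyP [gf] /not_implyP [ew nfar]; have [fW fd] := gf.
move: ht tmin nfar; set t := t'.+1 => ht tmin nfar.
have wfar i : i <= n -> t <= d w (f i).
  by move=> hi; rewrite leqNgt; apply/negP => hh; apply: nfar; exists i.
have [j hj dj] := ht n f w nN gf ew.
have W0 := fW 0 (leq0n _); have Wn := fW n (leqnn _); have Wj := fW j hj.
have Ww := tf_sub te W0 Wn ew.
have t3h : t <= 3 * h -> t <= R by move=> th; apply: (HR _ 0); rewrite ?expn0; lia.
pose i1 := j - 3 * t; pose i2 := minn (j + 3 * t) n.
have hi1 : i1 <= n by rewrite /i1; lia.
have hi2 : i2 <= n by rewrite /i2; lia.
have W1 := fW _ hi1; have W2 := fW _ hi2.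
have [w1 [e1|e1] dw1] := tf_thin te W0 Wn W1 ew.
  have Ww1 := tf_sub te W0 W1 e1; apply: t3h.
  case: (posnP i1) => i10.
    have := wfar 0 (leq0n _); rewrite i10 in e1.
    have := tf_loc te W0 W0 (ltac:(rewrite (gm0 gm) //)) e1.
    by have := gmT gm Ww Ww1 W0; lia.
  have [i hi di] := ht i1 f w1 (leq_trans hi1 nN) (geo_sub (i := 0) gf hi1) e1.
  have Wi : W (f i) by apply: fW; lia.
  have := gmT gm Wi Ww1 Wj; have := gmT gm Ww1 Ww Wj.
  rewrite (gmC gm Wi Ww1) (gmC gm Ww1 Ww) fd //; last by rewrite /i1 in hi; lia.
  by move: i10 hi; rewrite /i1; lia.
have Ww1 := tf_sub te W1 Wn e1.
have [w2 [e2|e2] dw2] := tf_thin te W1 Wn W2 e1; last first.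
  have Ww2 := tf_sub te W2 Wn e2; apply: t3h.
  case: (eqVneq i2 n) => i2n.
    have := wfar n (leqnn _); rewrite i2n in e2.
    have := tf_loc te Wn Wn (ltac:(rewrite (gm0 gm) //)) e2.
    by have := gmT gm Ww Ww1 Wn; have := gmT gm Ww1 Ww2 Wn; lia.
  have h2 : i2 + (n - i2) <= n by lia.
  have := ht (n - i2) (fun i => f (i2 + i)) w2 (ltac:(lia)) (geo_sub gf h2).
  rewrite /= addn0 subnKC // => /(_ e2) [i hi di].
  have Wi : W (f (i2 + i)) by apply: fW; lia.
  have := gmT gm Wj Ww Wi; have := gmT gm Ww Ww1 Wi; have := gmT gm Ww1 Ww2 Wi.
  rewrite (gmC gm Wj Ww) fd; [|by rewrite /i2; lia|by lia].
  have i2e : i2 = j + 3 * t by rewrite /i2 in i2n *; lia.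
  by lia.
have [k [k1 k2]] := up_pow2 (i2 - i1).
have h12 : i1 <= i2 by rewrite /i1 /i2; lia.
have Ww2 := tf_sub te W1 W2 e2.
have := @thin_family_chain k (i2 - i1) (fun i => f (i1 + i)) w2 k1.
rewrite addn0 subnKC //; case.
- by move=> i hi; apply: fW; lia.
- by move=> i hi; rewrite fd //; lia.
- by [].
move=> i hi di; have Wi : W (f (i1 + i)) by apply: fW; lia.
apply: (HR _ k); first by move: k2; rewrite /i1 /i2; lia.
have := gmT gm Ww Ww1 Wi; have := gmT gm Ww1 Ww2 Wi.
have := wfar (i1 + i) (ltac:(lia)); nia.
Qed.

End Guess.

(* Bowditch's criterion for hyperbolicity. *)
Theorem guess_geodesics h : exists delta R, forall (X : Type) (W : X -> Prop) d eta,
  graph_metric W d -> thin_family W d h eta ->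
  [/\ hyp W d delta,
      forall x y w, W x -> W y -> eta x y w ->
        exists q, [/\ W q, btw d 0 x y q & d w q <= R] &
      forall x y p, W x -> W y -> W p -> btw d 0 x y p ->
        exists2 w, eta x y w & d p w <= R].
Proof.
have [R1 HR] := expn_beats_linear (3 * h) 14.
exists (8 * (4 * R1 + 2 * h) + 4), (3 * R1 + h) => X W d eta gm te.
have near1 x y w : W x -> W y -> eta x y w ->
    exists q, [/\ W q, btw d 0 x y q & d w q <= R1].
  move=> Wx Wy ew; have [f [gf f0 fn]] := geo_exists gm Wx Wy.
  have [|i hi di] := thin_family_geo gm te HR gf (w := w); first by rewrite f0 fn.
  exists (f i); split=> //; first by apply: gf.1.
  have := gf.2 0 i (leq0n _) hi; have := gf.2 i _ hi (leqnn _).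
  by rewrite f0 fn /btw; lia.
have near2 x y p : W x -> W y -> W p -> btw d 0 x y p ->
    exists2 w, eta x y w & d p w <= 3 * R1 + h.
  move=> Wx Wy Wp; rewrite /btw => b.
  have pe : d x p + d p y = d x y by have := gmT gm Wx Wp Wy; lia.
  have [f [gf f0 fn fp]] := geo_through gm Wx Wy Wp pe; have [fW fd] := gf.
  (* [Q] means close to the part of the geodesic before [p]. A small jump of [eta x y] out of [Q]
     lands close to the part after [p], so [p] lies between two close points of the geodesic. *)
  pose Q w := exists2 i, i <= d x p & d w (f i) <= R1.
  have Qx : Q x by exists 0 => //; rewrite f0 (gm0 gm).
  case: (EM (Q y)) => Qy.
    exists y; first exact: (tf_right te).
    have [i hi di] := Qy.
    have := fd i (d x y) (ltac:(lia)) (leqnn _); rewrite fn (gmC gm _ Wy) //.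
      by lia.
    by apply: fW; lia.
  have [w [w' [ew ew' qw qw' dw]]] := tf_conn te Wx Wy Qx Qy.
  exists w => //; have [i hi di] := qw.
  have [|i' hi' di'] := thin_family_geo gm te HR gf (w := w'); first by rewrite f0 fn.
  have lt : d x p < i' by rewrite ltnNge; apply/negP => hh; apply: qw'; exists i'.
  have Wi : W (f i) by apply: fW; lia.
  have Wi' := fW _ hi'.
  have Ww := tf_sub te Wx Wy ew; have Ww' := tf_sub te Wx Wy ew'.
  have := gmT gm Wi Ww Wi'; have := gmT gm Ww Ww' Wi'.
  rewrite (gmC gm Wi Ww) fd //; last by lia.
  have := gmT gm Wp Wi Ww; rewrite -{2}fp (gmC gm _ Wi); last by apply: fW; lia.
  rewrite fd //; last by lia.
  by rewrite (gmC gm Wi Ww); lia.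
split=> // [|x y w Wx Wy /near1 [] // q [Wq bq dq]]; last first.
  by exists q; split=> //; lia.
apply: (thin_hyp gm) => x y z p Wx Wy Wz Wp b.
have [w ew dw] := near2 _ _ _ Wx Wy Wp b.
have Ww := tf_sub te Wx Wy ew.
have [w' [e|e] dw'] := tf_thin te Wx Wy Wz ew.
  have [q [Wq bq dq]] := near1 _ _ _ Wx Wz e; have Ww' := tf_sub te Wx Wz e.
  exists q; split; [by []|by left|].
  by have := gmT gm Wp Ww Wq; have := gmT gm Ww Ww' Wq; lia.
have [q [Wq bq dq]] := near1 _ _ _ Wz Wy e; have Ww' := tf_sub te Wz Wy e.
exists q; split; [by []|by right|].
by have := gmT gm Wp Ww Wq; have := gmT gm Ww Ww' Wq; lia.
Qed.

Definition nearest (X : Type) (d : X -> X -> nat) (C : X -> Prop) x v :=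
  C v /\ forall c, C c -> d x v <= d x c.

Definition quasiconvex (X : Type) (W : X -> Prop) (d : X -> X -> nat)
    (C : X -> Prop) k :=
  forall c c' p, C c -> C c' -> W p -> btw d 0 c c' p -> exists2 c'', C c'' & d p c'' <= k.

Lemma nearest_exists (X : Type) (d : X -> X -> nat) (C : X -> Prop) x c :
  C c -> exists v, nearest d C x v.
Proof.
move=> Cc; have ex : exists n, `[< exists2 v, C v & d x v <= n >].
  by exists (d x c); apply/asboolP; exists c.
have := ex_minnP ex; case=> n /asboolP [v Cv dv] nmin; exists v; split=> // c' Cc'.
by apply: (leq_trans dv); apply: nmin; apply/asboolP; exists c'.
Qed.

Section Projection.
Context (X : Type) (W C : X -> Prop) (d : X -> X -> nat) (delta k : nat).
Hypotheses (gm : graph_metric W d) (hd : hyp W d delta).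
Hypotheses (CW : forall c, C c -> W c) (qc : quasiconvex W d C k).

(** The point [m] of [[v, c]] at distance from [v] the Gromov product of [x] and [c] at [v] is
    closer to [x] than [v] by this amount, up to [delta]. Being within [k] of [C], it cannot beat
    the nearest point [v] by more than [k], so this product is small. *)
Lemma nearest_btw x v c : W x -> nearest d C x v -> C c ->
  btw d (2 * (k + delta + 1) + 1) x c v.
Proof.
move=> Wx [Cv vmin] Cc; have Wv := CW Cv; have Wc := CW Cc.
have := gmT gm Wv Wx Wc; have := gmT gm Wx Wv Wc; rewrite (gmC gm Wv Wx) => t1 t2.
have := gmT gm Wx Wc Wv; rewrite (gmC gm Wc Wv) => t3.
pose a := (d x v + d v c - d x c)./2.
have [m [Wm m1 m2]] := gmG gm (n := a) Wv Wc (ltac:(rewrite /a; lia)).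
have bm : btw d 0 v c m by rewrite /btw m1 m2; rewrite /a; lia.
have [c' Cc' dc'] := qc Cv Cc Wm bm.
have := vmin _ Cc'; have := gmT gm Wx Wm (CW Cc').
have := hd Wx Wm Wv Wc; rewrite (gmC gm Wm Wv) m1 m2 /btw /a; lia.
Qed.

Let r := 2 * (k + delta + 1) + 1.

(** The dichotomy on which the combination theorem turns: unless the projections are close, a
    geodesic from [x] to [y] passes near both. *)
Lemma nearest_dich x y v w : W x -> W y -> nearest d C x v -> nearest d C y w ->
  d v w <= r + delta \/ d x v + d v w + d w y <= d x y + 2 * r + delta.
Proof.
move=> Wx Wy nv nw; have [Cv _] := nv; have [Cw _] := nw.
have Wv := CW Cv; have Ww := CW Cw.
have := nearest_btw Wx nv Cw; have := nearest_btw Wy nw Cv; rewrite -/r /btw.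
have := hd Wx Ww Wy Wv.
rewrite (gmC gm Wy Ww) (gmC gm Ww Wv) (gmC gm Wy Wv); lia.
Qed.

End Projection.

Section Pullback.
Context (X Y : Type) (WX : X -> Prop) (WY : Y -> Prop) (dX : X -> X -> nat)
  (dY : Y -> Y -> nat) (q : Y -> X) (lam s k delta : nat).
Hypotheses (gmX : graph_metric WX dX) (hX : hyp WX dX delta) (gmY : graph_metric WY dY)
  (qW : forall y, WY y -> WX (q y))
  (lo : forall x y, WY x -> WY y -> dY x y <= lam * (dX (q x) (q y)).+1)
  (up : forall x y, WY x -> WY y -> dX (q x) (q y) <= s * (dY x y).+1)
  (qc : forall x y p, WY x -> WY y -> WX p -> btw dX 0 (q x) (q y) p ->
    exists2 c, WY c & dX p (q c) <= k).

(** The guessed geodesics of [Y] are the points whose image is [k]-close to an interval. The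
    criterion gives hyperbolicity and, at the same time, the comparison of the intervals of [X] and
    [Y] in both directions. It is applied to inclusions of undistorted subgroups and to the orbit
    map into the development. *)
Lemma pullback_hyp : exists delta' R, [/\ hyp WY dY delta',
  forall x y p, WY x -> WY y -> WX p -> btw dX 0 (q x) (q y) p ->
    exists c, [/\ WY c, btw dY 0 x y c & dX p (q c) <= R] &
  forall x y c, WY x -> WY y -> WY c -> btw dY 0 x y c ->
    exists p, [/\ WX p, btw dX 0 (q x) (q y) p & dX (q c) p <= R]].
Proof.
pose eta x y c := WY c /\ exists p, [/\ WX p, btw dX 0 (q x) (q y) p & dX p (q c) <= k].
pose h := lam * (2 * s + 3 * k + 2 * delta + 1).+1.
have loh m x y : WY x -> WY y -> dX (q x) (q y) <= m -> m <= 2 * s + 3 * k + 2 * delta + 1 ->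
    dY x y <= h.
  move=> Wx Wy h1 h2; apply: (leq_trans (lo Wx Wy)); rewrite leq_mul2l ltnS.
  by rewrite (leq_trans h1 h2) orbT.
have te : thin_family WY dY h eta.
  split.
  - by move=> x y w _ _ [].
  - move=> x y w Wx Wy d1 [Ww [p [Wp bp dp]]].
    have u := up Wx Wy; have u' : s * (dY x y).+1 <= s * 2 by rewrite leq_mul2l !ltnS d1 orbT.
    have := gmT gmX (qW Ww) Wp (qW Wx); rewrite (gmC gmX (qW Ww) Wp) (gmC gmX Wp (qW Wx)) => t.
    by apply: (loh _ _ _ Ww Wx (leqnn _)); move: bp; rewrite /btw; lia.
  - move=> x y z w Wx Wy Wz [Ww [p [Wp bp dp]]].
    have [b|b] := btw_thin gmX hX (qW Wx) (qW Wy) (qW Wz) Wp bp.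
      have [r [Wr br dr]] := btw_near gmX hX (qW Wx) (qW Wz) Wp b.
      have [c Wc dc] := qc Wx Wz Wr br.
      exists c; first by left; split=> //; exists r.
      apply: (loh _ _ _ Ww Wc (leqnn _)).
      have := gmT gmX (qW Ww) Wp (qW Wc); have := gmT gmX Wp Wr (qW Wc).
      by rewrite (gmC gmX (qW Ww) Wp); lia.
    have [r [Wr br dr]] := btw_near gmX hX (qW Wz) (qW Wy) Wp b.
    have [c Wc dc] := qc Wz Wy Wr br.
    exists c; first by right; split=> //; exists r.
    apply: (loh _ _ _ Ww Wc (leqnn _)).
    have := gmT gmX (qW Ww) Wp (qW Wc); have := gmT gmX Wp Wr (qW Wc).
    by rewrite (gmC gmX (qW Ww) Wp); lia.
  - move=> x y Wx Wy; split=> //; exists (q x); have Ux := qW Wx; split=> //.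
      by rewrite /btw (gm0 gmX) //; lia.
    by rewrite (gm0 gmX).
  - move=> x y Wx Wy; split=> //; exists (q y); have Uy := qW Wy; split=> //.
      by rewrite /btw (gm0 gmX) //; lia.
    by rewrite (gm0 gmX).
  move=> x y Q Wx Wy Qx Qy.
  have [f [[fW fd] f0 fn]] := geo_exists gmX (qW Wx) (qW Wy).
  have bf i : i <= dX (q x) (q y) -> btw dX 0 (q x) (q y) (f i).
    move=> hi; have h1 := fd 0 i (leq0n _) hi; have h2 := fd i _ hi (leqnn _).
    by rewrite f0 in h1; rewrite fn in h2; rewrite /btw; lia.
  pose Q' p := exists c, [/\ WY c, dX p (q c) <= k & Q c].
  have Q0 : Q' (f 0) by rewrite f0; exists x; split=> //; rewrite (gm0 gmX) //; apply: qW.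
  have near i : i <= dX (q x) (q y) -> ~ Q' (f i) ->
      exists c, [/\ WY c, dX (f i) (q c) <= k & ~ Q c].
    move=> hi nq; have [c Wc dc] := qc Wx Wy (fW _ hi) (bf _ hi).
    by exists c; split=> // Qc; apply: nq; exists c.
  have fin2 i j c c' : i <= dX (q x) (q y) -> j <= dX (q x) (q y) -> i <= j -> j <= i.+1 ->
      WY c -> WY c' -> dX (f i) (q c) <= k -> dX (f j) (q c') <= k -> Q c -> ~ Q c' ->
      exists w w', [/\ eta x y w, eta x y w', Q w, ~ Q w' & dY w w' <= h].
    move=> hi hj ij ji Wc Wc' dc dc' qc1 qc2; exists c, c'; split=> //.
    - by split=> //; exists (f i); split=> //; [apply: fW|apply: bf].
    - by split=> //; exists (f j); split=> //; [apply: fW|apply: bf].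
    apply: (loh _ _ _ Wc Wc' (leqnn _)).
    have := gmT gmX (qW Wc) (fW _ hi) (qW Wc'); have := gmT gmX (fW _ hi) (fW _ hj) (qW Wc').
    by rewrite (gmC gmX (qW Wc) (fW _ hi)) fd //; lia.
  case: (EM (Q' (f (dX (q x) (q y))))) => Qn.
    have [c [Wc dc qc']] := Qn.
    apply: (fin2 (dX (q x) (q y)) (dX (q x) (q y)) c y) => //.
    by rewrite fn (gm0 gmX) //; apply: qW.
  have [i [hi qi qi']] := switch Q0 Qn.
  have [c [Wc dc qc1]] := qi; have [c' [Wc' dc' qc2]] := near _ hi qi'.
  by apply: (fin2 i i.+1 c c') => //; apply: ltnW.
have [delta' [R HR]] := guess_geodesics h.
have [h1 h2 h3] := HR _ _ _ _ gmY te.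
exists delta', (k + s * R.+1); split=> // [x y p Wx Wy Wp b|x y c Wx Wy Wc b].
  have [c Wc dc] := qc Wx Wy Wp b.
  have [|r [Wr br dr]] := h2 x y c Wx Wy; first by split=> //; exists p.
  exists r; split=> //.
  have := gmT gmX Wp (qW Wc) (qW Wr); have := up Wc Wr; nia.
have [w [Ww [p [Wp bp dp]]] dw] := h3 _ _ _ Wx Wy Wc b.
exists p; split=> //.
have := gmT gmX (qW Wc) (qW Ww) Wp; have := up Wc Ww.
rewrite (gmC gmX (qW Ww) Wp); nia.
Qed.

End Pullback.

Local Open Scope group_scope.

(** * Word metrics *)

Local Open Scope group_scope.

Definition subgrp (G : groupType) (H : G -> Prop) :=
  [/\ H 1, forall x y, H x -> H y -> H (x * y) & forall x, H x -> H x^-1].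

Section Words.
Context (G : groupType).
Implicit Types (S H W : G -> Prop) (x y z g : G).

Lemma mulVA x y z : x^-1 * y * (y^-1 * z) = x^-1 * z.
Proof. by rewrite -mulgA mulVKg. Qed.

Lemma invVM x y : (x^-1 * y)^-1 = y^-1 * x.
Proof. by rewrite invgM invgK. Qed.

Lemma sub1 H : subgrp H -> H 1. Proof. by case. Qed.
Lemma subM H x y : subgrp H -> H x -> H y -> H (x * y).
Proof. by case=> _ h _; apply: h. Qed.
Lemma subV H x : subgrp H -> H x -> H x^-1.
Proof. by case=> _ _ h; apply: h. Qed.
Lemma subVr H x : subgrp H -> H x^-1 -> H x.
Proof. by move=> h /(subV h); rewrite invgK. Qed.
Lemma subVM H x y : subgrp H -> H x -> H y -> H (x^-1 * y).
Proof. by move=> h /(subV h) hx hy; apply: subM. Qed.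
Lemma subMl H x y : subgrp H -> H x -> H (x * y) -> H y.
Proof. by move=> h hx hxy; rewrite -(mulKg x y); apply: subVM. Qed.
Lemma subMr H x y : subgrp H -> H y -> H (x * y) -> H x.
Proof. by move=> h hy hxy; rewrite -(mulgK y x); apply: subM => //; apply: subV. Qed.
Lemma subVC H x y : subgrp H -> H (x^-1 * y) -> H (y^-1 * x).
Proof. by move=> h /(subV h); rewrite invVM. Qed.
Lemma subVT H x y z : subgrp H -> H (x^-1 * y) -> H (y^-1 * z) -> H (x^-1 * z).
Proof. by move=> h h1 h2; rewrite -(mulVA x y z); apply: subM. Qed.
Lemma subV11 H x : subgrp H -> H (x^-1 * x).
Proof. by move=> h; rewrite mulVg; apply: sub1. Qed.

(** The set of letters may be infinite: besides the word metrics of finitely generated groups, the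
    metric over the union of all vertex groups is needed. *)
Fixpoint wl S n x : Prop :=
  if n is m.+1 then exists s y, [/\ S s \/ S s^-1, wl S m y & x = s * y] else x = 1.

Definition gen S x := exists n, wl S n x.

Lemma wl_cat S n m x y : wl S n x -> wl S m y -> wl S (n + m) (x * y).
Proof.
elim: n x => [x ->|n IH x [s [z [hs hz ->]]] hy]; first by rewrite mul1g.
by exists s, (z * y); split=> //; [apply: IH|rewrite mulgA].
Qed.

Lemma wl1 S s : S s \/ S s^-1 -> wl S 1 s.
Proof. by move=> h; exists s, 1; rewrite mulg1. Qed.

Lemma wl_inv S n x : wl S n x -> wl S n x^-1.
Proof.
elim: n x => [x ->|n IH x [s [z [hs hz ->]]]]; first by rewrite invg1.
rewrite invgM -addn1; apply: wl_cat; first exact: IH.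
by apply: wl1; rewrite invgK or_comm.
Qed.

Lemma wl_split S n m z : wl S (n + m) z -> exists x y, [/\ wl S n x, wl S m y & z = x * y].
Proof.
elim: n z => [z h|n IH z [s [y [hs /IH [x [y' [h1 h2 ->]]] ->]]]].
  by exists 1, z; rewrite mul1g.
by exists (s * x), y'; rewrite mulgA; split=> //; exists s, x.
Qed.

Lemma wl_mono S S' n x : (forall s, S s -> S' s) -> wl S n x -> wl S' n x.
Proof.
move=> h; elim: n x => [//|n IH] x [s [y [hs /IH hy ->]]].
by exists s, y; split=> //; case: hs => /h; [left|right].
Qed.

Lemma gen_subgrp S : subgrp (gen S).
Proof.
split=> [|x y [n hx] [m hy]|x [n hx]]; first by exists 0.
- by exists (n + m); apply: wl_cat.
- by exists n; apply: wl_inv.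
Qed.

Lemma gen_in S s : S s -> gen S s.
Proof. by move=> h; exists 1%N; apply: wl1; left. Qed.

Lemma gen_min S H : subgrp H -> (forall s, S s -> H s) -> forall x, gen S x -> H x.
Proof.
move=> sH h x [n]; elim: n x => [x ->|n IH x [s [y [hs /IH hy ->]]]]; first exact: sub1.
by apply: subM => //; case: hs => /h //; apply: subVr.
Qed.

Definition len S x : nat :=
  if pselect (exists n, `[< wl S n x >]) is left ex then ex_minn ex else 0.

Lemma len_wl S x : gen S x -> wl S (len S x) x.
Proof.
move=> [n hn]; rewrite /len; case: pselect => [ex|]; last first.
  by case; exists n; apply/asboolP.
by case: ex_minnP => m /asboolP.
Qed.

Lemma len_le S n x : wl S n x -> len S x <= n.
Proof.
move=> hn; rewrite /len; case: pselect => [ex|//].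
by case: ex_minnP => m _; apply; apply/asboolP.
Qed.

Lemma len1 S : len S 1 = 0.
Proof. by apply/eqP; rewrite -leqn0; apply: len_le. Qed.

Lemma len_eq0 S x : gen S x -> len S x = 0 -> x = 1.
Proof. by move=> /len_wl h e; rewrite e in h. Qed.

Lemma lenV S x : gen S x -> len S x^-1 = len S x.
Proof.
move=> h; have h' : gen S x^-1 by apply: subV => //; apply: gen_subgrp.
apply/eqP; rewrite eqn_leq !len_le //; last by apply/wl_inv/len_wl.
by rewrite -{2}(invgK x); apply/wl_inv/len_wl.
Qed.

Lemma lenM S x y : gen S x -> gen S y -> len S (x * y) <= len S x + len S y.
Proof. by move=> hx hy; apply/len_le/wl_cat; apply: len_wl. Qed.

Lemma len_gen1 S s : S s -> len S s <= 1.
Proof. by move=> h; apply/len_le/wl1; left. Qed.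

Definition wd S x y := len S (x^-1 * y).

Lemma wd_mul S g x y : wd S (g * x) (g * y) = wd S x y.
Proof. by rewrite /wd invgM -mulgA mulKg. Qed.

(** A left coset of [gen S], or the empty set. The cosets of a factor and of the edge group inherit
    the geometry of the subgroup by translation. *)
Definition torsor S W :=
  (forall x y, W x -> W y -> gen S (x^-1 * y)) /\ (forall x s, W x -> gen S s -> W (x * s)).

Lemma torsor_coset S g : torsor S (fun x => gen S (g^-1 * x)).
Proof.
have sg := gen_subgrp S; split=> [x y hx hy|x s hx hs].
  by apply: subVT hy => //; apply: subVC.
by rewrite mulgA; apply: subM.
Qed.

Lemma torsor_gen S : torsor S (gen S).
Proof.
have sg := gen_subgrp S; split=> [x y hx hy|x s hx hs]; first exact: subVM.
exact: subM.
Qed.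

Lemma torsor_gm S W : torsor S W -> graph_metric W (wd S).
Proof.
move=> [tW tW']; split.
- by move=> x _; rewrite /wd mulVg len1.
- move=> x y Wx Wy /(len_eq0 (tW x y Wx Wy)) h.
  by rewrite -(mulVKg x y) h mulg1.
- by move=> x y Wx Wy; rewrite /wd -lenV ?invVM //; apply: tW.
- by move=> x y z Wx Wy Wz; rewrite /wd -(mulVA x y z); apply: lenM; apply: tW.
move=> x y n Wx Wy hn; have gxy := tW _ _ Wx Wy; have h := len_wl gxy.
rewrite -/(wd S x y) -(subnKC hn) in h; have [a [b [ha hb e]]] := wl_split h.
have ga : gen S a by exists n.
have gb : gen S b by exists (wd S x y - n).
have ey : (x * a)^-1 * y = b by rewrite invgM -mulgA e mulKg.
have la := len_le ha; have lb := len_le hb.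
have := lenM ga gb; rewrite -e -/(wd S x y) => lab.
by exists (x * a); split; [apply: tW'|rewrite {1}/wd mulKg; lia|rewrite {1}/wd ey; lia].
Qed.

Lemma hyp_torsor S W delta : hyp (gen S) (wd S) delta -> torsor S W ->
  hyp W (wd S) delta.
Proof.
move=> h [tW _] x y z w Wx Wy Wz Ww.
have := h (x^-1 * x) (x^-1 * y) (x^-1 * z) (x^-1 * w); rewrite !wd_mul; apply; exact: tW.
Qed.

Lemma bilip S S' (s : seq G) : (forall x, S x <-> x \in s) -> (forall x, S x -> gen S' x) ->
  exists lam, forall x, gen S x -> len S' x <= lam * len S x.
Proof.
move=> hs hS'.
have [lam hl] : exists lam, forall x, S x -> len S' x <= lam.
  have : forall x, x \in s -> gen S' x by move=> x /hs /hS'.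
  have -> : (forall x, S x <-> x \in s) -> (exists lam, forall x, S x -> len S' x <= lam) =
    (exists lam, forall x, x \in s -> len S' x <= lam).
    move=> h; apply/propext; split=> -[l hl]; exists l => x /h; exact: hl.
    2: by [].
  elim: s {hs} => [|a s IH] h; first by exists 0.
  have [|l hl] := IH; first by move=> x hx; apply: h; rewrite inE hx orbT.
  exists (l + len S' a) => x; rewrite inE => /orP [/eqP ->|/hl]; lia.
exists lam => x gx.
have : forall n x, wl S n x -> gen S' x /\ len S' x <= lam * n.
  move=> {x gx} n; elim: n => [|n IH] x; first by move=> ->; rewrite len1; split=> //; exists 0.
  move=> [t [y [ht /IH [gy ly] ->]]].
  have [gt lt] : gen S' t /\ len S' t <= lam.
    case: ht => ht; first by split; [apply: hS'|apply: hl].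
    have g' := hS' _ ht; split; last by rewrite -lenV; [exact: hl|apply: subVr => //; exact: gen_subgrp].
    by apply: subVr => //; exact: gen_subgrp.
  split; first by apply: subM => //; exact: gen_subgrp.
  by rewrite mulnS; apply: leq_trans (lenM gt gy) _; lia.
by move=> /(_ _ _ (len_wl gx)) [].
Qed.

Lemma ball_finite S (s : seq G) n : (forall x, S x <-> x \in s) ->
  exists L : seq G, forall x, gen S x -> len S x <= n -> x \in L.
Proof.
move=> hs; suff [L hL] : exists L : seq G, forall m x, m <= n -> wl S m x -> x \in L.
  by exists L => x gx lx; apply: (hL (len S x)) => //; apply: len_wl.
elim: n => [|n [L hL]].
  by exists [:: 1] => m x; rewrite leqn0 => /eqP ->/= ->; rewrite inE.
exists (1 :: [seq a * b | a <- s ++ [seq t^-1 | t <- s], b <- L]) => -[|m] x hm.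
  by move=> /= ->; rewrite inE eqxx.
move=> [t [y [ht hy ->]]]; rewrite inE; apply/orP; right; apply: allpairs_f; last exact: hL hy.
rewrite mem_cat; case: ht => /hs h; first by rewrite h.
by apply/orP; right; rewrite -(invgK t); apply: map_f.
Qed.

End Words.

Lemma seq_bound (T : eqType) (f : T -> nat) (L : seq T) :
  exists M, forall x, x \in L -> f x <= M.
Proof.
elim: L => [|a L [M hM]]; first by exists 0.
exists (M + f a) => x; rewrite inE => /orP [/eqP ->|/hM]; lia.
Qed.

Section Subgroups.
Context (G : groupType).
Implicit Types (S : G -> Prop) (x y z g : G).

Definition fin S := exists s : seq G, forall x, S x <-> x \in s.

Definition undist S S' := exists lam, forall x, gen S x -> len S x <= lam * len S' x.

Lemma undist_change S1 S2 S1' S2' : fin S1 -> fin S2' ->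
  (forall x, gen S1 x <-> gen S2 x) -> (forall x, gen S1' x <-> gen S2' x) ->
  (forall x, gen S1 x -> gen S1' x) -> undist S1 S1' -> undist S2 S2'.
Proof.
move=> [s1 f1] [s2 f2] e1 e2 sub [lam hl].
have [a ha] : exists a, forall x, gen S1 x -> len S2 x <= a * len S1 x.
  by apply: (bilip f1) => x hx; apply/e1/gen_in.
have [b hb] : exists b, forall x, gen S2' x -> len S1' x <= b * len S2' x.
  by apply: (bilip f2) => x hx; apply/e2/gen_in.
exists (a * (lam * b))%N => x /e1 gx.
have h1 := ha _ gx; have h2 := hl _ gx.
have h3 := hb _ ((e2 x).1 (sub _ gx)).
apply: (leq_trans h1); rewrite -!mulnA leq_mul2l; apply/orP; right.
by apply: (leq_trans h2); rewrite leq_mul2l h3 orbT.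
Qed.

Section Inclusion.
Context (S SU : G -> Prop) (delta : nat).
Hypotheses (sub : forall x, gen S x -> gen SU x) (fS : fin S).
Hypotheses (und : undist S SU) (hU : hyp (gen SU) (wd SU) delta).

Let gmSC := torsor_gm (torsor_gen S).
Let gmU := torsor_gm (torsor_gen SU).

Lemma coarse_lip : exists lam, forall x, gen S x -> len SU x <= lam * len S x.
Proof. by have [s fs] := fS; apply: (bilip fs) => x hx; apply/sub/gen_in. Qed.

Lemma undist_qc : exists k, quasiconvex (gen SU) (wd SU) (gen S) k.
Proof.
have [lam hl] := und; have [s hs] := coarse_lip.
have [R HR] := morse delta lam s; exists R => c c' p Cc Cc' Wp b.
apply: (HR G (gen SU) (gen S) (wd SU)) b => // {}c {}c' {}Cc {}Cc'.
have [f [[fW fd] f0 fn]] := geo_exists gmSC Cc Cc'.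
exists (wd S c c'), f; split=> //.
  have := hl _ ((torsor_gen S).1 _ _ Cc Cc'); rewrite -!/(wd _ _ _) => h.
  by apply: (leq_trans h); rewrite leq_mul2l leqnSn orbT.
move=> i hi; have g := (torsor_gen S).1 _ _ (fW i (ltnW hi)) (fW i.+1 hi).
have := hs _ g; rewrite -!/(wd _ _ _) fd //; lia.
Qed.

Lemma undist_hyp : exists delta' R, [/\ hyp (gen S) (wd S) delta',
  forall x y p, gen S x -> gen S y -> gen SU p -> btw (wd SU) 0 x y p ->
    exists c, [/\ gen S c, btw (wd S) 0 x y c & wd SU p c <= R] &
  forall x y c, gen S x -> gen S y -> gen S c -> btw (wd S) 0 x y c ->
    exists p, [/\ gen SU p, btw (wd SU) 0 x y p & wd SU c p <= R]].
Proof.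
have [lam hl] := und; have [s hs] := coarse_lip; have [k qc] := undist_qc.
have hl' x y : gen S x -> gen S y -> wd S x y <= lam * wd SU x y.
  by move=> gx gy; apply/hl/(torsor_gen S).1.
have hs' x y : gen S x -> gen S y -> wd SU x y <= s * wd S x y.
  by move=> gx gy; apply/hs/(torsor_gen S).1.
apply: (pullback_hyp (q := id) (lam := lam) (s := s) (k := k) gmU hU gmSC sub _ _ qc) => x y gx gy.
  by apply: leq_trans (hl' _ _ gx gy) _; rewrite leq_mul2l leqnSn orbT.
by apply: leq_trans (hs' _ _ gx gy) _; rewrite leq_mul2l leqnSn orbT.
Qed.

End Inclusion.

Lemma hyp_change S S' delta : fin S -> fin S' -> (forall x, gen S x <-> gen S' x) ->
  hyp (gen S) (wd S) delta -> exists delta', hyp (gen S') (wd S') delta'.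
Proof.
move=> [s fS] [s' fS'] e h.
have [|||delta' [R [h' _ _]]] := @undist_hyp S' S delta _ _ _ h.
- by move=> x /e.
- by exists s'.
- have [lam hl] : exists lam, forall x, gen S x -> len S' x <= lam * len S x.
    by apply: (bilip fS) => x hx; apply/e/gen_in.
  by exists lam => x /e /hl.
by exists delta'.
Qed.

(** Follow an ambient geodesic and choose points of [gen S] within [R] of it. Consecutive ones
    differ by an element of the ambient ball of radius [2 R + 1], which is finite, so that [M]
    bounds their [S]-lengths. *)
Lemma qc_undist S SU R : fin SU -> (forall x, gen S x -> gen SU x) ->
  (forall x p, gen S x -> gen SU p -> btw (wd SU) 0 1 x p ->
     exists2 c, gen S c & wd SU p c <= R) -> undist S SU.
Proof.
move=> [sU fU] sub qc; have gmU := torsor_gm (torsor_gen SU).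
have sg := gen_subgrp S; have sgU := gen_subgrp SU.
have [L hL] := ball_finite (2 * R + 1) fU.
have [M hM] := seq_bound (len S) L.
exists (2 * M)%N => x gx; have Ux := sub _ gx.
have [f [[fW fd] f0 fn]] := geo_exists gmU (sub1 sgU) Ux.
have e : wd SU 1 x = len SU x by rewrite /wd invg1 mul1g.
rewrite e in fW fd fn.
have key i c : i <= len SU x -> gen S c -> wd SU (f i) c <= R -> len S c <= M * i.+1.
  elim: i c => [|i IH] c hi gc dc.
    rewrite muln1; apply/hM/hL; first exact: sub.
    by move: dc; rewrite f0 /wd invg1 mul1g; lia.
  have bi : btw (wd SU) 0 1 x (f i).
    have h1 := fd 0 i (leq0n _) (ltnW hi); have h2 := fd i _ (ltnW hi) (leqnn _).
    by rewrite f0 in h1; rewrite fn in h2; rewrite /btw e; lia.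
  have [c' gc' dc'] := qc _ _ gx (fW _ (ltnW hi)) bi.
  have h1 := IH _ (ltnW hi) gc' dc'.
  have g2 : gen S (c'^-1 * c) by apply: subVM.
  have h2 : len S (c'^-1 * c) <= M.
    apply/hM/hL; first exact: sub.
    rewrite -/(wd SU c' c).
    have := gmT gmU (sub _ gc') (fW _ (ltnW hi)) (sub _ gc).
    have := gmT gmU (fW _ (ltnW hi)) (fW _ hi) (sub _ gc).
    by rewrite (gmC gmU (sub _ gc') (fW _ (ltnW hi))) fd //; lia.
  have := lenM gc' g2; rewrite mulVKg mulnS; lia.
have := key _ x (leqnn _) gx; rewrite fn (gm0 gmU) // => /(_ (leq0n _)).
case e0 : (len SU x) => [|m]; last by nia.
by rewrite (len_eq0 Ux e0) len1.
Qed.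

(** Take a centre [c] of [K] of minimal radius. Each [g] in [K] maps it to another centre; if [c]
    and [g * c] were more than [2 * delta + 1] apart, their midpoint would have a smaller radius. So
    [K] is conjugate into a ball of this radius, whose size does not depend on [K]. The list [L]
    only expresses that [K] is finite. *)
Lemma finite_subgroup_bound S delta : fin S -> hyp (gen S) (wd S) delta ->
  exists M, forall K L, subgrp K -> (forall x, K x -> gen S x) ->
    (forall x, K x -> x \in (L : seq G)) ->
    forall s : seq G, uniq s -> (forall x, x \in s -> K x) -> size s <= M.
Proof.
move=> [s0 fS] hS; have gm := torsor_gm (torsor_gen S).
have sg := gen_subgrp S.
have [B hB] := ball_finite (2 * delta + 1) fS.
exists (size B) => K L sK KS KL s us sK'.
pose r n := exists2 c, gen S c & forall f, K f -> wd S c f <= n.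
have ex : exists n, `[< r n >].
  have [M hM] := seq_bound (len S) L; exists M; apply/asboolP; exists 1; first exact: sub1.
  by move=> f Kf; rewrite /wd invg1 mul1g; apply/hM/KL.
have := ex_minnP ex; case=> n /asboolP [c gc hc] nmin.
have inB g : K g -> c^-1 * g * c \in B.
  move=> Kg; have ggc : gen S (g * c) by apply: subM => //; apply: KS.
  apply: hB; first by rewrite -mulgA; apply: subVM.
  rewrite -mulgA -/(wd S c (g * c)).
  have hgc f : K f -> wd S (g * c) f <= n.
    by move=> Kf; rewrite -(mulVKg g f) wd_mul; apply: hc; apply: subVM.
  pose D := wd S c (g * c).
  have [m [gm1 m1 m2]] := gmG gm (n := D./2) gc ggc (ltac:(rewrite /D; lia)).
  case: n hc nmin hgc => [|n] hc nmin hgc.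
    have := gmT gm gc (KS _ Kg) ggc; have := hc _ Kg; have := hgc _ Kg.
    by rewrite (gmC gm (KS _ Kg) ggc); lia.
  have [f Kf nf] : exists2 f, K f & n < wd S m f.
    apply: contrapT => nex; have : r n.
      exists m => // f Kf; rewrite leqNgt; apply/negP => h; by apply: nex; exists f.
    by move=> h; have /nmin := asboolT h; rewrite ltnn.
  have Uf := KS _ Kf.
  have := hS m f c (g * c) gm1 Uf gc ggc; rewrite (gmC gm gm1 gc) (gmC gm Uf ggc) (gmC gm Uf gc).
  have := hc _ Kf; have := hgc _ Kf; rewrite m1 m2 -/D; lia.
have uB : uniq [seq c^-1 * g * c | g <- s].
  by rewrite map_inj_uniq // => a b /mulIg /mulgI.
rewrite -(size_map (fun g => c^-1 * g * c)); apply: uniq_leq_size => //.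
by move=> _ /mapP [g gs ->]; apply/inB/sK'.
Qed.

End Subgroups.

(** * Amalgamated products *)

Section Reduced.
Context (G : groupType) (U : bool -> G -> Prop) (C : G -> Prop).
Implicit Types (x y z g c s : G) (a b : bool).

(* [a] and [b] are the factors of the first and of the last letter. *)
Fixpoint red n a b x : Prop :=
  if n is m.+1 then exists y s, [/\ U b s, ~ C s, x = y * s &
      [/\ m = 0, a = b & y = 1] \/ red m a (~~ b) y]
  else False.

Definition factors x := U true x \/ U false x.

(** Replaces the action on the Bass-Serre tree: the edges are the cosets [x C], the vertices the
    cosets [x U_b], and [l (x^-1 * y)] is the distance between two edges. A function with value [n]
    on reduced words of [n] letters and 0 on [C] already prevents reduced words from being trivial,
    so that [gen (factors U)] is the amalgam. *)
Record tree_split (l : G -> nat) : Prop := TreeSplit {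
  ts_U : forall b, subgrp (U b);
  ts_C : subgrp C;
  ts_CU : forall b c, C c -> U b c;
  ts_l0 : forall c, C c -> l c = 0;
  ts_l : forall n a b x, red n a b x -> l x = n }.

Definition ends b x := exists n a, red n a b x.
(** Geometrically, [x C] is the gate of the vertex [x U_b]: its edge nearest to the base edge [C].
    Gates exist by [gate_ex] and are unique modulo [C] by [nends_uniq]. *)
Definition nends b x := C x \/ ends (~~ b) x.

End Reduced.

Section TreeSplit.
Context (G : groupType) (U : bool -> G -> Prop) (C : G -> Prop) (l : G -> nat).
Hypothesis ts : tree_split U C l.
Implicit Types (x y z g c s : G) (a b : bool).
Local Notation red := (red U C).
Local Notation ends := (ends U C).
Local Notation nends := (nends U C).
Local Notation W := (gen (factors U)).

Let sU b : subgrp (U b). Proof. exact: (ts_U ts). Qed.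
Let sC : subgrp C. Proof. exact: (ts_C ts). Qed.
Let CU b c : C c -> U b c. Proof. exact: (ts_CU ts). Qed.
Let sW : subgrp W. Proof. exact: gen_subgrp. Qed.

Lemma tsUW b x : U b x -> W x.
Proof. by case: b => h; apply: gen_in; [left|right]. Qed.

Lemma tsCW c : C c -> W c.
Proof. by move=> h; apply: (tsUW (CU true h)). Qed.

Lemma red1 b s : U b s -> ~ C s -> red 1 b b s.
Proof. by move=> us ns; exists 1, s; rewrite mul1g; split=> //; left. Qed.

Lemma redS n a b x s : red n a (~~ b) x -> U b s -> ~ C s -> red n.+1 a b (x * s).
Proof. by move=> rx us ns; exists x, s; split=> //; right. Qed.

Lemma red_cat n a b m b' x y : red n a b x -> red m (~~ b) b' y -> red (n + m) a b' (x * y).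
Proof.
move=> rx; elim: m b' y => [//|m IH] b' y /= [y' [s [us ns -> h]]].
rewrite addnS; exists (x * y'), s; rewrite mulgA; split=> //; right.
case: h => [[-> e ->]|/IH //]; by rewrite addn0 mulg1 -e negbK.
Qed.

Lemma red_inv n a b x : red n a b x -> red n b a x^-1.
Proof.
elim: n b x => [//|n IH] b x [y [s [us ns -> h]]].
have r1 : red 1 b b s^-1.
  by apply: red1; [apply: subV|move=> /(subVr sC)].
rewrite invgM; case: h => [[-> -> ->]|/IH r2]; first by rewrite invg1 mulg1.
exact: red_cat r1 r2.
Qed.

Lemma redCr n a b x c : red n a b x -> C c -> red n a b (x * c).
Proof.
case: n => [//|n] [y [s [us ns -> h]]] cc; exists y, (s * c); rewrite mulgA; split=> //.
  by apply: subM => //; apply: CU.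
by move=> h'; apply: ns; apply: subMr cc h'.
Qed.

Lemma redCl n a b x c : red n a b x -> C c -> red n a b (c * x).
Proof.
move=> r cc; rewrite -(invgK (c * x)) invgM; apply: red_inv; apply: redCr; last exact: subV.
exact: red_inv.
Qed.

Lemma redW n a b x : red n a b x -> W x.
Proof.
elim: n b x => [//|n IH] b x [y [s [us _ -> h]]].
by apply: subM => //; [case: h => [[_ _ ->]|/IH //]; apply: sub1|apply: tsUW us].
Qed.

Lemma red_ex x : W x -> C x \/ exists n a b, red n a b x.
Proof.
have step y s b : (C y \/ exists n a b, red n a b y) -> U b s ->
    (C (y * s) \/ exists n a b, red n a b (y * s)).
  move=> hy us; case: (EM (C s)) => cs.
    case: hy => [cy|[n [a [b' r]]]]; first by left; apply: subM.
    by right; exists n, a, b'; apply: redCr.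
  case: hy => [cy|[n [a [b' r]]]].
    right; exists 1%N, b, b; apply: red1; first by apply: subM => //; apply: CU.
    by move=> h; apply: cs; apply: subMl cy h.
  case: (eqVneq b' (~~ b)) => [e|ne].
    by right; exists n.+1, a, b; apply: redS => //; rewrite -e.
  have {ne} e : b' = b by move: ne; case: b' r => _; case: b {us}.
  subst b'; case: n r => [//|n] [y' [s' [us' ns' -> h]]]; rewrite -mulgA.
  have u2 : U b (s' * s) by apply: subM.
  case: (EM (C (s' * s))) => cs'.
    case: h => [[_ _ ->]|r]; first by left; rewrite mul1g.
    by right; exists n, a, (~~ b); apply: redCr.
  right; case: h => [[_ _ ->]|r]; first by exists 1%N, b, b; rewrite mul1g; apply: red1.
  by exists n.+1, a, b; apply: redS.
move=> Wx; rewrite -(invgK x); move: (subV sW Wx); move: (x^-1) => {Wx} y [n].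
elim: n y => [y /= ->|n IH y [s [z [hs /IH hz ->]]]]; first by left; rewrite invg1; apply: sub1.
rewrite invgM; case: hs => -[h|h]; first [exact: step hz h|exact: step hz (subV (sU _) h)].
Qed.

Lemma red_neq0 n a b x : red n a b x -> 0 < n.
Proof. by case: n. Qed.

Lemma red_notC n a b x : red n a b x -> ~ C x.
Proof.
by move=> r /(ts_l0 ts); rewrite (ts_l ts r) => e; have := red_neq0 r; rewrite e.
Qed.

Lemma lV x : W x -> l x^-1 = l x.
Proof.
move=> /red_ex [c|[n [a [b r]]]]; first by rewrite !(ts_l0 ts) //; apply: subV.
by rewrite (ts_l ts r) (ts_l ts (red_inv r)).
Qed.

Lemma l0C x : W x -> l x = 0 -> C x.
Proof. by move=> /red_ex [//|[n [a [b r]]]]; rewrite (ts_l ts r) => e; case: n r e. Qed.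

Lemma lCr x c : W x -> C c -> l (x * c) = l x.
Proof.
move=> /red_ex [cx|[n [a [b r]]]] cc; first by rewrite !(ts_l0 ts) //; apply: subM.
by rewrite (ts_l ts r) (ts_l ts (redCr r cc)).
Qed.

Lemma lCl x c : W x -> C c -> l (c * x) = l x.
Proof.
move=> /red_ex [cx|[n [a [b r]]]] cc; first by rewrite !(ts_l0 ts) //; apply: subM.
by rewrite (ts_l ts r) (ts_l ts (redCl r cc)).
Qed.

Lemma endsW b x : ends b x -> W x.
Proof. by move=> [n [a r]]; apply: redW r. Qed.

Lemma nendsW b x : nends b x -> W x.
Proof. by case=> [/tsCW|/endsW]. Qed.

Lemma nends1 b : nends b 1.
Proof. by left; apply: sub1. Qed.

Lemma add1 b x s : nends b x -> U b s -> ~ C s -> ends b (x * s) /\ l (x * s) = (l x).+1.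
Proof.
move=> nx us ns; have [n [a [r e]]] : exists n a, red n.+1 a b (x * s) /\ l x = n.
  case: nx => [cx|[n [a r]]].
    exists 0, b; split; last exact: (ts_l0 ts).
    apply: red1; first by apply: subM => //; apply: CU.
    by move=> h; apply: ns; apply: subMl cx h.
  by exists n, a; split; [apply: redS|apply: ts_l r].
by split; [exists n.+1, a|rewrite (ts_l ts r) e].
Qed.

Lemma addcat b x s y : nends b x -> U b s -> ~ C s -> nends b y^-1 ->
  l (x * s * y) = l x + 1 + l y.
Proof.
move=> nx us ns ny; have [[n [a r]] e] := add1 nx us ns.
have Wy : W y by apply: subVr => //; apply: nendsW ny.
case: ny => [cy|[m [a' r']]].
  have cy' := subVr sC cy.
  by rewrite lCr // ?e ?(ts_l0 ts cy'); [lia|apply: redW r].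
have r2 := red_inv r'; rewrite invgK in r2.
by rewrite (ts_l ts (red_cat r r2)) -(ts_l ts r) -(ts_l ts r2) e; lia.
Qed.

Lemma gate_ex b x : W x -> exists2 a, U b a & nends b (x * a).
Proof.
have one y : nends b y -> exists2 a, U b a & nends b (y * a).
  by move=> h; exists 1; [apply: sub1|rewrite mulg1].
move=> /red_ex [cx|[n [a [b' r]]]]; first by apply: one; left.
case: (eqVneq b' (~~ b)) => [e|ne]; first by apply: one; right; exists n, a; rewrite -e.
have {ne} e : b' = b by move: ne; case: b' r => _; case: b {one}.
subst b'; case: n r => [//|n] [y [s [us ns -> h]]]; exists s^-1; first exact: subV.
rewrite mulgK; case: h => [[_ _ ->]|r]; first exact: nends1.
by right; exists n, a.
Qed.

Lemma ends_excl b x : ends b x -> ends (~~ b) x -> False.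
Proof.
move=> [n [a r]] [m [a' r']]; have := red_cat r (red_inv r').
by rewrite mulgV => /red_notC; apply; apply: sub1.
Qed.

Lemma ends_notC b x : ends b x -> ~ C x.
Proof. by move=> [n [a /red_notC]]. Qed.

Lemma ends_nends b x : ends b x -> ~ nends b x.
Proof. by move=> h [/(ends_notC h)|/(ends_excl h)]. Qed.

Lemma endsP b x : W x -> nends b x \/ ends b x.
Proof.
move=> /red_ex [cx|[n [a [b' r]]]]; first by left; left.
case: (eqVneq b' b) => [e|ne]; first by right; exists n, a; rewrite -e.
left; right; exists n, a; suff -> : ~~ b = b' by [].
by move: ne; case: b' {r}; case: b.
Qed.

Lemma nends_uniq b x s : nends b x -> U b s -> nends b (x * s) -> C s.
Proof.
by move=> h us; case: (EM (C s)) => // ns; have [/ends_nends] := add1 h us ns.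
Qed.

Lemma nendsCr b x c : nends b x -> C c -> nends b (x * c).
Proof.
case=> [cx|[n [a r]]] cc; first by left; apply: subM.
by right; exists n, a; apply: redCr.
Qed.

Lemma endsCr b x c : ends b x -> C c -> ends b (x * c).
Proof. by move=> [n [a r]] cc; exists n, a; apply: redCr. Qed.

Lemma ends_step b x : ends b x -> exists s, [/\ U b s, ~ C s, nends b (x * s) & l x = (l (x * s)).+1].
Proof.
move=> h; have [s us ns] := gate_ex b (endsW h); exists s.
have cs : ~ C s.
  move=> cs; apply: (ends_nends h); rewrite -(mulgK s x); apply: nendsCr ns _; exact: subV.
split=> //.
have [|_] := add1 ns (subV (sU b) us); first by move=> /(subVr sC).
by rewrite mulgK.
Qed.

Lemma l_mulU b x s : W x -> U b s -> l (x * s) <= (l x).+1.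
Proof.
move=> Wx us; have [a ua na] := gate_ex b Wx.
have la : l (x * a) <= l x.
  case: (EM (C a)) => ca; first by rewrite lCr.
  have [|_] := add1 na (subV (sU b) ua); first by move=> /(subVr sC).
  by rewrite mulgK => ->; lia.
have us' : U b (a^-1 * s) by apply: subVM.
have e : x * s = x * a * (a^-1 * s) by rewrite -mulgA mulVKg.
case: (EM (C (a^-1 * s))) => cs; first by rewrite e lCr; [lia|apply: nendsW na|].
by have [_] := add1 na us' cs; rewrite -e => ->; lia.
Qed.

Lemma l_wl n x : wl (factors U) n x -> l x <= n.
Proof.
elim: n x => [x ->|n IH x [s [y [hs hy ->]]]]; first by rewrite (ts_l0 ts) //; apply: sub1.
have Wy : W y by exists n.
have Ws : exists b, U b s.
  by case: hs => -[h|h]; [exists true|exists false|exists true|exists false] => //; apply: (subVr (sU _)).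
have [b us] := Ws; have Wsy : W (s * y) by apply: subM => //; apply: tsUW us.
rewrite -lV // invgM; have := l_mulU (subV sW Wy) (subV (sU b) us).
have := IH _ hy; rewrite (lV Wy) => h1 h2; apply: leq_trans h2 _; lia.
Qed.

Lemma l_tri x y : W x -> W y -> l (x * y) <= l x + l y.
Proof.
move=> Wx /red_ex [cy|[n [a [b r]]]]; first by rewrite lCr // leq_addr.
elim: n b y r => [//|n IH] b y r; rewrite (ts_l ts r).
case: r => z [s [us ns -> h]]; case: h => [[-> _ ->]|r].
  by rewrite mul1g addn1; apply: l_mulU us.
have := IH _ _ r; rewrite (ts_l ts r) mulgA => h.
apply: leq_trans (l_mulU (subM sW Wx (redW r)) us) _; lia.
Qed.

End TreeSplit.

(** * The combination theorem for acylindrical amalgams *)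

Lemma pigeon (T : eqType) (s : seq nat) (F : nat -> T) (L : seq T) M :
  (forall i, i \in s -> F i \in L) ->
  (forall t, t \in L -> size [seq i <- s | F i == t] <= M) -> size s <= (M * size L)%N.
Proof.
elim: L s => [|t L IH] s h1 h2.
  by case: s h1 {h2} => [//|a s] /(_ a); rewrite inE eqxx => /(_ isT).
rewrite -(count_predC (fun i => F i == t)) /= mulnS -!size_filter leq_add //.
  by apply: h2; rewrite inE eqxx.
apply: IH => [i|t' ht']; rewrite ?mem_filter /=.
  by case/andP=> h /h1; rewrite inE (negbTE h).
rewrite -filter_predI; apply: leq_trans (h2 t' _); last by rewrite inE ht' orbT.
by rewrite !size_filter; apply: sub_count => i /= /andP [].
Qed.

Definition pick_or (T : Type) (P : T -> Prop) (t : T) : T :=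
  if pselect (exists v, P v) is left ex then sval (cid ex) else t.

Lemma pick_orP (T : Type) (P : T -> Prop) t v : P v -> P (pick_or P t).
Proof. by move=> Pv; rewrite /pick_or; case: pselect => [ex|[]]; [case: cid|exists v]. Qed.

Section Combination.
Context (G : groupType) (S : bool -> G -> Prop) (SC : G -> Prop) (l : G -> nat).
Implicit Types (x y z g h c s : G) (b : bool).
Local Notation U := (fun b => gen (S b)).
Local Notation C := (gen SC).
Local Notation W := (gen (factors U)).
Local Notation nends := (nends U C).
Local Notation ends := (ends U C).
Hypothesis ts : tree_split U C l.

Definition SW x := S true x \/ S false x.
Definition cosU b g x := gen (S b) (g^-1 * x).
Definition cosC g x := gen SC (g^-1 * x).
Local Notation D := (wd SW).
Local Notation db b := (wd (S b)).
Local Notation dC := (wd SC).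

Context (delta k lam : nat).
Hypotheses (fS : forall b, fin (S b))
  (hU : forall b, hyp (gen (S b)) (wd (S b)) delta)
  (qcC : forall b, quasiconvex (gen (S b)) (wd (S b)) C k)
  (lamC : forall b x, C x -> len SC x <= lam * len (S b) x)
  (lamU : forall b x, C x -> len (S b) x <= lam * len SC x)
  (UtoC : forall b x y p, C x -> C y -> gen (S b) p -> btw (wd (S b)) 0 x y p ->
    exists c, [/\ C c, btw (wd SC) 0 x y c & wd (S b) p c <= k])
  (CtoU : forall b x y c, C x -> C y -> C c -> btw (wd SC) 0 x y c ->
    exists p, [/\ gen (S b) p, btw (wd (S b)) 0 x y p & wd (S b) c p <= k]).

Let sU b : subgrp (gen (S b)). Proof. exact: gen_subgrp. Qed.
Let sC : subgrp C. Proof. exact: gen_subgrp. Qed.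
Let sW : subgrp W. Proof. exact: gen_subgrp. Qed.
Let CU b c : C c -> gen (S b) c. Proof. exact: (ts_CU ts). Qed.

Lemma SW_gen x : gen SW x <-> W x.
Proof.
split; apply: gen_min => //; try exact: gen_subgrp.
  by move=> s [h|h]; apply: gen_in; [left|right]; apply: gen_in.
by move=> s [|] [n /(@wl_mono _ _ SW)] h; exists n; apply: h => t; [left|right].
Qed.

Lemma torsorW : torsor SW W.
Proof.
have [h1 h2] := torsor_gen SW; split=> [x y|x s] /SW_gen Wx h; first exact/h1/SW_gen.
by apply/SW_gen/h2.
Qed.

Let gmW : graph_metric W D := torsor_gm torsorW.
Let gmU b g : graph_metric (cosU b g) (db b) := torsor_gm (torsor_coset (S b) g).
Let gmSC g : graph_metric (cosC g) dC := torsor_gm (torsor_coset SC g).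
Let hUg b g : hyp (cosU b g) (db b) delta := hyp_torsor (@hU b) (torsor_coset (S b) g).

Lemma cosUW b g x : W g -> cosU b g x -> W x.
Proof. by move=> Wg /(tsUW (U := U)) h; rewrite -(mulVKg g x); apply: subM. Qed.
Lemma cosCU b g x : cosC g x -> cosU b g x.
Proof. exact: CU. Qed.
Lemma cosCW g x : W g -> cosC g x -> W x.
Proof. by move=> Wg /(cosCU true); apply: cosUW. Qed.
Lemma cosUg b g : cosU b g g. Proof. exact: subV11. Qed.
Lemma cosCg g : cosC g g. Proof. exact: subV11. Qed.
Lemma cosU_sym b x y : cosU b x y -> cosU b y x. Proof. exact: subVC. Qed.
Lemma cosC_sym x y : cosC x y -> cosC y x. Proof. exact: subVC. Qed.
Lemma cosU_trans b x y z : cosU b x y -> cosU b y z -> cosU b x z.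
Proof. exact: subVT. Qed.
Lemma cosC_trans x y z : cosC x y -> cosC y z -> cosC x z.
Proof. exact: subVT. Qed.

Lemma D_db b x y : cosU b x y -> D x y <= db b x y.
Proof.
move=> h; apply: len_le; apply: (wl_mono (S := S b)); last exact: len_wl.
by move=> s; case: (b) => hs; [left|right].
Qed.

Lemma qcCg b g : quasiconvex (cosU b g) (db b) (cosC g) k.
Proof.
move=> c c' p cc cc' cp b0; have [|c'' h1 h2] := qcC cc cc' cp.
  by rewrite /btw !wd_mul.
exists (g * c''); first by rewrite /cosC mulKg.
by rewrite -(mulVKg g p) wd_mul.
Qed.

Lemma UtoCg b g x y p : cosC g x -> cosC g y -> cosU b g p -> btw (db b) 0 x y p ->
  exists c, [/\ cosC g c, btw dC 0 x y c & db b p c <= k].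
Proof.
move=> cx cy cp b0; have [|c [h1 h2 h3]] := UtoC cx cy cp; first by rewrite /btw !wd_mul.
exists (g * c); split; first by rewrite /cosC mulKg.
  by move: h2; rewrite /btw -(wd_mul _ g (g^-1 * x)) -(wd_mul _ g c) -(wd_mul _ g (_ * x)) !mulVKg.
by rewrite -(mulVKg g p) wd_mul.
Qed.

Lemma CtoUg b g x y c : cosC g x -> cosC g y -> cosC g c -> btw dC 0 x y c ->
  exists p, [/\ cosU b g p, btw (db b) 0 x y p & db b c p <= k].
Proof.
move=> cx cy cc b0; have [|p [h1 h2 h3]] := CtoU b cx cy cc; first by rewrite /btw !wd_mul.
exists (g * p); split; first by rewrite /cosU mulKg.
  by move: h2; rewrite /btw -(wd_mul _ g (g^-1 * x)) -(wd_mul _ g p) -(wd_mul _ g (_ * x)) !mulVKg.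
by rewrite -(mulVKg g c) wd_mul.
Qed.

Lemma dC_db b g x y : cosC g x -> cosC g y -> dC x y <= lam * db b x y.
Proof. by move=> cx cy; apply: lamC; apply: (cosC_trans (cosC_sym cx)). Qed.

Lemma db_dC b g x y : cosC g x -> cosC g y -> db b x y <= lam * dC x y.
Proof. by move=> cx cy; apply: lamU; apply: (cosC_trans (cosC_sym cx)). Qed.

(* Greedy projection: follow the path of the tree from the edge [x C] to the
   edge [z C], projecting at each step to the next coset of [C]. *)
Definition proj b (E : G -> Prop) x : G := pick_or (nearest (db b) E x) x.

(** [bh] stands for a vertex of the edge [z C] together with the gate of this vertex seen from [x],
    that is, the edge before [z C] on the path from [x C]. *)
Definition selP x z (bh : bool * G) :=
  [/\ cosU bh.1 z bh.2, nends bh.1 (x^-1 * bh.2) & ends bh.1 (x^-1 * z)].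

Definition sel x z : bool * G := pick_or (selP x z) (true, 1).

Fixpoint Pin n x z : G :=
  if n is m.+1 then proj (sel x z).1 (cosC z) (Pin m x (sel x z).2) else x.

Definition Pi x z := Pin (l (x^-1 * z)) x z.

Lemma proj_nearest b E x c : E c -> nearest (db b) E x (proj b E x).
Proof.
by move=> Ec; have [v] := nearest_exists (db b) x Ec; apply: pick_orP.
Qed.

Lemma cosC_eq z z' : cosC z z' -> cosC z = cosC z'.
Proof.
move=> h; apply/funext => x; apply/propext; split; first exact/cosC_trans/cosC_sym.
exact: cosC_trans.
Qed.

Lemma Wdiv x y : W x -> W y -> W (x^-1 * y). Proof. by move=> *; apply: subVM. Qed.

Lemma l_cosC x z z' : W x -> W z -> cosC z z' -> l (x^-1 * z') = l (x^-1 * z).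
Proof. by move=> Wx Wz h; rewrite -(mulVA x z z') (lCr ts) //; apply: Wdiv. Qed.

Lemma nends_cosC b x z z' : cosC z z' -> nends b (x^-1 * z) -> nends b (x^-1 * z').
Proof. by move=> h n; rewrite -(mulVA x z z'); apply: (nendsCr ts). Qed.

Lemma ends_cosC b x z z' : cosC z z' -> ends b (x^-1 * z) -> ends b (x^-1 * z').
Proof. by move=> h n; rewrite -(mulVA x z z'); apply: (endsCr ts). Qed.

Lemma Pi_C x z z' : W x -> W z -> cosC z z' -> Pi x z' = Pi x z.
Proof.
move=> Wx Wz h; rewrite /Pi (l_cosC Wx Wz h); case: (l _) => [//|n] /=.
have h' := cosC_sym h.
suff e : selP x z' = selP x z by rewrite /sel e (cosC_eq h).
apply/funext => -[b g]; apply/propext; rewrite /selP /=; split=> -[h1 h2 h3]; split=> //.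
- by apply: cosU_trans h1; apply: cosCU.
- exact: ends_cosC h' h3.
- by apply: cosU_trans h1; apply: cosCU.
- exact: ends_cosC h h3.
Qed.

Lemma Pi_0 x z : cosC x z -> Pi x z = x.
Proof. by move=> h; rewrite /Pi (ts_l0 ts h). Qed.

Lemma Pi_in x z : W x -> W z -> cosC z (Pi x z).
Proof.
move=> Wx Wz; rewrite /Pi; move e : (l _) => [|n] /=.
  by apply: cosC_sym; apply: (l0C ts) => //; apply: Wdiv.
by have [] := proj_nearest (sel x z).1 (Pin n x (sel x z).2) (cosCg z).
Qed.

(* In a coset [g U_b] the greedy projections of [x] are the nearest point
   projections of one single point, sitting on the edge of entry. *)
Lemma Pi_gate b x g z : W x -> W g -> nends b (x^-1 * g) -> cosU b g z ->
  nearest (db b) (cosC z) (Pi x g) (Pi x z).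
Proof.
move=> Wx Wg ng uz; have Wz := cosUW Wg uz.
case: (EM (cosC g z)) => cz.
  have h := Pi_C Wx Wg cz; rewrite h; split; last by move=> c _; rewrite /wd mulVg len1.
  by rewrite -h; apply: Pi_in.
have [ez el] := add1 ts ng uz cz; rewrite mulVA in ez el.
have [e1 e2 e3] : selP x z (sel x z).
  by apply: (@pick_orP _ _ _ (b, g)); split=> //=; apply: cosU_sym.
rewrite {2}/Pi el /=; move: (sel x z) e1 e2 e3 => [b' h] /= e1 e2 e3.
have eb : b' = b.
  case: (eqVneq b' b) => // ne; case: (ends_excl ts ez).
  by rewrite (_ : ~~ b = b') //; move: ne; case: b' {e1 e2 e3}; case: (b).
subst b'; have gh : cosC g h.
  by apply: (nends_uniq ts ng (cosU_trans uz e1)); rewrite mulVA.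
have -> : Pin (l (x^-1 * g)) x h = Pi x g by rewrite -(l_cosC Wx Wg gh) -/(Pi x h); apply: Pi_C.
exact: proj_nearest (cosCg z).
Qed.

Let r := 2 * (k + delta + 1) + 1.

(** Inside the coset [g U_b], the projections of [y] and [z] to [g C] are nearest points to their
    projections on the entry edges, so [nearest_dich] applies: either they are close, or the
    interval between them shadows the one between the entry points. *)
Lemma stepA b y z g hy hz : W y -> W z -> W g -> cosU b g hy -> cosU b g hz ->
  nends b (y^-1 * hy) -> nends b (z^-1 * hz) ->
  dC (Pi y g) (Pi z g) <= lam * (r + delta) \/
  db b (Pi y g) (Pi z g) <= db b (Pi y hy) (Pi z hz) + 2 * r + delta /\
  forall c, cosC g c -> btw dC 0 (Pi y g) (Pi z g) c -> exists q,
    [/\ cosU b g q, btw (db b) 0 (Pi y hy) (Pi z hz) q & D c q <= k + 2 * r + 2 * delta].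
Proof.
move=> Wy Wz Wg ghy ghz ny nz.
have Why := cosUW Wg ghy; have Whz := cosUW Wg ghz.
have uy : cosU b g (Pi y hy) := cosU_trans ghy (cosCU b (Pi_in Wy Why)).
have uz : cosU b g (Pi z hz) := cosU_trans ghz (cosCU b (Pi_in Wz Whz)).
have cy := Pi_in Wy Wg; have cz := Pi_in Wz Wg.
have n1 := Pi_gate Wy Why ny (cosU_sym ghy); have n2 := Pi_gate Wz Whz nz (cosU_sym ghz).
have gm := gmU b g.
have := nearest_dich gm (@hUg b g) (@cosCU b g) (@qcCg b g) uy uz n1 n2.
rewrite -/r => -[h|h]; [left|right].
  by apply: leq_trans (dC_db b cy cz) _; rewrite leq_mul2l h orbT.
split; first by lia.
move=> c cc bc; have [p [up bp dp]] := CtoUg b cy cz cc bc.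
have bp' : btw (db b) (2 * r + delta) (Pi y hy) (Pi z hz) p.
  move: bp; rewrite /btw => bp.
  have := gmT gm uy (cosCU b cy) up; have := gmT gm up (cosCU b cz) uz.
  rewrite (gmC gm (cosCU b cz) uz) in h *; lia.
have [q [uq bq dq]] := btw_near gm (@hUg b g) uy uz up bp'.
exists q; split=> //; apply: leq_trans (D_db (cosU_trans (cosU_sym (cosCU b cc)) uq)) _.
have := gmT gm (cosCU b cc) up uq; lia.
Qed.

Lemma step b y z g h : W y -> W z -> W g -> cosU b g h ->
  nends b (y^-1 * h) -> nends b (z^-1 * h) ->
  dC (Pi y g) (Pi z g) <= lam * (r + delta) \/
  dC (Pi y g) (Pi z g) <= lam * (lam * dC (Pi y h) (Pi z h) + 2 * r + delta) /\
  forall c, cosC g c -> btw dC 0 (Pi y g) (Pi z g) c -> exists q,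
    [/\ cosC h q, btw dC 0 (Pi y h) (Pi z h) q & D c q <= 2 * k + 2 * r + 2 * delta].
Proof.
move=> Wy Wz Wg gh ny nz; have [h1|[h1 h2]] := stepA Wy Wz Wg gh gh ny nz; [by left|right].
have Wh := cosUW Wg gh; have cy := Pi_in Wy Wh; have cz := Pi_in Wz Wh.
split.
  apply: leq_trans (dC_db b (Pi_in Wy Wg) (Pi_in Wz Wg)) _; rewrite leq_mul2l; apply/orP; right.
  by have := db_dC b cy cz; lia.
move=> c cc /(h2 _ cc) [q [uq bq dq]].
have uq' := cosU_trans (cosU_sym gh) uq.
have [q' [cq' bq' dq']] := UtoCg cy cz uq' bq.
exists q'; split=> //.
have Wq := cosUW Wg uq; have Wq' := cosCW Wh cq'; have Wc := cosCW Wg cc.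
have := gmT gmW Wc Wq Wq'; have := D_db (cosU_trans (cosU_sym uq') (cosCU b cq')); lia.
Qed.

Definition eta x y w := exists b g g', [/\ W g /\ cosU b g g', nends b (x^-1 * g),
  nends b (y^-1 * g'), l (x^-1 * g) + l (g^-1 * g') + l (g'^-1 * y) = l (x^-1 * y) &
  cosU b g w /\ btw (db b) 0 (Pi x g) (Pi y g') w].

Context (K M0 : nat).
Hypothesis acyl : forall t, W t -> K <= l t -> forall s : seq G, uniq s ->
  (forall c, c \in s -> C c /\ C (t^-1 * c * t)) -> size s <= M0.

Lemma fin_SW : fin SW.
Proof.
have [s hs] := fS true; have [s' hs'] := fS false; exists (s ++ s') => x.
by rewrite mem_cat; split=> [[/hs ->|/hs' ->]|/orP [/hs|/hs']]; rewrite ?orbT //; [left|right].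
Qed.

(** By pigeonhole, a long interval of [g C] that shadows [g' C] has many points [f i] with the same
    displacement [t = (f i)^-1 * q i]. For these the quotients [(f i0)^-1 * f i] lie in [C] and in
    [t C t^-1], and acylindricity bounds their number. *)
Lemma far_bound m : exists Phi, forall g g' u v, W g -> W g' -> K <= l (g^-1 * g') ->
  cosC g u -> cosC g v ->
  (forall c, cosC g c -> btw dC 0 u v c -> exists2 q, cosC g' q & D c q <= m) ->
  dC u v <= Phi.
Proof.
have [s0 hs0] := fin_SW; have [L hL] := ball_finite m hs0.
exists (M0 * size L)%N => g g' u v Wg Wg' Kl cu cv near.
have [f [[fC fd] f0 fn]] := geo_exists (gmSC g) cu cv.
have near' i : exists q, i <= dC u v -> cosC g' q /\ D (f i) q <= m.
  case: (leqP i (dC u v)) => hi; last by exists 1; lia.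
  have [|q cq dq] := near _ (fC _ hi); last by exists q.
  have := fd 0 i (leq0n _) hi; have := fd i _ hi (leqnn _).
  by rewrite f0 fn /btw; lia.
have [q hq] := choice near'.
pose F i := (f i)^-1 * q i.
have Wf i : i <= dC u v -> W (f i) by move=> /fC /(cosCW Wg).
have Wq i : i <= dC u v -> W (q i) by move=> /hq [/(cosCW Wg')].
suff : size (iota 0 (dC u v).+1) <= M0 * size L by rewrite size_iota; lia.
apply: (@pigeon G _ F) => [i|t _].
  rewrite mem_iota add0n ltnS /= => hi.
  by apply: hL; [apply/SW_gen/Wdiv; [apply: Wf|apply: Wq]|case: (hq _ hi)].
set I := [seq i <- _ | _]; case e : I => [//|i0 I']; rewrite -e.
have inI i : i \in I -> i <= dC u v /\ F i = t.
  by rewrite mem_filter mem_iota add0n ltnS => /andP [/eqP ->].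
have [hi0 F0] : i0 <= dC u v /\ F i0 = t by apply: inI; rewrite e inE eqxx.
rewrite -(size_map (fun i => (f i0)^-1 * f i)).
have ci i : i <= dC u v -> cosC g (f i) by apply: fC.
apply: (acyl (t := t)).
- by rewrite -F0; apply: Wdiv; [apply: Wf|apply: Wq].
- have [cq _] := hq _ hi0.
  rewrite -F0 /F (l_cosC (Wf _ hi0) Wg' cq).
  have -> : (f i0)^-1 * g' = (g^-1 * f i0)^-1 * (g^-1 * g') by rewrite invVM mulVA.
  by rewrite (lCl ts) //; [apply: Wdiv|apply: subV => //; apply: ci].
- rewrite map_inj_in_uniq; first by apply/filter_uniq/iota_uniq.
  move=> i j /inI [hi _] /inI [hj _] /mulgI eij.
  have dd : dC (f i) (f j) = 0 by rewrite eij (gm0 (gmSC g)) //; apply: ci.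
  have dd' : dC (f j) (f i) = 0 by rewrite eij (gm0 (gmSC g)) //; apply: ci.
  by case: (leqP i j) => ij; [move: dd|move: dd']; rewrite fd //; lia.
move=> c /mapP [i /inI [hi Fi] ->].
split; first exact: cosC_trans (cosC_sym (ci _ hi0)) (ci _ hi).
have -> : t^-1 * ((f i0)^-1 * f i) * t = (q i0)^-1 * q i.
  by rewrite -{1}F0 -Fi /F invVM mulVA -!mulgA mulVKg.
have [c1 _] := hq _ hi0; have [c2 _] := hq _ hi.
exact: cosC_trans (cosC_sym c1) c2.
Qed.

Lemma l_cosU b g g' : cosU b g g' -> ~ cosC g g' -> l (g^-1 * g') = 1%N.
Proof. by move=> h n; apply: (ts_l ts (red1 (U := U) (C := C) (b := b) h n)). Qed.

(** Both tree paths enter [g U_b] through [g C]; follow them backwards for [j] edges. In the first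
    outcome the projections have come close on the way. In the second the paths have split or one
    has reached its start, which puts the interval near [eta y z]. In the third the shadowing
    persists down to an edge at distance [j], and for [j = K] this case is left to [far_bound]. *)
Lemma same_gate_rec j : exists phi m, forall b y z g, W y -> W z -> W g ->
  nends b (y^-1 * g) -> nends b (z^-1 * g) ->
  [\/ dC (Pi y g) (Pi z g) <= phi,
      forall c, cosC g c -> btw dC 0 (Pi y g) (Pi z g) c -> exists2 q, eta y z q & D c q <= m |
      exists g', [/\ W g', l (g'^-1 * g) = j, nends b (g'^-1 * g) &
        forall c, cosC g c -> btw dC 0 (Pi y g) (Pi z g) c ->
          exists2 q, cosC g' q & D c q <= m]].
Proof.
elim: j => [|j [phi [m IH]]].
  exists 0, 0 => b y z g Wy Wz Wg ny nz; apply: Or33; exists g; split=> //.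
  - by rewrite mulVg (ts_l0 ts) //; apply: sub1.
  - by rewrite mulVg; apply: (nends1 ts).
  by move=> c cc _; exists c => //; rewrite (gm0 gmW) //; apply: cosCW cc.
exists (maxn (lam * (r + delta)) (lam * (lam * phi + 2 * r + delta))),
  (m + 2 * k + 2 * r + 2 * delta)%N => b y z g Wy Wz Wg ny nz.
case: (EM (cosC y g)) => cyg.
  apply: Or32 => c cc bc.
  have [p [up bp dp]] := CtoUg b (Pi_in Wy Wg) (Pi_in Wz Wg) cc bc.
  exists p; last first.
    by apply: leq_trans (D_db (cosU_trans (cosU_sym (cosCU b cc)) up)) _; lia.
  exists b, g, g; split=> //; first by split=> //; apply: cosUg.
  rewrite mulVg (ts_l0 ts cyg) (ts_l0 ts (sub1 sC)) !add0n -(mulVA g y z) (lCl ts) //.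
    exact: Wdiv.
  exact: cosC_sym.
case: (EM (cosC z g)) => czg.
  apply: Or32 => c cc bc.
  have [p [up bp dp]] := CtoUg b (Pi_in Wy Wg) (Pi_in Wz Wg) cc bc.
  exists p; last first.
    by apply: leq_trans (D_db (cosU_trans (cosU_sym (cosCU b cc)) up)) _; lia.
  exists b, g, g; split=> //; first by split=> //; apply: cosUg.
  rewrite mulVg (ts_l0 ts (cosC_sym czg)) (ts_l0 ts (sub1 sC)) !addn0.
  exact: l_cosC.
have ey : ends (~~ b) (y^-1 * g) by case: ny.
have ez : ends (~~ b) (z^-1 * g) by case: nz.
have [sy [uy _ ny' _]] := ends_step ts ey; have [sz [uz _ nz' _]] := ends_step ts ez.
rewrite -mulgA in ny'; rewrite -mulgA in nz'.
have ghy : cosU (~~ b) g (g * sy) by rewrite /cosU mulKg.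
have ghz : cosU (~~ b) g (g * sz) by rewrite /cosU mulKg.
have Why := cosUW Wg ghy; have Whz := cosUW Wg ghz.
set hy := g * sy in ny' ghy Why; set hz := g * sz in nz' ghz Whz.
case: (EM (cosC hy hz)) => chh.
  have nz2 : nends (~~ b) (z^-1 * hy) by apply: nends_cosC nz'; apply: cosC_sym.
  have [h1|[h1 h2]] := step Wy Wz Wg ghy ny' nz2.
    by apply: Or31; apply: leq_trans h1 (leq_maxl _ _).
  have Wc c : cosC g c -> W c by apply: cosCW.
  have [h3|h3|[g' [Wg' lg' ng' h3]]] := IH (~~ b) y z hy Wy Wz Why ny' nz2.
  - apply: Or31; apply: leq_trans h1 _; apply: leq_trans (leq_maxr _ _).
    by rewrite leq_mul2l !leq_add2r leq_mul2l h3 !orbT.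
  - apply: Or32 => c cc /(h2 _ cc) [q [cq bq dq]].
    have [q' eq' dq'] := h3 _ cq bq; exists q' => //.
    have Wq' : W q' by case: eq' => b' [g1 [g2 [[Wg1 _] _ _ _ [uq _]]]]; apply: cosUW uq.
    by have := gmT gmW (Wc _ cc) (cosCW Why cq) Wq'; lia.
  apply: Or33; exists g'.
  have nc : ~ cosC hy g.
    move=> h; apply: (ends_nends ts ey); exact: nends_cosC h ny'.
  have [e1 e2] := add1 ts ng' (cosU_sym ghy) nc; rewrite mulVA in e1 e2.
  split=> //; first by rewrite e2 lg'.
    by right.
  move=> c cc /(h2 _ cc) [q [cq bq dq]].
  have [q' cq' dq'] := h3 _ cq bq; exists q' => //.
  by have := gmT gmW (Wc _ cc) (cosCW Why cq) (cosCW Wg' cq'); lia.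
have [h1|[_ h2]] := stepA Wy Wz Wg ghy ghz ny' nz'.
  by apply: Or31; apply: leq_trans h1 (leq_maxl _ _).
apply: Or32 => c cc /(h2 _ cc) [q [uq bq dq]]; exists q; last by lia.
exists (~~ b), hy, hz; split=> //.
- by split=> //; apply: cosU_trans (cosU_sym ghy) ghz.
- have uu : cosU (~~ b) hy hz := cosU_trans (cosU_sym ghy) ghz.
  have nn : nends (~~ b) (hz^-1 * z)^-1 by rewrite invVM.
  have := addcat ts ny' uu chh nn; rewrite !mulVA => ->.
  by rewrite (l_cosU uu chh).
by split=> //; apply: cosU_trans (cosU_sym ghy) uq.
Qed.

Lemma same_gate : exists phi m, forall b y z g, W y -> W z -> W g ->
  nends b (y^-1 * g) -> nends b (z^-1 * g) ->
  dC (Pi y g) (Pi z g) <= phi \/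
  forall c, cosC g c -> btw dC 0 (Pi y g) (Pi z g) c -> exists2 q, eta y z q & D c q <= m.
Proof.
have [phi [m h1]] := same_gate_rec K; have [Phi h2] := far_bound m.
exists (maxn phi Phi), m => b y z g Wy Wz Wg ny nz.
have [h|h|[g' [Wg' lg' _ h]]] := h1 b y z g Wy Wz Wg ny nz; [left|by right|left].
  by apply: leq_trans h (leq_maxl _ _).
apply: leq_trans (leq_maxr _ _); apply: (h2 g g') => //; try exact: Pi_in.
by rewrite -invVM (lV ts) ?lg' //; apply: Wdiv.
Qed.

Lemma eta_in b y z g g' w : W y -> W z -> W g -> cosU b g g' ->
  nends b (y^-1 * g) -> nends b (z^-1 * g') -> [\/ cosC y g, cosC z g' | ~ cosC g g'] ->
  cosU b g w -> btw (db b) 0 (Pi y g) (Pi z g') w -> eta y z w.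
Proof.
move=> Wy Wz Wg ugg ny nz on uw bw; exists b, g, g'; split=> //.
have Wg' := cosUW Wg ugg.
case: (EM (cosC g g')) => cgg; last first.
  have nn : nends b (g'^-1 * z)^-1 by rewrite invVM.
  have := addcat ts ny ugg cgg nn; rewrite !mulVA => ->.
  by rewrite (l_cosU ugg cgg).
rewrite (ts_l0 ts cgg) addn0; case: on => [cy|cz|//].
  rewrite (ts_l0 ts cy) -(mulVA g' y z) (lCl ts) //; first exact: Wdiv.
  exact/cosC_sym/(cosC_trans cy).
by rewrite (ts_l0 ts (cosC_sym cz)) addn0 -(mulVA y g z) (lCr ts (Wdiv Wy Wg) (cosC_trans cgg (cosC_sym cz))).
Qed.

Lemma l_U b s : gen (S b) s -> l s <= 1.
Proof.
move=> us; case: (EM (C s)) => cs; first by rewrite (ts_l0 ts).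
by rewrite (ts_l ts (red1 (U := U) (b := b) us cs)).
Qed.

(** Otherwise [x] and [y] both reach the edge [g C] from its other end, and turning back already
    there shortens the path. *)
Lemma on_path b x y g g' : W x -> W y -> W g -> cosU b g g' ->
  nends b (x^-1 * g) -> nends b (y^-1 * g') ->
  l (x^-1 * g) + l (g^-1 * g') + l (g'^-1 * y) = l (x^-1 * y) ->
  [\/ cosC x g, cosC y g' | ~ cosC g g'].
Proof.
move=> Wx Wy Wg ugg nx ny e; have Wg' := cosUW Wg ugg.
case: (EM (cosC x g)) => cx; first exact: Or31.
case: (EM (cosC y g')) => cy; first exact: Or32.
apply: Or33 => cg.
have ex : ends (~~ b) (x^-1 * g) by case: nx.
have ey : ends (~~ b) (y^-1 * g') by case: ny.
have [s [us _ _ ls]] := ends_step ts ex; have [s' [us' _ _ ls']] := ends_step ts ey.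
have Ws : W s := tsUW (U := U) us.
have Ws' : W s' := tsUW (U := U) us'.
have W1 : W (x^-1 * g * s) by apply: subM => //; apply: Wdiv.
have W2 : W (y^-1 * g' * s') by apply: subM => //; apply: Wdiv.
have Wc : gen (S (~~ b)) (s^-1 * (g^-1 * g') * s').
  by apply: subM => //; apply: subM; [|apply: subV|apply: CU].
have e2 : x^-1 * y = x^-1 * g * s * (s^-1 * (g^-1 * g') * s') * (y^-1 * g' * s')^-1.
  by rewrite !invgM !invgK !mulgA !mulgK.
have := l_tri ts (subM sW W1 (tsUW (U := U) Wc)) (subV sW W2).
have := l_tri ts W1 (tsUW (U := U) Wc).
rewrite (lV ts W2) -e2 -e (ts_l0 ts cg) -(invVM y g') (lV ts (Wdiv Wy Wg')).
have := l_U Wc; move: ls ls'; set A1 := l (x^-1 * g); set A2 := l (y^-1 * g').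
set A3 := l (x^-1 * g * s); set A4 := l (y^-1 * g' * s'); set A5 := l (s^-1 * _ * _).
by set A6 := l (_ * _); lia.
Qed.

Lemma eta_sym x y w : W x -> W y -> eta x y w -> eta y x w.
Proof.
move=> Wx Wy [b [g [g' [[Wg ugg] nx ny e [uw bw]]]]].
have Wg' := cosUW Wg ugg.
have uw' := cosU_trans (cosU_sym ugg) uw.
have u1 := cosU_trans (cosU_sym ugg) (cosCU b (Pi_in Wx Wg)).
have u2 := cosCU b (Pi_in Wy Wg').
apply: (eta_in Wy Wx Wg' (cosU_sym ugg) ny nx) => //; last exact: (btw_sym (gmU b g') u1 u2 uw').
case: (on_path Wx Wy Wg ugg nx ny e) => h; [exact: Or32|exact: Or31|apply: Or33].
by move=> /cosC_sym.
Qed.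

Lemma eta_W x y w : eta x y w -> W w.
Proof. by move=> [b [g [g' [[Wg _] _ _ _ [uw _]]]]]; apply: cosUW uw. Qed.

Lemma gate b x g : W x -> W g -> exists2 g', cosU b g g' & nends b (x^-1 * g').
Proof.
move=> Wx Wg; have [a ua na] := gate_ex ts b (Wdiv Wx Wg); exists (g * a).
  by rewrite /cosU mulKg.
by rewrite mulgA.
Qed.

Lemma eta_left x y : W x -> W y -> eta x y x.
Proof.
move=> Wx Wy; have [g' ug ng] := gate true Wy Wx.
apply: (eta_in Wx Wy Wx ug _ ng) => //.
- by rewrite mulVg; apply: (nends1 ts).
- exact/Or31/cosCg.
- exact: cosUg.
rewrite (Pi_0 (cosCg x)) /btw (gm0 (gmU true x)) //; [lia|exact: cosUg].
Qed.

(** Let [z] enter the vertex [g U_b] through [g2]. The triangle of the three projections in [g U_b]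
    is thin, and its side from [Pi x g] to [Pi z g2] belongs to [eta x z] unless [z] enters through
    the same edge as [x]. In that case [same_gate] shows that this side is short or close to
    [eta x z]. *)
Lemma eta_thin : exists m, forall x y z w, W x -> W y -> W z -> eta x y w ->
  exists2 w', eta x z w' \/ eta z y w' & D w w' <= m.
Proof.
have [phi [m hsg]] := same_gate; exists (2 * delta + k + m + lam * phi)%N => x y z w Wx Wy Wz.
have half b x' z' g g' w' : W x' -> W z' -> W g -> cosU b g g' -> nends b (x'^-1 * g) ->
    nends b (z'^-1 * g') -> cosU b g w' -> btw (db b) delta (Pi x' g) (Pi z' g') w' ->
    exists2 q, eta x' z' q \/ q = Pi z' g' & D w' q <= 2 * delta + k + m + lam * phi.
  move=> Wx' Wz' Wg ugg nx nz uw bw; have Wg' := cosUW Wg ugg.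
  have u1 := cosCU b (Pi_in Wx' Wg).
  have u2 := cosU_trans ugg (cosCU b (Pi_in Wz' Wg')).
  have [p [up bp dp]] := btw_near (gmU b g) (@hUg b g) u1 u2 uw bw.
  have dp' := D_db (cosU_trans (cosU_sym uw) up).
  case: (EM (cosC g g')) => cgg; last first.
    exists p; last by lia.
    by left; apply: (eta_in Wx' Wz' Wg ugg) => //; apply: Or33.
  have ez : Pi z' g' = Pi z' g by apply: Pi_C.
  have nz' := nends_cosC (cosC_sym cgg) nz.
  have c1 := Pi_in Wx' Wg; have c2 := Pi_in Wz' Wg.
  case: (hsg b x' z' g Wx' Wz' Wg nx nz') => h.
    exists (Pi z' g'); first by right.
    have := D_db (cosU_trans (cosU_sym uw) u2).
    have := db_dC b c1 c2; have : lam * dC (Pi x' g) (Pi z' g) <= lam * phi.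
      by rewrite leq_mul2l h orbT.
    move: bw; rewrite /btw ez; lia.
  rewrite ez in bp.
  have [c [cc bc dc]] := UtoCg c1 c2 up bp.
  have [q eq dq] := h _ cc bc; exists q; first by left.
  have Wp := cosUW Wg up.
  have := gmT gmW (cosUW Wg uw) Wp (eta_W eq).
  have := gmT gmW Wp (cosCW Wg cc) (eta_W eq).
  have := D_db (cosU_trans (cosU_sym up) (cosCU b cc)); lia.
move=> [b [g [g' [[Wg ugg] nx ny e [uw bw]]]]].
have Wg' := cosUW Wg ugg.
have [g2 ug2 nz] := gate b Wz Wg; have Wg2 := cosUW Wg ug2.
have u1 := cosCU b (Pi_in Wx Wg).
have u2 := cosU_trans ugg (cosCU b (Pi_in Wy Wg')).
have u3 := cosU_trans ug2 (cosCU b (Pi_in Wz Wg2)).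
have ug2' := cosU_trans (cosU_sym ugg) ug2.
have endz : eta x z (Pi z g2) \/ eta z y (Pi z g2).
  have inx : cosC x g \/ ~ cosC g g2 -> eta x z (Pi z g2).
    move=> h; apply: (eta_in Wx Wz Wg ug2 nx nz) => //; last first.
      by rewrite /btw (gm0 (gmU b g) u3); lia.
    by case: h => h; [apply: Or31|apply: Or33].
  have iny : cosC y g' \/ ~ cosC g' g2 -> eta z y (Pi z g2).
    move=> h; apply: eta_sym => //; apply: (eta_in Wy Wz Wg' ug2' ny nz); last first.
    - by rewrite /btw (gm0 (gmU b g) u3); lia.
    - exact: cosU_trans (cosU_sym ugg) u3.
    by case: h => h; [apply: Or31|apply: Or33].
  case: (on_path Wx Wy Wg ugg nx ny e) => h; [by left; apply: inx; left|by right; apply: iny; left|].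
  case: (EM (cosC g g2)) => cg; [right; apply: iny; right|by left; apply: inx; right].
  by move=> cg'; apply: h; apply: cosC_trans cg (cosC_sym cg').
have bw' : btw (db b) 0 (Pi x g) (Pi y g') w := bw.
have [b1|b1] := btw_thin (gmU b g) (@hUg b g) u1 u2 u3 uw bw.
  have [q eq dq] := half b x z g g2 w Wx Wz Wg ug2 nx nz uw b1.
  by case: eq dq => [eq|->] dq; [exists q => //; left|exists (Pi z g2)].
have b2 := btw_sym (gmU b g) u3 u2 uw b1.
have uw' := cosU_trans (cosU_sym ugg) uw.
have [q eq dq] := half b y z g' g2 w Wy Wz Wg' ug2' ny nz uw' b2.
case: eq dq => [eq|->] dq; last by exists (Pi z g2).
by exists q => //; right; apply: eta_sym.
Qed.

(** For [x] and [y] in one coset the tree path crosses at most one vertex. So [eta x y] consists of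
    an interval in that vertex and of intervals in the vertices beside [x C] and [y C], whose ends
    lie in an edge coset. The factor 2 is the price of a nearest point projection. *)
Lemma eta_short b0 x y w : W x -> W y -> cosU b0 x y -> eta x y w ->
  (cosU b0 x w /\ btw (db b0) 0 x y w) \/
  exists e b u v, [/\ e = x \/ e = y, cosC e u, cosC e v,
    db b0 u e <= 2 * db b0 x y /\ db b0 v e <= 2 * db b0 x y &
    cosU b e w /\ btw (db b) 0 u v w].
Proof.
move=> Wx Wy uxy [b [g [g' [[Wg ugg] nx ny e [uw bw]]]]].
have Wg' := cosUW Wg ugg; have lxy := l_U uxy; rewrite -/(x^-1 * y) in lxy.
have gm := gmU b0 x; have ux := cosUg b0 x.
have le2 a : a <= db b0 x y -> a <= 2 * db b0 x y by lia.
have d0 z : cosU b0 x z -> db b0 z z <= 2 * db b0 x y by move=> uz; rewrite (gm0 gm).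
have dC_ x' y' : W x' -> W y' -> cosU b0 x' y' ->
    cosC x' (Pi y' x') /\ db b0 (Pi y' x') x' <= 2 * db b0 x' y'.
  move=> Wx' Wy' u'; have c := Pi_in Wy' Wx'; split=> //.
  have ny' : nends b0 (y'^-1 * y') by rewrite mulVg; apply: (nends1 ts).
  have [_ /(_ _ (cosCg x'))] := Pi_gate Wy' Wy' ny' (cosU_sym u').
  rewrite (Pi_0 (cosCg y')); have gm' := gmU b0 x'; have uP := cosCU b0 c.
  have := gmT gm' uP u' (cosUg b0 x').
  rewrite (gmC gm' uP u') (gmC gm' u' (cosUg b0 x')); lia.
case: (EM (cosC x g)) => cx; case: (EM (cosC y g')) => cy.
- have ex : Pi x g = x by apply: Pi_0.
  have ey : Pi y g' = y by apply: Pi_0.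
  rewrite ex ey in bw; have uw' := cosU_trans (cosCU b cx) uw.
  case: (EM (cosC x y)) => cxy.
    right; exists x, b, x, y; split=> //; try exact: cosCg.
    - by left.
    - by rewrite (gmC gm uxy ux); split; [apply: d0|apply: le2].
  case: (eqVneq b b0) => [eb|nb]; first by subst b0; left.
  case: (ends_excl (b := b) ts (x := x^-1 * y)).
    have ub : cosU b x y := cosU_trans (cosCU b cx) (cosU_trans ugg (cosU_sym (cosCU b cy))).
    by exists 1%N, b; apply: (red1 (U := U) (C := C)).
  have -> : ~~ b = b0 by move: nb; case: (b); case: (b0).
  by exists 1%N, b0; apply: (red1 (U := U) (C := C)).
- right; have ex : Pi x g = x by apply: Pi_0.
  case: (EM (cosC g g')) => cgg; last first.
    have cy' : 0 < l (g'^-1 * y).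
      rewrite lt0n; apply/eqP => /(l0C ts (Wdiv Wg' Wy)) h.
      by apply: cy; apply: cosC_sym.
    by have := l_cosU ugg cgg; lia.
  have cxg := cosC_trans cx cgg.
  have [h1 h2] := dC_ _ _ Wx Wy uxy.
  exists x, b, (Pi x g), (Pi y g'); rewrite ex (Pi_C Wy Wx cxg); split=> //.
  + by left.
  + exact: cosCg.
  + by split=> //; apply: d0.
  by split; [apply: cosU_trans (cosCU b cx) uw|rewrite -(Pi_C Wy Wx cxg) -{1}ex].
- right; have ey : Pi y g' = y by apply: Pi_0.
  case: (EM (cosC g g')) => cgg; last first.
    have cx' : 0 < l (x^-1 * g) by rewrite lt0n; apply/eqP => /(l0C ts (Wdiv Wx Wg)).
    by have := l_cosU ugg cgg; lia.
  have cyg := cosC_trans cy (cosC_sym cgg).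
  have [h1 h2] := dC_ _ _ Wy Wx (cosU_sym uxy); rewrite (gmC gm uxy ux) in h2.
  exists y, b, (Pi x g), (Pi y g'); rewrite ey (Pi_C Wx Wy cyg); split=> //.
  + by right.
  + exact: cosCg.
  + by split=> //; apply: d0.
  by split; [apply: cosU_trans (cosCU b cyg) uw|rewrite -(Pi_C Wx Wy cyg) -ey].
have cy' : 0 < l (g'^-1 * y).
  rewrite lt0n; apply/eqP => /(l0C ts (Wdiv Wg' Wy)) h.
  by apply: cy; apply: cosC_sym.
have cx' : 0 < l (x^-1 * g) by rewrite lt0n; apply/eqP => /(l0C ts (Wdiv Wx Wg)).
lia.
Qed.

Lemma eta_loc : exists m, forall x y w, W x -> W y -> D x y <= 1 -> eta x y w -> D w x <= m.
Proof.
exists (4 * lam * lam + 10)%N => x y w Wx Wy d1 ew.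
have [b0 uxy dxy] : exists2 b0, cosU b0 x y & db b0 x y <= 1.
  have gW : gen SW (x^-1 * y) by apply/SW_gen/Wdiv.
  have hw := len_wl gW; rewrite -/(wd SW x y) in hw.
  case e : (wd SW x y) d1 hw => [|[|n]] // _.
    move=> h; exists true; rewrite /cosU /wd h ?len1 //; exact: sub1.
  move=> [s [z [hs hz ez]]]; rewrite /= in hz; rewrite hz mulg1 in ez.
  have [b h] : exists b, S b s \/ S b s^-1.
    by case: hs => -[h|h]; [exists true; left|exists false; left|exists true; right|exists false; right].
  exists b; rewrite /cosU /wd ez; first by exists 1%N; apply: wl1.
  exact/len_le/wl1.
have [[uw bw]|[z [b [u [v [ez cu cv [du dv] [uw bw]]]]]]] := eta_short Wx Wy uxy ew.
  apply: leq_trans (D_db (cosU_sym uw)) _.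
  have gm := gmU b0 x; have ux := cosUg b0 x.
  by rewrite (gmC gm uw ux); move: bw; rewrite /btw; lia.
have Wz : W z by case: ez => ->.
have Dzx : D z x <= 1.
  by case: ez => ->; [rewrite (gm0 gmW)|rewrite (gmC gmW Wy Wx)].
have gmz := gmSC z; have gmb := gmU b z.
have h1 := dC_db b0 cu (cosCg z); have h2 := dC_db b0 cv (cosCg z).
have h3 := db_dC b cu cv.
have h4 := gmT gmz cu (cosCg z) cv; rewrite (gmC gmz (cosCg z) cv) in h4.
have h5 : dC u v <= lam * 4.
  have a1 : lam * db b0 u z <= lam * 2 by rewrite leq_mul2l (leq_trans du) ?orbT; lia.
  have a2 : lam * db b0 v z <= lam * 2 by rewrite leq_mul2l (leq_trans dv) ?orbT; lia.
  lia.
have h6 : lam * dC u v <= lam * (lam * 4) by rewrite leq_mul2l h5 orbT.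
have uu := cosCU b cu; have uv := cosCU b cv.
have Wu := cosCW Wz cu; have Ww := cosUW Wz uw.
have := gmT gmW Ww Wu Wx; have := gmT gmW Wu Wz Wx.
have := D_db (cosU_trans (cosU_sym uw) uu); rewrite (gmC gmb uw uu).
have := D_db (cosU_trans (cosU_sym (cosCU b0 cu)) (cosUg b0 z)).
move: bw; rewrite /btw; nia.
Qed.

Lemma eta_Pi x y g : W x -> W y -> W g ->
  l (x^-1 * g) + l (g^-1 * y) = l (x^-1 * y) -> eta x y (Pi x g).
Proof.
move=> Wx Wy Wg e.
case: (EM (cosC y g)) => cy.
  have [b nb] : exists b, nends b (x^-1 * g).
    by case: (endsP ts true (Wdiv Wx Wg)) => h; [exists true|exists false; right].
  apply: (eta_in Wx Wy Wg (cosUg b g) nb) => //.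
  - by left.
  - exact: Or32.
  - exact/cosCU/Pi_in.
  by rewrite /btw (gm0 (gmU b g)) //; [lia|exact/cosCU/Pi_in].
have [b eb] : exists b, ends b (y^-1 * g).
  case: (red_ex ts (Wdiv Wy Wg)) => [//|[n [a [b h]]]]; by exists b, n, a.
have [s [us ns ng ls]] := ends_step ts eb; rewrite -mulgA in ng ls.
have Ws : W s := tsUW (U := U) us.
have ugs : cosU b g (g * s) by rewrite /cosU mulKg.
have Wgs := cosUW Wg ugs.
have nx : nends b (x^-1 * g).
  case: (endsP ts b (Wdiv Wx Wg)) => // ex.
  have [s' [us' ns' ng' ls']] := ends_step ts ex; rewrite -mulgA in ng' ls'.
  have Ws' : W s' := tsUW (U := U) us'.
  have Wgs' : W (g * s') by apply: subM.
  have e2 : x^-1 * y = x^-1 * (g * s') * ((s'^-1 * s) * (y^-1 * (g * s))^-1).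
    by rewrite !invgM !invgK !mulgA !mulgK.
  have us2 : gen (S b) (s'^-1 * s) by apply: subVM.
  have Wys : W (y^-1 * (g * s))^-1 by apply: subV => //; apply: Wdiv.
  have h1 := l_tri ts (Wdiv Wx Wgs') (subM sW (tsUW (U := U) us2) Wys).
  have h2 := l_tri ts (tsUW (U := U) us2) Wys; have h3 := l_U us2.
  have h4 := lV ts (Wdiv Wy Wgs); have h5 := lV ts (Wdiv Wy Wg); rewrite invVM in h5.
  have h6 := l_tri ts (Wdiv Wx Wgs') (tsUW (U := U) (subV (@sU b) us')).
  exfalso; rewrite -e2 -e h5 in h1; move: h1 h2 h3 h4 ls ls'.
  set A1 := l (x^-1 * (g * s')); set A2 := l (_ * _^-1); set A3 := l (s'^-1 * s).
  set A4 := l _^-1; set A5 := l (y^-1 * (g * s)); set A6 := l (y^-1 * g).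
  by set A7 := l (x^-1 * g); lia.
apply: (eta_in Wx Wy Wg ugs nx ng) => //; last first.
- by rewrite /btw (gm0 (gmU b g)) //; [lia|exact/cosCU/Pi_in].
- exact/cosCU/Pi_in.
by apply: Or33 => h; apply: ns; rewrite -(mulKg g s).
Qed.

Lemma path_switch b g u v x y (Q : G -> Prop) : cosU b g u -> cosU b g v ->
  (forall w, cosU b g w -> btw (db b) 0 u v w -> eta x y w) -> Q u -> ~ Q v ->
  exists w w', [/\ eta x y w, eta x y w', Q w, ~ Q w' & D w w' <= 1].
Proof.
move=> uu uv sub Qu Qv; have [f [[fU fd] f0 fn]] := geo_exists (gmU b g) uu uv.
rewrite -f0 in Qu; rewrite -fn in Qv.
have [i [hi q1 q2]] := @switch _ Q f _ Qu Qv.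
have bf j : j <= db b u v -> eta x y (f j).
  move=> hj; apply: sub; first exact: fU.
  have h1 := fd 0 j (leq0n _) hj; have h2 := fd j _ hj (leqnn _).
  by rewrite f0 in h1; rewrite fn in h2; rewrite /btw; lia.
exists (f i), (f i.+1); split=> //; [by apply: bf; apply: ltnW|by apply: bf|].
have u1 := fU i (ltnW hi); have u2 := fU i.+1 hi.
by apply: leq_trans (D_db (cosU_trans (cosU_sym u1) u2)) _; rewrite fd //; lia.
Qed.

(** Walk along the edges [g] of the tree path and follow the greedy projections [Pi x g], which
    belong to [eta x y] by [eta_Pi]. From an edge [h] to the next edge [g], [Pi x g] lies nearly
    between [Pi x h] and [Pi y g], so that an interval inside [eta x y] leads close to it. *)
Lemma eta_conn : exists m, forall x y (Q : G -> Prop), W x -> W y -> Q x -> ~ Q y ->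
  exists w w', [/\ eta x y w, eta x y w', Q w, ~ Q w' & D w w' <= m].
Proof.
exists (r + delta + 1)%N => x y Q Wx Wy Qx Qy.
pose T := exists w w', [/\ eta x y w, eta x y w', Q w, ~ Q w' & D w w' <= r + delta + 1].
have T1 : (exists w w', [/\ eta x y w, eta x y w', Q w, ~ Q w' & D w w' <= 1]) -> T.
  by move=> [w [w' [h1 h2 h3 h4 h5]]]; exists w, w'; split=> //; lia.
have key n : forall g, W g -> l (x^-1 * g) = n ->
    l (x^-1 * g) + l (g^-1 * y) = l (x^-1 * y) -> T \/ Q (Pi x g).
  elim: n => [|n IH] g Wg ln e.
    by right; rewrite Pi_0 //; apply: (l0C ts) => //; apply: Wdiv.
  have [b eb] : exists b, ends b (x^-1 * g).
    case: (red_ex ts (Wdiv Wx Wg)) => [c|[n' [a [b h]]]]; last by exists b, n', a.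
    by rewrite (ts_l0 ts c) in ln.
  have [s [us ns nx ls]] := ends_step ts eb; rewrite -mulgA in nx ls.
  set h := g * s in nx ls.
  have ugh : cosU b g h by rewrite /cosU mulKg.
  have Wh := cosUW Wg ugh.
  have cgh : ~ cosC g h by move=> c; apply: ns; rewrite -(mulKg g s).
  have lh1 := l_cosU ugh cgh.
  have lh2 : l (h^-1 * g) = 1%N by rewrite -(lV ts (Wdiv Wh Wg)) invVM.
  have t1 := l_tri ts (Wdiv Wx Wh) (Wdiv Wh Wy).
  have t2 := l_tri ts (Wdiv Wh Wg) (Wdiv Wg Wy).
  rewrite !mulVA in t1 t2.
  have ny : nends b (y^-1 * g).
    case: (endsP ts b (Wdiv Wy Wg)) => // ey; exfalso.
    have [s' [us' ns' _ ls']] := ends_step ts ey; rewrite -mulgA in ls'.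
    set h' := g * s' in ls'.
    have ugh' : cosU b g h' by rewrite /cosU mulKg.
    have Wh' := cosUW Wg ugh'.
    have uhh := l_U (cosU_trans (cosU_sym ugh) ugh').
    have t3 := l_tri ts (Wdiv Wx Wh) (Wdiv Wh Wh').
    have t4 := l_tri ts (Wdiv Wx Wh') (Wdiv Wh' Wy).
    have e1 := lV ts (Wdiv Wy Wh'); have e2 := lV ts (Wdiv Wy Wg).
    rewrite !mulVA !invVM in t3 t4 e1 e2 uhh; move: t3 t4 e1 e2 uhh ls ls' e.
    set A1 := l (x^-1 * h); set A2 := l (h^-1 * h'); set A3 := l (x^-1 * h').
    set A4 := l (h'^-1 * y); set A5 := l (x^-1 * y); set A6 := l (y^-1 * h').
    by set A7 := l (g^-1 * y); set A8 := l (y^-1 * g); set A9 := l (x^-1 * g); lia.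
  have lh : l (x^-1 * h) = n.
    by move: ls ln; set A1 := l (x^-1 * h); set A2 := l (x^-1 * g); lia.
  have eh : l (x^-1 * h) + l (h^-1 * y) = l (x^-1 * y).
    move: t1 t2 lh2 ls e; set A1 := l (x^-1 * h); set A2 := l (x^-1 * g).
    set A3 := l (h^-1 * y); set A4 := l (x^-1 * y); set A5 := l (h^-1 * g).
    by set A6 := l (g^-1 * y); lia.
  have [h1|Qh] := IH h Wh lh eh; first by left.
  have uhg := cosU_sym ugh.
  have u1 := cosCU b (Pi_in Wx Wh); have u2 := cosU_trans uhg (cosCU b (Pi_in Wy Wg)).
  have u3 := cosU_trans uhg (cosCU b (Pi_in Wx Wg)).
  have inE w : cosU b h w -> btw (db b) 0 (Pi x h) (Pi y g) w -> eta x y w.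
    move=> uw bw; apply: (eta_in Wx Wy Wh uhg nx ny) => //.
    by apply: Or33 => /cosC_sym.
  have nst := Pi_gate Wx Wh nx uhg.
  have gm := gmU b h.
  have CgU c : cosC g c -> cosU b h c by move=> cc; apply: cosU_trans uhg (cosCU b cc).
  have qc : quasiconvex (cosU b h) (db b) (cosC g) k.
    by move=> c c' p cc cc' up; apply: (@qcCg b g) => //; apply: cosU_trans ugh up.
  have bP := nearest_btw gm (@hUg b h) CgU qc u1 nst (Pi_in Wy Wg).
  have [q [uq bq dq]] := btw_near gm (@hUg b h) u1 u2 u3 bP.
  case: (EM (Q (Pi x g))) => Qg; [by right|left].
  have ePi := eta_Pi Wx Wy Wg e.
  case: (EM (Q q)) => Qq.
    exists q, (Pi x g); split=> //; first exact: inE.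
    apply: leq_trans (D_db (cosU_trans (cosU_sym uq) u3)) _.
    by rewrite (gmC gm uq u3); rewrite -/r in dq; lia.
  apply/T1/(path_switch u1 uq _ Qh Qq) => w uw bw; apply: inE => //.
  have := gmT gm uw uq u2; move: bw bq; rewrite /btw; lia.
have eyy : l (x^-1 * y) + l (y^-1 * y) = l (x^-1 * y).
  by rewrite mulVg (ts_l0 ts (sub1 sC)) addn0.
have [//|QP] := key _ y Wy erefl eyy.
have [b nb] : exists b, nends b (x^-1 * y).
  by case: (endsP ts true (Wdiv Wx Wy)) => h; [exists true|exists false; right].
have cP := Pi_in Wx Wy.
apply/T1/(path_switch (cosCU b cP) (cosUg b y) _ QP Qy) => w uw bw.
apply: (eta_in Wx Wy Wy (cosUg b y) nb) => //.
- by rewrite mulVg; apply: (nends1 ts).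
- exact/Or32/cosCg.
by rewrite [Pi y y](Pi_0 (cosCg y)).
Qed.

Theorem combination_hyp : exists delta' m, [/\ hyp W D delta',
  forall x y w, W x -> W y -> eta x y w -> exists q, [/\ W q, btw D 0 x y q & D w q <= m] &
  forall x y p, W x -> W y -> W p -> btw D 0 x y p -> exists2 w, eta x y w & D p w <= m].
Proof.
have [m1 h1] := eta_loc; have [m2 h2] := eta_thin; have [m3 h3] := eta_conn.
have te : thin_family W D (m1 + m2 + m3) eta.
  split.
  - by move=> x y w _ _; apply: eta_W.
  - by move=> x y w Wx Wy d1 /(h1 _ _ _ Wx Wy d1); lia.
  - by move=> x y z w Wx Wy Wz /(h2 _ _ _ _ Wx Wy Wz) [w' ew' dw]; exists w' => //; lia.
  - exact: eta_left.
  - by move=> x y Wx Wy; apply: eta_sym => //; apply: eta_left.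
  move=> x y Q Wx Wy Qx Qy; have [w [w' [e1 e2 e3 e4 e5]]] := h3 x y Q Wx Wy Qx Qy.
  by exists w, w'; split=> //; lia.
have [delta' [m hm]] := guess_geodesics (m1 + m2 + m3).
by exists delta', m; apply: hm gmW te.
Qed.

(** By [eta_short], a guessed geodesic between two points of a factor stays within [k] of this
    factor, so the factor is quasiconvex. *)
Theorem combination_undist b : undist (S b) SW.
Proof.
have [_ [m [_ _ h]]] := combination_hyp.
apply: (qc_undist (R := m + k) fin_SW) => [x gx|x p gx /SW_gen Wp bp].
  by apply/SW_gen/(tsUW (U := U) (b := b)).
have u1 : cosU b 1 x by rewrite /cosU invg1 mul1g.
have W1 := sub1 sW; have Wx := cosUW W1 u1.
have [w ew dw] := h _ _ _ W1 Wx Wp bp.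
have Ww := eta_W ew.
suff [c uc dc] : exists2 c, cosU b 1 c & D w c <= k.
  exists c; first by move: uc; rewrite /cosU invg1 mul1g.
  by have := gmT gmW Wp Ww (cosUW W1 uc); lia.
have [[uw _]|[z [b' [u [v [ez cu cv _ [uw bw]]]]]]] := eta_short W1 Wx u1 ew.
  by exists w => //; rewrite (gm0 gmW).
have [c [cc _ dc]] := UtoCg cu cv uw bw; exists c.
  by apply: cosU_trans (cosCU b cc); case: ez => ->; [apply: cosUg|].
by apply: leq_trans (D_db (cosU_trans (cosU_sym uw) (cosCU b' cc))) _.
Qed.

(* Stated separately so that both sides use the same multiplication instance. *)
Lemma gmA (x y z : G) : x^-1 * (y * z) = x^-1 * y * z. Proof. exact: mulgA. Qed.

(** The recursion of [same_gate_rec] when both tree paths are known to run through [g' C]. *)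
Lemma deep j : exists phi m, forall y z g g', W y -> W z -> W g -> W g' ->
  l (g'^-1 * g) = j -> l (y^-1 * g) = l (y^-1 * g') + j -> l (z^-1 * g) = l (z^-1 * g') + j ->
  dC (Pi y g) (Pi z g) <= phi \/
  forall c, cosC g c -> btw dC 0 (Pi y g) (Pi z g) c -> exists2 q, cosC g' q & D c q <= m.
Proof.
elim: j => [|j [phi [m IH]]].
  exists 0, 0 => y z g g' Wy Wz Wg Wg' e _ _; right=> c cc _; exists c.
    by apply: cosC_trans cc; apply: (l0C ts) => //; apply: Wdiv.
  by rewrite (gm0 gmW) //; apply: cosCW cc.
exists (maxn (lam * (r + delta)) (lam * (lam * phi + 2 * r + delta))),
  (m + 2 * k + 2 * r + 2 * delta)%N => y z g g' Wy Wz Wg Wg' e ey ez.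
have [b eb] : exists b, ends b (g'^-1 * g).
  case: (red_ex ts (Wdiv Wg' Wg)) => [c|[n' [a [b h]]]]; last by exists b, n', a.
  by rewrite (ts_l0 ts c) in e.
have [s [us ns nx ls]] := ends_step ts eb; rewrite -gmA in nx ls.
set h := g * s in nx ls.
have ugh : cosU b g h by rewrite /cosU mulKg.
have Wh := cosUW Wg ugh.
have lh : l (g'^-1 * h) = j by lia.
have thr y' : W y' -> l (y'^-1 * g) = l (y'^-1 * g') + j.+1 ->
    nends b (y'^-1 * h) /\ l (y'^-1 * h) = l (y'^-1 * g') + j.
  move=> Wy' e'.
  have t1 := l_tri ts (Wdiv Wy' Wg') (Wdiv Wg' Wh).
  have t2 := l_mulU ts (Wdiv Wy' Wh) (cosU_sym ugh).
  rewrite !mulVA in t1 t2; split; last by lia.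
  case: (endsP ts b (Wdiv Wy' Wh)) => // eh.
  have [s' [us' _ _ ls']] := ends_step ts eh; rewrite -gmA in ls'.
  have uhs : cosU b (h * s') g.
    by apply: cosU_trans (cosU_sym ugh); rewrite /cosU invgM -mulgA mulVg mulg1; apply: subV.
  have Whs := cosUW Wg (cosU_sym uhs).
  have t3 := l_mulU ts (Wdiv Wy' Whs) uhs; rewrite !mulVA in t3; lia.
have [ny ly] := thr y Wy ey; have [nz lz] := thr z Wz ez.
have [h1|[h1 h2]] := step Wy Wz Wg ugh ny nz.
  by left; apply: leq_trans h1 (leq_maxl _ _).
have [h3|h3] := IH y z h g' Wy Wz Wh Wg' lh ly lz; [left|right].
  apply: leq_trans h1 _; apply: leq_trans (leq_maxr _ _).
  by rewrite leq_mul2l !leq_add2r leq_mul2l h3 !orbT.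
move=> c cc /(h2 _ cc) [q [cq bq dq]].
have [q' cq' dq'] := h3 _ cq bq; exists q' => //.
by have := gmT gmW (cosCW Wg cc) (cosCW Wh cq) (cosCW Wg' cq'); lia.
Qed.

(** Up to a constant, the greedy projection to [g C] remembers only the last [K] edges of the
    path. *)
Lemma Pi_acyl : exists Phi, forall y z g g', W y -> W z -> W g -> W g' ->
  l (g'^-1 * g) = K -> l (y^-1 * g) = l (y^-1 * g') + K -> l (z^-1 * g) = l (z^-1 * g') + K ->
  dC (Pi y g) (Pi z g) <= Phi.
Proof.
have [phi [m h1]] := deep K; have [Phi h2] := far_bound m.
exists (maxn phi Phi) => y z g g' Wy Wz Wg Wg' e ey ez.
have [h|h] := h1 y z g g' Wy Wz Wg Wg' e ey ez; first by apply: leq_trans h (leq_maxl _ _).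
apply: leq_trans (leq_maxr _ _); apply: (h2 g g') => //; try exact: Pi_in.
by rewrite -(invVM g' g) (lV ts (Wdiv Wg' Wg)) e.
Qed.

(** * Sub-amalgams with undistorted factors *)

Section SubAmalgam.
Context (S' : bool -> G -> Prop) (k' : nat).
Local Notation U' := (fun b => gen (S' b)).
Local Notation W' := (gen (factors U')).
Let C' x := C x /\ gen (S' true) x.
Hypotheses (fS' : forall b, fin (S' b)) (U'U : forall b x, gen (S' b) x -> gen (S b) x)
  (U'C : forall b x, gen (S' b) x -> C x -> gen (S' (~~ b)) x)
  (qcU' : forall b, quasiconvex (gen (S b)) (wd (S b)) (gen (S' b)) k').

Let C'P b x : gen (S' b) x -> C x -> C' x.
Proof. by case: b => h c; split=> //; apply: U'C h c. Qed.

Let C'U' b x : C' x -> gen (S' b) x.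
Proof. by case: b => -[c h] //; apply: U'C h c. Qed.

Let red'_red n a b x : red U' C' n a b x -> red U C n a b x.
Proof.
elim: n b x => [//|n IH] b x [y [s [us ns -> h]]]; exists y, s; split=> //; first exact: U'U.
  by move=> c; apply: ns; apply: C'P us c.
by case: h => [h|/IH h]; [left|right].
Qed.

Lemma ts' : tree_split U' C' l.
Proof.
split.
- by move=> b; apply: gen_subgrp.
- split=> [|x y [c1 h1] [c2 h2]|x [c1 h1]]; first by split; apply: sub1 => //; apply: gen_subgrp.
    by split; apply: subM => //; apply: gen_subgrp.
  by split; apply: subV => //; apply: gen_subgrp.
- by move=> b c; apply: C'U'.
- by move=> c [cc _]; apply: (ts_l0 ts).
- by move=> n a b x /red'_red; apply: (ts_l ts).
Qed.

Let sW' : subgrp W'. Proof. exact: gen_subgrp. Qed.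
Let sU' b : subgrp (gen (S' b)). Proof. exact: gen_subgrp. Qed.

Let W'W x : W' x -> W x.
Proof. by apply: gen_min => // s [/U'U|/U'U] h; apply: gen_in; [left|right]. Qed.

Let W'div x y : W' x -> W' y -> W' (x^-1 * y). Proof. by move=> *; apply: subVM. Qed.

Let W'U b x : W' x -> gen (S b) x -> gen (S' b) x.
Proof.
move=> /(red_ex ts') [c _|[n [a [b' h]]]]; first exact: C'U'.
move=> ux; have lx := l_U ux; rewrite (ts_l ts' h) in lx.
case: n h lx => [//|[|//]] h _.
have h0 := red'_red h.
move: h => [y [s [us ns ->]]] [[_ _ ->]|//]; rewrite mul1g.
case: (eqVneq b' b) => [<- //|nb].
have ex : ends b' x by exists 1%N, a.
case: (ends_excl ts ex); exists 1%N, b; rewrite (_ : ~~ b' = b).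
  exact: (red1 (U := U) (C := C)) ux (ends_notC ts ex).
by move: nb; case: (b); case: (b').
Qed.

Let step' x z n : W' x -> W' z -> l (x^-1 * z) = n.+1 -> exists b h,
  [/\ W' h, gen (S' b) (z^-1 * h), ends b (x^-1 * z), nends b (x^-1 * h) & l (x^-1 * h) = n].
Proof.
move=> Wx Wz e.
case: (red_ex ts' (W'div Wx Wz)) => [[c _]|[n' [a [b h]]]]; first by rewrite (ts_l0 ts c) in e.
have [|s [us _ ns ls]] := ends_step ts' (b := b) (x := x^-1 * z); first by exists n', a.
exists b, (z * s); split.
- by apply: subM => //; apply: (tsUW (U := U') us).
- by rewrite mulKg.
- by exists n', a; apply: red'_red.
- rewrite gmA; case: ns => [[c _]|[n2 [a2 h2]]]; first by left.
  by right; exists n2, a2; apply: red'_red.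
by move: ls; rewrite -gmA; lia.
Qed.

Let prefix' x z j : W' x -> W' z -> j <= l (x^-1 * z) ->
  exists h, [/\ W' h, l (h^-1 * z) = j & l (x^-1 * z) = l (x^-1 * h) + j].
Proof.
move=> Wx; elim: j z => [|j IH] z Wz lj.
  by exists z; rewrite mulVg (ts_l0 ts (sub1 sC)); split=> //; lia.
case e : (l (x^-1 * z)) lj => [//|n] lj.
have [b [h [Wh us ex nx lh]]] := step' Wx Wz e.
have [|h' [Wh' l1 l2]] := IH h Wh; first by lia.
exists h'; split=> //; last by lia.
have us1 : cosU b h z by apply: cosU_sym; apply: U'U.
have t1 := l_mulU ts (Wdiv (W'W Wh') (W'W Wh)) us1.
have t2 := l_tri ts (Wdiv (W'W Wx) (W'W Wh')) (Wdiv (W'W Wh') (W'W Wz)).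
rewrite !mulVA in t1 t2; lia.
Qed.

(** Convexity in the tree of the set of edges [h C] with [h] in [W']. *)
Let edge' x y g : W' x -> W' y -> W g -> l (x^-1 * g) + l (g^-1 * y) = l (x^-1 * y) ->
  exists2 h, W' h & cosC g h.
Proof.
move=> Wx Wy Wg; have Wx0 := W'W Wx.
move e : (l (g^-1 * y)) => n; elim: n y Wy e => [|n IH] y Wy e en.
  by exists y => //; apply: (l0C ts) => //; apply: Wdiv => //; apply: W'W.
have [b [h [Wh us ex nx lh]]] := @step' x y (l (x^-1 * g) + n) Wx Wy (ltac:(lia)).
have Wy0 := W'W Wy; have Wh0 := W'W Wh.
have uyh : cosU b y h by apply: U'U.
have low b' s : gen (S b') s -> l (g^-1 * (y * s)) = n -> l (x^-1 * (y * s)) <= l (x^-1 * g) + n.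
  move=> us' ls; have Ws := tsUW (U := U) us'.
  have Wys : W (y * s) by apply: subM.
  by have := l_tri ts (Wdiv Wx0 Wg) (Wdiv Wg Wys); rewrite mulVA ls.
have eb : ends b (g^-1 * y).
  case: (endsP ts b (Wdiv Wg Wy0)) => // -[c|eb]; first by rewrite (ts_l0 ts c) in e.
  have [s [us1 ns1 _ ls1]] := ends_step ts eb; rewrite -gmA in ls1.
  have l4 : l (x^-1 * (y * s)) <= l (x^-1 * g) + n by apply: (low _ _ us1); lia.
  exfalso; have nx' : nends (~~ b) (x^-1 * y) by right; rewrite negbK.
  have [_] := add1 ts nx' us1 ns1; rewrite -gmA; lia.
have [s [us1 ns1 _ ls1]] := ends_step ts eb; rewrite -gmA in ls1.
have ls2 : l (g^-1 * (y * s)) = n by lia.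
have l3 := low _ _ us1 ls2.
have Ws := tsUW (U := U) us1; have Wys : W (y * s) by apply: subM.
have uys : cosU b h (y * s) by apply: cosU_trans (cosU_sym uyh) _; rewrite /cosU mulKg.
case: (EM (cosC h (y * s))) => ch; last first.
  by have [_] := add1 ts nx uys ch; rewrite mulVA; lia.
apply: (IH h Wh); last by lia.
by rewrite -ls2 (l_cosC Wg Wh0 ch).
Qed.

(** Where two subgroups come close, they are close to their intersection: the differences
    [t = c^-1 * a] range over a finite ball, and right multiplication by the inverses of one fixed
    pair with the same [t] moves [c] and [a] to a common point. *)
Let coset_near b n : exists rho, forall c a, C c -> gen (S' b) a -> db b c a <= n ->
  exists2 p, C' p & dC c p <= rho.
Proof.
have [sb hs] := fS b; have [L hL] := ball_finite n hs.
have pick t : exists rho, (forall c a, C c -> gen (S' b) a -> c^-1 * a = t ->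
    exists2 p, C' p & dC c p <= rho).
  case: (EM (exists c a, [/\ C c, gen (S' b) a & c^-1 * a = t])) => [[c0 [a0 [cc0 ua0 e0]]]|no].
    exists (len SC c0^-1) => c a cc ua e.
    have e1 : c * c0^-1 = a * a0^-1.
      by apply: (mulIg a0); rewrite mulgVK -mulgA e0 -e mulVKg.
    exists (c * c0^-1).
      apply: (@C'P b); last by apply: subM => //; apply: subV.
      by rewrite e1; apply: subM => //; apply: subV.
    by rewrite /wd mulKg.
  by exists 0 => c a cc ua e; case: no; exists c, a.
have [F hF] := choice pick; have [M hM] := seq_bound F L.
exists M => c a cc ua dca; have tL : c^-1 * a \in L.
  by apply: hL => //; apply: subVM => //; [apply: CU|apply: U'U].
have [p cp dp] := hF _ _ _ cc ua erefl; exists p => //; exact: leq_trans dp (hM _ tL).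
Qed.

(** Each nearest point projection keeps the point near [W']: the new point is near a geodesic
    between two points of a coset of [U'], by quasiconvexity near this coset, and in [z C], so
    [coset_near] applies. The error grows with the number of edges; [Pi_near] makes it uniform by
    means of [Pi_acyl], restarting the projection [K] edges before its end. *)
Let Pi_near_rec j : exists rho, forall x z, W' x -> W' z -> l (x^-1 * z) <= j ->
  exists c, [/\ W' c, cosC z c & dC (Pi x z) c <= rho].
Proof.
elim: j => [|j [rho IH]].
  exists 0 => x z Wx Wz l0; have cxz : cosC x z.
    by apply: (l0C ts); [apply: Wdiv; apply: W'W|lia].
  exists x; rewrite (Pi_0 cxz) (gm0 (gmSC x)) //; last exact: cosCg.
  by split=> //; apply: cosC_sym.
have [rho0 hr0] : exists rho0, forall b c a, C c -> gen (S' b) a -> db b c a <= r + delta + k' ->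
    exists2 p, C' p & dC c p <= rho0.
  have [r1 h1] := coset_near true (r + delta + k'); have [r2 h2] := coset_near false (r + delta + k').
  exists (maxn r1 r2) => -[] c a cc ua dd.
    by have [p cp dp] := h1 _ _ cc ua dd; exists p => //; apply: leq_trans dp (leq_maxl _ _).
  by have [p cp dp] := h2 _ _ cc ua dd; exists p => //; apply: leq_trans dp (leq_maxr _ _).
exists (rho + (lam * (lam * rho + 2 * r + delta) + rho0))%N => x z Wx Wz lj.
case: (leqP (l (x^-1 * z)) j) => lj'.
  by have [c [Wc cc dc]] := IH x z Wx Wz lj'; exists c; split=> //; lia.
have [b [h [Wh us ex nx lh]]] := @step' x z j Wx Wz (ltac:(lia)).
have [c [Wc cc dc]] := IH x h Wx Wh (ltac:(lia)).
have Wx0 := W'W Wx; have Wh0 := W'W Wh; have Wz0 := W'W Wz.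
have uzh : cosU b z h by apply: U'U.
have gm := gmU b z.
have cPh := Pi_in Wx0 Wh0; have cPz := Pi_in Wx0 Wz0.
have u1 := cosU_trans uzh (cosCU b cPh); have u2 := cosU_trans uzh (cosCU b cc).
have n1 := Pi_gate Wx0 Wh0 nx (cosU_sym uzh).
have [v nv] := nearest_exists (db b) c (cosCg z); have [cv _] := nv.
have d1 : dC (Pi x z) v <= lam * (lam * rho + 2 * r + delta).
  apply: leq_trans (dC_db b cPz cv) _; rewrite leq_mul2l; apply/orP; right.
  have := nearest_dich gm (@hUg b z) (@cosCU b z) (@qcCg b z) u1 u2 n1 nv; rewrite -/r.
  have := db_dC b cPh cc; have : lam * dC (Pi x h) c <= lam * rho by rewrite leq_mul2l dc orbT.
  lia.
have bv := nearest_btw gm (@hUg b z) (@cosCU b z) (@qcCg b z) u2 nv (cosCg z).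
rewrite -/r in bv.
have uv := cosCU b cv; have uz := cosUg b z.
have [q [uq bq dq]] := btw_near gm (@hUg b z) u2 uz uv bv.
have czc : gen (S' b) (z^-1 * c).
  by apply: W'U u2; apply: W'div.
have [a ua da] : exists2 a, gen (S' b) (z^-1 * a) & db b q a <= k'.
  have [|a ua da] := @qcU' b (z^-1 * c) 1 (z^-1 * q) czc (sub1 (@sU' b)) uq.
    by rewrite -(mulVg z) /btw !wd_mul.
  by exists (z * a); rewrite ?mulKg // -(mulVKg z q) wd_mul.
have [p cp dp] : exists2 p, C' p & dC (z^-1 * v) p <= rho0.
  apply: (hr0 b _ (z^-1 * a)) => //; rewrite wd_mul.
  have := gmT gm uv uq (U'U ua); lia.
exists (z * p); split.
- by apply: subM => //; apply: (tsUW (U := U') (C'U' true cp)).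
- by rewrite /cosC mulKg; case: cp.
have cp' : cosC z (z * p) by rewrite /cosC mulKg; case: cp.
have e : dC v (z * p) = dC (z^-1 * v) p by rewrite -{1}(mulVKg z v) wd_mul.
have := gmT (gmSC z) cPz cv cp'; lia.
Qed.

Let Pi_near : exists rho, forall x z, W' x -> W' z ->
  exists c, [/\ W' c, cosC z c & dC (Pi x z) c <= rho].
Proof.
have [rho h1] := Pi_near_rec K; have [Phi h2] := Pi_acyl.
exists (Phi + rho)%N => x z Wx Wz.
case: (leqP (l (x^-1 * z)) K) => lK.
  by have [c [Wc cc dc]] := h1 x z Wx Wz lK; exists c; split=> //; lia.
have [h [Wh l1 l2]] := prefix' Wx Wz (ltnW lK).
have [|c [Wc cc dc]] := h1 h z Wh Wz; first by rewrite l1.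
have Wx0 := W'W Wx; have Wh0 := W'W Wh; have Wz0 := W'W Wz.
have h3 := h2 x h z h Wx0 Wh0 Wz0 Wh0 l1 l2.
have h4 : dC (Pi x z) (Pi h z) <= Phi.
  by apply: h3; rewrite mulVg (ts_l0 ts (sub1 sC)) l1.
exists c; split=> //.
by have := gmT (gmSC z) (Pi_in Wx0 Wz0) (Pi_in Wh0 Wz0) cc; lia.
Qed.

(** In each vertex on the path, [Pi_near] puts both ends of the interval of [eta 1 x] near [W'], and
    quasiconvexity of [U'] in the factor keeps the whole interval near [W']. *)
Theorem sub_amalgam_undist : undist (fun x => S' true x \/ S' false x) SW.
Proof.
have [_ [m [_ _ hm]]] := combination_hyp; have [rho hr] := Pi_near.
have W'E x : gen (fun x => S' true x \/ S' false x) x <-> W' x.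
  split; apply: gen_min; try exact: gen_subgrp.
    by move=> s [h|h]; apply: gen_in; [left|right]; apply: gen_in.
  by move=> s [|] [n /(@wl_mono _ _ (fun x => S' true x \/ S' false x))] h;
     exists n; apply: h => t; [left|right].
apply: (qc_undist (R := m + (4 * lam * rho + delta + k')) fin_SW) => [x /W'E /W'W /SW_gen //|].
move=> x p /W'E Wx /SW_gen Wp bp.
have W1 : W' 1 := sub1 sW'.
have Wx0 := W'W Wx; have W10 := W'W W1.
have [w ew dw] := hm _ _ _ W10 Wx0 Wp bp.
have Ww := eta_W ew.
suff [c Wc dc] : exists2 c, W' c & D w c <= 4 * lam * rho + delta + k'.
  exists c; first exact/W'E.
  by have := gmT gmW Wp Ww (W'W Wc); lia.
move: ew => [b [g [g' [[Wg ugg] nx ny e [uw bw]]]]].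
have Wg' := cosUW Wg ugg.
have t1 := l_tri ts (Wdiv W10 Wg) (Wdiv Wg Wx0).
have t2 := l_tri ts (Wdiv Wg Wg') (Wdiv Wg' Wx0).
have t3 := l_tri ts (Wdiv W10 Wg) (Wdiv Wg Wg').
have t4 := l_tri ts (Wdiv W10 Wg') (Wdiv Wg' Wx0).
rewrite !mulVA in t1 t2 t3 t4.
have [h Wh cgh] : exists2 h, W' h & cosC g h by apply: (edge' W1 Wx Wg); lia.
have [h' Wh' cgh'] : exists2 h', W' h' & cosC g' h' by apply: (edge' W1 Wx Wg'); lia.
have [c [Wc cc dc]] := hr 1 h W1 Wh; have [c' [Wc' cc' dc']] := hr x h' Wx Wh'.
rewrite (Pi_C W10 Wg cgh) in dc; rewrite (Pi_C Wx0 Wg' cgh') in dc'.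
have {}cc := cosC_trans cgh cc; have {}cc' := cosC_trans cgh' cc'.
have gm := gmU b g.
have u1 := cosCU b (Pi_in W10 Wg); have u2 := cosU_trans ugg (cosCU b (Pi_in Wx0 Wg')).
have uc := cosCU b cc; have uc' := cosU_trans ugg (cosCU b cc').
have d1 := db_dC b (Pi_in W10 Wg) cc; have d2 := db_dC b (Pi_in Wx0 Wg') cc'.
have d1' : lam * dC (Pi 1 g) c <= lam * rho by rewrite leq_mul2l dc orbT.
have d2' : lam * dC (Pi x g') c' <= lam * rho by rewrite leq_mul2l dc' orbT.
have bw' : btw (db b) (4 * lam * rho) c c' w.
  have := gmT gm uc u1 uw; have := gmT gm uw u2 uc'.
  have := gmT gm u1 uc u2; have := gmT gm uc uc' u2.
  rewrite (gmC gm uc u1) (gmC gm uc' u2); move: bw; rewrite /btw; lia.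
have [q [uq bq dq]] := btw_near gm (@hUg b g) uc uc' uw bw'.
have ucc' : gen (S' b) (c^-1 * c').
  by apply: W'U; [apply: W'div|apply: cosU_trans (cosU_sym uc) uc'].
have ucq := cosU_trans (cosU_sym uc) uq.
have s1 : gen (S' b) (c^-1 * c) by rewrite mulVg; apply: sub1.
have b1 : btw (db b) 0 (c^-1 * c) (c^-1 * c') (c^-1 * q) by move: bq; rewrite /btw !wd_mul.
have [a ua da] := qcU' s1 ucc' ucq b1.
exists (c * a); first by apply: subM => //; apply: (tsUW (U := U') ua).
have uca : cosU b c (c * a) by rewrite /cosU mulKg; apply: U'U.
have {}uca := cosU_trans uc uca.
have daq : db b q (c * a) <= k' by rewrite -(mulVKg c q) wd_mul.
apply: leq_trans (D_db (cosU_trans (cosU_sym uw) uca)) _.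
have := gmT gm uw uq uca; lia.
Qed.

End SubAmalgam.

End Combination.

(** * Hyperbolic and undistorted subgroups, independently of generators *)

Section HypSub.
Context (G : groupType).
Implicit Types (H A C : G -> Prop).

Definition fgen H S := fin S /\ forall x : G, gen S x <-> H x.
Definition hypsub H := exists S delta, fgen H S /\ hyp (gen S) (wd S) delta.
(** Required for all finite generating sets; by [undist_change], one pair is enough. The condition
    is empty unless both subgroups are finitely generated, which explains the hypothesis on the
    middle subgroup in [qisub_trans]. *)
Definition qisub H A := forall S S', fgen H S -> fgen A S' -> undist S S'.

Lemma hypsub_fgen H : hypsub H -> exists S, fgen H S.
Proof. by move=> [S [_ [h _]]]; exists S. Qed.

Lemma hypsub_any H S : hypsub H -> fgen H S -> exists delta, hyp (gen S) (wd S) delta.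
Proof.
move=> [S0 [delta [[f0 e0] h0]]] [f e]; apply: (hyp_change f0 f) h0 => x.
by split=> [/e0 /e|/e /e0].
Qed.

Lemma qisub_ex H A S S' : (forall x, H x -> A x) -> fgen H S -> fgen A S' ->
  undist S S' -> qisub H A.
Proof.
move=> HA [f e] [f' e'] u T T' [fT eT] [fT' eT']; apply: undist_change u => //.
- by move=> x; split=> [/e /eT|/eT /e].
- by move=> x; split=> [/e' /eT'|/eT' /e'].
by move=> x /e /HA /e'.
Qed.

Lemma qisub_trans H A B : (exists S, fgen A S) -> (forall x, H x -> A x) ->
  qisub H A -> qisub A B -> qisub H B.
Proof.
move=> [S1 g1] HA h1 h2 S S' g g'; have [a ha] := h1 _ _ g g1; have [b hb] := h2 _ _ g1 g'.
exists (a * b)%N => x gx; apply: (leq_trans (ha _ gx)).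
by rewrite -mulnA leq_mul2l hb ?orbT //; apply/g1.2/HA/g.2.
Qed.

Lemma qisub_refl H : qisub H H.
Proof.
move=> S S' [_ e] [[s f] e']; have [lam hl] : exists lam, forall x, gen S' x -> len S x <= lam * len S' x.
  by apply: (bilip f) => x /gen_in /e' /e.
by exists lam => x /e /e' /hl.
Qed.

Definition acylindrical_split (A : bool -> G -> Prop) C (l : G -> nat) :=
  exists K M, forall t, gen (factors A) t -> K <= l t -> forall s : seq G, uniq s ->
    (forall c, c \in s -> C c /\ C (t^-1 * c * t)) -> size s <= M.

Section Split.
Context (A : bool -> G -> Prop) (C : G -> Prop) (l : G -> nat).
Hypotheses (ts : tree_split A C l) (hA : forall b, hypsub (A b))
  (fC : exists SC, fgen C SC) (qC : forall b, qisub C (A b))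
  (acyl : acylindrical_split A C l).

Lemma hyp_mono (X : Type) (W : X -> Prop) d a b : a <= b -> hyp W d a -> hyp W d b.
Proof. by move=> ab h x y z w Wx Wy Wz Ww; have := h x y z w Wx Wy Wz Ww; lia. Qed.

Lemma quasiconvex_mono (X : Type) (W Q : X -> Prop) d a b : a <= b ->
  quasiconvex W d Q a -> quasiconvex W d Q b.
Proof.
move=> ab h c c' p Cc Cc' Wp bp; have [c2 h1 h2] := h c c' p Cc Cc' Wp bp.
by exists c2 => //; lia.
Qed.

(** Fixes one choice of generators and constants common to both factors, shared by the two theorems
    drawn from it. *)
Lemma combination_aux : exists S, [/\ forall b, fgen (A b) (S b),
  exists delta', hyp (gen (SW S)) (wd (SW S)) delta', forall b, undist (S b) (SW S) &
  forall A' : bool -> G -> Prop, (forall b, exists S', fgen (A' b) S') ->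
    (forall b x, A' b x -> A b x) -> (forall b x, A' b x -> C x -> A' (~~ b) x) ->
    (forall b, qisub (A' b) (A b)) ->
    exists S', (forall b, fgen (A' b) (S' b)) /\
      undist (fun x => S' true x \/ S' false x) (SW S)].
Proof.
have [S0 gS] := choice (fun b => hypsub_fgen (hA b)).
have [SC gSC] := fC.
have eA : A = (fun b => gen (S0 b)).
  by apply/funext => b; apply/funext => x; apply/propext; split=> /(gS b).2.
have eC : C = gen SC by apply/funext => x; apply/propext; split=> /gSC.2.
have ts0 := ts; rewrite eA eC in ts0.
have fS b : fin (S0 b) by case: (gS b).
have CU b x : gen SC x -> gen (S0 b) x by move=> h; apply: (ts_CU ts0).
have [Dl hDl] : exists Dl, forall b, hyp (gen (S0 b)) (wd (S0 b)) Dl.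
  have [d1 h1] := hypsub_any (hA true) (gS true).
  have [d2 h2] := hypsub_any (hA false) (gS false).
  by exists (maxn d1 d2) => -[]; [apply: hyp_mono h1|apply: hyp_mono h2]; lia.
have und b := qC gSC (gS b).
have data b : exists k lam, [/\
    quasiconvex (gen (S0 b)) (wd (S0 b)) (gen SC) k,
    forall x, gen SC x -> len SC x <= lam * len (S0 b) x,
    forall x, gen SC x -> len (S0 b) x <= lam * len SC x,
    forall x y p, gen SC x -> gen SC y -> gen (S0 b) p -> btw (wd (S0 b)) 0 x y p ->
      exists c, [/\ gen SC c, btw (wd SC) 0 x y c & wd (S0 b) p c <= k] &
    forall x y c, gen SC x -> gen SC y -> gen SC c -> btw (wd SC) 0 x y c ->
      exists p, [/\ gen (S0 b) p, btw (wd (S0 b)) 0 x y p & wd (S0 b) c p <= k]].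
  have [k1 q1] := undist_qc (CU b) gSC.1 (und b) (hDl b).
  have [l1 hl1] := und b; have [l2 hl2] := coarse_lip (CU b) gSC.1.
  have [_ [k2 [_ h1 h2]]] := undist_hyp (CU b) gSC.1 (und b) (hDl b).
  exists (maxn k1 k2), (maxn l1 l2); split.
  - by apply: quasiconvex_mono q1; lia.
  - by move=> x /hl1; nia.
  - by move=> x /hl2; nia.
  - by move=> x y p gx gy gp b0; have [c [c1 c2 c3]] := h1 x y p gx gy gp b0; exists c; split=> //; lia.
  by move=> x y c gx gy gc b0; have [p [c1 c2 c3]] := h2 x y c gx gy gc b0; exists p; split=> //; lia.
have [kf hk] := choice data; have [lf hlf] := choice hk.
pose k := maxn (kf true) (kf false); pose lam := maxn (lf true) (lf false).
have kb b : kf b <= k by rewrite /k; case: b; lia.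
have lb b : lf b <= lam by rewrite /lam; case: b; lia.
have H1 b : quasiconvex (gen (S0 b)) (wd (S0 b)) (gen SC) k.
  by case: (hlf b) => q _ _ _ _; apply: quasiconvex_mono q.
have H2 b x : gen SC x -> len SC x <= lam * len (S0 b) x.
  case: (hlf b) => _ q _ _ _ /q h; apply: (leq_trans h); rewrite leq_mul2r lb orbT //.
have H3 b x : gen SC x -> len (S0 b) x <= lam * len SC x.
  case: (hlf b) => _ _ q _ _ /q h; apply: (leq_trans h); rewrite leq_mul2r lb orbT //.
have H4 b x y p : gen SC x -> gen SC y -> gen (S0 b) p -> btw (wd (S0 b)) 0 x y p ->
    exists c, [/\ gen SC c, btw (wd SC) 0 x y c & wd (S0 b) p c <= k].
  case: (hlf b) => _ _ _ q _ gx gy gp b0; have [c [c1 c2 c3]] := q x y p gx gy gp b0.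
  by exists c; split=> //; apply: leq_trans c3 (kb b).
have H5 b x y c : gen SC x -> gen SC y -> gen SC c -> btw (wd SC) 0 x y c ->
    exists p, [/\ gen (S0 b) p, btw (wd (S0 b)) 0 x y p & wd (S0 b) c p <= k].
  case: (hlf b) => _ _ _ _ q gx gy gc b0; have [p [c1 c2 c3]] := q x y c gx gy gc b0.
  by exists p; split=> //; apply: leq_trans c3 (kb b).
have [K [M hacyl]] := acyl; rewrite eA eC in hacyl.
exists S0; split=> //.
- have [d' [_ [h _ _]]] := combination_hyp ts0 fS hDl H1 H2 H3 H4 H5 hacyl.
  by exists d' => x y z w /(SW_gen S0) Wx /(SW_gen S0) Wy /(SW_gen S0) Wz /(SW_gen S0) Ww; apply: h.
- by move=> b; apply: (combination_undist ts0 fS hDl H1 H2 H3 H4 H5 hacyl).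
move=> A' fA' A'A A'C qA'.
have [S' gS'] := choice fA'.
exists S'; split=> //.
have sub b x : gen (S' b) x -> gen (S0 b) x by move=> /(gS' b).2 /A'A /(gS b).2.
have [k' qk'] : exists k', forall b, quasiconvex (gen (S0 b)) (wd (S0 b)) (gen (S' b)) k'.
  have q b := undist_qc (sub b) (gS' b).1 (qA' b _ _ (gS' b) (gS b)) (hDl b).
  have [kk hkk] := choice q; exists (maxn (kk true) (kk false)) => b.
  by apply: quasiconvex_mono (hkk b); case: (b); lia.
apply: (sub_amalgam_undist ts0 fS hDl H1 H2 H3 H4 H5 hacyl sub _ qk').
by move=> b x /(gS' b).2 h /gSC.2 c; apply: ((gS' (~~ b)).2 x).2; apply: A'C h c.
Qed.

Lemma fgen_factors (A0 : bool -> G -> Prop) S : (forall b, fgen (A0 b) (S b)) ->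
  fgen (gen (factors A0)) (fun x => S true x \/ S false x).
Proof.
move=> gS; split.
  have [s hs] := (gS true).1; have [s' hs'] := (gS false).1; exists (s ++ s') => x.
  by rewrite mem_cat; split=> [[/hs ->|/hs' ->]|/orP [/hs|/hs']]; rewrite ?orbT //; [left|right].
move=> x; split; apply: gen_min; try exact: gen_subgrp.
  by move=> s [h|h]; apply: gen_in; [left; apply/(gS true).2|right; apply/(gS false).2]; apply: gen_in.
by move=> s [/(gS true).2|/(gS false).2] [n h]; exists n; apply: (wl_mono _ h) => t ht;
  [left|right].
Qed.

Theorem combination : hypsub (gen (factors A)) /\ forall b, qisub (A b) (gen (factors A)).
Proof.
have [S [gS [d hd] und _]] := combination_aux; have gW := fgen_factors gS.
split; first by exists (SW S), d.
move=> b; apply: qisub_ex (gS b) gW (und b) => x.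
by move=> h; apply: gen_in; case: (b) h; [left|right].
Qed.

Theorem combination_sub (A' : bool -> G -> Prop) : (forall b, exists S', fgen (A' b) S') ->
  (forall b x, A' b x -> A b x) -> (forall b x, A' b x -> C x -> A' (~~ b) x) ->
  (forall b, qisub (A' b) (A b)) -> qisub (gen (factors A')) (gen (factors A)).
Proof.
move=> fA' A'A A'C qA'; have [S [gS _ _ sub]] := combination_aux.
have [S' [gS' und]] := sub A' fA' A'A A'C qA'.
apply: (qisub_ex _ (fgen_factors gS') (fgen_factors gS) und).
apply: gen_min; first exact: gen_subgrp.
by move=> x [/A'A|/A'A] h; apply: gen_in; [left|right].
Qed.

End Split.
End HypSub.

(** * Presentations and pushouts *)

Section PresentedTheory.
Context (X : choiceType) (rel_ : fword X -> fword X -> Prop).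
Local Notation P := (presented rel_).

Definition feval (H : groupType) (phi : X -> H) (w : seq (bool * X)) : H :=
  foldr (fun p h => (if p.1 then (phi p.2)^-1 else phi p.2) * h) 1 w.

Lemma feval_cat (H : groupType) (phi : X -> H) u v :
  feval phi (u ++ v) = feval phi u * feval phi v.
Proof. by elim: u => [|p u IH] /=; rewrite ?mul1g // IH mulgA. Qed.

Lemma feval_eqv (H : groupType) (phi : X -> H) :
  (forall u v, rel_ u v -> feval phi u = feval phi v) ->
  forall u v, clos_refl_sym_trans _ (word_step rel_) u v -> feval phi u = feval phi v.
Proof.
move=> hr u v; elim=> [{}u {}v [a b e x|a b u1 v1 /hr h]|//|? ? _ -> //|? ? ? _ -> _ -> //].
  rewrite !feval_cat /=; congr (_ * _); case: e => /=; first by rewrite mulKg.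
  by rewrite mulVKg.
by rewrite !feval_cat h.
Qed.

Lemma pi_word (w : seq (bool * X)) :
  (\pi_(P) w)%qT = feval (pres_gen rel_) w.
Proof.
elim: w => [//|[e x] w IH] /=.
have -> : (\pi_P ((e, x) :: w))%qT = (\pi_P [:: (e, x)])%qT * (\pi_P w)%qT :> P.
  by symmetry; apply: (pres_mulE rel_ [:: (e, x)] w).
rewrite IH; congr (_ * _); case: e => //.
apply: (mulIg (pres_gen rel_ x)); rewrite mulVg; apply: etrans (pres_mulE rel_ _ _) _.
by apply/pres_piP; apply: rst_step; apply: (step_cancel rel_ [::] [::] true x).
Qed.

Lemma pres_rel u v : rel_ u v -> feval (pres_gen rel_) u = feval (pres_gen rel_) v.
Proof.
move=> r; rewrite -!pi_word; apply/pres_piP; apply: rst_step.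
by have := step_rel [::] [::] r; rewrite !cats0.
Qed.

Lemma pres_ind (H : P -> Prop) : subgrp H -> (forall x, H (pres_gen rel_ x)) -> forall g, H g.
Proof.
move=> sH hx g; rewrite -[g]reprK pi_word; elim: (repr g) => [|[e x] w IH] /=; first exact: sub1.
by apply: subM => //; case: e => //; apply: subV.
Qed.

Section Universal.
Context (H : groupType) (phi : X -> H).
Hypothesis phi_rel : forall u v, rel_ u v -> feval phi u = feval phi v.

Definition pres_lift (g : P) : H := feval phi (repr g).

Lemma pres_lift_pi w : pres_lift (\pi_P w)%qT = feval phi w.
Proof. by apply: (feval_eqv phi_rel); apply/pres_piP; rewrite reprK. Qed.

Lemma pres_liftM g h : pres_lift (g * h) = pres_lift g * pres_lift h.
Proof.
rewrite -[g]reprK -[h]reprK.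
have -> : (\pi_P (repr g))%qT * (\pi_P (repr h))%qT = (\pi_P (repr g ++ repr h))%qT :> P.
  exact: pres_mulE.
by rewrite !pres_lift_pi feval_cat.
Qed.

Lemma pres_lift_gen x : pres_lift (pres_gen rel_ x) = phi x.
Proof. by rewrite /pres_gen pres_lift_pi /= mulg1. Qed.

End Universal.
End PresentedTheory.

Definition morph (G H : groupType) (f : G -> H) := forall x y, f (x * y) = f x * f y.

Section Morph.
Context (G H : groupType) (f : G -> H).
Hypothesis fM : morph f.
Lemma morph1 : f 1 = 1.
Proof. by apply: (mulIg (f 1)); rewrite -fM !mul1g. Qed.
Lemma morphV x : f x^-1 = (f x)^-1.
Proof. by apply: (mulIg (f x)); rewrite -fM !mulVg morph1. Qed.
End Morph.

(** * Normal forms in an amalgamated product *)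

Section Pushout.
Context (K : groupType) (AB : bool -> groupType) (iota : forall b, K -> AB b).
Hypotheses (iM : forall b, morph (iota b)) (iI : forall b, injective (iota b)).

Inductive po_letter : Type := PoL (b : bool) (x : AB b).
HB.instance Definition _ := gen_eqMixin po_letter.
HB.instance Definition _ := gen_choiceMixin po_letter.

Inductive po_rel : fword po_letter -> fword po_letter -> Prop :=
| po_mul b (x y : AB b) : po_rel [:: (false, PoL x); (false, PoL y)] [:: (false, PoL (x * y))]
| po_glue (k : K) : po_rel [:: (false, PoL (iota true k))] [:: (false, PoL (iota false k))].

Definition pushout : groupType := presented po_rel.
Definition po_in b (x : AB b) : pushout := pres_gen po_rel (PoL x).

Lemma po_inM b : morph (@po_in b).
Proof. by move=> x y; have := pres_rel (po_mul x y); rewrite /= !mulg1 => ->. Qed.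

Lemma po_in_glue k b b' : po_in (iota b k) = po_in (iota b' k).
Proof.
by have := pres_rel (po_glue k); rewrite /= !mulg1 => h; case: b; case: b'.
Qed.

(* Normal forms: an element of [K] followed by an alternating list of
   representatives of the cosets of [K] in the two factors. *)
Let inK b (y : AB b) := exists k, iota b k = y.

(** The predicate given to [pick_or] depends only on the coset [K y], hence so does the choice: this
    is how [rep_Kmul] holds. *)
Definition rep b (y : AB b) : AB b :=
  if pselect (inK y) then 1 else pick_or (fun z => inK (z * y^-1)) 1.

Let inKM b (x y : AB b) : inK x -> inK y -> inK (x * y).
Proof. by move=> [k <-] [k' <-]; exists (k * k'); rewrite iM. Qed.
Let inKV b (x : AB b) : inK x -> inK x^-1.
Proof. by move=> [k <-]; exists k^-1; rewrite (morphV (@iM b)). Qed.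
Let inK1 b : inK (1 : AB b).
Proof. by exists 1; rewrite (morph1 (@iM b)). Qed.

Lemma rep_spec b (y : AB b) : inK (y * (rep y)^-1).
Proof.
rewrite /rep; case: pselect => h; first by rewrite invg1 mulg1.
have : inK (pick_or (fun z => inK (z * y^-1)) 1 * y^-1).
  by apply: (@pick_orP _ (fun z => inK (z * y^-1)) 1 y); rewrite mulgV.
by move/inKV; rewrite invgM invgK.
Qed.

Lemma rep_K b (k : K) : rep (iota b k) = 1.
Proof. by rewrite /rep; case: pselect => // -[]; exists k. Qed.

Lemma rep_Kmul b (k : K) (y : AB b) : rep (iota b k * y) = rep y.
Proof.
have hk : inK (iota b k) by exists k.
rewrite /rep; case: pselect => h1; case: pselect => h2 //.
- by case: h2; rewrite -(mulKg (iota b k) y); apply: inKM => //; apply: inKV.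
- by case: h1; apply: inKM.
congr (pick_or _ _); apply/funext => z; apply/propext; rewrite invgM mulgA; split=> h.
  by rewrite -(mulgVK (iota b k) (z * y^-1)); apply: inKM.
by apply: inKM => //; apply: inKV.
Qed.

Lemma rep_eq1 b (y : AB b) : rep y = 1 -> inK y.
Proof. by move=> h; have := rep_spec y; rewrite h invg1 mulg1. Qed.

Definition kap b (y : AB b) : K := pick_or (fun k => iota b k = y * (rep y)^-1) 1.

Lemma kapP b (y : AB b) : iota b (kap y) * rep y = y.
Proof.
have [k hk] := rep_spec y.
rewrite (@pick_orP _ (fun k => iota b k = y * (rep y)^-1) 1 k hk) mulgVK //.
Qed.

Lemma kap_Kmul b k (y : AB b) : kap (iota b k * y) = k * kap y.
Proof.
apply: (@iI b); apply: (mulIg (rep (iota b k * y))).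
by rewrite kapP iM rep_Kmul -mulgA kapP.
Qed.

Lemma kap_K b k : kap (iota b k) = k.
Proof. by apply: (@iI b); have := kapP (iota b k); rewrite rep_K mulg1. Qed.

Definition as_b b (p : po_letter) : option (AB b) :=
  let: PoL b' t := p in
  if Bool.bool_dec b' b is left e then Some (eq_rect b' (fun b => AB b) t b e) else None.

Lemma as_bb b (t : AB b) : as_b b (PoL t) = Some t.
Proof. by case: b t. Qed.
Lemma as_bN b (t : AB b) : as_b (~~ b) (PoL t) = None.
Proof. by case: b t. Qed.

Lemma as_b_Some b p (t : AB b) : as_b b p = Some t -> p = PoL t.
Proof.
case: p => b' t' /=; case: Bool.bool_dec => // e; subst b'; by move=> [->].
Qed.

Definition nh b (s : seq po_letter) := if s is p :: _ then as_b b p = None else True.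

Fixpoint valid (s : seq po_letter) : Prop :=
  if s is p :: s' then
    (let: PoL b t := p in [/\ rep t = t, t <> 1 & nh b s']) /\ valid s'
  else True.

Definition norm b (y : AB b) (s : seq po_letter) : K * seq po_letter :=
  (kap y, if rep y == 1 then s else PoL (rep y) :: s).

Definition opn b (s : K * seq po_letter) : AB b * seq po_letter :=
  if s.2 is p :: s' then if as_b b p is Some t then (iota b s.1 * t, s') else (iota b s.1, s.2)
  else (iota b s.1, s.2).

(** Van der Waerden's method: a factor acts on normal forms by opening the form into an element of
    this factor and a rest, multiplying, and closing it again. The defining relations hold for this
    action, so the pushout acts, and lengths are read off the orbit of the empty form. *)
Definition act b (x : AB b) s := norm (x * (opn b s).1) (opn b s).2.

Lemma rep_idem b (y : AB b) : rep (rep y) = rep y.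
Proof. by rewrite -{2}(kapP y) rep_Kmul. Qed.

Lemma opn_norm b (y : AB b) s : nh b s -> opn b (norm y s) = (y, s).
Proof.
move=> hs; rewrite /norm /opn /=; case: eqP => [e|_]; last by rewrite as_bb kapP.
have := kapP y; rewrite e mulg1 => ->.
by case: s hs => [//|p s] /= ->.
Qed.

Lemma norm_opn b s : valid s.2 -> norm (opn b s).1 (opn b s).2 = s.
Proof.
case: s => k [|p s] /=; rewrite /norm /opn /=; first by rewrite kap_K rep_K eqxx.
case e : (as_b b p) => [t|] [hp hs] /=; last by rewrite kap_K rep_K eqxx.
rewrite (as_b_Some e) in hp *; case: hp => h1 h2 _; rewrite kap_Kmul rep_Kmul h1.
case: eqP => // _; congr (_, _).
have := kapP t; rewrite h1 => h; have : iota b (kap t) = iota b 1.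
  by rewrite (morph1 (@iM b)); apply: (mulIg t); rewrite h mul1g.
by move/(@iI b) => ->; rewrite mulg1.
Qed.

Lemma opn_valid b s : valid s.2 -> valid (opn b s).2 /\ nh b (opn b s).2.
Proof.
case: s => k [|p s] //=; rewrite /opn /=; case e : (as_b b p) => [t|] //= [hp hs].
by rewrite (as_b_Some e) in hp; case: hp.
Qed.

Lemma norm_valid b (y : AB b) s : valid s -> nh b s -> valid (norm y s).2.
Proof.
move=> vs ns; rewrite /norm /=; case: eqP => // h; split=> //; split=> //; exact: rep_idem.
Qed.

Lemma act_valid b (x : AB b) s : valid s.2 -> valid (act x s).2.
Proof. by move=> /(opn_valid b) [h1 h2]; apply: norm_valid. Qed.

Lemma actM b (x y : AB b) s : valid s.2 -> act (x * y) s = act x (act y s).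
Proof. by move=> /(opn_valid b) [h1 h2]; rewrite /act opn_norm //= mulgA. Qed.

Lemma act1 b s : valid s.2 -> act (1 : AB b) s = s.
Proof. by move=> vs; rewrite /act mul1g norm_opn. Qed.

Lemma actK b k s : valid s.2 -> act (iota b k) s = (k * s.1, s.2).
Proof.
by move=> vs; rewrite /act /norm kap_Kmul rep_Kmul -/(norm _ _) -[in RHS](norm_opn b vs).
Qed.

Definition actl (p : bool * po_letter) s :=
  let: PoL b x := p.2 in act (if p.1 then x^-1 else x) s.
Definition actw (w : seq (bool * po_letter)) s := foldr actl s w.

Lemma actw_valid w s : valid s.2 -> valid (actw w s).2.
Proof. by move=> vs; elim: w => [//|[e [b x]] w IH] /=; apply: act_valid. Qed.

Lemma actw_eqv u v : clos_refl_sym_trans _ (word_step po_rel) u v ->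
  forall s, valid s.2 -> actw u s = actw v s.
Proof.
elim=> {u v} [u v st|//|? ? _ IH s vs|? ? ? _ IH1 _ IH2 s vs]; last 2 first.
- by rewrite IH.
- by rewrite IH1 // IH2.
case: st => [a b e [b' x]|a b u' v' r] s vs; rewrite /actw !foldr_cat; congr foldr.
  rewrite /= /actl /=; have vb := actw_valid b vs; rewrite -actM //.
  by case: e => /=; rewrite ?mulVg ?mulgV act1.
have vb := actw_valid b vs; case: r => [b' x y|k] /=; first by rewrite /actl /= actM.
by rewrite /actl /= !actK.
Qed.

Definition actg (g : pushout) s := actw (repr g) s.

Lemma actg_pi w s : valid s.2 -> actg (\pi_(pushout) w)%qT s = actw w s.
Proof. by apply: actw_eqv; apply/pres_piP; rewrite reprK. Qed.

Lemma actgM g h s : valid s.2 -> actg (g * h) s = actg g (actg h s).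
Proof.
move=> vs; rewrite -{1}[g]reprK -{1}[h]reprK.
have -> : (\pi_(pushout) (repr g))%qT * (\pi_(pushout) (repr h))%qT
    = (\pi_(pushout) (repr g ++ repr h))%qT :> pushout by exact: pres_mulE.
by rewrite actg_pi // /actw foldr_cat.
Qed.

Lemma actg_in b (x : AB b) s : valid s.2 -> actg (po_in x) s = act x s.
Proof. by move=> vs; rewrite /po_in /pres_gen actg_pi. Qed.

Definition po_U b (g : pushout) := exists x : AB b, g = po_in x.
Definition po_C (g : pushout) := exists k : K, g = po_in (iota true k).
Definition po_l (g : pushout) : nat := size (actg g (1, [::])).2.

Lemma po_red n a b (x : pushout) s : valid s.2 -> nh b s.2 -> red po_U po_C n a b x ->
  size (actg x s).2 = n + size s.2 /\ nh (~~ a) (actg x s).2.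
Proof.
elim: n a b x s => [//|n IH] a b x s vs ns [y [z [[t ->] nz -> h]]].
have ev : actg (po_in t) s = norm (t * iota b s.1) s.2.
  rewrite actg_in // /act /opn; case: s vs ns => k [|p s] //= vs ->//.
have nt : rep (t * iota b s.1) <> 1.
  move=> /rep_eq1 [k hk]; apply: nz; exists (k * s.1^-1).
  rewrite (po_in_glue _ true b) iM (morphV (@iM b)) hk mulgK //.
have e2 : (actg (po_in t) s).2 = PoL (rep (t * iota b s.1)) :: s.2.
  by rewrite ev /norm /=; case: eqP.
have v2 : valid (actg (po_in t) s).2 by rewrite actg_in //; apply: act_valid.
have n2 : nh (~~ b) (actg (po_in t) s).2 by rewrite e2 /= -/(as_b (~~ b) (PoL _)) as_bN.
rewrite actgM //; case: h => [[-> -> ->]|h].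
  have e1 : actg 1 (actg (po_in t) s) = actg (po_in t) s by apply: (@actg_pi [::] _ v2).
  by rewrite e1; split=> //; rewrite e2.
have [h1 h2] := IH _ _ _ _ v2 n2 h; rewrite h1 e2 /= addnS; split=> //.
Qed.

Theorem pushout_split : tree_split po_U po_C po_l.
Proof.
have im b : subgrp (po_U b).
  split=> [|x y [a ->] [a' ->]|x [a ->]].
  - by exists 1; rewrite (morph1 (@po_inM b)).
  - by exists (a * a'); rewrite po_inM.
  by exists a^-1; rewrite (morphV (@po_inM b)).
split=> //.
- split=> [|x y [a ->] [a' ->]|x [a ->]].
  + by exists 1; rewrite (morph1 (@iM true)) (morph1 (@po_inM true)).
  + by exists (a * a'); rewrite iM po_inM.
  by exists a^-1; rewrite (morphV (@iM true)) (morphV (@po_inM true)).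
- by move=> b c [k ->]; exists (iota b k); apply: po_in_glue.
- by move=> c [k ->]; rewrite /po_l actg_in // actK.
by move=> n a b x /(po_red (s := (1, [::])) I I) [h _]; rewrite /po_l h addn0.
Qed.

Lemma po_in_inj b : injective (@po_in b).
Proof.
move=> x y e; have ex (z : AB b) : actg (po_in z) (1, [::]) = norm z [::].
  by rewrite actg_in // /act /opn /= (morph1 (@iM _)) mulg1.
have := ex x; rewrite e ex /norm => -[h1 h2].
have h3 : rep x = rep y.
  case: eqP h2 => [->|_]; case: eqP => [->|_] // h2.
  have := congr1 (fun s => if s is p :: _ then as_b b p else None) h2.
  by rewrite !as_bb => -[].
by rewrite -(kapP x) -(kapP y) h1 h3.
Qed.

Lemma po_ind (H : pushout -> Prop) : subgrp H -> (forall b (x : AB b), H (po_in x)) -> forall g, H g.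
Proof. by move=> sH h; apply: pres_ind => // -[b x]; apply: h. Qed.

Section PushoutLift.
Context (Q : groupType) (f : forall b, AB b -> Q).
Hypotheses (fM : forall b, morph (@f b)) (fg : forall k, f (iota true k) = f (iota false k)).

Definition po_lift : pushout -> Q := pres_lift (fun p => let: PoL b x := p in f x).

Let frel u v : po_rel u v -> feval (fun p => let: PoL b x := p in f x) u
  = feval (fun p => let: PoL b x := p in f x) v.
Proof. by case=> [b x y|k] /=; rewrite !mulg1 ?fM ?fg. Qed.

Lemma po_liftM : morph po_lift.
Proof. exact: pres_liftM frel. Qed.
Lemma po_lift_in b (x : AB b) : po_lift (po_in x) = f x.
Proof. exact: pres_lift_gen frel _. Qed.

End PushoutLift.
End Pushout.

Section SubgroupType.
Context (G : groupType) (H : G -> Prop) (sH : subgrp H).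

Definition subg_of (_ : subgrp H) : Type := {x : G | H x}.
Local Notation T := (subg_of sH).

HB.instance Definition _ := gen_eqMixin T.
HB.instance Definition _ := gen_choiceMixin T.

Lemma subg_val_inj (x y : T) : sval x = sval y -> x = y.
Proof. by case: x y => [x hx] [y hy] /= e; subst y; rewrite (Prop_irrelevance hx hy). Qed.

Definition subg_one : T := exist _ 1 (sub1 sH).
Definition subg_mul (x y : T) : T := exist _ (sval x * sval y) (subM sH (svalP x) (svalP y)).
Definition subg_inv (x : T) : T := exist _ (sval x)^-1 (subV sH (svalP x)).

Lemma subg_mulA : associative subg_mul.
Proof. by move=> x y z; apply: subg_val_inj; rewrite /= mulgA. Qed.
Lemma subg_mul1 : left_id subg_one subg_mul.
Proof. by move=> x; apply: subg_val_inj; rewrite /= mul1g. Qed.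
Lemma subg_1mul : right_id subg_one subg_mul.
Proof. by move=> x; apply: subg_val_inj; rewrite /= mulg1. Qed.
Lemma subg_mulV : left_inverse subg_one subg_inv subg_mul.
Proof. by move=> x; apply: subg_val_inj; rewrite /= mulVg. Qed.
Lemma subg_Vmul : right_inverse subg_one subg_inv subg_mul.
Proof. by move=> x; apply: subg_val_inj; rewrite /= mulgV. Qed.

HB.instance Definition _ := isGroup.Build T subg_mulA subg_mul1 subg_1mul subg_mulV subg_Vmul.

Definition subg : groupType := T.

Lemma subg_valM (x y : subg) : sval (x * y) = sval x * sval y.
Proof. by []. Qed.

End SubgroupType.

Lemma red_morph (G Q : groupType) (U : bool -> G -> Prop) C (V : bool -> Q -> Prop) D
    (f : G -> Q) : morph f -> (forall b x, U b x -> V b (f x)) ->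
  (forall b x, U b x -> D (f x) -> C x) ->
  forall n a b x, red U C n a b x -> red V D n a b (f x).
Proof.
move=> fM UV DC; elim=> [//|n IH] a b x [y [s [us ns -> h]]].
exists (f y), (f s); split; [exact: UV|by move=> h'; apply: ns; apply: DC us h'|exact: fM|].
case: h => [[-> -> ->]|/IH h]; last by right.
by left; split=> //; rewrite (morph1 fM).
Qed.

Lemma ts_UU (G : groupType) (U : bool -> G -> Prop) C l b b' x :
  tree_split U C l -> b != b' -> U b x -> U b' x -> C x.
Proof.
move=> ts nb u1 u2; apply: contrapT => nc; apply: (ends_excl ts (b := b) (x := x)).
  by exists 1%N, b; apply: red1.
by exists 1%N, b'; rewrite (_ : ~~ b = b') ?red1 //; [apply: red1|move: nb; case: (b); case: (b')].
Qed.

Lemma l_U1 (G : groupType) (U : bool -> G -> Prop) C l b x :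
  tree_split U C l -> U b x -> l x <= 1.
Proof.
move=> ts u; case: (EM (C x)) => c; first by rewrite (ts_l0 ts).
by rewrite (ts_l ts (red1 u c)).
Qed.

Section Amalgam.
Context (G : groupType) (X : bool -> G -> Prop) (F : G -> Prop).
Hypotheses (sX : forall b, subgrp (X b)) (sF : subgrp F) (FX : forall b x, F x -> X b x).

Let iota b (k : subg sF) : subg (sX b) := exist _ (sval k) (FX b (svalP k)).

Let iM b : morph (iota b).
Proof. by move=> x y; apply: subg_val_inj. Qed.

Let iI b : injective (iota b).
Proof. by move=> x y /(congr1 sval) /= h; apply: subg_val_inj. Qed.

Definition amalgam : groupType := pushout iota.

(** Total on [G], with value 1 off [X b], so that terms carry no proofs of membership. *)
Definition am_in b (x : G) : amalgam :=
  if pselect (X b x) is left h then po_in iota (exist _ x h : subg (sX b)) else 1.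

Lemma am_inE b (x : subg (sX b)) : am_in b (sval x) = po_in iota x.
Proof.
rewrite /am_in; case: pselect => [h|]; last by case; apply: svalP.
by congr (po_in _ _); apply: subg_val_inj.
Qed.

Lemma am_inM b x y : X b x -> X b y -> am_in b (x * y) = am_in b x * am_in b y.
Proof.
move=> hx hy; pose x' : subg (sX b) := exist _ x hx; pose y' : subg (sX b) := exist _ y hy.
by rewrite -[x]/(sval x') -[y]/(sval y') -subg_valM !am_inE po_inM.
Qed.

Lemma am_in_glue b b' x : F x -> am_in b x = am_in b' x.
Proof.
move=> hx; pose x' : subg sF := exist _ x hx.
rewrite -[in LHS](erefl : sval (iota b x') = x) -[in RHS](erefl : sval (iota b' x') = x).
by rewrite !am_inE; apply: po_in_glue.
Qed.

Lemma am_in_inj b x y : X b x -> X b y -> am_in b x = am_in b y -> x = y.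
Proof.
move=> hx hy; pose x' : subg (sX b) := exist _ x hx; pose y' : subg (sX b) := exist _ y hy.
rewrite -[x]/(sval x') -[y]/(sval y') !am_inE => /(po_in_inj iM iI) h.
by rewrite h.
Qed.

Definition am_U b (q : amalgam) := exists2 x, X b x & q = am_in b x.
Definition am_C (q : amalgam) := exists2 x, F x & q = am_in true x.

Lemma am_split : exists l, tree_split am_U am_C l.
Proof.
exists (@po_l _ _ iota).
have eU : am_U = po_U (iota := iota).
  apply/funext => b; apply/funext => q; apply/propext; split=> [[x hx ->]|[x ->]].
    by exists (exist _ x hx : subg (sX b)); rewrite -am_inE.
  by exists (sval x); [apply: svalP|rewrite am_inE].
have eC : am_C = po_C (iota := iota).
  apply/funext => q; apply/propext; split=> [[x hx ->]|[x ->]].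
    by exists (exist _ x hx : subg sF); rewrite -am_inE.
  by exists (sval x); [apply: svalP|rewrite -am_inE].
by rewrite eU eC; apply: pushout_split.
Qed.

Lemma am_ind (H : amalgam -> Prop) : subgrp H -> (forall b x, X b x -> H (am_in b x)) ->
  forall q, H q.
Proof.
move=> sH h; apply: po_ind => // b x; rewrite -am_inE; apply: h; exact: svalP.
Qed.

Lemma am_lift (Q : groupType) (f : bool -> G -> Q) :
  (forall b x y, X b x -> X b y -> f b (x * y) = f b x * f b y) ->
  (forall x, F x -> f true x = f false x) ->
  exists2 th : amalgam -> Q, morph th & forall b x, X b x -> th (am_in b x) = f b x.
Proof.
move=> fM fg; pose f' b (x : subg (sX b)) := f b (sval x).
have fM' b : morph (@f' b) by move=> x y; apply: fM; apply: svalP.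
have fg' k : f' true (iota true k) = f' false (iota false k).
  by apply: fg; apply: (svalP k).
exists (po_lift f'); first exact: po_liftM fM' fg'.
move=> b x hx; rewrite -[x]/(sval (exist _ x hx : subg (sX b))) am_inE.
exact: po_lift_in fM' fg' _ _.
Qed.

End Amalgam.

(** * Squares of groups *)

(* [G] is the colimit of a square of groups, with corners [XL b], [XR b] and
   sides [FL], [FR], [E b]. It is the pushout of the amalgams of the left and of
   the right corners over [<E true, E false>]. *)
Section Square.
Context (G : groupType) (XL XR : bool -> G -> Prop) (FL FR : G -> Prop) (E : bool -> G -> Prop).
Hypotheses (sXL : forall b, subgrp (XL b)) (sXR : forall b, subgrp (XR b))
  (sFL : subgrp FL) (sFR : subgrp FR) (sE : forall b, subgrp (E b))
  (FXL : forall b x, FL x -> XL b x) (FXR : forall b x, FR x -> XR b x)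
  (EXL : forall b x, E b x -> XL b x) (EXR : forall b x, E b x -> XR b x)
  (EFL : forall b x, E b x -> FL x -> E (~~ b) x) (EFR : forall b x, E b x -> FR x -> E (~~ b) x)
  (EE : forall x, E true x -> E false x -> FL x /\ FR x).
Hypothesis genG : forall H : G -> Prop, subgrp H -> (forall b x, XL b x -> H x) ->
  (forall b x, XR b x -> H x) -> forall x, H x.
Hypothesis univG : forall (Q : groupType) (fL fR : bool -> G -> Q),
  (forall b x y, XL b x -> XL b y -> fL b (x * y) = fL b x * fL b y) ->
  (forall b x y, XR b x -> XR b y -> fR b (x * y) = fR b x * fR b y) ->
  (forall x, FL x -> fL true x = fL false x) -> (forall x, FR x -> fR true x = fR false x) ->
  (forall b x, E b x -> fL b x = fR b x) ->
  exists2 th : G -> Q, morph th & forall b x, (XL b x -> th x = fL b x) /\ (XR b x -> th x = fR b x).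

Let L := amalgam sXL sFL FXL.
Let R := amalgam sXR sFR FXR.
Let jL b : G -> L := @am_in G XL FL sXL sFL FXL b.
Let jR b : G -> R := @am_in G XR FR sXR sFR FXR b.

Let EN b x : E b x -> E (~~ b) x -> FL x /\ FR x.
Proof. by case: b => h1 h2; apply: EE. Qed.

(* The diagonal copy of [<E true, E false>] in [L * R], itself an amalgam. *)
Let ZU b (z : (L * R)%type) := exists2 x, E b x & z = (jL b x, jR b x).
Let ZC (z : (L * R)%type) := exists2 x, E true x /\ E false x & z = (jL true x, jR true x).
Let Z := gen (factors ZU).

Let sLR : subgrp Z. Proof. exact: gen_subgrp. Qed.

Let j1L b : jL b 1 = 1.
Proof.
have := @am_inM _ _ _ sXL sFL FXL b 1 1 (sub1 (@sXL b)) (sub1 (@sXL b)).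
by rewrite mulg1 -/(jL b 1) => h; apply: (mulIg (jL b 1)); rewrite -h mul1g.
Qed.
Let j1R b : jR b 1 = 1.
Proof.
have := @am_inM _ _ _ sXR sFR FXR b 1 1 (sub1 (@sXR b)) (sub1 (@sXR b)).
by rewrite mulg1 -/(jR b 1) => h; apply: (mulIg (jR b 1)); rewrite -h mul1g.
Qed.
Let jVL b x : XL b x -> jL b x^-1 = (jL b x)^-1.
Proof.
move=> hx; apply: (mulIg (jL b x)); rewrite mulVg -(j1L b) -(mulVg x).
by symmetry; apply: am_inM => //; apply: subV.
Qed.
Let jVR b x : XR b x -> jR b x^-1 = (jR b x)^-1.
Proof.
move=> hx; apply: (mulIg (jR b x)); rewrite mulVg -(j1R b) -(mulVg x).
by symmetry; apply: am_inM => //; apply: subV.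
Qed.

Let sZU b : subgrp (ZU b).
Proof.
split=> [|x y [a ha ->] [a' ha' ->]|x [a ha ->]].
- by exists 1; rewrite ?j1L ?j1R //; apply: sub1.
- exists (a * a'); first exact: subM.
  by rewrite /jL /jR !am_inM //; by [apply: EXL|apply: EXR].
by exists a^-1; [apply: subV|rewrite jVL ?jVR //; by [apply: EXL|apply: EXR]].
Qed.

Let ZtsL l : tree_split (am_U (X := XL) (F := FL) (sX := sXL) (sF := sFL) (FX := FXL))
    (am_C (X := XL) (F := FL) (sX := sXL) (sF := sFL) (FX := FXL)) l ->
  tree_split ZU ZC (fun z => l z.1).
Proof.
move=> ts; split=> //.
- split=> [|x y [a [h1 h2] ->] [a' [h1' h2'] ->]|x [a [h1 h2] ->]].
  + by exists 1; rewrite ?j1L ?j1R //; split; apply: sub1.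
  + exists (a * a'); first by split; apply: subM.
    by rewrite /jL /jR !am_inM //; by [apply: EXL|apply: EXR].
  by exists a^-1; [split; apply: subV|rewrite jVL ?jVR //; by [apply: EXL|apply: EXR]].
- move=> b c [x [h1 h2] ->]; exists x; first by case: b.
  have [f1 f2] := EE h1 h2; congr (_, _); exact: am_in_glue.
- by move=> c [x [h1 h2] ->]; apply: (ts_l0 ts); exists x => //; case: (EE h1 h2).
move=> n a b z hz; apply: (ts_l ts (a := a) (b := b)).
apply: (red_morph (f := fst)) hz => // b' _ [x hx ->] /=.
  by exists x => //; apply: EXL.
move=> [y hy] e; have exy : x = y.
  apply: (am_in_inj (sX := sXL) (sF := sFL) (FX := FXL) (b := b')); [exact: EXL|exact: FXL|].
  by rewrite -/(jL b' x) e; apply: am_in_glue.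
subst y; exists x; first by have := EFL hx hy; case: b' hx e.
have [f1 f2] := EN hx (EFL hx hy); congr (_, _); exact: am_in_glue.
Qed.

Let ZtsR l : tree_split (am_U (X := XR) (F := FR) (sX := sXR) (sF := sFR) (FX := FXR))
    (am_C (X := XR) (F := FR) (sX := sXR) (sF := sFR) (FX := FXR)) l ->
  tree_split ZU ZC (fun z => l z.2).
Proof.
move=> ts; split=> //.
- split=> [|x y [a [h1 h2] ->] [a' [h1' h2'] ->]|x [a [h1 h2] ->]].
  + by exists 1; rewrite ?j1L ?j1R //; split; apply: sub1.
  + exists (a * a'); first by split; apply: subM.
    by rewrite /jL /jR !am_inM //; by [apply: EXL|apply: EXR].
  by exists a^-1; [split; apply: subV|rewrite jVL ?jVR //; by [apply: EXL|apply: EXR]].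
- move=> b c [x [h1 h2] ->]; exists x; first by case: b.
  have [f1 f2] := EE h1 h2; congr (_, _); exact: am_in_glue.
- by move=> c [x [h1 h2] ->]; apply: (ts_l0 ts); exists x => //; case: (EE h1 h2).
move=> n a b z hz; apply: (ts_l ts (a := a) (b := b)).
apply: (red_morph (f := snd)) hz => // b' _ [x hx ->] /=.
  by exists x => //; apply: EXR.
move=> [y hy] e; have exy : x = y.
  apply: (am_in_inj (sX := sXR) (sF := sFR) (FX := FXR) (b := b')); [exact: EXR|exact: FXR|].
  by rewrite -/(jR b' x) e; apply: am_in_glue.
subst y; exists x; first by have := EFR hx hy; case: b' hx e.
have [f1 f2] := EN hx (EFR hx hy); congr (_, _); exact: am_in_glue.
Qed.

Let AB (b : bool) : groupType := if b then L else R.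
Let iota (b : bool) : subg sLR -> AB b :=
  match b with true => fun z => (sval z).1 | false => fun z => (sval z).2 end.

Let iM b : morph (@iota b). Proof. by case: b => x y. Qed.

(** A reduced word over [ZU] and [ZC] has the same length in both coordinates, so neither projection
    of [Z] has a kernel. This makes the pushout over [Z] an amalgam. *)
Let Zind (z : (L * R)%type) : Z z -> z.1 = 1 \/ z.2 = 1 -> z = 1.
Proof.
move=> Zz h; have [lL tL] := am_split sXL sFL FXL; have [lR tR] := am_split sXR sFR FXR.
have := red_ex (ZtsL tL) Zz; case=> [[x [h1 h2] e]|[n [a [b hr]]]].
  move: h; rewrite e /= => h.
  have -> : x = 1.
    case: h => h.
      apply: (am_in_inj (sX := sXL) (sF := sFL) (FX := FXL) (b := true)); [exact: EXL|exact: sub1|].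
      by rewrite -/(jL true x) h -(j1L true).
    apply: (am_in_inj (sX := sXR) (sF := sFR) (FX := FXR) (b := true)); [exact: EXR|exact: sub1|].
    by rewrite -/(jR true x) h -(j1R true).
  by rewrite j1L j1R.
have n0 := red_neq0 hr.
have e1 := ts_l (ZtsL tL) hr; have e2 := ts_l (ZtsR tR) hr.
case: h => h; rewrite h in e1 e2.
  by move: n0; rewrite -e1 (ts_l0 tL) //; apply: sub1; apply: (ts_C tL).
by move: n0; rewrite -e2 (ts_l0 tR) //; apply: sub1; apply: (ts_C tR).
Qed.

Let iI b : injective (@iota b).
Proof.
move=> x y e; apply: subg_val_inj.
have hz : Z ((sval x)^-1 * sval y) by apply: subVM => //; apply: svalP.
have : (sval x)^-1 * sval y = 1.
  apply: Zind hz _; case: b e => /= e; [left|right].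
    by rewrite -[LHS]/((sval x).1^-1 * (sval y).1) e mulVg.
  by rewrite -[LHS]/((sval x).2^-1 * (sval y).2) e mulVg.
by move=> h; rewrite -(mulVKg (sval x) (sval y)) h mulg1.
Qed.

Let Gam := pushout iota.
Let pinL (x : L) : Gam := @po_in _ _ iota true x.
Let pinR (x : R) : Gam := @po_in _ _ iota false x.

Let pinLM : morph pinL. Proof. exact: (@po_inM _ _ iota true). Qed.
Let pinRM : morph pinR. Proof. exact: (@po_inM _ _ iota false). Qed.

Let pin_glue (z : (L * R)%type) : Z z -> pinL z.1 = pinR z.2.
Proof.
by move=> hz; apply: (@po_in_glue _ _ iota (exist _ z hz : subg sLR) true false).
Qed.

Let theta_ex : exists2 th : G -> Gam, morph th &
  forall b x, (XL b x -> th x = pinL (jL b x)) /\ (XR b x -> th x = pinR (jR b x)).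
Proof.
apply: (univG (fL := fun b x => pinL (jL b x)) (fR := fun b x => pinR (jR b x))).
- by move=> b x y hx hy; rewrite -pinLM /jL am_inM.
- by move=> b x y hx hy; rewrite -pinRM /jR am_inM.
- by move=> x hx; congr pinL; apply: am_in_glue.
- by move=> x hx; congr pinR; apply: am_in_glue.
move=> b x hx; apply: (pin_glue (z := (jL b x, jR b x))).
by apply: gen_in; case: b hx => hx; [left|right]; exists x.
Qed.

Definition sqU b : G -> Prop := gen (factors (fun b' => (if b then XL else XR) b')).
Definition sqC : G -> Prop := gen (factors E).

(** The length function is pulled back from the pushout along [th], which has [ps] as a left
    inverse. The last two conclusions say that a corner meets [sqC] only in its side: such an
    element has length at most 1 in the amalgam of the corners on its side of the square. *)
Theorem square_split : exists l, [/\ tree_split sqU sqC l,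
  forall b x, XL b x -> sqC x -> E b x & forall b x, XR b x -> sqC x -> E b x].
Proof.
have [th thM thX] := theta_ex.
have [psL psLM psLX] := @am_lift _ _ _ sXL sFL FXL G (fun _ x => x) (fun _ _ _ _ _ => erefl) (fun _ _ => erefl).
have [psR psRM psRX] := @am_lift _ _ _ sXR sFR FXR G (fun _ x => x) (fun _ _ _ _ _ => erefl) (fun _ _ => erefl).
have psZ z : Z z -> psL z.1 = psR z.2.
  apply: (@gen_min _ _ (fun z => psL z.1 = psR z.2)).
    split=> [|x y h1 h2|x h1]; first by rewrite (morph1 psLM) (morph1 psRM).
      by rewrite psLM psRM h1 h2.
    by rewrite (morphV psLM) (morphV psRM) h1.
  by move=> s [[x hx ->]|[x hx ->]] /=; rewrite psLX ?psRX //; by [apply: EXL|apply: EXR].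
pose ps0 b : AB b -> G := match b with true => psL | false => psR end.
have ps0M b : morph (ps0 b) by case: b.
have psg k : ps0 true (iota true k) = ps0 false (iota false k) by apply/psZ/svalP.
pose ps : Gam -> G := po_lift ps0.
have psM : morph ps := po_liftM ps0M psg.
have ps_pinL x : ps (pinL x) = psL x := @po_lift_in _ _ iota G ps0 ps0M psg true x.
have ps_pinR x : ps (pinR x) = psR x := @po_lift_in _ _ iota G ps0 ps0M psg false x.
have psth x : ps (th x) = x.
  apply: (genG (H := fun x => ps (th x) = x)).
  - split=> [|y z h1 h2|y h1]; first by rewrite (morph1 thM) (morph1 psM).
      by rewrite thM psM h1 h2.
    by rewrite (morphV thM) (morphV psM) h1.
  - by move=> b y hy; rewrite (thX b y).1 // ps_pinL psLX.
  - by move=> b y hy; rewrite (thX b y).2 // ps_pinR psRX.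
have thL y : th (psL y) = pinL y.
  apply: (@am_ind _ _ _ sXL sFL FXL (fun y => th (psL y) = pinL y)).
    split=> [|u v h1 h2|u h1]; first by rewrite (morph1 psLM) (morph1 thM) (morph1 pinLM).
      by rewrite psLM thM pinLM h1 h2.
    by rewrite (morphV psLM) (morphV thM) (morphV pinLM) h1.
  by move=> b x hx; rewrite psLX // (thX b x).1.
have thR y : th (psR y) = pinR y.
  apply: (@am_ind _ _ _ sXR sFR FXR (fun y => th (psR y) = pinR y)).
    split=> [|u v h1 h2|u h1]; first by rewrite (morph1 psRM) (morph1 thM) (morph1 pinRM).
      by rewrite psRM thM pinRM h1 h2.
    by rewrite (morphV psRM) (morphV thM) (morphV pinRM) h1.
  by move=> b x hx; rewrite psRX // (thX b x).2.
have uL y : sqU true (psL y).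
  apply: (@am_ind _ _ _ sXL sFL FXL (fun y => sqU true (psL y))).
    have s := gen_subgrp (factors XL).
    split=> [|u v h1 h2|u h1]; first by rewrite (morph1 psLM); apply: sub1.
      by rewrite psLM; apply: subM.
    by rewrite (morphV psLM); apply: subV.
  by move=> b x hx; rewrite psLX //; apply: gen_in; case: b hx; [left|right].
have uR y : sqU false (psR y).
  apply: (@am_ind _ _ _ sXR sFR FXR (fun y => sqU false (psR y))).
    have s := gen_subgrp (factors XR).
    split=> [|u v h1 h2|u h1]; first by rewrite (morph1 psRM); apply: sub1.
      by rewrite psRM; apply: subM.
    by rewrite (morphV psRM); apply: subV.
  by move=> b x hx; rewrite psRX //; apply: gen_in; case: b hx; [left|right].
have cZ z : Z z -> sqC (psL z.1).
  apply: (@gen_min _ _ (fun z => sqC (psL z.1))).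
    have s := gen_subgrp (factors E).
    split=> [|u v h1 h2|u h1]; first by rewrite (morph1 psLM); apply: sub1.
      by rewrite psLM; apply: subM.
    by rewrite (morphV psLM); apply: subV.
  by move=> s [[x hx ->]|[x hx ->]] /=; rewrite psLX; try (by apply: EXL); apply: gen_in; [left|right].
have cC x : sqC x -> exists2 z, Z z & [/\ th x = pinL z.1 & x = psL z.1].
  move=> hx; suff [z Zz e] : exists2 z, Z z & x = psL z.1 by exists z => //; rewrite e thL.
  move: x hx; apply: gen_min.
    split=> [|u v [z1 h1 ->] [z2 h2 ->]|u [z1 h1 ->]].
    - by exists 1; [apply: sub1|rewrite (morph1 psLM)].
    - by exists (z1 * z2); [apply: subM|rewrite -psLM].
    by exists z1^-1; [apply: subV|rewrite -(morphV psLM)].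
  move=> s [hx|hx]; [exists (jL true s, jR true s)|exists (jL false s, jR false s)].
  - by apply: gen_in; left; exists s.
  - by rewrite /= psLX //; apply: EXL.
  - by apply: gen_in; right; exists s.
  - by rewrite /= psLX //; apply: EXL.
have tsG := pushout_split iM iI.
have Uth b x : sqU b x -> po_U (iota := iota) b (th x).
  move: x; apply: gen_min.
    have [s1 s2 s3] := ts_U tsG b; split=> [|u v h1 h2|u h1]; first by rewrite (morph1 thM).
      by rewrite thM; apply: s2.
    by rewrite (morphV thM); apply: s3.
  by case: b => x [hx|hx]; [exists (jL true x)|exists (jL false x)|exists (jR true x)|exists (jR false x)];
    [exact: (thX _ _).1|exact: (thX _ _).1|exact: (thX _ _).2|exact: (thX _ _).2].
have Cth x : po_C (iota := iota) (th x) -> sqC x.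
  move=> [k e]; rewrite -(psth x) e.
  have -> : po_in iota (iota true k) = pinL (sval k).1 by [].
  by rewrite ps_pinL; apply/cZ/svalP.
have thC x : sqC x -> po_C (iota := iota) (th x).
  by move=> /cC [z hz [-> _]]; exists (exist _ z hz : subg sLR).
exists (fun x => po_l (th x)); split.
- split.
  + by move=> b; apply: gen_subgrp.
  + exact: gen_subgrp.
  + move=> b c hc; have [z Zz [_ ->]] := cC _ hc; case: b; first exact: uL.
    by rewrite psZ //; apply: uR.
  + by move=> c /thC; apply: (ts_l0 tsG).
  move=> n a b x hx; apply: (ts_l tsG (a := a) (b := b)).
  by apply: (red_morph thM Uth) hx => b' y _; apply: Cth.
- move=> b x hx /cC [z Zz [e1 e2]].
  have e3 : jL b x = z.1.
    by apply: (po_in_inj iM iI (b := true)); rewrite -[LHS](thX b x).1.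
  have [lL tL] := am_split sXL sFL FXL.
  case: (red_ex (ZtsL tL) Zz) => [[y [h1 h2] ez]|[n [a [b' hr]]]].
    have -> : x = y; last by case: (b).
    apply: (am_in_inj (sX := sXL) (sF := sFL) (FX := FXL) (b := b)) => //; first by case: (b); apply: EXL.
    by rewrite -/(jL b x) e3 ez; apply: am_in_glue; case: (EE h1 h2).
  have uq : am_U (sX := sXL) (sF := sFL) (FX := FXL) b z.1 by exists x.
  have n1 := ts_l (ZtsL tL) hr; have l1 := l_U1 tL uq; rewrite n1 in l1.
  case: n hr n1 l1 => [//|[|//]] [y [s [[e ue ->] _ ez h]]] n1 _.
  case: h => [[_ _ y1]|//]; rewrite y1 mul1g in ez.
  case: (eqVneq b b') => [eb|nb].
    subst b'; have -> : x = e; last by [].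
    by apply: (am_in_inj (sX := sXL) (sF := sFL) (FX := FXL) (b := b)) => //; [exact: EXL|rewrite -/(jL b x) e3 ez].
  have uq' : am_U (sX := sXL) (sF := sFL) (FX := FXL) b' z.1.
    by exists e; [apply: EXL|rewrite ez].
  by have := ts_l0 tL (ts_UU tL nb uq uq'); rewrite n1.
move=> b x hx /cC [z Zz [e1 e2]].
have e3 : jR b x = z.2.
  by apply: (po_in_inj iM iI (b := false)); rewrite -[LHS](thX b x).2 // e1; apply: pin_glue.
have [lR tR] := am_split sXR sFR FXR.
case: (red_ex (ZtsR tR) Zz) => [[y [h1 h2] ez]|[n [a [b' hr]]]].
  have -> : x = y; last by case: (b).
  apply: (am_in_inj (sX := sXR) (sF := sFR) (FX := FXR) (b := b)) => //; first by case: (b); apply: EXR.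
  by rewrite -/(jR b x) e3 ez; apply: am_in_glue; case: (EE h1 h2).
have uq : am_U (sX := sXR) (sF := sFR) (FX := FXR) b z.2 by exists x.
have n1 := ts_l (ZtsR tR) hr; have l1 := l_U1 tR uq; rewrite n1 in l1.
case: n hr n1 l1 => [//|[|//]] [y [s [[e ue ->] _ ez h]]] n1 _.
case: h => [[_ _ y1]|//]; rewrite y1 mul1g in ez.
case: (eqVneq b b') => [eb|nb].
  subst b'; have -> : x = e; last by [].
  by apply: (am_in_inj (sX := sXR) (sF := sFR) (FX := FXR) (b := b)) => //; [exact: EXR|rewrite -/(jR b x) e3 ez].
have uq' : am_U (sX := sXR) (sF := sFR) (FX := FXR) b' z.2.
  by exists e; [apply: EXR|rewrite ez].
by have := ts_l0 tR (ts_UU tR nb uq uq'); rewrite n1.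
Qed.

End Square.

(** * Bounded subgroups acting on the tree of a splitting *)

Section FixedPoint.
Context (G : groupType) (U : bool -> G -> Prop) (C : G -> Prop) (l : G -> nat).
Hypothesis ts : tree_split U C l.
Local Notation W := (gen (factors U)).
Local Notation nends := (nends U C).
Local Notation ends := (ends U C).

Lemma sub_split (U' : bool -> G -> Prop) C' : (forall b, subgrp (U' b)) -> subgrp C' ->
  (forall b x, C' x -> U' b x) -> (forall x, C' x -> C x) -> (forall b x, U' b x -> U b x) ->
  (forall b x, U' b x -> C x -> C' x) -> tree_split U' C' l.
Proof.
move=> sU' sC' C'U' C'C U'U U'C; split=> //; first by move=> c /C'C; apply: (ts_l0 ts).
move=> n a b x hx; apply: (ts_l ts (a := a) (b := b)).
elim: n b x hx => [//|n IH] b x [y [s [us ns -> h]]]; exists y, s; split=> //; first exact: U'U.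
  by move=> c; apply: ns; apply: U'C us c.
by case: h => [h|/IH h]; [left|right].
Qed.

Let sW : subgrp W. Proof. exact: gen_subgrp. Qed.
Let sU b : subgrp (U b). Proof. exact: (ts_U ts). Qed.
Let sC : subgrp C. Proof. exact: (ts_C ts). Qed.

Lemma l1_U x : W x -> l x <= 1 -> exists b, U b x.
Proof.
move=> /(red_ex ts) [c _|[n [a [b h]]]]; first by exists true; apply: (ts_CU ts).
rewrite (ts_l ts h); case: n h => [//|[|//]] [y [s [us _ -> [[_ _ ->]|//]]]] _.
by exists b; rewrite mul1g.
Qed.

(* In the Bass-Serre tree: a subgroup with a bounded orbit fixes a vertex. *)
Lemma bounded_elliptic N (K : G -> Prop) : subgrp K -> (forall k, K k -> W k) ->
  (forall k, K k -> l k <= N) -> exists u b, W u /\ forall k, K k -> U b (u^-1 * k * u).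
Proof.
elim: N K => [|N IH] K sK KW Kl.
  exists 1, true; split; first exact: sub1.
  move=> k hk; rewrite mulg1 invg1 mul1g; apply: (ts_CU ts); apply: (l0C ts); first exact: KW.
  by have := Kl _ hk; lia.
case: (EM (forall k, K k -> l k <= N)) => hN; first exact: IH.
have [k0 hk0 lk0] : exists2 k0, K k0 & l k0 = N.+1.
  apply: contrapT => no; apply: hN => k hk; have := Kl _ hk; rewrite leq_eqVlt => /orP [/eqP e|//].
  by case: no; exists k.
case: N IH hN lk0 Kl => [|N] IH hN lk0 Kl.
  have [b ub] := l1_U (KW _ hk0) (Kl _ hk0).
  have nc : ~ C k0 by move=> /(ts_l0 ts); rewrite lk0.
  exists 1, b; split; first exact: sub1.
  move=> k hk; rewrite mulg1 invg1 mul1g.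
  have [b' ub'] := l1_U (KW _ hk) (Kl _ hk).
  case: (EM (C k)) => ck; first exact: (ts_CU ts).
  case: (eqVneq b' b) => [<- //|nb].
  have r1 : red U C 1 b b k0 by apply: red1.
  have r2 : red U C 1 (~~ b) b' k.
    by rewrite (_ : ~~ b = b'); [apply: red1|move: nb; case: (b); case: (b')].
  by have := Kl _ (subM sK hk0 hk); rewrite (ts_l ts (red_cat r1 r2)).
have [n [a [b r0]]] : exists n a b, red U C n a b k0.
  by case: (red_ex ts (KW _ hk0)) => // /(ts_l0 ts); rewrite lk0.
have nN := ts_l ts r0; rewrite lk0 in nN.
(* If [k0] began and ended in different factors, its square would be longer than [k0], against
   maximality. *)
have eab : a = b.
  apply/eqP; apply: contraT => nab.
  have r1 : red U C n (~~ b) b k0 by rewrite (_ : ~~ b = a) //; move: nab; case: (a); case: (b).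
  by have := Kl _ (subM sK hk0 hk0); rewrite (ts_l ts (red_cat r0 r1)); lia.
subst a; have e0 : ends b k0^-1 by exists n, b; apply: (red_inv ts).
have [s [us ns ny ly]] := ends_step ts e0.
have Wk0 := KW _ hk0; rewrite (lV ts Wk0) lk0 in ly.
have Ws : W s := tsUW us.
(* [s C] is the edge after [C] on the path to [k0 C]. If [k] does not fix the vertex [U_b], the path
   from [C] to [k C] also leaves [U_b] through [s C], since otherwise [k^-1 * k0] would be too long.
   Hence conjugation by [s] lowers the maximal length. *)
have gate k : K k -> U b k \/ nends b (k^-1 * s).
  move=> hk; have Wk := KW _ hk.
  case: (endsP ts b (subM sW (subV sW Wk) Ws)) => [h|eh]; [by right|left].
  have [v [uv nv nh lh]] := ends_step ts eh.
  have nv' : ~ C v^-1 by move=> /(subVr sC).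
  have ny' : nends b ((k0^-1 * s)^-1)^-1 by rewrite invgK.
  have := addcat ts nh (subV (sU b) uv) nv' ny'.
  rewrite mulgK invgM invgK mulgA -[k^-1 * s * s^-1 * k0]/(k^-1 * s * s^-1 * k0) mulgK => e1.
  have := Kl _ (subVM sK hk hk0); rewrite e1.
  have -> : l (s^-1 * k0) = N.+1.
    by rewrite -(invVM k0 s) (lV ts (subM sW (subV sW Wk0) Ws)); case: ly.
  move=> h1; have h0 : l (k^-1 * s * v) = 0 by move: h1; set A := l (k^-1 * s * v); lia.
  have cc := l0C ts (nendsW ts nh) h0.
  have ub : U b (k^-1 * s) by apply: (subMr (sU b) uv); apply: (ts_CU ts).
  by apply: (subVr (sU b)); apply: (subMr (sU b) us).
have bound k : K k -> l (s^-1 * k * s) <= N.+1.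
  move=> hk; have Wk := KW _ hk.
  have done_ : U b k -> l (s^-1 * k * s) <= N.+1.
    move=> ub; have u2 : U b (s^-1 * k * s) by apply: subM => //; apply: subVM.
    case: (EM (C (s^-1 * k * s))) => c; first by rewrite (ts_l0 ts).
    by rewrite (ts_l ts (red1 u2 c)).
  case: (gate k hk) => [//|nz]; case: (gate k^-1 (subV sK hk)) => [ub|nz'].
    exact/done_/(subVr (sU b)).
  rewrite invgK in nz'.
  have Wz := nendsW ts nz; have Wz' := subV sW Wz.
  have ez : (k^-1 * s)^-1 = s^-1 * k by rewrite invgM invgK.
  have [_ lk] := add1 ts nz (subV (sU b) us) (fun h => ns (subVr sC h)).
  rewrite mulgK (lV ts Wk) in lk.
  have lz : l (s^-1 * k) <= N.+1 by have := Kl _ hk; rewrite -ez (lV ts Wz); lia.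
  case: (EM (C (s^-1 * k))) => cz.
    apply: done_; rewrite -(mulVKg s k); apply: subM => //; exact: (ts_CU ts).
  have ekb : ends b k.
    have [h _] := add1 ts nz' (subV (sU b) us) (fun h => ns (subVr sC h)).
    by rewrite mulgK in h.
  rewrite ez in Wz'.
  have eb : ends b (s^-1 * k).
    case: (endsP ts b Wz') => // -[//|[m [a' r1]]]; exfalso.
    have ea : a' = ~~ b.
      apply/eqP; apply: contraT => nab.
      have ab : a' = b by move: nab; case: (a'); case: (b).
      apply: False_ind; apply: (ends_nends ts (b := b) (x := k^-1 * s)) nz.
      by exists m, (~~ b); have := red_inv ts r1; rewrite -ez invgK ab.
    rewrite ea in r1; have r2 := red_cat (red1 us ns) r1; rewrite mulVKg in r2.
    by apply: (ends_excl ts ekb); exists (1 + m)%N, b.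
  have [s' [us' ns' nh lh]] := ends_step ts eb.
  have e2 : s^-1 * k * s = s^-1 * k * s' * (s'^-1 * s) by rewrite -[RHS]mulgA mulVKg.
  rewrite e2; apply: leq_trans (l_mulU ts (nendsW ts nh) (subVM (sU b) us' us)) _.
  by rewrite -lh.
pose K' x := K (s * x * s^-1).
have [||x hx|u [b' [Wu hu]]] := IH K'.
- split=> [|x y|x]; rewrite /K'; first by rewrite mulg1 mulgV; apply: sub1.
    by move=> h1 h2; have := subM sK h1 h2; rewrite !mulgA mulgVK.
  by move=> /(subV sK); rewrite !invgM invgK mulgA.
- move=> k /KW h; have -> : k = s^-1 * (s * k * s^-1) * s by rewrite !mulgA mulVg mul1g mulgVK.
  by apply: subM => //; apply: subVM.
- rewrite /K' in hx; have := bound _ hx.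
  by rewrite !mulgA mulVg mul1g mulgVK.
exists (s * u), b'; split; first exact: subM.
move=> k hk; have hk' : K' (s^-1 * k * s) by rewrite /K' !mulgA mulgV mul1g mulgK.
by have := hu _ hk'; rewrite invgM !mulgA.
Qed.

Lemma chain_red n a b x : red U C n a b x -> exists f : nat -> G,
  [/\ f 0 = 1, f n = x, forall i, W (f i) & forall i, i < n -> factors U ((f i)^-1 * f i.+1)].
Proof.
elim: n b x => [//|n IH] b x [y [s [us ns -> h]]].
have [f [f0 fn fW fd]] : exists f : nat -> G,
    [/\ f 0 = 1, f n = y, forall i, W (f i) & forall i, i < n -> factors U ((f i)^-1 * f i.+1)].
  case: h => [[-> _ ->]|/IH //]; exists (fun=> 1); split=> //; move=> i; exact: sub1.
have Wys : W (y * s) by rewrite -fn; apply: subM => //; apply: tsUW us.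
exists (fun i => if i <= n then f i else y * s); split=> [||i|i hi]; rewrite ?ltnn //.
  by case: leqP.
case: (leqP i.+1 n) => h1; first by rewrite (ltnW h1); apply: fd.
have -> : i = n by lia.
by rewrite leqnn fn mulKg; case: (b) us; [left|right].
Qed.

End FixedPoint.

Ltac gsimp := rewrite ?(invgM, invgK, mulgA, mulgK, mulgVK, mulVg, mulgV, mul1g, mulg1, invg1).

(** * Acylindricity of a cut over a group generated by two edge groups *)

Section CutAcylindrical.
Context (G : groupType) (Sh : G -> Prop) (delta : nat).
Hypotheses (allT : forall x, gen Sh x) (hSh : hyp (gen Sh) (wd Sh) delta).
Context (U : bool -> G -> Prop) (E : bool -> G -> Prop) (P : G -> Prop) (l l2 : G -> nat).
Local Notation C := (gen (factors E)).
Hypotheses (ts : tree_split U C l) (ts2 : tree_split E P l2).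
Hypotheses (lSh : forall x, l x <= len Sh x) (l2Sh : forall x, l2 x <= len Sh x)
  (ESh : forall b x, E b x -> Sh x) (genU : forall x, gen (factors U) x)
  (hypE : forall b, hypsub (E b)).
Hypothesis acylE : exists K0, forall b b' t, K0 <= len Sh t -> exists L : seq G,
  forall c, E b c -> E b' (t^-1 * c * t) -> c \in L.

Let gm := torsor_gm (torsor_gen Sh).
Local Notation d := (wd Sh).
Let sC : subgrp C. Proof. exact: gen_subgrp. Qed.
Let sE b : subgrp (E b). Proof. exact: (ts_U ts2). Qed.
Let sP : subgrp P. Proof. exact: (ts_C ts2). Qed.

(** A normal form over the [E b] is a path of [l2 x] letters of [Sh]; as [l2 x <= len Sh x] it is a
    geodesic, and [morse] applies with both constants 1. *)
Let qcC : exists R, quasiconvex (gen Sh) d C R.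
Proof.
have [R HR] := morse delta 1%N 1%N; exists R => c c' p Cc Cc' _ bp.
apply: (HR G (gen Sh) C d gm hSh _ _ c c' p) => // {}c {}c' {Cc Cc' bp}Cc Cc'.
have hx : C (c^-1 * c') by apply: subVM.
have facT x : factors E x -> Sh x by move=> [/ESh|/ESh].
case: (red_ex ts2 hx) => [px|[n [a [b h]]]].
  exists 1%N, (fun i => if i == 0 then c else c'); split=> //.
    by move=> i _; case: (i == 0).
  move=> [|//] _; rewrite /=; apply: len_gen1; apply: (ESh (b := true)).
  exact: (ts_CU ts2).
have [f [f0 fn fW fd]] := chain_red h.
exists n, (fun i => c * f i); split.
- by rewrite mul1n -(ts_l ts2 h); apply: leq_trans (l2Sh _) _.
- by rewrite f0 mulg1.
- by rewrite fn mulVKg.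
- by move=> i _; apply: subM.
by move=> i hi; rewrite wd_mul; apply/len_gen1/facT/fd.
Qed.

Let far_const R := (4 * (R + delta + 1) + 2 + delta)%N.

(* Two far apart translates of [C] have bounded projections to each other, so
   that an element preserving both moves the feet of a shortest connection by a
   bounded amount. *)
Let stab_bounded : exists B, forall t, B < l t -> exists x y, [/\ C x, C (t^-1 * y) &
  forall c, C c -> C (t^-1 * c * t) -> d x (c * x) <= B /\ d y (c * y) <= B].
Proof.
have [R qR] := qcC; exists (far_const R) => t lt.
pose tC y := C (t^-1 * y).
have qtC : quasiconvex (gen Sh) d tC R.
  move=> y y' p hy hy' _ bp; have [||c hc dc] := qR _ _ (t^-1 * p) hy hy'; rewrite /btw ?wd_mul //.
  by exists (t * c); rewrite /tC ?mulKg // -(mulVKg t p) wd_mul.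
have ex : exists m, `[< exists x y, [/\ C x, tC y & d x y = m] >].
  exists (d 1 t); apply/asboolP; exists 1, t; split=> //; first exact: sub1.
  by rewrite /tC mulVg; apply: sub1.
have := ex_minnP ex; case=> m /asboolP [x [y [Cx Cy dxy]]] mmin.
have mle x' y' : C x' -> tC y' -> m <= d x' y'.
  by move=> h1 h2; apply: mmin; apply/asboolP; exists x', y'.
have mt : l t <= m.
  rewrite -dxy; apply: leq_trans (lSh _).
  have -> : x^-1 * y = x^-1 * (t * (t^-1 * y)) by rewrite mulVKg.
  by rewrite mulgA (lCr ts) ?(lCl ts) //; apply: subV.
exists x, y; split=> // c Cc Cc'.
have Ccx : C (c * x) by apply: subM.
have Ccy : tC (c * y).
  have -> : tC (c * y) = C (t^-1 * c * t * (t^-1 * y)) by rewrite /tC; gsimp.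
  exact: subM.
have n1 : nearest d C y x.
  split=> // c' hc'; rewrite (gmC gm (allT _) (allT _)) (gmC gm (allT y) (allT c')) dxy.
  exact: mle.
have n2 : nearest d tC x y by split=> // y' hy'; rewrite dxy; apply: mle.
have CT c' : C c' -> gen Sh c' by move=> _; apply: allT.
have tCT c' : tC c' -> gen Sh c' by move=> _; apply: allT.
have b1 := nearest_btw gm hSh CT qR (allT y) n1 Ccx.
have b2 := nearest_btw gm hSh tCT qtC (allT x) n2 Ccy.
have h4 := hSh (allT x) (allT (c * y)) (allT y) (allT (c * x)).
have e1 : d (c * x) (c * y) = m by rewrite wd_mul.
move: b1 b2 h4; rewrite /btw (gmC gm (allT (c * y)) (allT (c * x))) e1 dxy.
rewrite (gmC gm (allT y) (allT x)) dxy (gmC gm (allT (c * y)) (allT y)); rewrite /far_const in lt *.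
lia.
Qed.

Lemma cut_acylindrical : acylindrical_split U C l.
Proof.
have [B hB] := stab_bounded; have [K0 hK] := acylE.
(* [acylE] gives finiteness without a bound; the bound is the one on the order of finite subgroups
   of the hyperbolic groups [E b]. *)
have bd b : exists M, forall K L, subgrp K -> (forall x, K x -> E b x) ->
    (forall x, K x -> x \in (L : seq G)) -> forall s : seq G, uniq s ->
    (forall x, x \in s -> K x) -> size s <= M.
  have [S [dl [[fS eS] hS]]] := hypE b; have [M hM] := finite_subgroup_bound fS hS.
  by exists M => K L sK KE KL; apply: (hM K L) => // x /KE /eS.
have [M1 h1] := bd true; have [M2 h2] := bd false.
exists (maxn B.+1 K0), (maxn M1 M2) => t _ lt s us hs.
have [x [y [Cx Cy hxy]]] := hB t (ltac:(lia)).
pose K c := C c /\ C (t^-1 * c * t).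
have sK : subgrp K.
  split=> [|u v [u1 u2] [v1 v2]|u [u1 u2]].
  - by rewrite /K; gsimp; split; apply: sub1.
  - split; first exact: subM.
    by have := subM sC u2 v2; gsimp.
  by split; [apply: subV|have := subV sC u2; gsimp].
have ell z : (forall c, K c -> C (z^-1 * c * z) /\ d z (c * z) <= B) ->
    exists u b, C u /\ forall c, K c -> E b ((z * u)^-1 * c * (z * u)).
  move=> hz; pose K' c := K (z * c * z^-1).
  have sK' : subgrp K'.
    split=> [|u v hu hv|u hu].
    - by rewrite /K'; gsimp; apply: sub1.
    - by rewrite /K'; have := subM sK hu hv; gsimp.
    by rewrite /K'; have := subV sK hu; gsimp.
  have K'C k : K' k -> C k by move=> /hz [h _]; move: h; gsimp.
  have K'l k : K' k -> l2 k <= B.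
    move=> /hz [_ h]; apply: leq_trans (l2Sh _) _; move: h.
    by rewrite /wd; gsimp.
  have [u [b [Cu hu]]] := bounded_elliptic ts2 sK' K'C K'l.
  exists u, b; split=> // c hc.
  have hc' : K' (z^-1 * c * z) by rewrite /K'; gsimp.
  by have := hu _ hc'; gsimp.
have [u [b [Cu hu]]] : exists u b, C u /\ forall c, K c -> E b ((x * u)^-1 * c * (x * u)).
  apply: ell => c [c1 c2]; split; last by case: (hxy c c1 c2).
  by apply: subM => //; apply: subVM.
have [u' [b' [Cu' hu']]] : exists u b, C u /\ forall c, K c -> E b ((y * u)^-1 * c * (y * u)).
  apply: ell => c [c1 c2]; split; last by case: (hxy c c1 c2).
  have -> : y^-1 * c * y = (t^-1 * y)^-1 * (t^-1 * c * t) * (t^-1 * y).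
    by gsimp.
  by apply: subM => //; apply: subVM.
pose w := (x * u)^-1 * (y * u').
(* [x * u] lies in [C] and [y * u'] in [t C], so [w] is as long as [t], and the two conjugates of
   edge groups are far apart in [Sh] as well. *)
have lw : l w = l t.
  have -> : w = (x * u)^-1 * (t * (t^-1 * y * u')) by rewrite /w; gsimp.
  rewrite mulgA (lCr ts) ?(lCl ts) //; try exact: subM.
  by apply: subV => //; apply: subM.
have [L hL] := hK b b' w (ltac:(have := lSh w; lia)).
pose Q c := E b c /\ E b' (w^-1 * c * w).
have sQ : subgrp Q.
  split=> [|p q [p1 p2] [q1 q2]|p [p1 p2]].
  - by rewrite /Q; gsimp; split; apply: sub1.
  - split; first exact: subM.
    by have := subM (@sE b') p2 q2; gsimp.
  by split; [apply: subV|have := subV (@sE b') p2; gsimp].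
rewrite -(size_map (fun c => (x * u)^-1 * c * (x * u))).
have us' : uniq [seq (x * u)^-1 * c * (x * u) | c <- s].
  by rewrite map_inj_uniq // => p q /mulIg /mulgI.
have inQ q : q \in [seq (x * u)^-1 * c * (x * u) | c <- s] -> Q q.
  move=> /mapP [c /hs hc ->]; split; first exact: hu.
  have := hu' _ hc; rewrite /w; congr (E b' _).
  by gsimp.
have QL q : Q q -> q \in L by case=> q1 q2; apply: hL.
case: b {hL} hu @Q sQ inQ QL => hu Q sQ inQ QL.
  by apply: leq_trans (leq_maxl _ _); apply: (h1 Q L) => // q [].
by apply: leq_trans (leq_maxr _ _); apply: (h2 Q L) => // q [].
Qed.

End CutAcylindrical.

(** * Polygons of groups, indexed by [nat] with period [n] *)

Lemma periodic_mod n (T : Type) (f : nat -> T) : (forall k, f (k + n) = f k) ->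
  forall k k', k = k' %[mod n] -> f k = f k'.
Proof.
move=> h k k' e; rewrite (divn_eq k n) (divn_eq k' n) e.
have p q r : f (q * n + r) = f r by elim: q => // q <-; rewrite mulSn -addnA addnC h.
by rewrite !p.
Qed.

Section PolygonOfGroups.
Context (G : groupType) (n : nat) (V E : nat -> G -> Prop) (P : G -> Prop).
Hypotheses (hn : 4 <= n) (sV : forall k, subgrp (V k)) (sE : forall k, subgrp (E k))
  (sP : subgrp P) (Vper : forall k, V (k + n) = V k) (Eper : forall k, E (k + n) = E k)
  (PE : forall k x, P x -> E k x) (EV : forall k x, E k x -> V k x)
  (EV1 : forall k x, E k x -> V k.+1 x)
  (EEP : forall i j x, i < j -> j < i + n -> E i x -> E j x -> P x)
  (genV : forall x, gen (fun y => exists k, V k y) x).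
Hypothesis univV : forall (Q : groupType) (f : nat -> G -> Q),
  (forall k x y, V k x -> V k y -> f k (x * y) = f k x * f k y) ->
  (forall k x, E k x -> f k x = f k.+1 x) -> (forall k, f (k + n) = f k) ->
  exists2 th : G -> Q, morph th & forall k x, V k x -> th x = f k x.

Definition arc a m := gen (fun x : G => exists k, [/\ a <= k, k < a + m & V k x]).

Let per_mod := @periodic_mod n.

(** [k - a] modulo [n]: adding [a * n.-1] avoids truncated subtraction. *)
Let res a k := (k + a * n.-1) %% n.

Let resE a j : j < n -> res a (a + j) = j.
Proof.
move=> hj; rewrite /res (_ : a + j + a * n.-1 = a * n + j)%N ?modnMDl ?modn_small //.
by rewrite addnAC -mulnS prednK //; lia.
Qed.

Let res_mod a k : a + res a k = k %[mod n].
Proof.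
rewrite /res modnDmr (_ : a + (k + a * n.-1) = a * n + k)%N ?modnMDl //.
by rewrite addnCA -mulnS prednK 1?addnC //; lia.
Qed.

Let res_lt a k : res a k < n.
Proof. by rewrite ltn_mod; lia. Qed.

Let res_per a k : res a (k + n) = res a k.
Proof. by rewrite /res addnAC modnDr. Qed.

Let resS a k : res a k.+1 = if (res a k).+1 == n then 0%N else (res a k).+1.
Proof.
have e := res_lt a k.
have -> : res a k.+1 = (res a k).+1 %% n.
  by rewrite -[in RHS]add1n /res modnDmr addnA add1n.
case: eqP => [->|ne]; first by rewrite modnn.
by rewrite modn_small //; lia.
Qed.

Let sarc a m : subgrp (arc a m). Proof. exact: gen_subgrp. Qed.

Let arc_in a m k x : a <= k -> k < a + m -> V k x -> arc a m x.
Proof. by move=> h1 h2 h; apply: gen_in; exists k. Qed.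

Let arc_per a m : arc (a + n) m = arc a m.
Proof.
apply/funext => x; apply/propext; split; apply: gen_min => // y [k [h1 h2 h]].
  have e : k = (k - n + n)%N by lia.
  by rewrite e Vper in h; apply: arc_in h; lia.
by rewrite -Vper in h; apply: arc_in h; lia.
Qed.

Let arc1 a : arc a 1 = V a.
Proof.
apply/funext => x; apply/propext; split; last by apply: arc_in; lia.
by apply: gen_min => // y [k [h1 h2 h]]; rewrite (_ : a = k) //; lia.
Qed.

Let arc_min a m (H : G -> Prop) : subgrp H ->
  (forall k x, a <= k -> k < a + m -> V k x -> H x) -> forall x, arc a m x -> H x.
Proof. by move=> sH h; apply: gen_min => // x [k [h1 h2 h3]]; apply: h h3. Qed.

Section Square.
Variables (a m0 m1 m2 m3 : nat).
Hypotheses (sm : m0 + m1 + m2 + m3 = n) (h0 : 0 < m0) (h1 : 0 < m1) (h2 : 0 < m2) (h3 : 0 < m3).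

(** In cyclic order the four arcs are [arcL true], [arcL false], [arcR false], [arcR true]. The cut
    goes through the edges between [arcR true] and [arcL true] and between [arcL false] and
    [arcR false]; these are [edgeLR]. *)
Definition arcL b := if b then arc a m0 else arc (a + m0) m1.
Definition arcR b := if b then arc (a + m0 + m1 + m2) m3 else arc (a + m0 + m1) m2.
Definition edgeLR b := E (if b then a + n - 1 else a + m0 + m1 - 1)%N.

Let V_arc k x : V k x -> exists b, arcL b x \/ arcR b x.
Proof.
rewrite -(per_mod Vper (res_mod a k)) => hx; have hr := res_lt a k.
case: (ltnP (res a k) m0) => r0; first by exists true; left; apply: arc_in hx; lia.
case: (ltnP (res a k) (m0 + m1)) => r1; first by exists false; left; apply: arc_in hx; lia.
case: (ltnP (res a k) (m0 + m1 + m2)) => r2; first by exists false; right; apply: arc_in hx; lia.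
by exists true; right; apply: arc_in hx; lia.
Qed.

Let arc_ext (Q : groupType) (th f : G -> Q) c m : morph th ->
  (forall x y, arc c m x -> arc c m y -> f (x * y) = f x * f y) ->
  (forall k x, c <= k -> k < c + m -> V k x -> th x = f x) -> forall x, arc c m x -> th x = f x.
Proof.
move=> thM fM e x hx; suff [] : arc c m x /\ th x = f x by [].
have f1 : f 1 = 1 by apply: (mulIg (f 1)); rewrite -fM ?mulg1 ?mul1g //; apply: sub1.
apply: (gen_min (H := fun x => arc c m x /\ th x = f x)) hx.
  split=> [|u v [u1 u2] [v1 v2]|u [u1 u2]].
  - by split; [apply: sub1|rewrite (morph1 thM) f1].
  - by split; [apply: subM|rewrite thM fM // u2 v2].
  split; first exact: subV.
  rewrite (morphV thM) u2; apply: (mulIg (f u)); rewrite mulVg -fM ?mulVg ?f1 //; exact: subV.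
by move=> y [k [k1 k2 k3]]; split; [apply: arc_in k3|apply: e k3].
Qed.

Lemma polygon_square : exists l, [/\ tree_split (sqU arcL arcR) (sqC edgeLR) l,
  forall b x, arcL b x -> sqC edgeLR x -> edgeLR b x,
  forall b x, arcR b x -> sqC edgeLR x -> edgeLR b x &
  forall x, l x <= len (fun y => exists k, V k y) x].
Proof.
have sL b : subgrp (arcL b) by case: b; apply: sarc.
have sR b : subgrp (arcR b) by case: b; apply: sarc.
have EA k c m x : E k x -> c <= k < c + m \/ c <= k.+1 < c + m -> arc c m x.
  by move=> hx [/andP [q1 q2]|/andP [q1 q2]]; [apply: arc_in (EV hx)|apply: arc_in (EV1 hx)].
pose FL := E (a + m0).-1; pose FR := E (a + m0 + m1 + m2).-1.
have FL' b x : FL x -> arcL b x.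
  by case: b => hx; apply: EA hx _; [left|right]; apply/andP; split; lia.
have FR' b x : FR x -> arcR b x.
  by case: b => hx; apply: EA hx _; [right|left]; apply/andP; split; lia.
have EL b x : edgeLR b x -> arcL b x.
  case: b => hx; last by apply: EA hx _; left; apply/andP; split; lia.
  have := EV1 hx; rewrite -subSn; last by lia.
  by rewrite subn1 /= Vper => h; apply: arc_in h; lia.
have ER b x : edgeLR b x -> arcR b x.
  by case: b => hx; apply: EA hx _; [left|right]; apply/andP; split; lia.
have PEb b x : P x -> edgeLR b x by move=> h; apply: PE.
have EFL b x : edgeLR b x -> FL x -> edgeLR (~~ b) x.
  case: b => /= e f; apply: PEb; first by apply: EEP f e; lia.
  by apply: EEP f e; lia.
have EFR b x : edgeLR b x -> FR x -> edgeLR (~~ b) x.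
  case: b => /= e f; apply: PEb; first by apply: EEP f e; lia.
  by apply: EEP e f; lia.
have EE x : edgeLR true x -> edgeLR false x -> FL x /\ FR x.
  move=> e f; have p : P x by apply: EEP f e; lia.
  by split; apply: PE.
have gG (H : G -> Prop) : subgrp H -> (forall b x, arcL b x -> H x) ->
    (forall b x, arcR b x -> H x) -> forall x, H x.
  move=> sH hL hR x; apply: gen_min (genV x) => // y [k /V_arc [b [h|h]]].
    exact: hL h.
  exact: hR h.
have uni (Q : groupType) (fL fR : bool -> G -> Q) :
  (forall b x y, arcL b x -> arcL b y -> fL b (x * y) = fL b x * fL b y) ->
  (forall b x y, arcR b x -> arcR b y -> fR b (x * y) = fR b x * fR b y) ->
  (forall x, FL x -> fL true x = fL false x) -> (forall x, FR x -> fR true x = fR false x) ->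
  (forall b x, edgeLR b x -> fL b x = fR b x) ->
  exists2 th : G -> Q, morph th &
    forall b x, (arcL b x -> th x = fL b x) /\ (arcR b x -> th x = fR b x).
  move=> fLM fRM eL eR eE.
  pose sel r := if r < m0 then fL true else if r < m0 + m1 then fL false else
    if r < m0 + m1 + m2 then fR false else fR true.
  have [|k x ex||th thM thV] := @univV Q (fun k => sel (res a k)).
  - move=> k x y; rewrite -(per_mod Vper (res_mod a k)) /sel; have hr := res_lt a k.
    case: ifP => r0; first by move=> hx hy; apply: fLM; [apply: arc_in hx|apply: arc_in hy]; lia.
    case: ifP => r1; first by move=> hx hy; apply: fLM; [apply: arc_in hx|apply: arc_in hy]; lia.
    by case: ifP => r2 hx hy; apply: fRM; [apply: arc_in hx|apply: arc_in hy|apply: arc_in hx|apply: arc_in hy]; lia.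
  - rewrite resS; have hr := res_lt a k; rewrite -(per_mod Eper (res_mod a k)) in ex.
    have ek j : res a k = j -> E (a + j) x by move=> <-.
    rewrite /sel; case: eqP => hn1.
      have e1 : (res a k < m0) = false by lia.
      have e2 : (res a k < m0 + m1) = false by lia.
      have e3 : (res a k < m0 + m1 + m2) = false by lia.
      rewrite h0 e1 e2 e3 -(eE true) // /edgeLR.
      by have := ek n.-1 ltac:(lia); rewrite (_ : a + n - 1 = a + n.-1)%N //; lia.
    case: (ltnP (res a k).+1 m0) => r0.
      by have -> : res a k < m0 by lia.
    case: (ltnP (res a k) m0) => r0'.
      have -> : (res a k).+1 < m0 + m1 by lia.
      by apply: eL; have := ek m0.-1 ltac:(lia); rewrite /FL (_ : (a + m0).-1 = a + m0.-1)%N //; lia.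
    case: (ltnP (res a k).+1 (m0 + m1)) => r1.
      by have -> : res a k < m0 + m1 by lia.
    case: (ltnP (res a k) (m0 + m1)) => r1'.
      have -> : (res a k).+1 < m0 + m1 + m2 by lia.
      apply: (eE false); have := ek (m0 + m1).-1 ltac:(lia).
      by rewrite /edgeLR (_ : a + m0 + m1 - 1 = a + (m0 + m1).-1)%N //; lia.
    case: (ltnP (res a k).+1 (m0 + m1 + m2)) => r2.
      by have -> : res a k < m0 + m1 + m2 by lia.
    case: (ltnP (res a k) (m0 + m1 + m2)) => // r2'.
    symmetry; apply: eR; have := ek (m0 + m1 + m2).-1 ltac:(lia).
    by rewrite /FR (_ : (a + m0 + m1 + m2).-1 = a + (m0 + m1 + m2).-1)%N //; lia.
  - by move=> k; rewrite res_per.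
  have thr k x : a <= k -> k < a + n -> V k x -> th x = sel (k - a) x.
    by move=> k1 k2 /thV ->; rewrite -(subnKC k1) resE ?addKn //; lia.
  exists th => // b x; split; case: b => hx.
  - apply: arc_ext thM (@fLM true) _ x hx => k y k1 k2 /thr -> //; last by lia.
    by rewrite /sel; have -> : k - a < m0 by lia.
  - apply: arc_ext thM (@fLM false) _ x hx => k y k1 k2 /thr -> //; try by lia.
    rewrite /sel; have -> : (k - a < m0) = false by lia.
    by have -> : k - a < m0 + m1 by lia.
  - apply: arc_ext thM (@fRM true) _ x hx => k y k1 k2 /thr -> //; try by lia.
    rewrite /sel; have -> : (k - a < m0) = false by lia.
    have -> : (k - a < m0 + m1) = false by lia.
    by have -> : (k - a < m0 + m1 + m2) = false by lia.
  apply: arc_ext thM (@fRM false) _ x hx => k y k1 k2 /thr -> //; try by lia.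
  rewrite /sel; have -> : (k - a < m0) = false by lia.
  have -> : (k - a < m0 + m1) = false by lia.
  by have -> : k - a < m0 + m1 + m2 by lia.
have [l [ts hL hR]] := square_split sL sR (sE _) (sE _) (fun b => sE _) FL' FR' EL ER EFL EFR EE gG uni.
exists l; split=> // x; apply: (l_wl ts).
apply: wl_mono (len_wl (genV x)) => y [k /V_arc [b [h|h]]]; [left|right];
  by apply: gen_in; case: b h => h; [left|right].
Qed.

End Square.

Local Notation Sh := (fun y : G => exists k, V k y).
Hypotheses (hypV : forall k, hypsub (V k)) (hypE : forall k, hypsub (E k))
  (qEV : forall k, qisub (E k) (V k)) (qEV1 : forall k, qisub (E k) (V k.+1)).
Context (delta : nat).
Hypothesis hSh : hyp (gen Sh) (wd Sh) delta.
Hypothesis acylE : exists K0, forall k k' t, K0 <= len Sh t -> exists L : seq G,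
  forall c, E k c -> E k' (t^-1 * c * t) -> c \in L.

Let edge_acylindrical A k l : tree_split A (E k) l -> (forall x, l x <= len Sh x) ->
  acylindrical_split A (E k) l.
Proof.
move=> ts lSh; have [K0 hK] := acylE.
have [S [dl [[fS eS] hS]]] := hypE k; have [M hM] := finite_subgroup_bound fS hS.
exists K0, M => t _ lt s us hs; have [L hL] := hK k k t (leq_trans lt (lSh t)).
apply: (hM (fun c => E k c /\ E k (t^-1 * c * t)) L) us hs => [|x [/eS //]|x [h1 h2]]; last exact: hL.
split=> [|u v [u1 u2] [v1 v2]|u [u1 u2]].
- by gsimp; split; apply: sub1.
- by split; [exact: subM|have := subM (sE k) u2 v2; gsimp].
by split; [exact: subV|have := subV (sE k) u2; gsimp].
Qed.

Definition two (A B : G -> Prop) (b : bool) := if b then A else B.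

(** Two arcs adjacent across one edge of the cut meet the cut group in that edge group only, so
    reduced words over the two arcs are still reduced for the whole square. *)
Let square_side a m0 m1 m2 m3 : m0 + m1 + m2 + m3 = n -> 0 < m0 -> 0 < m1 -> 0 < m2 -> 0 < m3 ->
  let A := two (arc a m0) (arc (a + m0 + m1 + m2) m3) in
  (exists l, tree_split A (E (a + n - 1)) l /\ forall x, l x <= len Sh x).
Proof.
move=> sm h0 h1 h2 h3 A.
have [l [ts hL hR hl]] := @polygon_square a m0 m1 m2 m3 sm h0 h1 h2 h3.
have EL x : E (a + n - 1) x -> arc a m0 x.
  move=> hx; have := EV1 hx; rewrite -subSn; last by lia.
  by rewrite subn1 /= Vper => h; apply: arc_in h; lia.
have ER x : E (a + n - 1) x -> arc (a + m0 + m1 + m2) m3 x.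
  by move=> /EV h; apply: arc_in h; lia.
exists l; split=> //; apply: (sub_split ts) => //.
- by case; apply: sarc.
- by case.
- by move=> x h; apply: gen_in; left.
- by case=> x h; apply: gen_in; left.
by case=> x h c; [apply: (hL true)|apply: (hR true)].
Qed.

Let V_fgen k : exists S, fgen (V k) S. Proof. exact: hypsub_fgen. Qed.
Let E_fgen k : exists S, fgen (E k) S. Proof. exact: hypsub_fgen. Qed.

Let two_gen (A B H : G -> Prop) : subgrp H -> (forall x, A x -> H x) -> (forall x, B x -> H x) ->
  (forall Q, subgrp Q -> (forall x, A x -> Q x) -> (forall x, B x -> Q x) -> forall x, H x -> Q x) ->
  gen (factors (two A B)) = H.
Proof.
move=> sH AH BH m; apply/funext => x; apply/propext; split.
  by apply: gen_min => // y [/AH|/BH].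
by apply: m; [apply: gen_subgrp|move=> y h; apply: gen_in; left|move=> y h; apply: gen_in; right].
Qed.

Let arcS_gen a m : gen (factors (two (V (a + m)) (arc a m))) = arc a m.+1.
Proof.
apply: two_gen; first exact: sarc.
- by move=> x h; apply: arc_in h; lia.
- by apply: arc_min; [apply: sarc|move=> k x k1 k2 h; apply: arc_in h; lia].
move=> Q sQ h1 h2; apply: arc_min => // k x k1 k2 hx.
case: (ltnP k (a + m)) => k3; first by apply/h2/(arc_in _ _ hx).
by apply: h1; rewrite (_ : a + m = k)%N //; lia.
Qed.

Let arc_hyp m : 0 < m -> m <= n - 2 ->
  [/\ hypsub (arc 2 m), qisub (V 2) (arc 2 m) & qisub (V m.+1) (arc 2 m)].
Proof.
case: m => // m _; elim: m => [|m IH] hm.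
  by rewrite arc1; split=> //; apply: qisub_refl.
have [hA q2 qm] := IH ltac:(lia).
(* The arcs of this square are the vertex [m.+3], the vertices from [m.+4] to [n], the vertex
   [n.+1], and those of [arc 2 m.+1] shifted by a period. *)
have [|||||l [ts hl]] := @square_side m.+3 1 (n - m - 3) 1 m.+1; try lia.
rewrite arc1 (_ : m.+3 + 1 + (n - m - 3) + 1 = 2 + n)%N ?arc_per in ts; last by lia.
rewrite (_ : m.+3 + n - 1 = m.+2 + n)%N ?Eper in ts; last by lia.
have Vm x : V m.+2 x -> arc 2 m.+1 x by move=> h; apply: arc_in h; lia.
have hyb b : hypsub (two (V m.+3) (arc 2 m.+1) b) by case: b => /=; [apply: hypV|].
have qb b : qisub (E m.+2) (two (V m.+3) (arc 2 m.+1) b).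
  case: b => /=; first exact: qEV1.
  by apply: (qisub_trans (V_fgen m.+2) _ (@qEV _) qm) => x; apply: EV.
have [h q] := combination ts hyb (E_fgen _) qb (edge_acylindrical ts hl).
rewrite -[V m.+3]/(V (2 + m.+1)) arcS_gen in h q.
split=> //; last exact: (q true).
apply: (qisub_trans _ _ q2 (q false)); first exact: hypsub_fgen.
by move=> x hx; apply: arc_in hx; lia.
Qed.

Local Notation A1 := (two (V 1) (V n)).
Let A1_split : exists l, tree_split A1 (E n) l /\ forall x, l x <= len Sh x.
Proof.
have [|||||l [ts hl]] := @square_side 1 1 (n - 3) 1 1; try lia.
have e1 : 1 + n - 1 = n by lia.
have e2 : 1 + 1 + (n - 3) + 1 = n by lia.
by exists l; split=> //; rewrite e1 e2 !arc1 in ts.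
Qed.

Local Notation L := (gen (factors A1)).
Local Notation EE := (two (E (n - 1)) (E 1)).
Local Notation C := (gen (factors EE)).

Let En1 x : E (n - 1) x -> V n x.
Proof. by move=> /EV1; rewrite -subSn ?subn1 //; lia. Qed.

Let two_swap A B : gen (factors (two A B)) = gen (factors (two B A)).
Proof.
apply/funext => x; apply/propext; split; apply: gen_min; try exact: gen_subgrp;
  by move=> y [h|h]; apply: gen_in; [right|left].
Qed.

Let final_split : exists l, tree_split (two L (arc 2 (n - 2))) C l /\ forall x, l x <= len Sh x.
Proof.
have [|||||l [ts _ _ hl]] := @polygon_square n 1 1 (n - 3) 1; try lia.
exists l; split=> //; move: ts.
have eL : arcL n 1 1 = two (V n) (V 1).
  by apply/funext => -[] /=; rewrite arc1 // addnC Vper.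
have eR : arcR n 1 1 (n - 3) 1 = two (V (n - 1)) (arc 2 (n - 3)).
  apply/funext => -[] /=; rewrite ?arc1; first by rewrite -[RHS]Vper; congr V; lia.
  by rewrite -[RHS]arc_per; congr arc; lia.
have eE : edgeLR n 1 1 = EE.
  by apply/funext => -[] /=; rewrite -[RHS]Eper; congr E; lia.
rewrite eL eR eE /sqC.
have -> : sqU (two (V n) (V 1)) (two (V (n - 1)) (arc 2 (n - 3))) = two L (arc 2 (n - 2)) => //.
apply/funext => -[]; first exact: two_swap.
have := arcS_gen 2 (n - 3); rewrite (_ : 2 + (n - 3) = n - 1)%N; last by lia.
by rewrite (_ : (n - 3).+1 = n - 2)%N //; lia.
Qed.

(** Cut along [E 0] and [E (n - 2)]: [E (n - 1)] lies in the corner [V (n - 1)] on one side, [E 1]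
    in the corner [V 1] on the other, and each meets the cut group in [P]. So [C] is their amalgam
    over [P]. *)
Let C_split : exists l, tree_split EE P l /\ forall x, l x <= len Sh x.
Proof.
have [|||||l [ts hL hR hl]] := @polygon_square (n - 1) 1 1 1 (n - 3); try lia.
exists l; split=> //.
have eL : arcL (n - 1) 1 1 true = V (n - 1) by rewrite /= arc1.
have eR : arcR (n - 1) 1 1 1 (n - 3) false = V 1.
  by rewrite /= arc1 -[RHS]Vper; congr V; lia.
have eE : edgeLR (n - 1) 1 1 true = E (n - 2) by rewrite /edgeLR -[RHS]Eper; congr E; lia.
have eE' : edgeLR (n - 1) 1 1 false = E 0 by rewrite /edgeLR -[RHS]Eper; congr E; lia.
have U1 x : E (n - 1) x -> arcL (n - 1) 1 1 true x by rewrite eL; apply: EV.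
have U2 x : E 1 x -> arcR (n - 1) 1 1 1 (n - 3) false x by rewrite eR; apply: EV.
apply: (sub_split ts) => //.
- by case; apply: sE.
- by case=> x h; apply: PE.
- by move=> x h; apply: gen_in; left; rewrite eE; apply: PE.
- by case=> x h; apply: gen_in; [left; apply: U1|right; apply: U2].
case=> x h c.
  have := hL true x (U1 _ h) c; rewrite eE => h'; apply: EEP h' h; lia.
have := hR false x (U2 _ h) c; rewrite eE' => h'; apply: EEP h' h; lia.
Qed.

(** [C] is undistorted in both factors by [combination_sub]. It is the sub-amalgam of [E (n - 1)]
    and [E 1] in the amalgam of [V n] and [V 1] over [E n], and also in that of [V (n - 1)] and
    [arc 2 (n - 3)] over [E (n - 2)]. In the second one, four sides make [E 1] and [E (n - 2)]
    different edges. *)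
Theorem polygon_combination (H : G -> Prop) : subgrp H -> (forall x, H x) ->
  [/\ hypsub H, exists l, tree_split (two (V 1) (V n)) (E n) l &
    qisub (gen (factors (two (V 1) (V n)))) H].
Proof.
move=> sH allH.
have [l1 [ts1 hl1]] := A1_split.
have qn : qisub (E (n - 1)) (V n).
  by have := @qEV1 (n - 1)%N; rewrite -subSn ?subn1 //; lia.
have hyb1 b : hypsub (A1 b) by case: b; apply: hypV.
have En : E n = E 0 by rewrite -(Eper 0).
have Vn : V n = V 0 by rewrite -(Vper 0).
have qb1 b : qisub (E n) (A1 b).
  by case: b => /=; rewrite ?En ?Vn; [apply: qEV1|apply: qEV].
have acyl1 := edge_acylindrical ts1 hl1.
have [hL qL] := combination ts1 hyb1 (E_fgen _) qb1 acyl1.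
have qCL : qisub C L.
  rewrite two_swap; apply: (combination_sub ts1 hyb1 (E_fgen _) qb1 acyl1).
  - by case; apply: E_fgen.
  - by case=> x /=; [apply: EV|apply: En1].
  - by case=> x h1 h2; apply: PE; [apply: EEP h1 h2|apply: EEP h1 h2]; lia.
  by case; [apply: qEV|apply: qn].
have [|||||l2 [ts2 hl2]] := @square_side (n - 1) 1 1 1 (n - 3); try lia.
have eE : E (n - 1 + n - 1) = E (n - 2) by rewrite -[RHS]Eper; congr E; lia.
have eA : arc (n - 1 + 1 + 1 + 1) (n - 3) = arc 2 (n - 3).
  by rewrite -[RHS]arc_per; congr arc; lia.
rewrite arc1 eE eA in ts2.
have [hA q2 qA] := @arc_hyp (n - 3) ltac:(lia) ltac:(lia).
have eV : (n - 3).+1 = n - 2 by lia.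
have eV1 : (n - 2).+1 = n - 1 by lia.
rewrite eV in qA.
have hyb2 b : hypsub (two (V (n - 1)) (arc 2 (n - 3)) b) by case: b => //=; apply: hypV.
have qb2 b : qisub (E (n - 2)) (two (V (n - 1)) (arc 2 (n - 3)) b).
  case: b => /=; first by rewrite -eV1; apply: qEV1.
  by apply: (qisub_trans (V_fgen (n - 2)) _ (@qEV _) qA) => x; apply: EV.
have acyl2 := edge_acylindrical ts2 hl2.
have eR : gen (factors (two (V (n - 1)) (arc 2 (n - 3)))) = arc 2 (n - 2).
  have := arcS_gen 2 (n - 3); rewrite (_ : 2 + (n - 3) = n - 1)%N; last by lia.
  by rewrite eV.
have E1V x : E 1 x -> V 2 x by apply: EV1.
have qCR : qisub C (arc 2 (n - 2)).
  rewrite -eR; apply: (combination_sub ts2 hyb2 (E_fgen _) qb2 acyl2).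
  - by case; apply: E_fgen.
  - by case=> x /=; [apply: EV|move=> /E1V h; apply: arc_in h; lia].
  - by case=> x h1 h2; apply: PE; [apply: EEP h2 h1|apply: EEP h1 h2]; lia.
  case; first by apply: qEV.
  by apply: (qisub_trans (V_fgen 2) E1V (@qEV1 _) q2).
have [l [ts hl]] := final_split; have [l3 [ts3 hl3]] := C_split.
have [hR _ _] := @arc_hyp (n - 2) ltac:(lia) ltac:(lia).
have allU x : gen (factors (two L (arc 2 (n - 2)))) x.
  apply: gen_min (genV x); first exact: gen_subgrp.
  move=> y [k]; rewrite -(per_mod Vper (modn_mod k n)).
  have : k %% n < n by rewrite ltn_mod; lia.
  case: (k %% n)%N => [_ h|[_ h|j hj h]].
  - by apply: gen_in; left; apply: gen_in; right; rewrite /= Vn.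
  - by apply: gen_in; left; apply: gen_in; left.
  by apply: gen_in; right; apply: arc_in h; lia.
have acyl : acylindrical_split (two L (arc 2 (n - 2))) C l.
  apply: (cut_acylindrical genV hSh ts ts3 hl hl3) => //.
  - by case=> x h; eexists; apply: EV h.
  - by case; apply: hypE.
  by have [K0 hK] := acylE; exists K0; case; case=> t /hK h; apply: h.
have hyb b : hypsub (two L (arc 2 (n - 2)) b) by case: b.
have fC : exists S, fgen C S.
  have fE b : exists S, fgen (EE b) S by case: b; apply: E_fgen.
  have [S hS] := choice fE.
  by eexists; apply: (fgen_factors hS).
have qC b : qisub C (two L (arc 2 (n - 2)) b) by case: b.
have [hG qG] := combination ts hyb fC qC acyl.
have -> : H = gen (factors (two L (arc 2 (n - 2)))).
  by apply/funext => x; apply/propext; split=> _.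
by split=> //; [exists l1|apply: (qG true)].
Qed.

End PolygonOfGroups.

(** * The fundamental group of a complex of groups *)

Section TreeLabelling.
Context (I : finType) (adj : rel I) (Q : groupType) (c : I -> I -> Q) (D : rel I) (P : I).
Hypotheses (adjE : forall x y, adj x y = D x y || D y x) (Dasym : forall x y, D x y -> ~~ D y x)
  (conn : forall x y, connect adj x y)
  (acyclic : forall s, ucycle adj s -> size s <= 2).

(* Partial solutions on a connected set of vertices, to be extended one leaf at
   a time. *)
Let solved (S : {set I}) := [/\ P \in S,
  forall x y, x \in S -> y \in S -> exists p, [/\ path adj x p, last x p = y & all (mem S) p] &
  exists ka : I -> Q, ka P = 1 /\ forall x y, x \in S -> y \in S -> D x y -> ka x = ka y * c x y].

Let Dirr x : ~~ D x x.
Proof. by apply/negP => h; have := Dasym h; rewrite h. Qed.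

Let extend S : solved S -> S != finset.setT -> exists2 S', solved S' & #|S| < #|S'|.
Proof.
move=> [PS cS [ka [kaP kaD]]] nS.
have [b0 nb0] : exists b, b \notin S.
  apply: contrapT => h; case/negP: nS; apply/eqP/setP => x; rewrite inE.
  by apply: contrapT => /negP nx; apply: h; exists x.
have [a [b [aS nb ab]]] : exists a b, [/\ a \in S, b \notin S & adj a b].
  have /connectP [p] := conn P b0; elim: p P PS => [|y p IH] x xS /=.
    by move=> _ e; rewrite e xS in nb0.
  move=> /andP [xy hp] e; case: (boolP (y \in S)) => hy; first exact: IH hp e.
  by exists x, y.
have adjC x y : adj x y = adj y x by rewrite !adjE orbC.
have uniq_nb a' : a' \in S -> adj a' b -> a' = a.
  move=> a'S a'b; have [p [hp ep pS]] := cS _ _ aS a'S.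
  have [q [hq eq uq qS]] : exists q, [/\ path adj a q, last a q = a', uniq (a :: q) & all (mem S) q].
    have := ep; case: (shortenP hp) => q hq uq sub eq; exists q; split=> //.
    by apply/allP => z /sub zp; apply: (allP pS).
  have : ucycle adj (b :: a :: q).
    have nbq : b \notin a :: q.
      rewrite inE negb_or; apply/andP; split; first by apply: contraNneq nb => ->.
      by apply/negP => /(allP qS) bS; have : b \in S := bS; rewrite (negbTE nb).
    by rewrite /ucycle cons_uniq nbq uq /= adjC ab rcons_path hq eq a'b.
  by move/acyclic; case: q eq {hq uq qS} => [/= ->|].
exists (b |: S)%SET; last by rewrite cardsU1 nb.
split; first by rewrite in_setU1 PS orbT.
  have sub p : all (mem S) p -> all (mem (b |: S)%SET) p.
    by move=> /allP h; apply/allP => z /h /= zS; rewrite in_setU1 zS orbT.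
  move=> x y; rewrite !in_setU1 => /orP [/eqP ->|xS] /orP [/eqP ->|yS].
  - by exists [::].
  - have [p [hp ep pS]] := cS _ _ aS yS; exists (a :: p).
    by rewrite /= adjC ab hp ep in_setU1 aS orbT sub.
  - have [p [hp ep pS]] := cS _ _ xS aS; exists (rcons p b).
    by rewrite rcons_path hp ep ab last_rcons all_rcons /= in_setU1 eqxx sub.
  by have [p [hp ep pS]] := cS _ _ xS yS; exists p; rewrite hp ep sub.
pose kb := if D a b then (ka a) * (c a b)^-1 else ka a * c b a.
exists (fun x => if x == b then kb else ka x); split.
  by case: eqP => // e; rewrite -e PS in nb.
move=> x y; rewrite !in_setU1.
case: (eqVneq x b) => [->|xb]; case: (eqVneq y b) => [->|yb] /=.
- by move=> _ _ h; have := Dirr b; rewrite h.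
- move=> _ yS h; have ya : y = a by apply: uniq_nb => //; rewrite adjE h orbT.
  by rewrite ya in h *; rewrite /kb (negbTE (Dasym h)).
- move=> xS _ h; have xa : x = a by apply: uniq_nb => //; rewrite adjE h.
  by rewrite xa in h *; rewrite /kb h mulgVK.
by move=> xS yS; apply: kaD.
Qed.

(** On a tree every labelling of the edges is a coboundary. By acyclicity a new vertex has a single
    neighbour among those already treated ([uniq_nb] in [extend]), so that its value is determined
    without a compatibility condition. *)
Lemma tree_coboundary : exists ka : I -> Q, ka P = 1 /\ forall x y, D x y -> ka x = ka y * c x y.
Proof.
suff [S [PS cS [ka [kaP kaD]]] hS] : exists2 S, solved S & #|I| <= #|S|.
  have allS x : x \in S.
    have : S = finset.setT by apply/eqP; rewrite eqEcard finset.subsetT finset.cardsT.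
    by move=> ->; rewrite inE.
  by exists ka; split=> // x y; apply: kaD.
have : forall m, m <= #|I| -> exists2 S, solved S & m <= #|S|.
  elim=> [|m IH] hm.
    exists [set P]%SET => //; split; first by rewrite inE.
      by move=> x y /set1P -> /set1P ->; exists [::].
    exists (fun=> 1); split=> // x y /set1P -> /set1P -> h.
    by have := Dirr P; rewrite h.
  have [S sS lS] := IH (ltnW hm); case: (ltngtP m #|S|) lS => // [lt|e] _; first by exists S.
  have [|S' sS' lt] := extend sS; last by exists S' => //; rewrite e.
  by apply/eqP => eS; move: hm; rewrite e eS finset.cardsT ltnn.
by apply.
Qed.

End TreeLabelling.

(** * Complexes of groups with a largest face, based at this face *)

Section Cone.
Context (V : finType) (F : {set {set V}}) (G : complex_of_groups F)
  (T : {set face F * face F}) (P : face F).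
Hypotheses (topP : forall s : face F, s = P \/ val s \proper val P)
  (chainP : forall r s t : face F, val s \proper val r -> val t \proper val s -> r = P).
Implicit Types r s t : face F.
Local Notation pi := (pi1 G T).
Local Notation gr := (pi1_group T).

Lemma pi1_groupM s : morph (@pi1_group V F G T s).
Proof. by move=> x y; have := pres_rel (@rel_group V F G T s x y); rewrite /= !mulg1 => ->. Qed.

Lemma pi1_conj (s t : face F) (st : val t \proper val s) (g : cg_group G s) :
  pi1_edge G T st * gr g * (pi1_edge G T st)^-1 = gr (cg_map G st g).
Proof.
by have := pres_rel (@rel_conj V F G T s t st g); rewrite /= !mulg1 !mulgA => h; apply: h.
Qed.

Lemma pi1_comp (r s t : face F) (rs : val s \proper val r)
    (st : val t \proper val s) (rt : val t \proper val r) :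
  pi1_edge G T st * pi1_edge G T rs = gr (cg_twist G rs st) * pi1_edge G T rt.
Proof.
by have := pres_rel (@rel_comp V F G T r s t rs st rt); rewrite /= !mulg1 => h; apply: h.
Qed.

Lemma pi1_tree (s t : face F) (st : val t \proper val s) : (s, t) \in T -> pi1_edge G T st = 1.
Proof.
by move=> h; have := pres_rel (@rel_tree V F G T s t st h); rewrite /= !mulg1 => e; apply: e.
Qed.

Lemma pi1_gen (H : pi -> Prop) : subgrp H -> (forall s (g : cg_group G s), H (gr g)) ->
  (forall s t (st : val t \proper val s), H (pi1_edge G T st)) -> forall x, H x.
Proof. by move=> sH h1 h2; apply: pres_ind => // -[]. Qed.

(* The local groups are transported to the base point [P]. *)
Definition spoke (s : face F) : pi :=
  if pselect (val s \proper val P) is left st then pi1_edge G T st else 1.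
Definition based s (g : cg_group G s) : pi := (spoke s)^-1 * gr g * spoke s.
(** The twisting element of [(s, t)] and [(P, s)], or 1 for [s = P]. Local maps corrected by it make
    the based local groups strictly nested ([based_transport]). *)
Definition cone_twist s t (st : val t \proper val s) : cg_group G t :=
  if pselect (val s \proper val P) is left ps then cg_twist G ps st else 1.
Definition transport s t (st : val t \proper val s) (g : cg_group G s) : cg_group G t :=
  (cone_twist st)^-1 * cg_map G st g * cone_twist st.

Lemma spokeP : spoke P = 1.
Proof. by rewrite /spoke; case: pselect => // h; have := h; rewrite fintype.properxx. Qed.

Lemma spokeE s (h : val s \proper val P) : spoke s = pi1_edge G T h.
Proof. by rewrite /spoke; case: pselect => // h'; congr pi1_edge; apply: bool_irrelevance. Qed.

Lemma spoke_edge s t (st : val t \proper val s) :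
  pi1_edge G T st * spoke s = gr (cone_twist st) * spoke t.
Proof.
have gr1 : gr (1 : cg_group G t) = 1 by apply: morph1; apply: pi1_groupM.
rewrite /cone_twist; case: pselect => [ps|nps].
  have pt := fintype.proper_trans st ps.
  by rewrite (spokeE ps) (spokeE pt) pi1_comp.
by case: (topP s) => // sP; subst s; rewrite spokeP mulg1 gr1 mul1g (spokeE st).
Qed.

Lemma edge_spoke s t (st : val t \proper val s) :
  pi1_edge G T st = gr (cone_twist st) * spoke t * (spoke s)^-1.
Proof. by rewrite -spoke_edge mulgK. Qed.

Lemma basedM s : morph (@based s).
Proof. by move=> x y; rewrite /based pi1_groupM; gsimp. Qed.

Lemma based_transport s t (st : val t \proper val s) g : based g = based (transport st g).
Proof.
rewrite /based /transport !pi1_groupM (morphV (@pi1_groupM t)) -pi1_conj edge_spoke.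
by gsimp.
Qed.

Lemma based_inj : developable G T -> forall s, injective (@based s).
Proof. by move=> dev s x y /mulIg /mulgI /dev. Qed.

Definition local_img s (x : pi) := exists g : cg_group G s, x = based g.

Lemma local_img_subgrp s : subgrp (local_img s).
Proof.
split=> [|x y [g ->] [h ->]|x [g ->]].
- by exists 1; rewrite (morph1 (@basedM s)).
- by exists (g * h); rewrite basedM.
by exists g^-1; rewrite (morphV (@basedM s)).
Qed.

Lemma local_img_sub s t : val t \proper val s -> forall x, local_img s x -> local_img t x.
Proof. by move=> st x [g ->]; exists (transport st g); apply: based_transport. Qed.

Section Tree.
Hypothesis hT : maximal_tree T.

(** Along an edge of the maximal tree the two spokes differ by a based twisting element, by
    [spoke_edge] with [k_e = 1]. The tree path starts at [P], where the spoke is 1. *)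
Lemma spoke_mem (H : pi -> Prop) : subgrp H -> (forall s x, local_img s x -> H x) ->
  forall s, H (spoke s).
Proof.
move=> sH hl s; case: hT => Tp Tc _; have /connectP [p] := Tc P s.
have: H (spoke P) by rewrite spokeP; apply: sub1.
elim: p P => [x hx _ -> //|y p IH x hx /= /andP [xy hp] e]; apply: (IH y) => //.
have step a b : (a, b) \in T -> H (spoke a) <-> H (spoke b).
  move=> ab; have st := Tp a b ab; have := spoke_edge st; rewrite pi1_tree // mul1g.
  have -> : gr (cone_twist st) * spoke b = spoke b * based (cone_twist st).
    by rewrite /based; gsimp.
  have hb : H (based (cone_twist st)) by apply: (hl b); eexists.
  by move=> ->; split=> h; [apply: subMr hb h|apply: subM].
by case/orP: xy => /step h; apply/h.
Qed.

Lemma local_img_gen (H : pi -> Prop) : subgrp H -> (forall s x, local_img s x -> H x) ->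
  forall x, H x.
Proof.
move=> sH hl; have sp := spoke_mem sH hl.
have hg s (g : cg_group G s) : H (gr g).
  have -> : gr g = spoke s * based g * (spoke s)^-1 by rewrite /based; gsimp.
  apply: subM => //; last exact: subV.
  by apply: subM => //; apply: (hl s); eexists.
apply: pi1_gen => // s t st; rewrite edge_spoke; apply: subM => //; last exact: subV.
exact: subM.
Qed.

Theorem cone_universal (Q : groupType) (f : forall s, cg_group G s -> Q) :
  (forall s, morph (f s)) ->
  (forall s t (st : val t \proper val s) g, f s g = f t (transport st g)) ->
  exists2 th : pi -> Q, morph th & forall s g, th (based g) = f s g.
Proof.
move=> fM fT; case: hT => Tp Tc Ta.
pose c s t := if pselect (val t \proper val s) is left st then f t (cone_twist st) else 1.
have cE s t (st : val t \proper val s) : c s t = f t (cone_twist st).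
  by rewrite /c; case: pselect => // st'; congr (f t (cone_twist _)); apply: bool_irrelevance.
have Das x y : (x, y) \in T -> (y, x) \notin T.
  by move=> /Tp h; apply/negP => /Tp h'; have := fintype.proper_trans h h'; rewrite fintype.properxx.
have [ka [kaP kaD]] := @tree_coboundary _ (tree_adj T) Q c (fun x y => (x, y) \in T) P
  (fun _ _ => erefl) Das Tc Ta.
(* The values are moved away from the base point by [ka]. The tree relations ask for
   [ka s = ka t * c s t] on [T], which is what [tree_coboundary] solves. *)
pose phi (x : pi1_letter G) : Q := match x with
  | Lgroup s g => ka s * f s g * (ka s)^-1
  | Ledge s t st => ka t * f t (cone_twist st) * (ka s)^-1 end.
have ctP t (h : val t \proper val P) : cone_twist h = 1.
  by rewrite /cone_twist; case: pselect => // h'; have := h'; rewrite fintype.properxx.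
have phi_rel u v : pi1_rel T u v -> feval phi u = feval phi v.
  case=> [s g h|s t st g|r s t rs st rt|s t st sT] /=.
  - by rewrite fM; gsimp.
  - rewrite [f s g](fT s t st) /transport fM fM (morphV (@fM t)); gsimp.
    by [].
  - have rP := chainP rs st; subst r.
    rewrite !ctP /cone_twist (morph1 (@fM s)) (morph1 (@fM t)).
    case: pselect => // ps; rewrite (bool_irrelevance ps rs); gsimp.
    by [].
  by rewrite (kaD s t sT) cE; gsimp.
exists (pres_lift (rel_ := @pi1_rel V F G T) phi).
  by move=> x y; apply: pres_liftM.
move=> s g; rewrite /based.
have lM : morph (pres_lift (rel_ := @pi1_rel V F G T) phi) by move=> x y; apply: pres_liftM.
have lsp : pres_lift (rel_ := @pi1_rel V F G T) phi (spoke s) = ka s.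
  case: (topP s) => [->|ps]; first by rewrite spokeP (morph1 lM) kaP.
  by rewrite (spokeE ps) /pi1_edge (pres_lift_gen phi_rel) /= ctP (morph1 (@fM s)) kaP; gsimp.
rewrite lM lM (morphV lM) lsp /pi1_group (pres_lift_gen phi_rel) /=.
by gsimp.
Qed.

End Tree.
End Cone.

Section PolygonFaces.
Context (n : nat) (hn : 4 <= n).

Let n_gt0 : 0 < n. Proof. by lia. Qed.

Definition corner (k : nat) : 'I_n := Ordinal (ltn_pmod k n_gt0).

Lemma corner_eq i j : corner i = corner j <-> i = j %[mod n].
Proof. by split=> [[]|e] //; apply: val_inj. Qed.

Lemma corner_per k : corner (k + n) = corner k.
Proof. by apply: val_inj; rewrite /= modnDr. Qed.

Lemma corner_val (i : 'I_n) : corner i = i.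
Proof. by apply: val_inj; rewrite /= modn_small. Qed.

Lemma ordS_corner k : ordS (corner k) = corner k.+1.
Proof. by apply: val_inj; rewrite /= -addn1 modnDml addn1. Qed.

Lemma corner_neq i j : i < j -> j < i + n -> corner i != corner j.
Proof.
move=> h1 h2; apply/eqP => /corner_eq e.
have : (j - i + i) = 0 + i %[mod n] by rewrite subnK ?add0n //; lia.
move/eqP; rewrite eqn_modDr mod0n modn_small; lia.
Qed.

Let top_in : finset.setT \in polygon n. Proof. by rewrite !inE eqxx. Qed.
Let edge_in k : [set corner k; corner k.+1]%SET \in polygon n.
Proof.
rewrite !inE; apply/orP; right; apply/orP; left; apply/imsetP.
by exists (corner k); rewrite ?ordS_corner.
Qed.
Let vertex_in k : [set corner k]%SET \in polygon n.
Proof. by rewrite !inE; apply/orP; right; apply/orP; right; apply/imsetP; exists (corner k). Qed.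

Definition top_face : face (polygon n) := exist (fun A : {set 'I_n} => A \in polygon n) _ (top_in).
Definition edge_face k : face (polygon n) := exist (fun A : {set 'I_n} => A \in polygon n) _ (edge_in k).
Definition vertex_face k : face (polygon n) := exist (fun A : {set 'I_n} => A \in polygon n) _ (vertex_in k).

Lemma face_eq (s t : face (polygon n)) : val s = val t -> s = t.
Proof. exact: val_inj. Qed.

Lemma vertex_face_per k : vertex_face (k + n) = vertex_face k.
Proof. by apply: face_eq; rewrite /= corner_per. Qed.

Lemma edge_face_per k : edge_face (k + n) = edge_face k.
Proof. by apply: face_eq; rewrite /= -addSn !corner_per. Qed.

Variant face_spec : face (polygon n) -> Prop :=
| FaceTop : face_spec top_face
| FaceEdge k : face_spec (edge_face k)
| FaceVertex k : face_spec (vertex_face k).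

Lemma faceP s : face_spec s.
Proof.
have := valP s; rewrite !inE => /orP [/eqP e|/orP [/imsetP [i _ e]|/imsetP [i _ e]]].
- by rewrite (_ : s = top_face) //; [constructor|apply: face_eq].
- rewrite (_ : s = edge_face i); first by constructor.
  by apply: face_eq; rewrite e /= -ordS_corner corner_val.
rewrite (_ : s = vertex_face i); first by constructor.
by apply: face_eq; rewrite e /= corner_val.
Qed.

Lemma card_edge k : #|val (edge_face k)| = 2.
Proof. by rewrite cards2 corner_neq //; lia. Qed.

Lemma edge_proper k : val (edge_face k) \proper val top_face.
Proof.
rewrite properEcard finset.subsetT /= finset.cardsT card_ord -[[set _; _]%SET]/(val (edge_face k)) card_edge; lia.
Qed.

Lemma vertex_proper k : val (vertex_face k) \proper val (edge_face k).
Proof. by rewrite properEcard card_edge cards1 finset.sub1set !inE eqxx. Qed.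

Lemma vertexS_proper k : val (vertex_face k.+1) \proper val (edge_face k).
Proof. by rewrite properEcard card_edge cards1 finset.sub1set !inE eqxx orbT. Qed.

Lemma vertex_top_proper k : val (vertex_face k) \proper val top_face.
Proof. exact: fintype.proper_trans (vertex_proper k) (edge_proper k). Qed.

Lemma face_top s : s = top_face \/ val s \proper val top_face.
Proof.
by case: (faceP s) => [|k|k]; [left|right; apply: edge_proper|right; apply: vertex_top_proper].
Qed.

Lemma face_chain (r s t : face (polygon n)) :
  val s \proper val r -> val t \proper val s -> r = top_face.
Proof.
move=> /proper_card h1 /proper_card h2; case: (faceP r) h1 => [//|k|k].
  rewrite card_edge; case: (faceP t) h2 => [|j|j]; rewrite ?card_edge /= ?finset.cardsT ?cards1 ?card_ord; lia.
by rewrite /= cards1 ltnS leqn0 => /eqP e; rewrite e in h2.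
Qed.

Section Local.
Context (G : complex_of_groups (polygon n)) (T : {set face (polygon n) * face (polygon n)}).
Local Notation pi := (pi1 G T).
Local Notation img := (@local_img _ _ G T top_face).

Definition Vgrp k := img (vertex_face k).
Definition Egrp k := img (edge_face k).
Definition Pgrp := img top_face.

Lemma Vgrp_per k : Vgrp (k + n) = Vgrp k. Proof. by rewrite /Vgrp vertex_face_per. Qed.
Lemma Egrp_per k : Egrp (k + n) = Egrp k. Proof. by rewrite /Egrp edge_face_per. Qed.
Lemma Pgrp_sub k x : Pgrp x -> Egrp k x.
Proof. by apply: (local_img_sub face_top); apply: edge_proper. Qed.
Lemma Egrp_sub k x : Egrp k x -> Vgrp k x.
Proof. by apply: (local_img_sub face_top); apply: vertex_proper. Qed.
Lemma Egrp_subS k x : Egrp k x -> Vgrp k.+1 x.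
Proof. by apply: (local_img_sub face_top); apply: vertexS_proper. Qed.

Hypothesis hT : maximal_tree T.

Lemma Vgrp_gen x : gen (fun y => exists k, Vgrp k y) x.
Proof.
have sg := gen_subgrp (fun y => exists k, Vgrp k y).
apply: (local_img_gen (T := T) face_top hT sg) => s y.
case: (faceP s) => [/(@Pgrp_sub 0) /Egrp_sub|k /Egrp_sub|k] h; apply: gen_in; eexists; exact: h.
Qed.

Lemma Vgrp_universal (Q : groupType) (f : nat -> pi -> Q) :
  (forall k x y, Vgrp k x -> Vgrp k y -> f k (x * y) = f k x * f k y) ->
  (forall k x, Egrp k x -> f k x = f k.+1 x) -> (forall k, f (k + n) = f k) ->
  exists2 th : pi -> Q, morph th & forall k x, Vgrp k x -> th x = f k x.
Proof.
move=> fM fE fper.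
have fmod := periodic_mod fper.
have fP k x : Pgrp x -> f k x = f 0 x.
  by move=> hx; elim: k => // k <-; rewrite -fE //; apply: Pgrp_sub.
(* The maps of two vertices agree on the group of a face containing both, so the map of a face does
   not depend on the vertex [vtx s] chosen in it. *)
have key (s : face (polygon n)) i j x : corner i \in val s -> corner j \in val s -> img s x -> f i x = f j x.
  case: (faceP s) => [_ _ hx|k|k]; first by rewrite !(fP _ _ hx).
    have ek m y : corner m \in val (edge_face k) -> Egrp k y -> f m y = f k y.
      rewrite !inE => /orP [/eqP /corner_eq /fmod -> //|/eqP /corner_eq /fmod -> h].
      by rewrite -fE.
    by move=> hi hj hx; rewrite !(ek _ _ _ hx).
  by rewrite !inE => /eqP /corner_eq e1 /eqP /corner_eq e2 _; rewrite (fmod i k) // (fmod j k).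
have vin (s : face (polygon n)) : exists k, corner k \in val s.
  by case: (faceP s) => [|k|k]; [exists 0|exists k|exists k]; rewrite !inE ?eqxx.
have [vtx hv] := choice vin.
have imgV (s : face (polygon n)) k x : corner k \in val s -> img s x -> Vgrp k x.
  case: (faceP s) => [_ /(@Pgrp_sub k) /Egrp_sub //|j|j].
    rewrite !inE => /orP [/eqP e|/eqP e] h.
      by rewrite /Vgrp (_ : vertex_face k = vertex_face j); [apply: Egrp_sub|apply: face_eq; rewrite /= e].
    by rewrite /Vgrp (_ : vertex_face k = vertex_face j.+1); [apply: Egrp_subS|apply: face_eq; rewrite /= e].
  rewrite !inE => /eqP e; rewrite /Vgrp (_ : vertex_face k = vertex_face j) //.
  by apply: face_eq; rewrite /= e.
have [|s t st g|th thM thE] := @cone_universal _ _ G T top_face face_top face_chain hT Q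
  (fun s g => f (vtx s) (based T top_face g)).
- move=> s x y; rewrite basedM fM //; apply: (imgV s) => //; by eexists.
- rewrite -(based_transport T face_top st); apply: (key s) => //; last by eexists.
  by apply: (fintype.subsetP (fintype.proper_sub st)).
exists th => // k _ [g ->]; rewrite thE; apply: (key (vertex_face k)) => //; last by eexists.
by rewrite !inE.
Qed.

End Local.
End PolygonFaces.

Import Order.TTheory GRing.Theory Num.Theory.

Local Open Scope ring_scope.
Local Open Scope group_scope.

(** * Word metrics with real and with integer values *)

Lemma nat_above (R : realType) (x : R) : exists n : nat, (x <= n%:R)%R.
Proof. by exists (Num.truncn x).+1; apply/ltW/truncnS_gt. Qed.

Lemma hyperbolic_space_hyp (R : realType) (X : Type) (D : X -> X -> R) (d : X -> X -> nat) :
  (forall x y, D x y = (d x y)%:R) -> (forall x y, d x y = d y x) ->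
  hyperbolic_space D <-> exists delta, hyp (fun=> True) d delta.
Proof.
move=> Dd dC; split=> [[de hd]|[de hd]].
  have [m hm] := nat_above (de * 2)%R; exists m => x y z w _ _ _ _.
  have := hd w x z y; rewrite /gromov_product !Dd.
  have -> : d y w = d w y by []. have -> : d z w = d w z by [].
  have -> : d x w = d w x by []. have -> : d z y = d y z by [].
  rewrite -(ler_nat R) !natrD natr_max !natrD.
  move: hm; rewrite /Num.min /Num.max; case: ifP; case: ifP; lra.
exists (de%:R / 2)%R => w x y z; rewrite /gromov_product !Dd.
have := hd x z y w I I I I.
have -> : d y w = d w y by []. have -> : d z w = d w z by [].
have -> : d x w = d w x by []. have -> : d z y = d y z by [].
rewrite -(ler_nat R) !natrD natr_max !natrD.
by rewrite /Num.min /Num.max; case: ifP; case: ifP; lra.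
Qed.

Section WordLength.
Context (R : realType) (G : groupType).
Implicit Types (S : seq G) (g : G).
Local Notation mm S := (fun x => x \in S).

Lemma word_wl S g w : word_over S g w -> wl (mm S) (size w) g.
Proof.
move=> [h <-]; elim: w h => [_|[b s] w IH] /=; first by rewrite /word_eval big_nil.
move=> /andP [hs /IH h]; rewrite /word_eval big_cons /=.
exists (if b then s^-1 else s), (word_eval w); split=> //.
by case: b; rewrite ?invgK; [right|left].
Qed.

Lemma wl_word S g n : wl (mm S) n g -> exists2 w, word_over S g w & size w = n.
Proof.
elim: n g => [g ->|n IH g [s [y [hs /IH [w [hw e] sw] ->]]]].
  by exists [::] => //; split=> //; rewrite /word_eval big_nil.
case: hs => hs; [exists ((false, s) :: w)|exists ((true, s^-1) :: w)] => /=; rewrite ?sw //;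
  by split; rewrite /= ?hs // /word_eval big_cons /= ?invgK -/(word_eval w) e.
Qed.

Lemma generatesP S : generates S <-> forall g, gen (mm S) g.
Proof.
split=> h g; first by have [w /word_wl hw] := h g; exists (size w).
by have [n /wl_word [w hw _]] := h g; exists w.
Qed.

Lemma word_lengthE S g : gen (mm S) g -> word_length R S g = ((len (mm S) g)%:R)%R.
Proof.
move=> hg; have [w hw sw] := wl_word (len_wl hg).
have lb : lbound [set ((size w)%:R : R)%R | w in word_over S g]%classic ((len (mm S) g)%:R)%R.
  by move=> _ [w' /word_wl h <-]; rewrite ler_nat; apply: len_le.
apply/eqP; rewrite eq_le; apply/andP; split.
  by apply: ge_inf; [eexists; exact: lb|exists w; rewrite ?sw].
by apply: lb_le_inf lb; exists ((size w)%:R)%R, w.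
Qed.

Lemma word_distE S : generates S -> forall x y, word_dist R S x y = ((wd (mm S) x y)%:R)%R.
Proof. by move=> /generatesP h x y; rewrite /word_dist word_lengthE. Qed.

Lemma wdC S : generates S -> forall x y, wd (mm S) x y = wd (mm S) y x.
Proof. by move=> /generatesP h x y; rewrite /wd -lenV ?invVM. Qed.

Lemma hyperbolic_group_of (H : G -> Prop) : (forall x, H x) -> hypsub H -> hyperbolic_group R G.
Proof.
move=> allH [S [de [[[s fS] eS] hS]]].
have eqS : S = mm s by apply/funext => x; apply/propext; apply: fS.
subst S.
have gs : generates s by apply/generatesP => g; apply/eS.
exists s => //; apply/(hyperbolic_space_hyp (word_distE gs) (wdC gs)).
exists de => x y z w _ _ _ _; apply: hS; exact/eS.
Qed.

Lemma hyperbolic_group_ex : hyperbolic_group R G -> exists S : seq G,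
  generates S /\ exists de, hyp (gen (mm S)) (wd (mm S)) de.
Proof.
move=> [S gs /(hyperbolic_space_hyp (word_distE gs) (wdC gs)) [de h]].
by exists S; split=> //; exists de => x y z w _ _ _ _; apply: h.
Qed.

End WordLength.

(** * Transfer of word metrics along injective homomorphisms *)

Section Image.
Context (A G : groupType) (j : A -> G).
Hypotheses (jM : morph j) (jI : injective j).

Definition img_set (S : A -> Prop) y := exists2 x, S x & y = j x.

Lemma img_wl S n x : wl S n x <-> wl (img_set S) n (j x).
Proof.
have j1 := morph1 jM; have jV := morphV jM.
split.
  elim: n x => [x ->|n IH x [s [y [hs /IH hy ->]]]]; first by rewrite j1.
  exists (j s), (j y); split=> //; case: hs => h; [left|right; rewrite -jV]; by eexists; first exact: h.
elim: n x => [x h|n IH x [s [y [hs hy e]]]]; first by apply: jI; rewrite [LHS]h j1.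
have [s' ss' es] : exists2 s', S s' \/ S s'^-1 & s = j s'.
  case: hs => -[a ha ea]; first by exists a => //; left.
  by exists a^-1; rewrite ?invgK ?jV -?ea ?invgK //; right.
exists s', (s'^-1 * x); split; rewrite ?mulVKg //; apply: IH.
by rewrite jM jV -es e mulKg.
Qed.

Lemma img_gen S x : gen S x <-> gen (img_set S) (j x).
Proof. by split=> -[n /img_wl h]; exists n. Qed.

Lemma img_len S x : gen S x -> len (img_set S) (j x) = len S x.
Proof.
move=> h; have h' : gen (img_set S) (j x) by apply/img_gen.
apply/eqP; rewrite eqn_leq; apply/andP; split; first by apply/len_le/img_wl/len_wl.
by apply/len_le/img_wl/len_wl.
Qed.

Definition img y := exists x, y = j x.

Lemma img_subgrp : subgrp img.
Proof.
split=> [|_ _ [x ->] [y ->]|_ [x ->]]; first by exists 1; rewrite (morph1 jM).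
  by exists (x * y); rewrite jM.
by exists x^-1; rewrite (morphV jM).
Qed.

Lemma img_fgen S : fin S -> (forall x, gen S x) -> fgen img (img_set S).
Proof.
move=> [s fS] gS; split.
  exists (map j s) => y; split=> [[x /fS hx ->]|/mapP [x /fS hx ->]]; first exact: map_f.
  by exists x.
move=> y; split=> [|[x ->]]; last exact/img_gen.
apply: gen_min; first exact: img_subgrp.
by move=> _ [x _ ->]; exists x.
Qed.

Lemma hypsub_img (R : realType) : hyperbolic_group R A -> hypsub img.
Proof.
move=> /hyperbolic_group_ex [S [/generatesP gS [de h]]].
have fS : fin (fun x => x \in S) by exists S.
have fg := img_fgen fS gS; exists (img_set (fun x => x \in S)), de; split=> //.
move=> _ _ _ _ /fg.2 [x ->] /fg.2 [y ->] /fg.2 [z ->] /fg.2 [w ->].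
rewrite /wd -!(morphV jM) -!jM !img_len //; exact: h.
Qed.

End Image.

(** Injectivity absorbs the additive constant: the image of a nontrivial element has length at least
    1. *)
Lemma qisub_img (R : realType) (A B G : groupType) (f : A -> B) (jA : A -> G) (jB : B -> G) :
  morph f -> injective f -> morph jA -> injective jA -> morph jB -> injective jB ->
  (forall x, jA x = jB (f x)) -> qi_embedding R f -> qisub (img jA) (img jB).
Proof.
move=> fM fI jAM jAI jBM jBI e [S [S' [gS gS' [lam [c [l1 c0 h]]]]]].
have gS1 := (generatesP S).1 gS; have gS1' := (generatesP S').1 gS'.
have fg := img_fgen jAM jAI (ex_intro _ S (fun=> iff_refl _)) gS1.
have fg' := img_fgen jBM jBI (ex_intro _ S' (fun=> iff_refl _)) gS1'.
apply: (qisub_ex _ fg fg') => [_ [x ->]|]; first by exists (f x).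
have [m hm] := nat_above (lam * (1 + c))%R; exists m.+1 => _ /fg.2 [x ->].
rewrite (img_len jAM jAI) // e (img_len jBM jBI) //.
have [-> |nx] := eqVneq x 1; first by rewrite len1.
have := (h 1 x).1; rewrite !word_distE // /wd (morph1 fM) !invg1 !mul1g.
set a := len _ x; set b := len _ (f x).
have b1 : (1 <= b)%N.
  rewrite lt0n; apply: contra nx => /eqP b0; apply/eqP/fI.
  by rewrite (morph1 fM); apply: (len_eq0 (S := fun x => x \in S')).
rewrite -(ler_nat R) natrM => h'.
have lam0 : (0 < lam)%R by lra.
have h2 : (a%:R <= lam * (b%:R + c))%R.
  by move: h'; rewrite lerBlDr -(ler_pM2l lam0) mulrA mulfV ?mul1r //; lra.
have b1' : (1 <= (b%:R : R))%R by rewrite ler1n.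
apply: (le_trans h2); apply: (@le_trans _ _ (lam * (1 + c) * b%:R)%R).
  by rewrite -mulrA ler_pM2l // mulrDl mul1r lerD2l ler_peMr.
by apply: ler_wpM2r => //; rewrite -natr1; lra.
Qed.

(** The generators of the source are the preimages of those of the image, which makes [f0]
    length-preserving onto its image; conjugation by [k] changes lengths by at most twice the length
    of [k]. *)
Lemma qi_embedding_conj (R : realType) (A G : groupType) (f0 f : A -> G) k (H : G -> Prop) :
  morph f0 -> injective f0 -> (forall x, f x = k * f0 x * k^-1) -> (forall x, H x) ->
  (exists S, fgen H S) -> (exists S, fgen (img f0) S) -> qisub (img f0) H ->
  qi_embedding R f.
Proof.
move=> fM fI fk allH [S1 [[s1 f1] g1]] [S0 [[s0 f0'] g0]] q.
have eS1 : S1 = (fun x => x \in s1) by apply/funext => x; apply/propext/f1.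
have eS0 : S0 = (fun x => x \in s0) by apply/funext => x; apply/propext/f0'.
subst S1 S0.
have gs1 : generates s1 by apply/generatesP => g; apply/g1.
have [sA hsA] : exists sA : seq A, forall x, x \in sA <-> f0 x \in s0.
  have pre y : exists x, y \in s0 -> y = f0 x.
    case: (boolP (y \in s0)) => h; last by exists 1.
    by have [x ->] := (g0 y).1 (gen_in h); exists x.
  have [p hp] := choice pre; exists (map p s0) => x; split=> [/mapP [y hy ->]|hx].
    by rewrite -hp.
  by apply/mapP; exists (f0 x) => //; apply: fI; rewrite -hp.
have eA : img_set f0 (fun x => x \in sA) = (fun x => x \in s0).
  apply/funext => y; apply/propext; split=> [[x /hsA h ->]//|hy].
  by have [x e] := (g0 y).1 (gen_in hy); exists x => //; apply/hsA; rewrite -e.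
have gA : generates sA.
  by apply/generatesP => x; apply/(img_gen fM fI); rewrite eA; apply/g0; exists x.
have gA1 := (generatesP sA).1 gA; have gs11 := (generatesP s1).1 gs1.
have lA x : len (fun x => x \in sA) x = len (fun x => x \in s0) (f0 x).
  by rewrite -eA img_len.
have gf0 x : gen (fun y => y \in s0) (f0 x) by apply/g0; exists x.
have [lam hl] := q _ _ (conj (ex_intro _ s0 (fun=> iff_refl _)) g0) (conj (ex_intro _ s1 (fun=> iff_refl _)) g1).
have [mu hmu] := @bilip _ _ (fun y => y \in s1) s0 (fun x => iff_refl _) (fun x _ => gs11 x).
exists sA, s1; split=> //; exists ((lam + mu).+1%:R)%R, ((2 * len (fun y => y \in s1) k)%N%:R)%R.
split; [by rewrite ler1n|by rewrite ler0n|] => x y.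
rewrite !word_distE // /wd lA !fk.
have -> : (k * f0 x * k^-1)^-1 * (k * f0 y * k^-1) = k * f0 (x^-1 * y) * k^-1.
  by rewrite fM (morphV fM); gsimp.
set u := f0 _; have gu : gen (fun y => y \in s0) u by apply: gf0.
have l1 := hl u gu; have l2 := hmu u gu.
have t1 := lenM (gs11 (k * u)) (gs11 k^-1); have t2 := lenM (gs11 k) (gs11 u).
have t3 := lenM (gs11 k^-1) (gs11 (k * u * k^-1 * k)); have t4 := lenM (gs11 (k * u * k^-1)) (gs11 k).
have e : k^-1 * (k * u * k^-1 * k) = u by rewrite mulgVK mulKg.
rewrite e lenV // in t3; rewrite lenV // in t1.
set a := len _ u in l1 l2 *; set b := len _ u in t2 t3 l1 l2; set c := len _ (k * u * k^-1) in t1 t4 *.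
set K := len _ k in t1 t2 t3 t4 *.
have n1 : (a <= (lam + mu).+1 * (c + 2 * K))%N by nia.
have n2 : (c <= (lam + mu).+1 * a + 2 * K)%N by nia.
have L0 : (0 < ((lam + mu).+1%:R : R))%R by rewrite ltr0n.
split; last by rewrite -natrM -natrD ler_nat.
rewrite lerBlDr -(ler_pM2l L0) mulrA mulfV ?lt0r_neq0 // mul1r -natrD -natrM ler_nat //.
Qed.

(** * The regular polygon *)

Local Open Scope ring_scope.

Section EuclideanPlane.
Context (R : realType).
Implicit Types x y z u : 'rV[R]_2.

Lemma eucl_distE x y :
  eucl_dist x y = Num.sqrt ((x 0 0 - y 0 0) ^+ 2 + (x 0 1 - y 0 1) ^+ 2).
Proof. by rewrite /eucl_dist !big_ord_recl big_ord0 addr0 (_ : lift ord0 ord0 = 1) //; apply: val_inj. Qed.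

Lemma eucl_dist_ge0 x y : 0 <= eucl_dist x y.
Proof. exact: sqrtr_ge0. Qed.

Lemma eucl_distxx x : eucl_dist x x = 0.
Proof. by rewrite eucl_distE !subrr expr0n addr0 sqrtr0. Qed.

Lemma eucl_distC x y : eucl_dist x y = eucl_dist y x.
Proof. by rewrite !eucl_distE; congr Num.sqrt; ring. Qed.

Lemma cauchy_schwarz_plane (a b c d : R) : c ^+ 2 + d ^+ 2 = 1 ->
  a * c + b * d <= Num.sqrt (a ^+ 2 + b ^+ 2).
Proof.
move=> e; apply: le_trans (ler_norm _) _; rewrite -sqrtr_sqr; apply: ler_wsqrtr.
have -> : a ^+ 2 + b ^+ 2 = (a * c + b * d) ^+ 2 + (a * d - b * c) ^+ 2.
  by rewrite -[a ^+ 2 + _]mulr1 -e; ring.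
by rewrite lerDl sqr_ge0.
Qed.

Lemma eucl_dist_segment x y (s t : R) :
  eucl_dist (x + s *: (y - x)) (x + t *: (y - x)) = `|s - t| * eucl_dist x y.
Proof.
rewrite !eucl_distE !mxE -sqrtr_sqr -sqrtrM ?sqr_ge0 //; congr Num.sqrt; ring.
Qed.

Lemma eucl_dist_triangle x y z : eucl_dist x z <= eucl_dist x y + eucl_dist y z.
Proof.
rewrite !eucl_distE.
set a := x 0 0 - y 0 0; set b := x 0 1 - y 0 1; set c := y 0 0 - z 0 0; set d := y 0 1 - z 0 1.
have -> : x 0 0 - z 0 0 = a + c by rewrite /a /c; ring.
have -> : x 0 1 - z 0 1 = b + d by rewrite /b /d; ring.
have [->|nz] := eqVneq ((a + c) ^+ 2 + (b + d) ^+ 2) 0.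
  by rewrite sqrtr0 addr_ge0 ?sqrtr_ge0.
set r := Num.sqrt _; have r0 : 0 < r.
  by rewrite sqrtr_gt0 lt0r nz addr_ge0 // sqr_ge0.
have r2 : r ^+ 2 = (a + c) ^+ 2 + (b + d) ^+ 2 by rewrite sqr_sqrtr // addr_ge0 // sqr_ge0.
have e : ((a + c) / r) ^+ 2 + ((b + d) / r) ^+ 2 = 1.
  by rewrite !expr_div_n -mulrDl -r2 divff // expf_neq0 // lt0r_neq0.
have h1 := cauchy_schwarz_plane a b e; have h2 := cauchy_schwarz_plane c d e.
apply: le_trans (lerD h1 h2); rewrite le_eqVlt; apply/orP; left; apply/eqP.
have -> : a * ((a + c) / r) + b * ((b + d) / r) + (c * ((a + c) / r) + d * ((b + d) / r))
  = ((a + c) ^+ 2 + (b + d) ^+ 2) / r by ring.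
by rewrite -r2 expr2 mulfK // lt0r_neq0.
Qed.

End EuclideanPlane.

Section RegularPolygon.
Context (R : realType) (n : nat) (hn : (4 <= n)%N) (rad : R) (hrad : 0 < rad).
Local Notation v := (@polygon_vertex R n rad).
Implicit Types (i j k : 'I_n) (A B : {set 'I_n}) (x y : 'rV[R]_2).

Let th (m : R) : R := pi * m / n%:R.
Let n0 : n%:R != 0 :> R. Proof. by rewrite pnatr_eq0; lia. Qed.
Let n_gt0 : 0 < n%:R :> R. Proof. by rewrite ltr0n; lia. Qed.

(* The signed distance of [x] to the line through the [j]-th edge. *)
Definition edge_height j x : R :=
  rad * cos (th 1) - (x 0 0 * cos (th (2 * j%:R + 1)) + x 0 1 * sin (th (2 * j%:R + 1))).

Lemma edge_height_lip j x y : edge_height j x <= edge_height j y + eucl_dist x y.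
Proof.
rewrite /edge_height eucl_distC eucl_distE.
have := cauchy_schwarz_plane (y 0 0 - x 0 0) (y 0 1 - x 0 1) (cos2Dsin2 (th (2 * j%:R + 1))).
lra.
Qed.

Lemma edge_height_comb j (a : 'I_n -> R) : \sum_i a i = 1 ->
  edge_height j (\sum_i a i *: v i) = \sum_i a i * edge_height j (v i).
Proof.
move=> a1; rewrite /edge_height !summxE.
under [in RHS]eq_bigr do rewrite mulrBr.
rewrite sumrB -mulr_suml a1 mul1r; congr (_ - _).
rewrite !mulr_suml -big_split /=; apply: eq_bigr => i _.
by rewrite !mxE; ring.
Qed.

Lemma edge_height_vertex j i :
  edge_height j (v i) = rad * (cos (th 1) - cos (th (2 * i%:R - 2 * j%:R - 1))).
Proof.
rewrite /edge_height !mxE /=; set t := 2 * pi * i%:R / n%:R.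
have -> : th (2 * i%:R - 2 * j%:R - 1) = t - th (2 * j%:R + 1) by rewrite /th /t; field.
by rewrite cosB; ring.
Qed.

Let th2pi m : cos (th (m + 2 * n%:R)) = cos (th m).
Proof.
rewrite -[RHS](cosD2pi (th m)); congr cos; rewrite /th mulr2n; field; exact: n0.
Qed.

Let cos_le m : (2 <= m)%N -> (m < n)%N -> cos (th (2 * m%:R - 1)) <= cos (th 3).
Proof.
move=> h1 h2; have pi0 := pi_gt0 R.
have mono a b : 0 <= a -> a <= b -> b <= n%:R -> cos (th b) <= cos (th a).
  move=> a0 ab bn; have tha c : 0 <= c -> c <= n%:R -> th c \in `[0, pi].
    move=> c0 cn; rewrite in_itv /= /th divr_ge0 ?mulr_ge0 ?(ltW pi0) ?ler0n //=.
    by rewrite ler_pdivrMr // ler_pM2l.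
  have : th a <= th b by rewrite /th ler_pM2r ?invr_gt0 // ler_pM2l.
  by rewrite (leNgt (th a)) (leNgt (cos _)) ltr_cos // ?tha //; lra.
have n4 : 4 <= n%:R :> R by rewrite (ler_nat R 4 n).
have m2 : 2 <= m%:R :> R by rewrite (ler_nat R 2 m).
have mn : m%:R + 1 <= n%:R :> R by rewrite natr1 ler_nat.
have [hm|hm] := leP (2 * m%:R - 1 : R) n%:R; first by apply: mono; lra.
rewrite -(th2pi (2 * m%:R - 1)) -cosN.
have -> : - th (2 * m%:R - 1 + 2 * n%:R) = th (2 * n%:R - (2 * m%:R - 1)) - pi *+ 2 *+ 2.
  by rewrite /th !mulr2n; field; exact: n0.
rewrite -(cosD2pi (_ - _)) -(cosD2pi (_ + _)) -[_ - _ + _ + _]/(_ - _ + pi *+ 2 + pi *+ 2).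
have -> : th (2 * n%:R - (2 * m%:R - 1)) - pi *+ 2 *+ 2 + pi *+ 2 + pi *+ 2 = th (2 * n%:R - (2 * m%:R - 1)).
  by rewrite -addrA -mulr2n subrK.
by apply: mono; lra.
Qed.

(** The least height over an edge of a vertex not on it. Vertices of the edge are seen from the
    centre at angle pi / n from its normal, the next ones at 3 pi / n. *)
Definition clearance : R := rad * (cos (th 1) - cos (th 3)).

Let cos31 : cos (th 3) < cos (th 1).
Proof.
have pi0 := pi_gt0 R; have n4 : 4 <= n%:R :> R by rewrite (ler_nat R 4 n).
have tha c : 0 <= c -> c <= n%:R -> th c \in `[0, pi].
  move=> c0 cn; rewrite in_itv /= /th divr_ge0 ?mulr_ge0 ?(ltW pi0) ?ler0n //=.
  by rewrite ler_pdivrMr // ler_pM2l.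
by rewrite ltr_cos ?tha //; try lra; rewrite /th ltr_pM2r ?invr_gt0 // ltr_pM2l //; lra.
Qed.

Lemma clearance_gt0 : 0 < clearance.
Proof. by rewrite mulr_gt0 // subr_gt0. Qed.

Lemma edge_height_on i j : i \in [set j; ordS j]%SET -> edge_height j (v i) = 0.
Proof.
rewrite !inE edge_height_vertex => /orP [/eqP ->|/eqP ->].
  rewrite subrr sub0r (_ : th (- 1) = - th 1) ?cosN ?subrr ?mulr0 //.
  by rewrite /th mulrN mulNr.
rewrite /=; have := ltn_ord j; rewrite leq_eqVlt => /orP [/eqP e|lt].
  rewrite e modnn mulr0 -(th2pi (_ - 1)) (_ : 0 - 2 * j%:R - 1 + 2 * n%:R = 1) ?subrr ?mulr0 //.
  by rewrite -[in n%:R]e -natr1; ring.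
by rewrite modn_small // (_ : 2 * j.+1%:R - 2 * j%:R - 1 = 1) ?subrr ?mulr0 // -natr1; ring.
Qed.

Lemma edge_height_off i j : i \notin [set j; ordS j]%SET -> clearance <= edge_height j (v i).
Proof.
rewrite !inE negb_or => /andP [/eqP n1 /eqP n2].
have hj := ltn_ord j; have hi := ltn_ord i.
have nij : (i : nat) <> j by move=> e; apply: n1; apply: val_inj.
have nij' : (i : nat) <> (j.+1 %% n)%N by move=> e; apply: n2; apply: val_inj.
rewrite edge_height_vertex /clearance ler_pM2l // lerD2l lerN2.
case: (ltnP j i) => ji.
  have nn : (j.+1 %% n)%N = j.+1 by rewrite modn_small //; lia.
  rewrite (_ : 2 * i%:R - 2 * j%:R - 1 = 2 * (i - j)%N%:R - 1); last first.
    by rewrite natrB ?(ltnW ji) //; ring.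
  by apply: cos_le; lia.
rewrite -(th2pi (_ - 1)) (_ : 2 * i%:R - 2 * j%:R - 1 + 2 * n%:R = 2 * (i + n - j)%N%:R - 1); last first.
  by rewrite natrB ?natrD; [ring|lia].
apply: cos_le; last by lia.
rewrite leqNgt; apply/negP => h; have e : (n = j.+1)%N by lia.
by apply: nij'; rewrite -e modnn; lia.
Qed.

Lemma edge_height_vertex_ge0 i j : 0 <= edge_height j (v i).
Proof.
case: (boolP (i \in [set j; ordS j]%SET)) => h; first by rewrite edge_height_on.
by apply: le_trans (edge_height_off h); apply/ltW/clearance_gt0.
Qed.

Lemma cell_sub (A B : {set 'I_n}) x : A \subset B -> cell rad A x -> cell rad B x.
Proof.
move=> /fintype.subsetP AB [a [a0 aA a1 ->]]; exists a; split=> // i iB.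
by apply: aA; apply: contra iB => /AB.
Qed.

Lemma cell_vertex (A : {set 'I_n}) i : i \in A -> cell rad A (v i).
Proof.
move=> iA; exists (fun k => (k == i)%:R); split=> [k|k kA||].
- exact: ler0n.
- by case: eqP => // e; rewrite e iA in kA.
- by rewrite (bigD1 i) //= eqxx big1 ?addr0 // => k /negbTE ->.
by rewrite (bigD1 i) //= eqxx scale1r big1 ?addr0 // => k /negbTE ->; rewrite scale0r.
Qed.

Lemma cell_convex (A : {set 'I_n}) x y t : cell rad A x -> cell rad A y -> 0 <= t <= 1 ->
  cell rad A (x + t *: (y - x)).
Proof.
move=> [a [a0 aA a1 ->]] [b [b0 bA b1 ->]] /andP [t0 t1].
exists (fun i => (1 - t) * a i + t * b i); split=> [i|i iA||].
- by rewrite addr_ge0 // mulr_ge0 //; lra.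
- by rewrite aA // bA //; ring.
- by rewrite big_split /= -!mulr_sumr a1 b1; ring.
rewrite -sumrB scaler_sumr -big_split /=; apply: eq_bigr => i _.
by rewrite scalerBr !scalerA -scalerBl -scalerDl; congr (_ *: _); ring.
Qed.

Lemma edge_height_ge0 j A x : cell rad A x -> 0 <= edge_height j x.
Proof.
move=> [a [a0 aA a1 ->]]; rewrite edge_height_comb //.
by apply: sumr_ge0 => i _; rewrite mulr_ge0 // edge_height_vertex_ge0.
Qed.

Lemma edge_height_cell j (A : {set 'I_n}) x : A \subset [set j; ordS j]%SET ->
  cell rad A x -> edge_height j x = 0.
Proof.
move=> /fintype.subsetP sA [a [a0 aA a1 ->]]; rewrite edge_height_comb // big1 // => i _.
case: (boolP (i \in A)) => h; last by rewrite aA // mul0r.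
by rewrite edge_height_on ?mulr0 //; apply: sA.
Qed.

(* Some barycentric coordinate of [x] is at least [1 / n]. *)
Lemma edge_height_far A x : cell rad A x -> exists i, forall j, i \notin [set j; ordS j]%SET ->
  clearance / n%:R <= edge_height j x.
Proof.
move=> [a [a0 aA a1 ->]].
have [i hi] : exists i, n%:R^-1 <= a i.
  apply: contrapT => /forallNP no.
  have : \sum_i a i < \sum_(i < n) n%:R^-1.
    apply: ltr_sum; last by move=> i _; rewrite ltNge; apply/negP/no.
    by apply/hasP; exists (Ordinal (ltac:(lia) : (0 < n)%N)); rewrite ?mem_index_enum.
  by rewrite a1 sumr_const card_ord -[_ *+ n]mulr_natr mulVf // ltxx.
exists i => j hj; rewrite edge_height_comb // (bigD1 i) //=.
apply: (@le_trans _ _ (a i * edge_height j (v i))).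
  have c0 := ltW clearance_gt0; have h := edge_height_off hj.
  by rewrite mulrC; apply: ler_pM => //; rewrite invr_ge0 ler0n.
by rewrite lerDl; apply: sumr_ge0 => k _; rewrite mulr_ge0 // edge_height_vertex_ge0.
Qed.

Lemma cell_diam A B x y : cell rad A x -> cell rad B y -> eucl_dist x y <= 4 * rad.
Proof.
have bnd (C : {set 'I_n}) z : cell rad C z -> forall k : 'I_2, `|z 0 k| <= rad.
  move=> [a [a0 aA a1 ->]] k; rewrite summxE; apply: le_trans (ler_norm_sum _ _ _) _.
  rewrite -[X in _ <= X]mul1r -a1 mulr_suml; apply: ler_sum => i _.
  rewrite !mxE normrM (ger0_norm (a0 i)) ler_wpM2l // normrM (gtr0_norm hrad).
  by rewrite ger_pMr //; case: (k == 0); [apply: cos_max|apply: sin_max].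
move=> /bnd hx /bnd hy; rewrite eucl_distE.
set a := _ - _; set b := x 0 1 - _.
have le_sum : Num.sqrt (a ^+ 2 + b ^+ 2) <= `|a| + `|b|.
  apply: (@le_trans _ _ (Num.sqrt ((`|a| + `|b|) ^+ 2))); last first.
    by rewrite sqrtr_sqr ger0_norm // addr_ge0.
  apply: ler_wsqrtr; have : 0 <= `|a| * `|b| by rewrite mulr_ge0.
  have := real_normK (num_real a); have := real_normK (num_real b); rewrite sqrrD mulr2n; lra.
have ha : `|a| <= 2 * rad by apply: le_trans (ler_normB _ _) _; have := hx 0; have := hy 0; lra.
have hb : `|b| <= 2 * rad by apply: le_trans (ler_normB _ _) _; have := hx 1; have := hy 1; lra.
lra.
Qed.

Definition edge_mid j : 'rV[R]_2 := v j + 2^-1 *: (v (ordS j) - v j).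

Lemma edge_mid_cell j : cell rad [set j; ordS j]%SET (edge_mid j).
Proof. by apply: cell_convex; [apply: cell_vertex..|lra]; rewrite !inE eqxx ?orbT. Qed.

Let height_mid j x y : edge_height j (x + 2^-1 *: (y - x)) = (edge_height j x + edge_height j y) / 2.
Proof. by rewrite /edge_height !mxE; field. Qed.

Lemma ordS_neq j : ordS j != j.
Proof.
apply/eqP => /(congr1 val) /=; have := ltn_ord j; rewrite leq_eqVlt => /orP [/eqP e|lt].
  by rewrite e modnn; lia.
by rewrite modn_small //; lia.
Qed.

Lemma ordSS_neq j : ordS (ordS j) != j.
Proof.
apply/eqP => /(congr1 val) /=; rewrite -addn1 modnDml addn1 => e.
have : (2 + j == 0 + j %[mod n])%N by rewrite add0n add2n e modn_small.
by rewrite eqn_modDr mod0n modn_small //; lia.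
Qed.

Lemma edge_height_mid_gt0 j k : j != k -> 0 < edge_height k (edge_mid j).
Proof.
move=> jk; rewrite /edge_mid height_mid.
have g i := edge_height_vertex_ge0 i k.
have [h|h] : j \notin [set k; ordS k]%SET \/ ordS j \notin [set k; ordS k]%SET.
  rewrite !inE; case: (eqVneq j (ordS k)) => [->|]; last by left; rewrite (negbTE jk).
  by right; rewrite negb_or ordSS_neq ordS_neq.
  by have := edge_height_off h; have := g (ordS j); have := clearance_gt0; lra.
by have := edge_height_off h; have := g j; have := clearance_gt0; lra.
Qed.

Lemma edge_height_interior i j k : i != j ->
  0 < edge_height k (edge_mid i + 2^-1 *: (edge_mid j - edge_mid i)).
Proof.
move=> ij; rewrite height_mid.
have g l := edge_height_ge0 k (edge_mid_cell l).
have [h|h] := eqVneq i k; last by have := edge_height_mid_gt0 h; have := g j; lra.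
have jk : j != k by rewrite -h eq_sym.
by have := edge_height_mid_gt0 jk; have := g i; lra.
Qed.

End RegularPolygon.

(** * The development *)

Local Open Scope group_scope.

Section DevelopmentGeometry.
Context (R : realType) (n : nat) (hn : (4 <= n)%N) (rad : R) (hrad : (0 < rad)%R)
  (G : complex_of_groups (polygon n)) (T : {set face (polygon n) * face (polygon n)}).
Local Notation pi1 := (pi1 G T).
Local Notation top := (top_face n).
Local Notation dev := (development rad G T).
Local Notation dpt := (dev_point rad G T).
Local Notation img := (@local_img _ _ G T top).
Local Notation spk := (@spoke _ _ G T top).
Local Notation v := (@polygon_vertex R n rad).
Local Notation V := (Vgrp hn (G := G) (T := T)).
Local Notation E := (Egrp hn (G := G) (T := T)).
Local Notation P := (Pgrp (G := G) (T := T)).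
Implicit Types (A : {set 'I_n}) (p q : dpt) (a b : dev) (h u : pi1) (x y : 'rV[R]_2).

Let face_top' (s : face (polygon n)) : s = top \/ val s \proper val top.
Proof. exact: face_top. Qed.

Definition dev_proj p : dev := (\pi_(dev) p)%qT.

Lemma dev_proj_repr a : dev_proj (repr a) = a.
Proof. exact: reprK. Qed.

Lemma dev_proj_glue p q : dev_glue p q -> dev_proj p = dev_proj q.
Proof. by move=> g; apply/eqmodP/asboolP/rst_step. Qed.

Lemma dev_proj_inv (X : Type) (f : dpt -> X) : (forall p q, dev_glue p q -> f p = f q) ->
  forall p q, dev_proj p = dev_proj q -> f p = f q.
Proof.
move=> fg p q /eqmodP /asboolP; elim=> [p' q' /fg //|//|p' q' _ -> //|p' q' r _ -> _ -> //].
Qed.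

(* A point of the development is a point of a translate of the base polygon. *)
Definition chamber p : pi1 := dp_elt p * spk (dp_face p).
Definition tile h x (hx : cell rad (val top) x) : dev := dev_proj (DevPoint h hx).

Lemma cell_top (s : face (polygon n)) x : cell rad (val s) x -> cell rad (val top) x.
Proof. by apply: cell_sub; apply: finset.subsetT. Qed.

Lemma tile_chamber p (hx : cell rad (val top) (dp_pos p)) : dev_proj p = tile (chamber p) hx.
Proof.
case: p hx => g s x xs hx; rewrite /tile /chamber /=.
case: (face_top' s) => [e|st].
  by subst s; rewrite spokeP mulg1 (Prop_irrelevance xs hx).
rewrite (dev_proj_glue (glue_face _ st hx xs)) (spokeE G T st) mulgK //.
Qed.

Lemma tile_local (s : face (polygon n)) u h x (hx : cell rad (val top) x) :
  img s u -> cell rad (val s) x -> tile (h * u) hx = tile h hx.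
Proof.
move=> [g ->] xs.
pose k := spk s.
have e h' : tile h' hx = dev_proj (DevPoint (h' * k^-1) xs).
  have := @tile_chamber (DevPoint (h' * k^-1) xs) hx.
  by rewrite /chamber /= mulgVK => ->.
rewrite !e -(dev_proj_glue (glue_group (h * k^-1) g xs)); rewrite /based -/k; congr (dev_proj _).
have -> : h * k^-1 * pi1_group T g = h * (k^-1 * pi1_group T g * k) * k^-1 by gsimp.
by [].
Qed.

Lemma dev_glue_chamber p q : dev_glue p q -> dp_pos q = dp_pos p /\
  exists s u, [/\ img s u, cell rad (val s) (dp_pos p) & chamber p = chamber q * u].
Proof.
case=> [g s h x xs|g s t st x xs xt]; split=> //.
  exists s, (based T top h); split=> //; first by eexists.
  by rewrite /chamber /= /based; gsimp.
exists t, (based T top (@cone_twist _ _ G top _ _ st)); split=> //; first by eexists.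
rewrite /chamber /= (edge_spoke G T face_top' st) /based; gsimp.
by [].
Qed.

Section Functions.
Variable F : pi1 -> 'rV[R]_2 -> R.
Hypotheses (Finv : forall (s : face (polygon n)) u h x, img s u -> cell rad (val s) x -> F (h * u) x = F h x)
  (Flip : forall h x y, (F h x <= F h y + eucl_dist x y)%R).

Definition dev_fun a : R := F (chamber (repr a)) (dp_pos (repr a)).

Lemma dev_funE p : dev_fun (dev_proj p) = F (chamber p) (dp_pos p).
Proof.
apply: (@dev_proj_inv R (fun p => F (chamber p) (dp_pos p))); last exact: dev_proj_repr.
move=> {}p q /dev_glue_chamber [-> [s [u [us xs ->]]]]; exact: Finv xs.
Qed.

Lemma dev_fun_chain a b c : dev_chain a b c ->
  (dev_fun a <= dev_fun b + \sum_(p <- c) eucl_dist (dp_pos p.1) (dp_pos p.2))%R.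
Proof.
elim: c a => [a -> /=|[p q] c IH a]; first by rewrite big_nil addr0.
rewrite /dev_chain -/dev_chain big_cons /= => -[-> e1 e2 /IH h].
rewrite -/(dev_proj p) dev_funE; rewrite -/(dev_proj q) dev_funE in h.
have -> : chamber p = chamber q by rewrite /chamber e1 e2.
have := Flip (chamber q) (dp_pos p) (dp_pos q); move: h; lra.
Qed.

End Functions.

Lemma dev_chain_tile h x y (hx : cell rad (val top) x) (hy : cell rad (val top) y) b c :
  dev_chain (tile h hy) b c ->
  dev_chain (tile h hx) b ((DevPoint h hx, DevPoint h hy) :: c).
Proof. by []. Qed.

(** Tiles [h] and [h * s] with [s] in [V k] share the corner [k]; the chain passes from corner to
    corner, each tile costing at most the bound [4 * rad] on its diameter. *)
Lemma chain_wl m h u x y (hx : cell rad (val top) x) (hy : cell rad (val top) y) :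
  wl (fun z : pi1 => exists k, V k z) m u -> exists2 c, dev_chain (tile h hx) (tile (h * u) hy) c &
    (\sum_(p <- c) eucl_dist (dp_pos p.1) (dp_pos p.2) <= 4 * rad * m.+1%:R)%R.
Proof.
elim: m h u x hx => [|m IH] h u x hx.
  move=> ->; rewrite mulg1; exists [:: (DevPoint h hx, DevPoint h hy)] => //.
  by rewrite big_seq1 mulr1; apply: (cell_diam hrad hx hy).
move=> [s [u' [hs /IH hu' ->]]].
have [k Vs] : exists k, V k s.
  by case: hs => -[k]; exists k => //; apply: subVr => //; apply: local_img_subgrp.
have vk : cell rad (val (vertex_face hn k)) (v (corner hn k)).
  by apply: cell_vertex => //; rewrite inE.
have vt := cell_top vk.
have [c hc lc] := hu' (h * s) _ vt.
exists ((DevPoint h hx, DevPoint h vt) :: c).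
  by apply: dev_chain_tile; rewrite -(tile_local h vt Vs vk) mulgA.
rewrite big_cons /= -[m.+2]addn1 natrD mulrDr mulr1 addrC lerD //.
exact: (cell_diam hrad hx vt).
Qed.

Hypothesis hT : maximal_tree T.
Local Notation Sh := (fun z : pi1 => exists k, V k z).

Lemma dev_dist_tile h h' x y (hx : cell rad (val top) x) (hy : cell rad (val top) y) :
  (dev_dist (tile h hx) (tile h' hy) <= 4 * rad * (wd Sh h h').+1%:R)%R.
Proof.
have [c hc lc] := @chain_wl _ h _ x y hx hy (len_wl (Vgrp_gen hn hT (h^-1 * h'))).
rewrite mulVKg in hc; apply: le_trans lc; apply: ge_inf; last by exists c.
by exists 0%R => _ [c' _ <-]; apply: sumr_ge0 => p _; apply: eucl_dist_ge0.
Qed.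

Lemma tileP a : exists h x (hx : cell rad (val top) x), a = tile h hx.
Proof.
rewrite -(dev_proj_repr a); have hx := cell_top (dp_in (repr a)).
by exists (chamber (repr a)), (dp_pos (repr a)), hx; apply: tile_chamber.
Qed.

Lemma dev_chain_ex a b : exists c, dev_chain a b c.
Proof.
have [h [x [hx ->]]] := tileP a; have [h' [y [hy ->]]] := tileP b.
have [c hc _] := @chain_wl _ h _ x y hx hy (len_wl (Vgrp_gen hn hT (h^-1 * h'))).
by rewrite mulVKg in hc; exists c.
Qed.

Lemma le_dev_dist a b (z : R) : (forall c, dev_chain a b c ->
    (z <= \sum_(p <- c) eucl_dist (dp_pos p.1) (dp_pos p.2))%R) -> (z <= dev_dist a b)%R.
Proof.
move=> hz; apply: lb_le_inf; last by move=> _ [c hc <-]; apply: hz.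
by have [c hc] := dev_chain_ex a b; eexists; exists c.
Qed.

(** The development folds onto the polygon by [dp_pos], and folding does not lengthen chains; hence
    tiles are isometrically embedded. *)
Lemma dev_dist_eucl h x y (hx : cell rad (val top) x) (hy : cell rad (val top) y) :
  dev_dist (tile h hx) (tile h hy) = eucl_dist x y.
Proof.
apply/eqP; rewrite eq_le; apply/andP; split.
  apply: ge_inf.
    by exists 0%R => _ [c' _ <-]; apply: sumr_ge0 => p _; apply: eucl_dist_ge0.
  by exists [:: (DevPoint h hx, DevPoint h hy)] => //; rewrite big_seq1.
apply: le_dev_dist => c; pose f a := dp_pos (repr a).
have fE p : f (dev_proj p) = dp_pos p.
  apply: (@dev_proj_inv _ (fun p => dp_pos p)); last exact: dev_proj_repr.
  by move=> {}p q /dev_glue_chamber [].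
have key a : dev_chain a (tile h hy) c ->
    (eucl_dist (f a) y <= \sum_(p <- c) eucl_dist (dp_pos p.1) (dp_pos p.2))%R.
  elim: c a => [a ->|[p q] c IH a]; first by rewrite big_nil fE eucl_distxx.
  rewrite /dev_chain -/dev_chain big_cons /= => -[-> _ _ /IH h'].
  rewrite -/(dev_proj p) fE; rewrite -/(dev_proj q) fE in h'.
  by apply: le_trans (eucl_dist_triangle _ (dp_pos q) _) _; rewrite lerD2l.
by move=> /key; rewrite fE.
Qed.

Let minh (Q : pred 'I_n) x : R :=
  \big[Order.min/(clearance n rad / n%:R)%R]_(j | Q j) edge_height rad j x.

Let clear_gt0 : (0 < clearance n rad / n%:R)%R.
Proof. by rewrite divr_gt0 ?clearance_gt0 // ltr0n; lia. Qed.

Let minh_lip Q x y : (minh Q x <= minh Q y + eucl_dist x y)%R.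
Proof.
rewrite -lerBlDr; apply: le_bigmin.
  have := bigmin_le_id (index_enum 'I_n) (clearance n rad / n%:R)%R Q (fun j => edge_height rad j x).
  by rewrite -/(minh Q x); have := eucl_dist_ge0 x y; lra.
move=> j Qj; have := bigmin_le_cond (clearance n rad / n%:R)%R (fun j => edge_height rad j x) Qj.
by rewrite -/(minh Q x); have := edge_height_lip rad j x y; lra.
Qed.

Let minh_ge0 Q A x : cell rad A x -> (0 <= minh Q x)%R.
Proof. by move=> hx; apply: le_bigmin => [|j _]; [apply: ltW|apply: (edge_height_ge0 hn hrad j hx)]. Qed.

Let minh_eq0 (Q : pred 'I_n) A j x : Q j -> A \subset [set j; ordS j]%SET -> cell rad A x -> minh Q x = 0%R.
Proof.
move=> Qj sA hx; apply/eqP; rewrite eq_le (minh_ge0 _ hx) andbT.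
rewrite -(edge_height_cell hn hrad sA hx); exact: bigmin_le_cond.
Qed.

(* Supported on the tiles [h] with [H h], and well defined on the development
   because it vanishes on the cells along which [H] may change. *)
Let bump (H : pi1 -> Prop) Q h x : R := if `[< H h >] then minh Q x else 0%R.

Let bump_lip H Q h x y : (bump H Q h x <= bump H Q h y + eucl_dist x y)%R.
Proof.
by rewrite /bump; case: ifP => _; [apply: minh_lip|rewrite add0r eucl_dist_ge0].
Qed.

Let bump_inv (H : pi1 -> Prop) (Q : pred 'I_n) :
  (forall (s : face (polygon n)), (forall h u, img s u -> H (h * u) <-> H h) \/
     exists2 j, Q j & val s \subset [set j; ordS j]%SET) ->
  forall (s : face (polygon n)) u h x, img s u -> cell rad (val s) x -> bump H Q (h * u) x = bump H Q h x.
Proof.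
move=> hs s u h x us xs; rewrite /bump; case: (hs s) => [e|[j Qj sj]].
  suff -> : `[< H (h * u) >] = `[< H h >] by [].
  by apply: asbool_equiv_eq; apply: e.
by rewrite (minh_eq0 Qj sj xs) !if_same.
Qed.

Let bump_pos H Q h h' x y (hx : cell rad (val top) x) (hy : cell rad (val top) y) :
  (forall s u h x, img s u -> cell rad (val s) x -> bump H Q (h * u) x = bump H Q h x) ->
  H h -> (dev_dist (tile h hx) (tile h' hy) < minh Q x)%R -> H h'.
Proof.
move=> inv Hh lt; apply: contrapT => nH.
have le : (minh Q x <= dev_dist (tile h hx) (tile h' hy))%R.
  apply: le_dev_dist => c /(dev_fun_chain inv (@bump_lip H Q)).
  rewrite !dev_funE // /chamber /= spokeP !mulg1 /bump asboolT // asboolF // add0r.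
  by [].
by move: lt; rewrite ltNge le.
Qed.

Let img_coset (H : pi1 -> Prop) h0 : subgrp H -> forall (s : face (polygon n)), (forall u, img s u -> H u) ->
  forall h u, img s u -> H (h0^-1 * (h * u)) <-> H (h0^-1 * h).
Proof.
move=> sH s sub h u /sub hu; rewrite mulgA; split=> h'; last exact: subM.
exact: subMr hu h'.
Qed.

Let ordSc k : ordS (corner hn k) = corner hn k.+1. Proof. exact: ordS_corner. Qed.

(** Some barycentric coordinate of [x] is at least [1 / n], say at the vertex [i], so [x] is far
    from all edges not containing [i]. The bump function on the tiles around this vertex, made of
    the heights over those edges, separates [x] from the other tiles. *)
Lemma near_tiles h h' x y (hx : cell rad (val top) x) (hy : cell rad (val top) y) :
  (dev_dist (tile h hx) (tile h' hy) < clearance n rad / n%:R)%R -> exists k, V k (h^-1 * h').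
Proof.
move=> lt; have [i hi] := edge_height_far hn hrad hx; exists i.
have sV : subgrp (V i) by apply: local_img_subgrp.
apply: (@bump_pos (fun g => V i (h^-1 * g)) (fun j => i \notin [set j; ordS j]%SET) h h' x y hx hy).
- apply: bump_inv => s; case: (faceP hn s) => [|k|k].
  + by left; apply: img_coset => // u /(@Pgrp_sub n hn G T i) /Egrp_sub.
  + case: (boolP (i \in val (edge_face hn k))) => hik; last first.
      by right; exists (corner hn k); rewrite /= ordSc.
    left; apply: img_coset => // u hu; move: hik; rewrite !inE => /orP [/eqP e|/eqP e].
      have -> : V i = V k by rewrite /Vgrp; congr img; apply: face_eq; rewrite /= corner_val e.
      exact: Egrp_sub hu.
    have -> : V i = V k.+1 by rewrite /Vgrp; congr img; apply: face_eq; rewrite /= corner_val e.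
    exact: Egrp_subS hu.
  have [e|ne] := eqVneq i (corner hn k).
    left; apply: img_coset => // u hu.
    by have -> : V i = V k by rewrite /Vgrp; congr img; apply: face_eq; rewrite /= corner_val e.
  right; have [e|ne'] := eqVneq i (corner hn k.+1).
    (* The edge before the corner [k], since the one after it contains [i]. *)
    exists (corner hn (k + n.-1)%N).
      rewrite e !inE ordSc negb_or (_ : (k + n.-1).+1 = k + n)%N; last by lia.
      by rewrite corner_per; apply/andP; split; [|rewrite eq_sym]; apply: corner_neq; lia.
    rewrite ordSc (_ : (k + n.-1).+1 = k + n)%N; last by lia.
    by rewrite corner_per finset.sub1set !inE eqxx orbT.
  exists (corner hn k); first by rewrite !inE ordSc negb_or ne ne'.
  by rewrite finset.sub1set !inE eqxx.
- by rewrite /= mulVg; apply: sub1.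
apply: lt_le_trans lt _; apply: le_bigmin => // j hj; exact: hi.
Qed.

Lemma interior_tiles h h' x (hx : cell rad (val top) x) : (forall j : 'I_n, (0 < edge_height rad j x)%R) ->
  dev_dist (tile h hx) (tile h' hx) = 0%R -> P (h^-1 * h').
Proof.
move=> pos e0; have sP : subgrp P by apply: local_img_subgrp.
apply: (@bump_pos (fun g => P (h^-1 * g)) predT h h' x x hx hx).
- apply: bump_inv => s; case: (faceP hn s) => [|k|k].
  + by left; apply: img_coset.
  + by right; exists (corner hn k); rewrite // ordSc.
  by right; exists (corner hn k) => //; rewrite finset.sub1set !inE eqxx.
- by rewrite /= mulVg; apply: sub1.
by rewrite e0; apply: lt_bigmin.
Qed.

Lemma dev_act_tile g h x (hx : cell rad (val top) x) : dev_act g (tile h hx) = tile (g * h) hx.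
Proof.
have inv p q : dev_glue p q ->
    dev_proj (DevPoint (g * dp_elt p) (dp_in p)) = dev_proj (DevPoint (g * dp_elt q) (dp_in q)).
  case=> [g' s h' x' xs|g' s t st x' xs xt] /=.
    by rewrite mulgA; apply: dev_proj_glue; apply: glue_group.
  by rewrite mulgA; apply: dev_proj_glue; apply: glue_face.
exact: (dev_proj_inv inv (p := repr (tile h hx)) (q := DevPoint h hx) (dev_proj_repr _)).
Qed.

End DevelopmentGeometry.

(** * Geodesic metrics rounded up to integers *)

Section CeilMetric.
Context (R : realType) (X : Type) (D : X -> X -> R).
Hypotheses (mD : is_metric D) (gD : geodesic_space D).

Definition nat_ceil (x : R) : nat :=
  ex_minn (let: ex_intro n h := nat_above x in ex_intro (fun n : nat => (x <= n%:R)%R) n h).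

Lemma nat_ceil_le (x : R) (m : nat) : (nat_ceil x <= m)%N = (x <= m%:R)%R.
Proof.
rewrite /nat_ceil; case: ex_minnP => k hk kmin; apply/idP/idP => [km|/kmin //].
by apply: le_trans hk _; rewrite ler_nat.
Qed.

Lemma nat_ceil_ge (x : R) : (x <= (nat_ceil x)%:R)%R.
Proof. by rewrite -nat_ceil_le. Qed.

Lemma nat_ceil_lt (x : R) : (0 <= x)%R -> ((nat_ceil x)%:R < x + 1)%R.
Proof.
move=> x0; case e : (nat_ceil x) => [|m]; first by rewrite mulr0n; lra.
have : ~~ (x <= m%:R)%R by rewrite -nat_ceil_le e -ltnNge.
by rewrite -ltNge -natr1; lra.
Qed.

Definition ceil_dist x y := nat_ceil (D x y).

Let D0 x : D x x = 0%R. Proof. by case: mD => h _ _; apply/h. Qed.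
Let D_ge0 x y : (0 <= D x y)%R.
Proof. by case: mD => _ hC hT; have := hT x y x; rewrite D0 (hC y x); lra. Qed.

(** Rounding up, unlike rounding down, keeps the triangle inequality and the separation of points.
    It commutes with subtracting an integer, which gives the intermediate points. *)
Lemma ceil_gm : graph_metric (fun=> True) ceil_dist.
Proof.
case: (mD) => h0 hC hT; split.
- by move=> x _; apply/eqP; rewrite -leqn0 nat_ceil_le D0.
- move=> x y _ _ e; apply/h0/eqP; rewrite eq_le D_ge0 andbT.
  by have := nat_ceil_ge (D x y); rewrite -/(ceil_dist x y) e.
- by move=> x y _ _; rewrite /ceil_dist hC.
- move=> x y z _ _ _; rewrite nat_ceil_le natrD; apply: le_trans (hT x y z) _.
  by apply: lerD; apply: nat_ceil_ge.
move=> x y k _ _; rewrite leq_eqVlt => /orP [/eqP ->|lt].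
  by exists y; rewrite subnn; split=> //; apply/eqP; rewrite -leqn0 nat_ceil_le D0.
have kD : (k%:R <= D x y)%R by apply/ltW; rewrite ltNge -nat_ceil_le -ltnNge.
have k0 : (0 <= k%:R :> R)%R by rewrite ler0n.
have [c [c0 cy cd]] := gD x y; exists (c k%:R%R).
have e1 : D x (c k%:R%R) = k%:R%R.
  by rewrite -{1}c0 cd ?lexx ?D_ge0 ?k0 ?kD // sub0r normrN ger0_norm.
have e2 : D (c k%:R%R) y = (D x y - k%:R)%R.
  by rewrite -{1}cy cd ?lexx ?D_ge0 ?k0 ?kD // distrC ger0_norm // subr_ge0.
rewrite /ceil_dist e1 e2; split=> //.
  by apply/eqP; rewrite eqn_leq nat_ceil_le lexx /= -(ler_nat R) nat_ceil_ge.
apply/eqP; rewrite eqn_leq nat_ceil_le leq_subLR nat_ceil_le.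
rewrite natrD natrB 1?ltnW // lerD2r nat_ceil_ge /=.
by have := nat_ceil_ge (D x y - k%:R)%R; lra.
Qed.

Lemma ceil_hyp : hyperbolic_space D -> exists delta, hyp (fun=> True) ceil_dist delta.
Proof.
move=> [de hd]; have [m hm] := nat_above (de * 2 + 2)%R; exists m => x y z w _ _ _ _.
case: (mD) => _ hC _; have := hd w x z y; rewrite /gromov_product.
rewrite (hC y w) (hC z w) (hC x w) (hC z y).
rewrite -(ler_nat R) !natrD natr_max !natrD.
have l1 := nat_ceil_lt (D_ge0 x y); have l2 := nat_ceil_lt (D_ge0 z w).
have g1 := nat_ceil_ge (D x z); have g2 := nat_ceil_ge (D y w).
have g3 := nat_ceil_ge (D x w); have g4 := nat_ceil_ge (D y z).
move: hm l1 l2 g1 g2 g3 g4; rewrite /ceil_dist (hC y w) (hC z w) (hC x w) /Num.min /Num.max.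
case: ifP; case: ifP; lra.
Qed.

End CeilMetric.

(** * Consequences of the CAT(0) condition on the development *)

Section Cat0Development.
Context (R : realType) (n : nat) (hn : (4 <= n)%N) (rad : R) (hrad : (0 < rad)%R)
  (G : complex_of_groups (polygon n)) (T : {set face (polygon n) * face (polygon n)}).
Hypothesis hT : maximal_tree T.
Local Notation pi1 := (pi1 G T).
Local Notation top := (top_face n).
Local Notation dev := (development rad G T).
Local Notation V := (Vgrp hn (G := G) (T := T)).
Local Notation E := (Egrp hn (G := G) (T := T)).
Local Notation P := (Pgrp (G := G) (T := T)).
Local Notation Sh := (fun z : pi1 => exists k, V k z).
Local Notation dd := (@dev_dist R n rad G T).
Hypothesis hcat : CAT0 dd.

Let mid k := edge_mid rad (corner hn k).
Let mid_edge k : cell rad (val (edge_face hn k)) (mid k).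
Proof. by rewrite /= -ordS_corner; apply: edge_mid_cell. Qed.
Let mid_top k : cell rad (val top) (mid k).
Proof. exact: cell_top (@mid_edge k). Qed.

Let dd0 a : dd a a = 0%R. Proof. by case: hcat => -[h _ _] _ _; apply/h. Qed.
Let dd_ge0 a b : (0 <= dd a b)%R.
Proof. by case: hcat => -[_ hC hT'] _ _; have := hT' a b a; rewrite dd0 (hC b a); lra. Qed.

(* An element of two edge groups would give a second geodesic between the
   middles of the two edges, running through another tile. *)
Lemma edge_inter i j u : (i < j)%N -> (j < i + n)%N -> E i u -> E j u -> P u.
Proof.
move=> ij ji ui uj.
have ne : corner hn i != corner hn j by apply: corner_neq.
pose x := mid i; pose y := mid j; have hx : cell rad (val top) x := @mid_top i.
have hy : cell rad (val top) y := @mid_top j.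
pose D := eucl_dist x y.
have D0 : (0 < D)%R.
  have h1 := @edge_height_mid_gt0 R n hn rad hrad (corner hn i) (corner hn j) ne.
  have h2 := @edge_height_cell R n hn rad hrad (corner hn j) _ y (subxx _) (edge_mid_cell rad (corner hn j)).
  have := edge_height_lip rad (corner hn j) x y; rewrite h2 -/D; move: h1; rewrite -/(mid i) -/x; lra.
pose pt t := (x + (t / D) *: (y - x))%R.
have hpt t : (0 <= t <= D)%R -> cell rad (val top) (pt t).
  move=> /andP [t0 tD]; apply: cell_convex => //.
  by rewrite divr_ge0 ?(ltW D0) //= ler_pdivrMr // mul1r.
pose seg h t := if pselect (cell rad (val top) (pt t)) is left hc then tile (T := T) (G := G) h hc
  else tile h hx.
have segE h t (hc : cell rad (val top) (pt t)) : seg h t = tile h hc.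
  by rewrite /seg; case: pselect => // hc'; congr tile; apply: Prop_irrelevance.
have tileE h z z' (hz : cell rad (val top) z) (hz' : cell rad (val top) z') : z = z' ->
    tile (T := T) (G := G) h hz = tile h hz'.
  by move=> e; subst z'; congr tile; apply: Prop_irrelevance.
have pt0 : pt 0%R = x by rewrite /pt mul0r scale0r addr0.
have ptD : pt D = y by rewrite /pt divff ?lt0r_neq0 // scale1r addrC subrK.
have DD : (0 <= D)%R := ltW D0.
have ptd s t : eucl_dist (pt s) (pt t) = `|s - t|%R.
  rewrite /pt eucl_dist_segment -/D -mulrBl normrM normrV ?unitfE ?lt0r_neq0 // (gtr0_norm D0).
  by rewrite mulfVK // lt0r_neq0.
have gseg h : geodesic dd (seg h) (tile h hx) (tile h hy).
  rewrite /geodesic dev_dist_eucl // -/D; split.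
  - have h0 : cell rad (val top) (pt 0%R) by rewrite pt0.
    by rewrite (segE _ _ h0); apply: tileE.
  - have h0 : cell rad (val top) (pt D) by rewrite ptD.
    by rewrite (segE _ _ h0); apply: tileE.
  by move=> s t hs ht; rewrite (segE _ _ (hpt s hs)) (segE _ _ (hpt t ht)) dev_dist_eucl // ptd.
have ex : tile u hx = tile 1 hx by rewrite -(mul1g u); apply: tile_local ui (@mid_edge i).
have ey : tile u hy = tile 1 hy by rewrite -(mul1g u); apply: tile_local uj (@mid_edge j).
have g1 := gseg 1; have g2 := gseg u; rewrite ex ey in g2.
have hD : (0 <= D / 2 <= D)%R by lra.
have hm := hpt _ hD.
have dxy : dd (tile 1 hx) (tile 1 hy) = D by rewrite dev_dist_eucl.
case: (hcat) => _ _ cat.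
(* The comparison triangle [x, y, y] is degenerate, so the middles of the two geodesics have the
   same comparison point and are at distance 0. *)
have := cat _ _ _ (seg 1) (seg u) (D / 2)%R (D / 2)%R x y y (pt (D / 2)%R) (pt (D / 2)%R) g1 g2.
rewrite dxy dd0 !eucl_distxx (segE 1 _ hm) (segE u _ hm).
have e1 : eucl_dist x (pt (D / 2)%R) = (D / 2)%R.
  by rewrite -{1}pt0 ptd sub0r normrN ger0_norm //; lra.
have e2 : eucl_dist (pt (D / 2)%R) y = (D - D / 2)%R.
  by have := ptd (D / 2)%R D; rewrite ptD => ->; rewrite distrC ger0_norm //; lra.
move=> /(_ hD hD erefl erefl erefl e1 e2 e1 e2) le0.
have e0 : dd (tile 1 hm) (tile u hm) = 0%R by apply/eqP; rewrite eq_le le0 dd_ge0.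
have := interior_tiles hn hrad hT _ e0; rewrite invg1 mul1g; apply => k.
have -> : pt (D / 2)%R = (x + 2^-1 *: (y - x))%R.
  by rewrite /pt; congr (_ + _ *: _)%R; rewrite mulrAC divff ?lt0r_neq0 // mul1r.
exact: edge_height_interior.
Qed.

Let eps : R := (clearance n rad / n%:R)%R.
Let eps0 : (0 < eps)%R.
Proof. by rewrite divr_gt0 ?clearance_gt0 // ltr0n; lia. Qed.
Let gSh x : gen Sh x. Proof. exact: Vgrp_gen. Qed.
Let gm := torsor_gm (torsor_gen Sh).

(* Cut a geodesic into pieces shorter than [eps]. *)
Lemma wd_dev_dist h h' x y (hx : cell rad (val top) x) (hy : cell rad (val top) y) :
  ((wd Sh h h')%:R <= dd (tile h hx) (tile h' hy) * 2 / eps + 3)%R.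
Proof.
pose L := dd (tile h hx) (tile h' hy); have L0 : (0 <= L)%R := dd_ge0 _ _.
pose N := (Num.truncn (L * 2 / eps)).+1.
have t0 : (0 <= L * 2 / eps)%R by rewrite divr_ge0 ?(ltW eps0) // mulr_ge0.
have /andP [N1 N2] := truncn_itv t0.
have Npos : (0 < N%:R :> R)%R by rewrite ltr0n.
have small : (L / N%:R < eps)%R.
  rewrite ltr_pdivrMr //; move: N2; rewrite ltr_pdivrMr // -/N; nra.
case: (hcat) => _ gs _; have [c [c0 cL cd]] := gs (tile h hx) (tile h' hy).
rewrite -/L in cL cd.
have step k : (k <= N)%N -> forall g z (hz : cell rad (val top) z),
    c (k%:R * (L / N%:R))%R = tile g hz -> (wd Sh h g <= k.+1)%N.
  elim: k => [|k IH] hk g z hz e.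
    rewrite mul0r c0 in e.
    have [k hv] : exists k, V k (h^-1 * g).
      by apply: (near_tiles hn hrad hT (hx := hx) (hy := hz)); rewrite -e dd0.
    by apply: len_gen1; exists k.
  have [g' [z' [hz' e']]] := tileP hn (c (k%:R * (L / N%:R))%R).
  have := IH (ltnW hk) g' z' hz' e'.
  have LN : (0 <= L / N%:R)%R by rewrite divr_ge0.
  have rng m : (m <= N)%N -> (0 <= m%:R * (L / N%:R) <= L)%R.
    by move=> hm; rewrite mulr_ge0 ?ler0n //= mulrCA ler_piMr // ler_pdivrMr // mul1r ler_nat.
  have [k' hv] : exists k', V k' (g'^-1 * g).
    apply: (near_tiles hn hrad hT (hx := hz') (hy := hz)); rewrite -e -e' (cd _ _ (rng _ (ltnW hk)) (rng _ hk)).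
    by rewrite -mulrBl -natr1 opprD addrA subrr sub0r mulN1r normrN ger0_norm.
  have := len_gen1 (S := Sh) (s := g'^-1 * g) (ex_intro _ k' hv).
  have := gmT gm (gSh h) (gSh g') (gSh g); rewrite /wd; lia.
have e : (N%:R * (L / N%:R) = L)%R by rewrite mulrC mulfVK // lt0r_neq0.
have := step N (leqnn _) h' y hy; rewrite e cL => /(_ erefl) hw.
apply: (@le_trans _ _ N.+1%:R%R); first by rewrite ler_nat.
have -> : (N.+1%:R = (Num.truncn (L * 2 / eps))%:R + 2 :> R)%R by rewrite /N -addn2 natrD.
by rewrite -/L; lra.
Qed.

(** The middle of the edge [k] of the tile 1 is fixed by [E k], that of the edge [k'] of the tile
    [t] by [t E_k' t^-1]. By [wd_dev_dist] the two points are at distance at least [A] once [t] is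
    long. *)
Lemma edge_acyl : acylindrical rad G T -> exists K0, forall k k' t, (K0 <= len Sh t)%N ->
  exists L : seq pi1, forall c, E k c -> E k' (t^-1 * c * t) -> c \in L.
Proof.
move=> [A A0 hA]; have [K hK] := nat_above (A * 2 / eps + 3)%R; exists K => k k' t Kt.
pose a := tile (T := T) (G := G) 1 (@mid_top k); pose b := tile (T := T) (G := G) t (@mid_top k').
have dab : (A <= dd a b)%R.
  have := wd_dev_dist 1 t (@mid_top k) (@mid_top k'); rewrite -/a -/b /wd invg1 mul1g => h.
  have : (A * 2 / eps + 3 <= dd a b * 2 / eps + 3)%R.
    by apply: le_trans hK _; apply: le_trans h; rewrite ler_nat.
  by rewrite lerD2r ler_pM2r ?invr_gt0 // ler_pM2r.
have := hA [set a; b]%classic; case.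
  apply: (@le_trans _ _ (dd a b)%:E); first by rewrite lee_fin.
  by apply: ereal_sup_ubound; exists (a, b) => //; split; [left|right].
move=> m fm; have : finite_set [set g : pi1 | forall z, [set a; b]%classic z -> dev_act g z = z].
  by exists m.
move=> /finite_seqP [L eL]; exists L => c hc hc'.
suff : [set g : pi1 | forall z, [set a; b]%classic z -> dev_act g z = z]%classic c by rewrite eL.
move=> z [->|->]; rewrite /a /b dev_act_tile.
  by rewrite mulg1 -[X in tile X _ = _](mul1g c); apply: tile_local hc (@mid_edge k).
have -> : c * t = t * (t^-1 * c * t) by gsimp.
exact: tile_local hc' (@mid_edge k').
Qed.

Lemma Vgrp_hyp : hyperbolic_space dd -> exists delta, hyp (gen Sh) (wd Sh) delta.
Proof.
move=> hh; case: (hcat) => mD gD _; have [de hde] := ceil_hyp mD hh.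
pose q h := tile (T := T) (G := G) h (@mid_top 0).
have [lam hlam] := nat_above (4 * rad + 2 / eps + 3)%R.
have p1 : (0 < 2 / eps)%R by rewrite divr_gt0.
have lo h h' : (wd Sh h h' <= lam * (ceil_dist dd (q h) (q h')).+1)%N.
  rewrite -(ler_nat R) natrM -natr1.
  have := wd_dev_dist h h' (@mid_top 0) (@mid_top 0); rewrite -/(q h) -/(q h').
  have := nat_ceil_ge (dd (q h) (q h')); rewrite -/(ceil_dist _ _ _).
  have := dd_ge0 (q h) (q h'); set d := dd _ _; set m : R := (ceil_dist _ _ _)%:R%R.
  have -> : (d * 2 / eps = d * (2 / eps))%R by rewrite mulrA.
  move: p1 hlam; set r := (2 / eps)%R => r0 hl d0 dm hw.
  have m0 : (0 <= m)%R by rewrite /m ler0n.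
  have h1 : (d * r <= m * r)%R by rewrite ler_pM2r.
  have m1 : (0 <= m + 1)%R by rewrite addr_ge0.
  have h2 : ((r + 3) * (m + 1) <= lam%:R * (m + 1))%R by rewrite ler_wpM2r //; move: hrad; lra.
  have h3 : ((r + 3) * (m + 1) = m * r + r + 3 * m + 3)%R by ring.
  lra.
have up h h' : (ceil_dist dd (q h) (q h') <= lam * (wd Sh h h').+1)%N.
  rewrite nat_ceil_le natrM.
  apply: le_trans (dev_dist_tile hn hrad hT h h' _ _) _.
  by apply: ler_wpM2r; [rewrite ler0n|lra].
have qc (h h' : pi1) a : gen Sh h -> gen Sh h' -> True -> btw (ceil_dist dd) 0 (q h) (q h') a ->
    exists2 g, gen Sh g & (ceil_dist dd a (q g) <= lam)%N.
  move=> _ _ _ _; have [g [x [hx ->]]] := tileP hn a; exists g; first exact: gSh.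
  rewrite nat_ceil_le dev_dist_eucl //.
  by apply: le_trans (cell_diam hrad hx (@mid_top 0)) _; lra.
have [d' [_ [h _ _]]] := pullback_hyp (q := q) (lam := lam) (s := lam) (k := lam) (ceil_gm mD gD)
  hde gm (fun _ _ => I) (fun x y _ _ => lo x y) (fun x y _ _ => up x y) qc.
by exists d'.
Qed.

End Cat0Development.

(** * The subgroup of an edge *)

Lemma morph_multiplicative (A B : groupType) (f : A -> B) : morph f ->
  exists F : {multiplicative A -> B}, forall x, F x = f x.
Proof.
move=> fM; pose m := isMultiplicative.Build A B f fM.
by exists (HB.pack_for {multiplicative A -> B} f m).
Qed.

(** Reduced words go to reduced words, so the kernel lies in [C']. *)
Lemma pullback_injective (A G : groupType) (f : A -> G) (U : bool -> G -> Prop) C l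
    (U' : bool -> A -> Prop) C' : morph f -> tree_split U C l ->
  (forall b, subgrp (U' b)) -> subgrp C' -> (forall b x, C' x -> U' b x) ->
  (forall b x, U' b x -> U b (f x)) -> (forall x, C' x -> C (f x)) ->
  (forall b x, U' b x -> C (f x) -> C' x) ->
  (forall x, gen (factors U') x) -> (forall x, C' x -> f x = 1 -> x = 1) -> injective f.
Proof.
move=> fM ts sU sC CU fU fC fUC gU inj.
have ts' : tree_split U' C' (fun x => l (f x)).
  split=> // [c /fC|n a b x h]; first exact: (ts_l0 ts).
  exact: (ts_l ts (red_morph fM fU fUC h)).
have ker x : f x = 1 -> x = 1.
  case: (red_ex ts' (gU x)) => [/inj //|[n [a [b h]]] e].
  have := ts_l ts' h; rewrite e (ts_l0 ts (sub1 (ts_C ts))) => n0.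
  by move: h; rewrite -n0.
move=> x y e; apply: (mulIg y^-1); rewrite mulgV; apply: ker.
by rewrite fM (morphV fM) e mulgV.
Qed.

Section EdgeSubgroup.
Context (n : nat) (hn : (4 <= n)%N) (G : complex_of_groups (polygon n))
  (T : {set face (polygon n) * face (polygon n)}) (i : nat).
Local Notation Y := [set corner hn i; corner hn i.+1]%SET.
Local Notation FY := (closed_face (polygon n) Y).
Local Notation GY := (restriction Y G).
Context (T1 : {set face FY * face FY}).
Hypothesis hT1 : maximal_tree T1.
Local Notation pi1 := (pi1 G T).
Local Notation piY := (Defs.pi1 GY T1).
Local Notation V := (Vgrp hn (G := G) (T := T)).
Local Notation E := (Egrp hn (G := G) (T := T)).
Local Notation incl := (@face_incl _ (polygon n) Y).
Implicit Types (s t z : face FY).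

Let face_of (s : face (polygon n)) : val s \subset Y -> {z : face FY | val z = val s}.
Proof.
move=> sY; have h : val s \in FY by rewrite inE (valP s).
by exists (exist (fun A : {set 'I_n} => A \in FY) _ h).
Qed.

Let yz := face_of (fintype.subxx (val (edge_face hn i))).
Let y := sval yz.
Let yE : val y = Y. Proof. exact: svalP yz. Qed.

Let y_top z : z = y \/ val z \proper val y.
Proof.
have : val z \subset val y by rewrite yE; have := valP z; rewrite inE => /andP [].
by move=> /finset.eqVproper [e|]; [left; apply: val_inj|right].
Qed.

Let incl_y : incl y = edge_face hn i. Proof. by apply: face_eq; rewrite /= yE. Qed.

Let y_chain s t : val t \proper val s -> s = y.
Proof.
move=> ts; case: (y_top s) => // sy.
have := @face_chain n hn (incl y) (incl s) (incl t) sy ts; rewrite incl_y => /(congr1 val) /= e.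
by exfalso; have := card_edge hn i; rewrite /= e finset.cardsT card_ord; lia.
Qed.

Let y_chain3 (r s t : face FY) : val s \proper val r -> val t \proper val s -> r = y.
Proof. by move=> /y_chain. Qed.

Let inT1 t : val t \proper val y -> (y, t) \in T1.
Proof.
move=> ty; case: hT1 => Tp Tc _; have /connectP [[|x p] /= ] := Tc t y.
  by move=> _ e; have := ty; rewrite -e fintype.properxx.
move=> /andP [/orP [h|h] _] _.
  by have e := y_chain (Tp _ _ h); have := ty; rewrite e fintype.properxx.
by rewrite -(y_chain (Tp _ _ h)).
Qed.

Let spokeY t : @spoke _ _ GY T1 y t = 1.
Proof.
case: (y_top t) => [->|ty]; first exact: spokeP.
by rewrite (spokeE GY T1 ty); apply: pi1_tree; apply: inT1.
Qed.

Let grY z (g : cg_group GY z) : pi1_group T1 g = based T1 y g.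
Proof. by rewrite /based spokeY; gsimp. Qed.

Let transportY t (yt : val t \proper val y) (g : cg_group GY y) :
  transport y yt g = cg_map GY yt g.
Proof.
rewrite /transport /cone_twist; case: pselect => [h|_]; last by gsimp.
by have := h; rewrite fintype.properxx.
Qed.

Let k z := @spoke _ _ G T (incl y) (incl z).
Let fz z (g : cg_group GY z) : pi1 := (k z)^-1 * pi1_group T (g : cg_group G (incl z)) * k z.

Let natural : exists2 f : piY -> pi1, morph f & forall z (g : cg_group GY z), f (pi1_group T1 g) = fz g.
Proof.
have [||f fM fE] := @cone_universal _ _ GY T1 y y_top y_chain3 hT1 pi1 fz.
- by move=> z a b; rewrite /fz pi1_groupM; gsimp.
- move=> s t st; have e := y_chain st; subst s => g.
  rewrite transportY /fz /k spokeP invg1 mul1g mulg1.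
  rewrite (@spokeE _ _ G T (incl y) (incl t) st).
  by rewrite -(@pi1_conj _ _ G T (incl y) (incl t) st g); gsimp.
by exists f => // z g; rewrite grY fE.
Qed.

Local Notation top := (top_face n).
Let kappa := @spoke _ _ G T top (incl y).

Let fz_based z : exists2 d : cg_group GY z,
  z = y -> d = 1 & forall g : cg_group GY z, kappa^-1 * fz g * kappa = based T top (d^-1 * g * d : cg_group G (incl z)).
Proof.
case: (y_top z) => [e|zy].
  subst z; exists 1 => // g; rewrite /fz /k spokeP /based -/kappa; gsimp.
  by [].
exists (@cone_twist _ _ G top (incl y) (incl z) zy) => [e|g].
  by exfalso; have := zy; rewrite e fintype.properxx.
have gM := @pi1_groupM _ _ G T (incl z).
rewrite /fz /k (@spokeE _ _ G T (incl y) (incl z) zy).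
rewrite (@edge_spoke _ _ G T top (face_top hn) (incl y) (incl z) zy) -/kappa.
by rewrite /based gM gM (morphV gM); gsimp.
Qed.

Let corner_of b := if b then i.+1 else i.
Let vert_sub b : val (vertex_face hn (corner_of b)) \subset Y.
Proof. by rewrite finset.sub1set !inE /corner_of; case: b; rewrite eqxx ?orbT. Qed.
Let vert b : face FY := sval (face_of (vert_sub b)).
Let vert_val b : val (vert b) = [set corner hn (corner_of b)]%SET.
Proof. exact: svalP (face_of (vert_sub b)). Qed.
Let incl_vert b : incl (vert b) = vertex_face hn (corner_of b).
Proof. by apply: face_eq; rewrite /= vert_val. Qed.
Let vert_y b : val (vert b) \proper val y.
Proof.
have := vertex_proper hn i; have := vertexS_proper hn i; rewrite vert_val yE.
by case: b.
Qed.

Let faceY z : z = y \/ exists b, z = vert b.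
Proof.
case: (y_top z) => [|zy]; [by left|right].
have zsub : val z \subset Y by have := fintype.proper_sub zy; rewrite yE.
have cE j : #|[set corner hn j; corner hn j.+1]%SET| = 2 := card_edge hn j.
have cz : (#|val z| < 2)%N by have := proper_card zy; rewrite yE cE.
have ez : val z = val (incl z) by [].
case: (faceP hn (incl z)) ez => [|j|j] e.
- by move: cz; rewrite e /= finset.cardsT card_ord; lia.
- by move: cz; rewrite e /= cE.
have : corner hn j \in Y by apply: (fintype.subsetP zsub); rewrite e /= inE.
rewrite !inE => /orP [/eqP h|/eqP h]; [exists false|exists true];
  by apply: val_inj; rewrite vert_val e /= h.
Qed.

Let two_V b : two (V i.+1) (V i) b = @local_img _ _ G T top (incl (vert b)).
Proof. by rewrite incl_vert; case: b. Qed.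

(** [f] is based at the edge, as [natural_hom] asks, and [f0] at the polygon, where the image is
    exactly the subgroup generated by the two vertex groups. They differ by conjugation by the spoke
    [kappa] of the edge. *)
Lemma edge_subgroup l : developable G T -> tree_split (two (V i.+1) (V i)) (E i) l ->
  exists f f0 : piY -> pi1, exists ka : pi1, [/\ morph f /\ natural_hom f, morph f0, injective f0,
    forall x, f x = ka * f0 x * ka^-1 & img f0 = gen (factors (two (V i.+1) (V i)))].
Proof.
move=> dev ts; have [f fM fE] := natural.
pose f0 x := kappa^-1 * f x * kappa.
have f0M : morph f0 by move=> a b; rewrite /f0 fM; gsimp.
have f0z z : exists2 d : cg_group GY z, z = y -> d = 1 &
    forall g : cg_group GY z, f0 (pi1_group T1 g) = based T top (d^-1 * g * d : cg_group G (incl z)).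
  by have [d d1 hd] := fz_based z; exists d => // g; rewrite /f0 fE hd.
have f0y (g : cg_group GY y) : f0 (pi1_group T1 g) = based T top (g : cg_group G (incl y)).
  have [d d1 ->] := f0z y; rewrite d1 //.
  by rewrite invg1 mul1g mulg1.
pose U' b (x : piY) := exists g : cg_group GY (vert b), x = pi1_group T1 g.
pose C' (x : piY) := exists g : cg_group GY y, x = pi1_group T1 g.
have sgr z : subgrp (fun x : piY => exists g : cg_group GY z, x = pi1_group T1 g).
  have gM := @pi1_groupM _ _ GY T1 z.
  split=> [|_ _ [a ->] [b ->]|_ [a ->]]; first by exists 1; rewrite (morph1 gM).
    by exists (a * b); rewrite gM.
  by exists a^-1; rewrite (morphV gM).
have glue b (g : cg_group GY y) : pi1_group T1 g = pi1_group T1 (cg_map GY (vert_y b) g).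
  by rewrite -pi1_conj pi1_tree ?inT1 //; gsimp.
have CU b x : C' x -> U' b x by move=> [g ->]; rewrite (glue b); eexists.
have fU b x : U' b x -> two (V i.+1) (V i) b (f0 x).
  by move=> [g ->]; rewrite two_V; have [d _ ->] := f0z (vert b); eexists.
have Ei : E i = @local_img _ _ G T top (incl y) by rewrite incl_y.
have fC x : C' x -> E i (f0 x) by move=> [g ->]; rewrite f0y Ei; eexists.
have fUC b x : U' b x -> E i (f0 x) -> C' x.
  move=> [g ->]; rewrite Ei => -[h e]; exists h.
  have binj := @based_inj _ _ G T top dev (incl (vert b)).
  have [d _ hd] := f0z (vert b); rewrite (glue b); congr (pi1_group T1 _).
  have e' : f0 (pi1_group T1 g) = f0 (pi1_group T1 (cg_map GY (vert_y b) (h : cg_group GY y))).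
    by rewrite e -glue f0y.
  by move: e'; rewrite !hd => /binj /mulIg /mulgI.
have gU x : gen (factors U') x.
  have sg := gen_subgrp (factors U').
  have hU b (w : piY) : U' b w -> gen (factors U') w by case: b => h; apply: gen_in; [left|right].
  apply: (@pi1_gen _ _ GY T1 _ sg) => [s g|s t st].
    case: (faceY s) => [e|[b e]]; subst s; last by apply: (hU b); exists g.
    by apply: (hU true); apply: CU; exists g.
  have e := y_chain st; subst s; rewrite pi1_tree ?inT1 //; exact: sub1.
have injC x : C' x -> f0 x = 1 -> x = 1.
  move=> [g ->]; rewrite f0y -(morph1 (@basedM _ _ G T top (incl y))) => /(based_inj dev) ->.
  exact: (morph1 (@pi1_groupM _ _ GY T1 y)).
have inj : injective f0.
  exact: (pullback_injective f0M ts (fun b => sgr _) (sgr y) CU fU fC fUC gU injC).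
exists f, f0, kappa; split=> //.
- split=> // y' hy'; have ey : y' = y by apply: val_inj; rewrite yE.
  subst y'; split=> [g|s ys g /=].
    by rewrite fE /fz /k spokeP invg1 mul1g mulg1.
  by rewrite fE /fz /k (@spokeE _ _ G T (incl y) (incl s) ys).
- by move=> x; rewrite /f0; gsimp.
have sL := gen_subgrp (factors (two (V i.+1) (V i))).
apply/funext => x; apply/propext; split.
  move=> [z ->]; apply: (gen_min (H := fun w : piY => gen (factors (two (V i.+1) (V i))) (f0 w))) (gU z).
    split=> [|a b ha hb|a ha]; rewrite ?(morph1 f0M) ?f0M ?(morphV f0M).
    - exact: sub1.
    - exact: subM.
    exact: subV.
  by move=> w [/(fU true)|/(fU false)] h; apply: gen_in; [left|right].
apply: gen_min; first exact: img_subgrp.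
have im b w : two (V i.+1) (V i) b w -> img f0 w.
  rewrite two_V => -[g ->]; have [d _ hd] := f0z (vert b).
  exists (pi1_group T1 (d * (g : cg_group GY (vert b)) * d^-1)); rewrite hd; congr based.
  by gsimp.
by move=> w [/(im true)|/(im false)].
Qed.

End EdgeSubgroup.

(** * Developable polygons of hyperbolic groups *)

Section PolygonTheorem.
Context (R : realType) (n : nat) (hn : (4 <= n)%N) (rad : R) (hrad : (0 < rad)%R)
  (G : complex_of_groups (polygon n)) (T : {set face (polygon n) * face (polygon n)}).
Hypotheses (hT : maximal_tree T) (hdev : developable G T)
  (hhyp : complex_of_hyperbolic_groups rad G T) (hcat : CAT0 (@dev_dist R n rad G T))
  (hacyl : acylindrical rad G T).
Local Notation pi1 := (pi1 G T).
Local Notation top := (top_face n).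
Local Notation V := (Vgrp hn (G := G) (T := T)).
Local Notation E := (Egrp hn (G := G) (T := T)).
Local Notation P := (Pgrp (G := G) (T := T)).

Let img_hyp (s : face (polygon n)) : hypsub (@local_img _ _ G T top s).
Proof.
case: hhyp => _ h _ _; apply: (hypsub_img (@basedM _ _ G T top s) (@based_inj _ _ G T top hdev s) (h s)).
Qed.

Let img_qi (s t : face (polygon n)) : val t \proper val s ->
  qisub (@local_img _ _ G T top s) (@local_img _ _ G T top t).
Proof.
move=> st; case: hhyp => _ _ h _.
pose d := @cone_twist _ _ G top s t st.
pose jt (g : cg_group G t) := based T top (d^-1 * g * d).
have -> : @local_img _ _ G T top t = img jt.
  apply/funext => x; apply/propext; split=> -[g ->]; last by eexists.
  by exists (d * g * d^-1); rewrite /jt; congr based; gsimp.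
have bM := @basedM _ _ G T top; have bI := @based_inj _ _ G T top hdev.
have jM : morph jt by move=> a b; rewrite /jt -bM; congr based; gsimp.
have jI : injective jt by move=> a b /bI /mulIg /mulgI.
have mM : morph (cg_map G st) by move=> a b; apply: gmulfM.
apply: (qisub_img mM (@cg_map_inj _ _ _ _ _ st) (@bM s) (@bI s) jM jI _ (h s t st)) => g.
by rewrite (based_transport T (face_top hn) st).
Qed.

Lemma polygon_edge (i : nat) : let L := gen (factors (two (V i.+1) (V i))) in
  [/\ hypsub (fun _ : pi1 => True), exists l, tree_split (two (V i.+1) (V i)) (E i) l,
    exists S, fgen L S & qisub L (fun=> True)].
Proof.
(* Indices are rotated so that the edge [i] becomes the edge [n] of [polygon_combination]; adding
   [i * n.-1] is the inverse rotation. *)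
move=> L; pose Vs k := V (k + i)%N; pose Es k := E (k + i)%N.
have Vp j : V (j + n)%N = V j by apply: Vgrp_per.
have Ep j : E (j + n)%N = E j by apply: Egrp_per.
have Vmod := periodic_mod Vp.
have em k : (k + i + i * n.-1 = k %[mod n])%N.
  rewrite -addnA -mulnS prednK; last by lia.
  by rewrite addnC modnMDl.
have em' k : (k + i * n.-1 + i = k %[mod n])%N by rewrite addnAC.
have [de hde] : exists de, hyp (gen (fun z : pi1 => exists k, V k z)) (wd (fun z => exists k, V k z)) de.
  by case: hhyp => _ _ _ h; apply: (Vgrp_hyp hn hrad hT hcat h).
have eSh : (fun z : pi1 => exists k, V k z) = (fun z => exists k, Vs k z).
  apply/funext => z; apply/propext; split=> -[k h]; last by exists (k + i)%N.
  by exists (k + i * n.-1)%N; rewrite /Vs (Vmod _ _ (em' k)).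
have gV (x : pi1) : gen (fun z : pi1 => exists k, V k z) x by apply: Vgrp_gen.
have acyl := edge_acyl hn hrad hT hcat hacyl.
rewrite eSh in hde gV acyl.
have sT : subgrp (fun _ : pi1 => True) by split.
have univ (Q : groupType) (f : nat -> pi1 -> Q) :
    (forall k x y, Vs k x -> Vs k y -> f k (x * y) = f k x * f k y) ->
    (forall k x, Es k x -> f k x = f k.+1 x) -> (forall k, f (k + n)%N = f k) ->
    exists2 th : pi1 -> Q, morph th & forall k x, Vs k x -> th x = f k x.
  move=> fM fE fper; have fmod := periodic_mod fper.
  have [|k x h|k|th thM thE] := @Vgrp_universal n hn G T hT Q (fun k => f (k + i * n.-1)%N).
  - by move=> k x y; rewrite -(Vmod _ _ (em' k)); apply: fM.
  - by rewrite /= addSn; apply: fE; rewrite /Es (periodic_mod Ep (em' k)).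
  - by rewrite /= addnAC fper.
  by exists th => // k x h; rewrite (thE _ _ h) (fmod _ _ (em k)).
have sV k : subgrp (Vs k) by apply: local_img_subgrp.
have sE k : subgrp (Es k) by apply: local_img_subgrp.
have sP : subgrp P by apply: local_img_subgrp.
have Vsp k : Vs (k + n)%N = Vs k by rewrite /Vs addnAC Vp.
have Esp k : Es (k + n)%N = Es k by rewrite /Es addnAC Ep.
have hV k : hypsub (Vs k) by apply: img_hyp.
have hE k : hypsub (Es k) by apply: img_hyp.
have qV k : qisub (Es k) (Vs k) by apply: img_qi; apply: vertex_proper.
have qV1 k : qisub (Es k) (Vs k.+1) by apply: img_qi; apply: vertexS_proper.
have PE k x : P x -> Es k x by apply: Pgrp_sub.
have EV k x : Es k x -> Vs k x by apply: Egrp_sub.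
have EV1 k x : Es k x -> Vs k.+1 x by apply: Egrp_subS.
have EE j k x : (j < k)%N -> (k < j + n)%N -> Es j x -> Es k x -> P x.
  by move=> h1 h2; apply: (edge_inter hrad hT hcat); lia.
have acyl' : exists K0, forall k k' t, (K0 <= len (fun z => exists k, Vs k z) t)%N ->
    exists L : seq pi1, forall c, Es k c -> Es k' (t^-1 * c * t) -> c \in L.
  by have [K0 hK] := acyl; exists K0 => k k' t /hK h; apply: h.
have [h1 h2 h3] := polygon_combination hn sV sE sP Vsp Esp PE EV EV1 EE gV univ hV hE (@qV) (@qV1)
  hde acyl' sT (fun _ => I).
have e1 : Vs 1%N = V i.+1 by rewrite /Vs add1n.
have en : Vs n = V i by rewrite /Vs addnC Vp.
have een : Es n = E i by rewrite /Es addnC Ep.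
rewrite e1 en een in h2 h3; split=> //.
have fV b : exists S, fgen (two (V i.+1) (V i) b) S by case: b; apply: hypsub_fgen; apply: img_hyp.
have [S hS] := choice fV; eexists; exact: (fgen_factors hS).
Qed.

End PolygonTheorem.

Theorem theorem5 (R : realType) (n : nat) (hn : (4 <= n)%N)
    (rad : R) (hrad : 0 < rad)
    (G : complex_of_groups (polygon n))
    (T : {set face (polygon n) * face (polygon n)}) (hT : maximal_tree T)
    (hdev : developable G T)
    (hhyp : complex_of_hyperbolic_groups rad G T)
    (hcat : CAT0 (@dev_dist R n rad G T))
    (hacyl : acylindrical rad G T)
    (i : 'I_n) (Y1 : {set 'I_n}) (hY1 : Y1 = [set i; ordS i]%SET)
    (T1 : {set face (closed_face (polygon n) Y1)
              * face (closed_face (polygon n) Y1)})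
    (hT1 : maximal_tree T1) :
  hyperbolic_group R (pi1 G T) /\
  exists f : {multiplicative pi1 (restriction Y1 G) T1 -> pi1 G T},
    natural_hom f /\ injective f /\ qi_embedding R f.
Proof.
have eY : Y1 = [set corner hn i; corner hn i.+1]%SET by rewrite hY1 -ordS_corner corner_val.
clear hY1; subst Y1.
have [hG [l ts] fL qL] := polygon_edge hn hrad hT hdev hhyp hcat hacyl i.
split; first exact: hyperbolic_group_of hG.
have [f [f0 [ka [[fM fN] f0M f0I fE imf]]]] := edge_subgroup hT1 hdev ts.
have [F eF] := morph_multiplicative fM.
have eF' : (F : _ -> _) = f by apply/funext.
exists F; split; first by rewrite eF'.
rewrite eF'; split.
  by move=> x y; rewrite !fE => /mulIg /mulgI /f0I.
apply: (qi_embedding_conj R f0M f0I fE (H := fun=> True)) => //.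
- exact: hypsub_fgen.
- by rewrite imf.
by rewrite imf.
Qed.
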